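(* Consider the planar system $$\dot x=y,\qquad \dot y=-g(x)-f(x,y)y,\qquad (x,y)\in\mathbb R^2 ,$$ with origin $O=(0,0)$. Suppose that - $g(x)$ is analytic in $|x|<\epsilon$ for some small $\epsilon>0$ and $f(x,y)$ is analytic in a small neighborhood $S_\delta(O)$ of $O$; - $xg(x)>0$ for all $x\ne0$, and $g(x)$ and $f(x,y)$ are Lipschitz continuous for $(x,y)\in\mathbb R^2$; - either $g(x)=-g(-x)$ and $f(x,y)\equiv -f(-x,y)$ for $(x,y)\in(0,+\infty)\times\mathbb R$; or $g(x)\not\equiv -g(-x)$ and $f(x,y)/g(x)\equiv f(\hat x,y)/g(\hat x)$ for $(x,y)\in(0,+\infty)\times\mathbb R$, where $\hat x<0<x$ satisfy $\int_0^x g(s)\,ds=\int_0^{\hat x}g(s)\,ds$. Then the following statements hold. (1) Either $O$ is a center, or $S_\delta(O)$ consists of one elliptic sector and one hyperbolic sector, or $S_\delta(O)$ consists of one elliptic sector, one hyperbolic sector and two parabolic sectors. (2) When the elliptic sector is bounded, there are no parabolic sectors at $O$; in other words, two parabolic sectors can appear in a neighborhood of $O$ only when the elliptic sector is unbounded. Both situations (a bounded elliptic sector with no parabolic sectors, and an unbounded elliptic sector with two parabolic sectors) are realized by concrete systems satisfying the hypotheses.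
   Context: $S_\delta(O)$ denotes a sufficiently small neighborhood of $O$. Elliptic, hyperbolic and parabolic sectors have the standard meaning in the local theory of planar equilibria. The elliptic sector is understood as the global region filled with orbits homoclinic to $O$ (orbits tending to $O$ as $t\to+\infty$ and as $t\to-\infty$); it is called bounded or unbounded according to whether this region is a bounded subset of $\mathbb R^2$. *)

(* Defs.v *)
(* Stdlib reals with Coquelicot. *)
From Stdlib Require Import Reals List Permutation Arith.
From Coquelicot Require Import Coquelicot.
Import ListNotations.
Open Scope R_scope.

Definition plane : Type := (R * R)%type.

Definition origin : plane := (0, 0).

Definition lienard (g : R -> R) (f : R -> R -> R) (p : plane) : plane :=
  (snd p, - g (fst p) - f (fst p) (snd p) * snd p).

(** * Regularity and symmetry hypotheses *)

Definition analytic_at (g : R -> R) (x0 : R) : Prop :=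
  exists (a : nat -> R) (r : R), 0 < r /\
    forall x, Rabs (x - x0) < r -> is_pseries a (x - x0) (g x).

(* The double power series is summed by total degree; the first condition is
   absolute convergence, so that the order of summation is immaterial. *)
Definition analytic_at2 (f : R -> R -> R) (x0 y0 : R) : Prop :=
  exists (a : nat -> nat -> R) (r : R), 0 < r /\
    forall u v, Rabs u < r -> Rabs v < r ->
      ex_series (fun n =>
        sum_n (fun i => Rabs (a i (n - i)%nat * u ^ i * v ^ (n - i))) n) /\
      is_series (fun n =>
        sum_n (fun i => a i (n - i)%nat * u ^ i * v ^ (n - i)) n)
        (f (x0 + u) (y0 + v)).

Definition lipschitz_on {U V : NormedModule R_AbsRing}
    (D : U -> Prop) (h : U -> V) : Prop :=
  exists L : R, forall p q, D p -> D q ->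
    norm (minus (h p) (h q)) <= L * norm (minus p q).

Definition lipschitz {U V : NormedModule R_AbsRing} (h : U -> V) : Prop :=
  lipschitz_on (fun _ => True) h.

Definition locally_lipschitz {U V : NormedModule R_AbsRing}
    (h : U -> V) : Prop :=
  forall M : R, lipschitz_on (fun p => norm p <= M) h.

Definition symmetric_system (g : R -> R) (f : R -> R -> R) : Prop :=
  ((forall x, g x = - g (- x)) /\
   (forall x y, 0 < x -> f x y = - f (- x) y))
  \/
  ((exists x, g x <> - g (- x)) /\
   (forall x xh y, xh < 0 -> 0 < x -> RInt g 0 x = RInt g 0 xh ->
      f x y / g x = f xh y / g xh)).

Record hypotheses (g : R -> R) (f : R -> R -> R) : Prop := {
  hyp_g_analytic :
    exists eps, 0 < eps /\ forall x, Rabs x < eps -> analytic_at g x;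
  hyp_f_analytic :
    exists delta, 0 < delta /\
      forall x y, norm ((x, y) : plane) < delta -> analytic_at2 f x y;
  hyp_sign : forall x, x <> 0 -> 0 < x * g x;
  hyp_g_lipschitz : locally_lipschitz g;
  hyp_f_lipschitz : locally_lipschitz (fun p : plane => f (fst p) (snd p));
  hyp_symmetric : symmetric_system g f }.

(** * Orbits of a planar vector field

    Solutions need not be defined for all times, so every notion below asserts
    the existence of a solution on the time interval it involves. *)

Definition reversed (X : plane -> plane) (p : plane) : plane := opp (X p).

(* The forward semi-orbit of [p] exists for all times, stays in [S] and tends
   to the origin; backward semi-orbits are forward ones of [reversed X]. *)
Definition captured (X : plane -> plane) (S : plane -> Prop) (p : plane) : Prop :=
  exists gam : R -> plane,
    gam 0 = p /\
    (forall t, 0 <= t -> is_derive gam t (X (gam t)) /\ S (gam t)) /\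
    filterlim gam (Rbar_locally p_infty) (locally origin).

Definition leaves (X : plane -> plane) (S : plane -> Prop) (p : plane) : Prop :=
  exists (gam : R -> plane) (T : R), 0 < T /\
    gam 0 = p /\
    (forall t, 0 <= t <= T -> is_derive gam t (X (gam t))) /\
    ~ S (gam T).

Definition homoclinic (X : plane -> plane) (p : plane) : Prop :=
  p <> origin /\
  exists gam : R -> plane,
    gam 0 = p /\
    (forall t, is_derive gam t (X (gam t))) /\
    filterlim gam (Rbar_locally p_infty) (locally origin) /\
    filterlim gam (Rbar_locally m_infty) (locally origin).

Definition periodic (X : plane -> plane) (p : plane) : Prop :=
  exists (gam : R -> plane) (T : R), 0 < T /\
    gam 0 = p /\
    (forall t, is_derive gam t (X (gam t))) /\
    (forall t, gam (t + T) = gam t) /\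
    (exists t, gam t <> p).

Definition center (X : plane -> plane) : Prop :=
  exists delta, 0 < delta /\
    forall p : plane, p <> origin -> norm p < delta -> periodic X p.

Definition elliptic_region_bounded (X : plane -> plane) : Prop :=
  exists M : R, forall p : plane, homoclinic X p -> norm p <= M.

(** * Sectors at the origin *)

(* [Phi (rho, theta)], with [rho] and [theta] in [0, 1], are topological polar
   coordinates (the angle being counted in turns) on a neighborhood of the
   origin homeomorphic to a closed disk, contained in the ball of radius
   [delta]. *)
Record polar_chart (delta : R) (Phi : R * R -> plane) : Prop := {
  chart_continuous :
    continuous_on (fun z => 0 <= fst z <= 1 /\ 0 <= snd z <= 1) Phi;
  chart_pole : forall theta, 0 <= theta <= 1 -> Phi (0, theta) = origin;
  chart_closes : forall rho, 0 <= rho <= 1 -> Phi (rho, 0) = Phi (rho, 1);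
  chart_nonzero : forall rho theta,
    0 < rho <= 1 -> 0 <= theta <= 1 -> Phi (rho, theta) <> origin;
  chart_injective : forall rho theta rho' theta',
    0 < rho <= 1 -> 0 <= theta < 1 -> 0 < rho' <= 1 -> 0 <= theta' < 1 ->
    Phi (rho, theta) = Phi (rho', theta') -> rho = rho' /\ theta = theta';
  chart_neighborhood :
    locally origin (fun p => exists rho theta,
      0 <= rho <= 1 /\ 0 <= theta <= 1 /\ p = Phi (rho, theta));
  chart_small : forall rho theta,
    0 <= rho <= 1 -> 0 <= theta <= 1 -> norm (Phi (rho, theta)) < delta }.

Definition closed_sector (Phi : R * R -> plane) (alpha beta : R) (p : plane) : Prop :=
  exists rho theta,
    0 < rho <= 1 /\ alpha <= theta <= beta /\ p = Phi (rho, theta).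

Definition open_sector (Phi : R * R -> plane) (alpha beta : R) (p : plane) : Prop :=
  exists rho theta,
    0 < rho <= 1 /\ alpha < theta < beta /\ p = Phi (rho, theta).

Definition ray (Phi : R * R -> plane) (alpha : R) : plane -> Prop :=
  closed_sector Phi alpha alpha.

(* The ray is a semi-orbit tending to the origin in forward time. *)
Definition stable_ray (X : plane -> plane) (Phi : R * R -> plane) (alpha : R) : Prop :=
  forall p, ray Phi alpha p -> captured X (ray Phi alpha) p.

Definition unstable_ray (X : plane -> plane) : (R * R -> plane) -> R -> Prop :=
  stable_ray (reversed X).

Definition opposite_sides (X : plane -> plane) (Phi : R * R -> plane)
    (alpha beta : R) : Prop :=
  (stable_ray X Phi alpha /\ unstable_ray X Phi beta) \/
  (unstable_ray X Phi alpha /\ stable_ray X Phi beta).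

Definition path_connected (K : plane -> Prop) : Prop :=
  forall p q, K p -> K q ->
    exists c : R -> plane,
      continuous_on (fun s => 0 <= s <= 1) c /\
      c 0 = p /\ c 1 = q /\ (forall s, 0 <= s <= 1 -> K (c s)).

Definition hyperbolic_sector (X : plane -> plane) (Phi : R * R -> plane)
    (alpha beta : R) : Prop :=
  opposite_sides X Phi alpha beta /\
  forall p, open_sector Phi alpha beta p ->
    leaves X (closed_sector Phi alpha beta) p /\
    leaves (reversed X) (closed_sector Phi alpha beta) p.

(* The elliptic sector is the global region filled with homoclinic orbits.
   Inside a small neighborhood, an orbit of that region lies in the sector
   entirely or up to one of its two ends, and may leave the neighborhood in
   between.  The last clause says that the loops contained in the sector form
   a single family, i.e. that consecutive elliptic sectors are not merged. *)
Definition elliptic_sector (X : plane -> plane) (Phi : R * R -> plane)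
    (alpha beta : R) : Prop :=
  opposite_sides X Phi alpha beta /\
  (forall p, open_sector Phi alpha beta p ->
    homoclinic X p /\
    (captured X (closed_sector Phi alpha beta) p \/
     captured (reversed X) (closed_sector Phi alpha beta) p)) /\
  path_connected (fun p =>
    captured X (closed_sector Phi alpha beta) p /\
    captured (reversed X) (closed_sector Phi alpha beta) p).

(* Orbits that leave the neighborhood and come back to the origin belong to the
   elliptic region: a parabolic sector contains no homoclinic orbit. *)
Definition attracting_sector (X : plane -> plane) (Phi : R * R -> plane)
    (alpha beta : R) : Prop :=
  stable_ray X Phi alpha /\ stable_ray X Phi beta /\
  forall p, closed_sector Phi alpha beta p ->
    captured X (closed_sector Phi alpha beta) p /\ ~ homoclinic X p.

Definition parabolic_sector (X : plane -> plane) (Phi : R * R -> plane)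
    (alpha beta : R) : Prop :=
  attracting_sector X Phi alpha beta \/
  attracting_sector (reversed X) Phi alpha beta.

Inductive sector_kind : Set := Elliptic | Hyperbolic | Parabolic.

Definition sector (X : plane -> plane) (Phi : R * R -> plane) (k : sector_kind)
    : R -> R -> Prop :=
  match k with
  | Elliptic => elliptic_sector X Phi
  | Hyperbolic => hyperbolic_sector X Phi
  | Parabolic => parabolic_sector X Phi
  end.

(* [l] lists the kinds of the successive sectors around the origin, the [i]-th
   one lying between the angles [theta i] and [theta (S i)].  Parabolic sectors
   are maximal: two neighboring ones would be counted as one. *)
Definition decomposition (X : plane -> plane) (Phi : R * R -> plane)
    (theta : nat -> R) (l : list sector_kind) : Prop :=
  l <> [] /\ theta 0%nat = 0 /\ theta (length l) = 1 /\
  (forall i, (i < length l)%nat ->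
    theta i < theta (S i) /\
    sector X Phi (nth i l Elliptic) (theta i) (theta (S i))) /\
  (forall i j, (i < length l)%nat -> j = (S i mod length l)%nat -> i <> j ->
    ~ (nth i l Elliptic = Parabolic /\ nth j l Elliptic = Parabolic)).

(* Arbitrarily small neighborhoods of the origin consist of sectors of the
   given kinds, counted with multiplicity and in any cyclic order. *)
Definition consists_of (X : plane -> plane) (kinds : list sector_kind) : Prop :=
  forall delta, 0 < delta ->
    exists (Phi : R * R -> plane) (theta : nat -> R) (l : list sector_kind),
      polar_chart delta Phi /\ Permutation l kinds /\
      decomposition X Phi theta l.

(* Main.v *)
(** The symmetry hypothesis says that the left half plane, reflected and with its abscissa
reparametrized so that the potentials agree, carries the right half system run backward.
Hence an orbit that crosses both half planes closes up, and the reflection of an orbit that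
emanates from [O] on the right is an orbit that tends to [O] on the left. By analyticity [f]
has a sign on the positive axis near [O], and a point reflection makes it nonpositive there;
then a small orbit can leave [O] into the right half plane only through [y > 0], as a graph
over the axis. If no orbit emanates from [O] in this way, the small orbits turn around [O],
so [O] is a center. Otherwise there is a topmost emanating graph [A]. Together with its
mirror image it bounds the hyperbolic sector from below. Below it the orbits of the points of
the negative vertical axis close to [O] are homoclinic, and they fill everything up to an
emanating graph [U <= A]: if [U = A] there is nothing but the elliptic sector below [A],
otherwise the bands between [U] and [A] on the two sides are the parabolic sectors.
If all homoclinic orbits stay in a bounded set, then being homoclinic is both an open and a
closed condition along a section through the emanating orbits, so all of these are homoclinic
and there are no parabolic sectors.

For the examples, [g = 2 phi phi'] and [f = -3 phi'] with [phi = x^2 / 2] near [O]: both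
[y = x^2 / 2] and [y = x^2] emanate from [O], and the first one is globally [y = phi x], hence
not homoclinic. Cutting [f] off outside a compact set makes the elliptic sector bounded. *)
Require Import Defs.
From Stdlib Require Import Reals List Lra Lia Psatz ClassicalEpsilon FunctionalExtensionality
 PropExtensionality Permutation.
From Coquelicot Require Import Coquelicot.
Import ListNotations.
Open Scope R_scope.

(** Solutions may blow up in finite time, so the analysis is done for the truncated field [vf N g f]
    with clamped arguments, which is bounded and Lipschitz and agrees with the system in the box of
    size [N]; an orbit that stays in a box is the same for every larger [N]. The left half plane is
    reached through the involution [gT], [fT], which exchanges the halves and reverses time, so that
    the orbit lemmas are stated on the right. The obstacle is that the potentials of the two sides
    may have different limits at infinity: an orbit has a mirror image only below a level that the
    other side attains. This is the reason for the bound [B] in the mirror lemmas and for [hom_gap].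
    Small orbits are controlled by the energy with weight exp(2 L x) or exp(- 2 L x) according to
    the sign of [y]: with [f x y <= L * |y|] near [O] it never decreases along small orbits on the
    right, so nothing falls into [O] through the fourth quadrant, and small backward orbits remain
    small. Boundedness matters for closedness because a limit of homoclinic orbits can otherwise run
    off to infinity. *)

Ltac conj3 := split; [|split].
Ltac conj4 := split; [|conj3].
Ltac conj5 := split; [|conj4].
Ltac conj6 := split; [|conj5].
Ltac conj7 := split; [|conj6].

(** * Elementary real analysis: mean value arguments, continuous induction, Gronwall's inequality *)

Lemma Rabs_le_iff (a b : R) : Rabs a <= b <-> - b <= a <= b.
Proof. split; [apply Rabs_le_between | intros; apply Rabs_le; lra]. Qed.

Lemma Rabs_lt_iff (a b : R) : Rabs a < b <-> - b < a < b.
Proof. split; [apply Rabs_lt_between | intros; apply Rabs_def1; lra]. Qed.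

Lemma is_derive_continuous (h : R -> R) (t l : R) :
 is_derive h t l -> continuous h t.
Proof.
 intros H. apply (ex_derive_continuous (K := R_AbsRing) (V := R_NormedModule)).
 now exists l.
Qed.

Lemma continuous_eps (h : R -> R) (t : R) :
 continuous h t <->
 (forall eps, 0 < eps -> exists d, 0 < d /\
   forall s, Rabs (s - t) < d -> Rabs (h s - h t) < eps).
Proof.
 split.
 - intros H eps He.
  destruct (proj1 (filterlim_locally h (h t)) H (mkposreal eps He)) as [d Hd].
  exists d. split; [apply cond_pos|]. intros s Hs. apply (Hd s Hs).
 - intros H. apply filterlim_locally. intros eps.
  destruct (H eps (cond_pos eps)) as [d [Hd1 Hd2]].
  exists (mkposreal d Hd1). intros s Hs. apply (Hd2 s Hs).
Qed.

Lemma continuous_pos (h : R -> R) (t : R) : continuous h t -> 0 < h t ->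
 exists d, 0 < d /\ forall s, Rabs (s - t) < d -> 0 < h s.
Proof.
 intros C H. destruct (proj1 (continuous_eps h t) C (h t) H) as [d [Hd1 Hd2]].
 exists d; split; [assumption|]. intros s Hs. specialize (Hd2 s Hs).
 apply Rabs_lt_iff in Hd2. lra.
Qed.

Lemma continuous_neg (h : R -> R) (t : R) : continuous h t -> h t < 0 ->
 exists d, 0 < d /\ forall s, Rabs (s - t) < d -> h s < 0.
Proof.
 intros C H.
 destruct (proj1 (continuous_eps h t) C (- h t)) as [d [Hd1 Hd2]]; [lra|].
 exists d; split; [assumption|]. intros s Hs. specialize (Hd2 s Hs).
 apply Rabs_lt_iff in Hd2. lra.
Qed.

Lemma continuous_lipschitz (h : R -> R) (B : R) :
 (forall s t, Rabs (h s - h t) <= B * Rabs (s - t)) -> forall t, continuous h t.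
Proof.
 intros H t. apply continuous_eps. intros eps He.
 assert (HB : 0 <= B).
 { specialize (H 1 0). rewrite Rminus_0_r, Rabs_R1 in H.
  pose proof (Rabs_pos (h 1 - h 0)). lra. }
 exists (eps / (B + 1)). split; [apply Rdiv_lt_0_compat; lra|].
 intros s Hs. apply Rle_lt_trans with (B * Rabs (s - t)); [apply H|].
 pose proof (Rabs_pos (s - t)).
 apply Rle_lt_trans with ((B + 1) * Rabs (s - t)); [nra|].
 apply Rmult_lt_compat_l with (r := B + 1) in Hs; [|lra].
 replace ((B + 1) * (eps / (B + 1))) with eps in Hs by (field; lra). lra.
Qed.

Lemma mvt (h dh : R -> R) (a b : R) : a < b ->
 (forall t, a <= t <= b -> is_derive h t (dh t)) ->
 exists c, a < c < b /\ h b - h a = dh c * (b - a).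
Proof.
 intros Hab H. destruct (MVT_cor2 h dh a b Hab) as [c [Hc1 Hc2]].
 - intros c Hc. now apply is_derive_Reals, H.
 - now exists c.
Qed.

Lemma derive_nondecr (h dh : R -> R) (a b : R) : a <= b ->
 (forall t, a <= t <= b -> is_derive h t (dh t)) ->
 (forall t, a < t < b -> 0 <= dh t) -> h a <= h b.
Proof.
 intros [Hab| ->] H Hp; [|lra]. destruct (mvt h dh a b Hab H) as [c [Hc E]].
 specialize (Hp c Hc). nra.
Qed.

Lemma derive_nonincr (h dh : R -> R) (a b : R) : a <= b ->
 (forall t, a <= t <= b -> is_derive h t (dh t)) ->
 (forall t, a < t < b -> dh t <= 0) -> h b <= h a.
Proof.
 intros [Hab| ->] H Hp; [|lra]. destruct (mvt h dh a b Hab H) as [c [Hc E]].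
 specialize (Hp c Hc). nra.
Qed.

Lemma derive_incr (h dh : R -> R) (a b : R) : a < b ->
 (forall t, a <= t <= b -> is_derive h t (dh t)) ->
 (forall t, a < t < b -> 0 < dh t) -> h a < h b.
Proof.
 intros Hab H Hp. destruct (mvt h dh a b Hab H) as [c [Hc E]].
 specialize (Hp c Hc). nra.
Qed.

Lemma derive_decr (h dh : R -> R) (a b : R) : a < b ->
 (forall t, a <= t <= b -> is_derive h t (dh t)) ->
 (forall t, a < t < b -> dh t < 0) -> h b < h a.
Proof.
 intros Hab H Hp. destruct (mvt h dh a b Hab H) as [c [Hc E]].
 specialize (Hp c Hc). nra.
Qed.

Lemma derive_neg_right (h : R -> R) (t l : R) : is_derive h t l -> l < 0 ->
 exists d, 0 < d /\ (forall s, t < s < t + d -> h s < h t) /\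
  (forall s, t - d < s < t -> h t < h s).
Proof.
 intros H Hl. apply is_derive_Reals in H.
 destruct (H (- l / 2)) as [d Hd]; [lra|].
 exists d. split; [apply cond_pos|].
 assert (K : forall s, s <> 0 -> Rabs s < d -> (h (t + s) - h t) / s < 0).
 { intros s Hs1 Hs2. specialize (Hd s Hs1 Hs2). apply Rabs_lt_iff in Hd. lra. }
 split; intros s Hs.
 - specialize (K (s - t)). replace (t + (s - t)) with s in K by ring.
  assert (E : h s - h t = (h s - h t) / (s - t) * (s - t)) by (field; lra).
  assert ((h s - h t) / (s - t) < 0) by (apply K; [lra | apply Rabs_lt_iff; lra]).
  nra.
 - specialize (K (s - t)). replace (t + (s - t)) with s in K by ring.
  assert (E : h s - h t = (h s - h t) / (s - t) * (s - t)) by (field; lra).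
  assert ((h s - h t) / (s - t) < 0) by (apply K; [lra | apply Rabs_lt_iff; lra]).
  nra.
Qed.

(** The supremum of the initial segments on which [P] holds belongs to them by the closing
    hypothesis and equals [b] by the opening one. This replaces compactness wherever an orbit or a
    parameter is followed along an interval. *)
Lemma real_induction (P : R -> Prop) (a b : R) : P a ->
 (forall t, a <= t < b -> (forall s, a <= s <= t -> P s) ->
   exists e, 0 < e /\ forall s, t < s < t + e -> s <= b -> P s) ->
 (forall t, a < t <= b -> (forall s, a <= s < t -> P s) -> P t) ->
 forall t, a <= t <= b -> P t.
Proof.
 intros Ha Ho Hc t0 Ht0.
 set (E := fun t => a <= t <= b /\ forall s, a <= s <= t -> P s).
 assert (Ea : E a).
 { split; [lra|]. intros s Hs. now replace s with a by lra. }
 destruct (completeness E) as [m [Hm1 Hm2]].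
 - exists b. intros t [Ht _]. lra.
 - now exists a.
 - assert (Ham : a <= m) by now apply Hm1.
  assert (Hmb : m <= b) by (apply Hm2; intros t [Ht _]; lra).
  assert (B : forall s, a <= s < m -> P s).
  { intros s Hs. destruct (classic (exists t, E t /\ s < t)) as [[t [[Ht1 Ht2] Ht3]]|N].
   - apply Ht2. lra.
   - exfalso. apply (Rlt_not_le m s); [lra|]. apply Hm2. intros t Ht.
    destruct (Rle_or_lt t s) as [|L]; [assumption|]. exfalso. apply N. now exists t. }
  assert (Pm : P m).
  { destruct Ham as [Ham| <-]; [|assumption]. apply Hc; [lra|assumption]. }
  assert (Em : E m).
  { split; [lra|]. intros s Hs. destruct (Req_dec s m) as [->|]; [assumption|].
   apply B. lra. }
  destruct (Rle_lt_or_eq_dec m b Hmb) as [L| ->].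
  + exfalso. destruct (Ho m) as [e [He1 He2]]; [lra | apply Em |].
   set (u := Rmin (m + e / 2) b).
   assert (Hu : m < u /\ u <= m + e / 2 /\ u <= b).
   { unfold u. repeat split; [apply Rmin_glb_lt; lra | apply Rmin_l | apply Rmin_r]. }
   assert (E u).
   { split; [lra|]. intros s Hs. destruct (Rle_or_lt s m) as [Hs'|Hs'].
    - apply Em. lra.
    - apply He2; lra. }
   assert (u <= m) by now apply Hm1. lra.
  + apply Em. lra.
Qed.

(** Without a first zero, positivity would propagate from [a] to [b] by continuous induction: a
    limit of points where [h] is positive has [h >= 0], and the value 0 there would be a first
    zero. *)
Lemma first_zero (h : R -> R) (a b : R) : a <= b ->
 (forall t, a <= t <= b -> continuous h t) -> 0 < h a -> h b <= 0 ->
 exists c, a < c <= b /\ h c = 0 /\ forall t, a <= t < c -> 0 < h t.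
Proof.
 intros Hab C Ha Hb. apply NNPP. intros N.
 enough (K : forall t, a <= t <= b -> 0 < h t) by (specialize (K b); lra).
 apply real_induction; [assumption| |].
 - intros t Ht IH. destruct (continuous_pos h t) as [d [Hd1 Hd2]].
  + apply C. lra.
  + apply IH. lra.
  + exists d. split; [assumption|]. intros s Hs _. apply Hd2, Rabs_lt_iff. lra.
 - intros t Ht IH. destruct (Rtotal_order (h t) 0) as [L|[L|L]]; [|exfalso|lra].
  + exfalso. destruct (continuous_neg h t) as [d [Hd1 Hd2]]; [apply C; lra|assumption|].
   set (s := Rmax a (t - d / 2)).
   assert (a <= s < t /\ t - d / 2 <= s).
   { unfold s. repeat split; [apply Rmax_l | apply Rmax_lub_lt; lra | apply Rmax_r]. }
   assert (h s < 0) by (apply Hd2, Rabs_lt_iff; lra).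
   assert (0 < h s) by (apply IH; lra). lra.
  + apply N. exists t. repeat split; [lra|lra|assumption|assumption].
Qed.

Lemma ivt (h : R -> R) (a b v : R) : a <= b ->
 (forall t, a <= t <= b -> continuous h t) -> h a <= v <= h b ->
 exists c, a <= c <= b /\ h c = v.
Proof.
 intros Hab C Hv. destruct (Req_dec (h a) v) as [E|E]; [exists a; split; [lra|assumption]|].
 destruct (first_zero (fun t => v - h t) a b Hab) as [c [Hc1 [Hc2 _]]].
 - intros t Ht. apply (continuous_minus (V := R_NormedModule)); [apply continuous_const|].
  now apply C.
 - lra.
 - lra.
 - exists c. split; lra.
Qed.

Lemma ivt_decr (h : R -> R) (a b v : R) : a <= b ->
 (forall t, a <= t <= b -> continuous h t) -> h b <= v <= h a ->
 exists c, a <= c <= b /\ h c = v.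
Proof.
 intros Hab C Hv. destruct (ivt (fun t => - h t) a b (- v) Hab) as [c [Hc E]].
 - intros t Ht. apply (continuous_opp (V := R_NormedModule)). now apply C.
 - lra.
 - exists c. split; [assumption|lra].
Qed.

(** The function [D t * exp (- K * (t - a))] is nonincreasing. *)
Lemma gronwall (D D' : R -> R) (K a b : R) : a <= b ->
 (forall t, a <= t <= b -> is_derive D t (D' t)) ->
 (forall t, a < t < b -> D' t <= K * D t) -> D b <= D a * exp (K * (b - a)).
Proof.
 intros Hab H HK.
 assert (E : D b * exp (- K * (b - a)) <= D a * exp (- K * (a - a))).
 { apply (derive_nonincr (fun t => D t * exp (- K * (t - a)))
   (fun t => (D' t - K * D t) * exp (- K * (t - a)))); [assumption| |].
  - intros t Ht. pose proof (H t Ht) as Hd.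
   assert (Ed : Derive (fun x => D x) t = D' t) by now apply is_derive_unique.
   auto_derive; [now exists (D' t)|]. rewrite Ed. unfold Rminus. ring.
  - intros t Ht. pose proof (exp_pos (- K * (t - a))). specialize (HK t Ht). nra. }
 replace (- K * (a - a)) with 0 in E by ring. rewrite exp_0 in E.
 replace (D b) with (D b * exp (- K * (b - a)) * exp (K * (b - a))).
 - pose proof (exp_pos (K * (b - a))). nra.
 - rewrite Rmult_assoc, <- exp_plus.
  replace (- K * (b - a) + K * (b - a)) with 0 by ring. rewrite exp_0. ring.
Qed.

Lemma is_derive_reverse (h : R -> R) (t l : R) :
 is_derive h (- t) l -> is_derive (fun s => h (- s)) t (- l).
Proof.
 intros H. assert (E : Derive (fun x => h x) (- t) = l) by now apply is_derive_unique.
 auto_derive; [now exists l|]. rewrite E. ring.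
Qed.

Lemma is_derive_neg (h : R -> R) (t l : R) :
 is_derive h t l -> is_derive (fun s => - h s) t (- l).
Proof. intros H. now apply (is_derive_opp (V := R_NormedModule)). Qed.

Lemma is_derive_shift (h : R -> R) (a t l : R) :
 is_derive h (t + a) l -> is_derive (fun s => h (s + a)) t l.
Proof.
 intros H. assert (E : Derive (fun x => h x) (t + a) = l) by now apply is_derive_unique.
 auto_derive; [now exists l|]. rewrite E. ring.
Qed.

Lemma gronwall_back (D D' : R -> R) (K a b : R) : a <= b ->
 (forall t, a <= t <= b -> is_derive D t (D' t)) ->
 (forall t, a < t < b -> - K * D t <= D' t) -> D a <= D b * exp (K * (b - a)).
Proof.
 intros Hab H HK.
 assert (E := gronwall (fun t => D (- t)) (fun t => - D' (- t)) K (- b) (- a)).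
 simpl in E. rewrite !Ropp_involutive in E.
 replace (- a - - b) with (b - a) in E by ring. apply E.
 - lra.
 - intros t Ht. apply is_derive_reverse, H. lra.
 - intros t Ht. specialize (HK (- t)). lra.
Qed.

(** * Picard iteration *)

(** Summing a geometric series of ratio 1/2 shows that the sequence is Cauchy. [Lim_seq] always
    returns a value; the bound identifies it as the actual limit, with a rate. *)
Lemma geometric_limit (u : nat -> R) (D : R) :
 (forall n, Rabs (u (S n) - u n) <= D * (/ 2) ^ n) ->
 forall n, Rabs (u n - real (Lim_seq u)) <= 2 * D * (/ 2) ^ n.
Proof.
 intros H.
 assert (P : forall n, 0 < (/ 2) ^ n) by (intros; apply pow_lt; lra).
 assert (HD : 0 <= D).
 { pose proof (H 0%nat) as H0. simpl in H0.
  pose proof (Rabs_pos (u 1%nat - u 0%nat)). lra. }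
 assert (B : forall n k, Rabs (u (n + k)%nat - u n) <= 2 * D * (/ 2) ^ n * (1 - (/ 2) ^ k)).
 { intros n k. induction k as [|k IH].
  - rewrite Nat.add_0_r, Rminus_diag, Rabs_R0. simpl. lra.
  - replace (u (n + S k)%nat - u n) with
    ((u (S (n + k)) - u (n + k)%nat) + (u (n + k)%nat - u n))
    by (rewrite Nat.add_succ_r; ring).
   eapply Rle_trans; [apply Rabs_triang|].
   specialize (H (n + k)%nat). rewrite pow_add in H. simpl. 
   replace (2 * D * (/ 2) ^ n * (1 - / 2 * (/ 2) ^ k)) with
    (D * ((/ 2) ^ n * (/ 2) ^ k) + 2 * D * (/ 2) ^ n * (1 - (/ 2) ^ k)) by field.
   lra. }
 assert (B' : forall n k, Rabs (u (n + k)%nat - u n) <= 2 * D * (/ 2) ^ n).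
 { intros n k. eapply Rle_trans; [apply B|]. specialize (P n) as Pn. specialize (P k).
  assert (0 <= 2 * D * (/ 2) ^ n) by nra. nra. }
 assert (C : ex_finite_lim_seq u).
 { apply ex_lim_seq_cauchy_corr. intros eps.
  destruct (pow_lt_1_zero (/ 2)) with (y := eps / (4 * D + 1)) as [N HN].
  - rewrite Rabs_pos_eq; lra.
  - apply Rdiv_lt_0_compat; [apply cond_pos|lra].
  - exists N. intros n m Hn Hm.
   assert (K : forall q, (N <= q)%nat -> Rabs (u q - u N) <= 2 * D * (/ 2) ^ N).
   { intros q Hq. replace q with (N + (q - N))%nat by lia. apply B'. }
   pose proof (K n Hn) as K1. pose proof (K m Hm) as K2.
   specialize (HN N (le_n N)). rewrite Rabs_pos_eq in HN by (left; apply P).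
   assert (4 * D * (/ 2) ^ N < eps).
   { apply Rle_lt_trans with ((4 * D + 1) * (/ 2) ^ N); [specialize (P N); nra|].
    apply Rmult_lt_compat_l with (r := 4 * D + 1) in HN; [|lra].
    replace ((4 * D + 1) * (eps / (4 * D + 1))) with (pos eps) in HN by (field; lra).
    lra. }
   apply Rabs_le_iff in K1. apply Rabs_le_iff in K2. apply Rabs_lt_iff. lra. }
 intros n. apply Lim_seq_correct' in C.
 assert (L : is_lim_seq (fun k => Rabs (u n - u (k + n)%nat)) (Rabs (u n - real (Lim_seq u)))).
 { apply is_lim_seq_abs with (l := Finite (u n - real (Lim_seq u))).
  apply is_lim_seq_minus'; [apply is_lim_seq_const|].
  now apply (is_lim_seq_incr_n u n). }
 apply (is_lim_seq_le _ (fun _ => 2 * D * (/ 2) ^ n) _ (Finite (2 * D * (/ 2) ^ n))) in L.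
 - exact L.
 - intros k. rewrite Rabs_minus_sym, Nat.add_comm. apply B'.
 - apply is_lim_seq_const.
Qed.

Lemma is_RInt_exp (K t : R) : 0 < K -> is_RInt (fun s => exp (K * s)) 0 t ((exp (K * t) - 1) / K).
Proof.
 intros HK. replace ((exp (K * t) - 1) / K) with (minus (exp (K * t) / K) (exp (K * 0) / K)).
 - apply (is_RInt_derive (fun s => exp (K * s) / K)).
  + intros s _. auto_derive; [lra|]. field. lra.
  + intros s _. apply (is_derive_continuous _ _ (K * exp (K * s))). auto_derive; [trivial|ring].
 - rewrite Rmult_0_r, exp_0. unfold minus, plus, opp; simpl. field. lra.
Qed.

Lemma RInt_reverse (h : R -> R) (t : R) : (forall s, continuous h s) ->
 RInt h 0 t = - RInt (fun s => h (- s)) 0 (- t).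
Proof.
 intros C. assert (E : is_RInt h (- 0) (- (- t)) (RInt h 0 t)).
 { rewrite Ropp_0, Ropp_involutive. apply (RInt_correct (V := R_CompleteNormedModule)),
  (ex_RInt_continuous (V := R_CompleteNormedModule)). auto. }
 apply is_RInt_comp_opp, (is_RInt_opp (V := R_NormedModule)) in E.
 apply (is_RInt_ext (V := R_NormedModule) _ (fun s => h (- s))) in E;
  [|intros s _; apply (opp_opp (G := R_AbelianGroup))].
 rewrite (is_RInt_unique _ _ _ _ E). symmetry. apply Ropp_involutive.
Qed.

(** In the norm weighted by exp(- K |s|), integration from 0 divides by [K]. This lets the iteration
    converge on the whole line at once instead of on short intervals. *)
Lemma RInt_exp_bound (h : R -> R) (A K : R) : 0 < K -> (forall s, continuous h s) ->
 (forall s, Rabs (h s) <= A * exp (K * Rabs s)) ->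
 forall t, Rabs (RInt h 0 t) <= A / K * exp (K * Rabs t).
Proof.
 intros HK.
 assert (Q : forall h t, 0 <= t -> (forall s, continuous h s) ->
  (forall s, Rabs (h s) <= A * exp (K * Rabs s)) ->
  Rabs (RInt h 0 t) <= A / K * exp (K * Rabs t)).
 { clear h. intros h t Ht C H.
  assert (HA : 0 <= A).
  { specialize (H 0). rewrite Rabs_R0, Rmult_0_r, exp_0 in H.
   pose proof (Rabs_pos (h 0)). lra. }
  apply Rle_trans with (A * ((exp (K * t) - 1) / K)).
  - apply (norm_RInt_le h (fun s => A * exp (K * s)) 0 t).
   + assumption.
   + intros s Hs. specialize (H s). rewrite (Rabs_pos_eq s) in H by lra. exact H.
   + apply (RInt_correct (V := R_CompleteNormedModule)),
    (ex_RInt_continuous (V := R_CompleteNormedModule)). auto.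
   + apply (is_RInt_scal (V := R_NormedModule) (fun s => exp (K * s))). now apply is_RInt_exp.
  - rewrite (Rabs_pos_eq t) by assumption.
   pose proof (exp_pos (K * t)). unfold Rdiv.
   assert (0 < / K) by now apply Rinv_0_lt_compat.
   assert (0 <= A * / K) by nra. nra. }
 intros C H t. destruct (Rle_or_lt 0 t) as [Ht|Ht]; [now apply Q|].
 rewrite RInt_reverse by assumption. rewrite Rabs_Ropp, <- (Rabs_Ropp t).
 apply Q; [lra| |].
 - intros s. apply (continuous_comp (fun y => - y) h); [|apply C].
  apply (continuous_opp (V := R_NormedModule)), continuous_id.
 - intros s. rewrite <- (Rabs_Ropp s). apply H.
Qed.

Lemma RInt_sub (h : R -> R) (s t : R) : (forall s, continuous h s) ->
 RInt h 0 s - RInt h 0 t = RInt h t s :> R.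
Proof.
 intros C. assert (E : RInt h 0 t + RInt h t s = RInt h 0 s :> R).
 { apply (RInt_Chasles (V := R_CompleteNormedModule));
   apply (ex_RInt_continuous (V := R_CompleteNormedModule)); auto. }
 rewrite <- E. lra.
Qed.

Lemma RInt_lipschitz (h : R -> R) (B : R) : (forall s, continuous h s) ->
 (forall s, Rabs (h s) <= B) ->
 forall s t, Rabs (RInt h 0 s - RInt h 0 t) <= B * Rabs (s - t).
Proof.
 intros C H.
 assert (Q : forall s t, t <= s -> Rabs (RInt h 0 s - RInt h 0 t) <= B * Rabs (s - t)).
 { intros s t Hst.
  assert (X : forall a b, ex_RInt h a b) by (intros;
   apply (ex_RInt_continuous (V := R_CompleteNormedModule)); auto).
  rewrite RInt_sub by assumption.
  rewrite (Rabs_pos_eq (s - t)) by lra. rewrite Rmult_comm.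
  apply abs_RInt_le_const; auto. }
 intros s t. destruct (Rle_or_lt t s); [now apply Q|].
 rewrite Rabs_minus_sym, (Rabs_minus_sym s). apply Q. lra.
Qed.

Lemma Radd_cancel (a b : R) : a + b - a = b.
Proof. ring. Qed.

Lemma Radd_sub_cancel (a b c : R) : (a + b) - (a + c) = b - c.
Proof. ring. Qed.

Section Picard.
Variables (F1 F2 : R -> R -> R) (L B x0 y0 : R).
Hypothesis HL : 0 < L.
Hypothesis Lip1 : forall x y x' y',
 Rabs (F1 x y - F1 x' y') <= L * (Rabs (x - x') + Rabs (y - y')).
Hypothesis Lip2 : forall x y x' y',
 Rabs (F2 x y - F2 x' y') <= L * (Rabs (x - x') + Rabs (y - y')).
Hypothesis Bd1 : forall x y, Rabs (F1 x y) <= B.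
Hypothesis Bd2 : forall x y, Rabs (F2 x y) <= B.

Fixpoint picard (n : nat) (t : R) : R * R :=
 match n with
 | O => (x0, y0)
 | S n => (x0 + RInt (fun s => F1 (fst (picard n s)) (snd (picard n s))) 0 t,
      y0 + RInt (fun s => F2 (fst (picard n s)) (snd (picard n s))) 0 t)
 end.

(** All iterates are kept [B]-Lipschitz, which is how the continuity of every integrand is known. *)
Lemma field_along_lipschitz (F : R -> R -> R) (x y : R -> R) :
 (forall x y x' y', Rabs (F x y - F x' y') <= L * (Rabs (x - x') + Rabs (y - y'))) ->
 (forall s t, Rabs (x s - x t) <= B * Rabs (s - t)) ->
 (forall s t, Rabs (y s - y t) <= B * Rabs (s - t)) ->
 forall t, continuous (fun s => F (x s) (y s)) t.
Proof.
 intros HF Hx Hy. apply continuous_lipschitz with (L * (2 * B)). intros s t.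
 eapply Rle_trans; [apply HF|]. specialize (Hx s t). specialize (Hy s t). nra.
Qed.

Lemma picard_lipschitz n : forall s t,
 Rabs (fst (picard n s) - fst (picard n t)) <= B * Rabs (s - t) /\
 Rabs (snd (picard n s) - snd (picard n t)) <= B * Rabs (s - t).
Proof.
 assert (0 <= B) by (specialize (Bd1 0 0); pose proof (Rabs_pos (F1 0 0)); lra).
 induction n as [|n IH]; intros s t; simpl.
 - rewrite !Rminus_diag, Rabs_R0. pose proof (Rabs_pos (s - t)). split; nra.
 - split.
  + replace (x0 + _ - _) with (RInt (fun s => F1 (fst (picard n s)) (snd (picard n s))) 0 s
    - RInt (fun s => F1 (fst (picard n s)) (snd (picard n s))) 0 t) by (symmetry;
     apply Radd_sub_cancel).
   apply RInt_lipschitz; [|auto].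
   apply field_along_lipschitz; [assumption|intros; apply IH|intros; apply IH].
  + replace (y0 + _ - _) with (RInt (fun s => F2 (fst (picard n s)) (snd (picard n s))) 0 s
    - RInt (fun s => F2 (fst (picard n s)) (snd (picard n s))) 0 t) by (symmetry;
     apply Radd_sub_cancel).
   apply RInt_lipschitz; [|auto].
   apply field_along_lipschitz; [assumption|intros; apply IH|intros; apply IH].
Qed.

(** A weighted bound [A] on the differences of both coordinates becomes [2 * L * A] for the field;
    with the weight [4 * L] one integration is then a contraction of ratio 1/2. *)
Let K := 4 * L.
Let C := B / K.

Lemma RInt_field_diff (F : R -> R -> R) (x y x' y' : R -> R) (A t : R) :
 (forall x y x' y', Rabs (F x y - F x' y') <= L * (Rabs (x - x') + Rabs (y - y'))) ->
 (forall s t, Rabs (x s - x t) <= B * Rabs (s - t)) ->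
 (forall s t, Rabs (y s - y t) <= B * Rabs (s - t)) ->
 (forall s t, Rabs (x' s - x' t) <= B * Rabs (s - t)) ->
 (forall s t, Rabs (y' s - y' t) <= B * Rabs (s - t)) ->
 (forall s, Rabs (x s - x' s) <= A * exp (K * Rabs s)) ->
 (forall s, Rabs (y s - y' s) <= A * exp (K * Rabs s)) ->
 Rabs (RInt (fun s => F (x s) (y s)) 0 t - RInt (fun s => F (x' s) (y' s)) 0 t)
  <= A / 2 * exp (K * Rabs t).
Proof.
 intros HF H1 H2 H3 H4 H5 H6.
 assert (C1 := field_along_lipschitz F x y HF H1 H2).
 assert (C2 := field_along_lipschitz F x' y' HF H3 H4).
 rewrite <- (RInt_minus (V := R_CompleteNormedModule)) by
  (apply (ex_RInt_continuous (V := R_CompleteNormedModule)); auto).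
 replace (A / 2) with ((2 * L * A) / K) by (unfold K; field; lra).
 apply (RInt_exp_bound (fun s => F (x s) (y s) - F (x' s) (y' s))).
 - unfold K; lra.
 - intros s. now apply (continuous_minus (V := R_NormedModule)).
 - intros s. eapply Rle_trans; [apply HF|]. specialize (H5 s). specialize (H6 s). nra.
Qed.

Lemma picard_step n : forall t,
 Rabs (fst (picard (S n) t) - fst (picard n t)) <= C * exp (K * Rabs t) * (/ 2) ^ n /\
 Rabs (snd (picard (S n) t) - snd (picard n t)) <= C * exp (K * Rabs t) * (/ 2) ^ n.
Proof.
 assert (HB : 0 <= B) by (specialize (Bd1 0 0); pose proof (Rabs_pos (F1 0 0)); lra).
 induction n as [|n IH]; intros t.
 - simpl. rewrite Rmult_1_r.
  assert (HK : 0 < K) by (unfold K; lra).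
  split.
  + replace (x0 + _ - _) with (RInt (fun _ => F1 x0 y0) 0 t : R) by (symmetry; apply Radd_cancel).
   apply RInt_exp_bound; [assumption|intros; apply continuous_const|].
   intros s. eapply Rle_trans; [apply Bd1|]. pose proof (exp_ineq1_le (K * Rabs s)).
   pose proof (Rabs_pos s). assert (1 <= exp (K * Rabs s)) by nra. nra.
  + replace (y0 + _ - _) with (RInt (fun _ => F2 x0 y0) 0 t : R) by (symmetry; apply Radd_cancel).
   apply RInt_exp_bound; [assumption|intros; apply continuous_const|].
   intros s. eapply Rle_trans; [apply Bd2|]. pose proof (exp_ineq1_le (K * Rabs s)).
   pose proof (Rabs_pos s). assert (1 <= exp (K * Rabs s)) by nra. nra.
 - replace (C * exp (K * Rabs t) * (/ 2) ^ S n) with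
   ((C * (/ 2) ^ n) / 2 * exp (K * Rabs t)) by (simpl; field).
  split.
  + replace (fst (picard (S (S n)) t) - fst (picard (S n) t)) with
    (RInt (fun s => F1 (fst (picard (S n) s)) (snd (picard (S n) s))) 0 t -
     RInt (fun s => F1 (fst (picard n s)) (snd (picard n s))) 0 t) by (symmetry;
      apply Radd_sub_cancel).
   apply RInt_field_diff; try (intros; apply picard_lipschitz); [assumption| |];
   intros s; eapply Rle_trans; try apply IH; right; ring.
  + replace (snd (picard (S (S n)) t) - snd (picard (S n) t)) with
    (RInt (fun s => F2 (fst (picard (S n) s)) (snd (picard (S n) s))) 0 t -
     RInt (fun s => F2 (fst (picard n s)) (snd (picard n s))) 0 t) by (symmetry;
      apply Radd_sub_cancel).
   apply RInt_field_diff; try (intros; apply picard_lipschitz); [assumption| |];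
   intros s; eapply Rle_trans; try apply IH; right; ring.
Qed.

Lemma half_pow_zero (a b : R) : (forall n, Rabs a <= b * (/ 2) ^ n) -> a = 0.
Proof.
 intros H. destruct (Req_dec a 0) as [|N]; [assumption|exfalso].
 assert (Ha : 0 < Rabs a) by now apply Rabs_pos_lt.
 assert (Hb : 0 < b) by (specialize (H 0%nat); simpl in H; lra).
 destruct (pow_lt_1_zero (/ 2)) with (y := Rabs a / b) as [n Hn].
 - rewrite Rabs_pos_eq; lra.
 - now apply Rdiv_lt_0_compat.
 - specialize (Hn n (le_n n)). specialize (H n).
  rewrite Rabs_pos_eq in Hn by (apply pow_le; lra).
  apply Rmult_lt_compat_l with (r := b) in Hn; [|assumption].
  replace (b * (Rabs a / b)) with (Rabs a) in Hn by (field; lra). lra.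
Qed.

Lemma picard_existence : exists x y : R -> R, x 0 = x0 /\ y 0 = y0 /\
 (forall t, is_derive x t (F1 (x t) (y t)) /\ is_derive y t (F2 (x t) (y t))).
Proof.
 set (x := fun t => real (Lim_seq (fun n => fst (picard n t)))).
 set (y := fun t => real (Lim_seq (fun n => snd (picard n t)))).
 assert (Hx : forall t n, Rabs (fst (picard n t) - x t) <= 2 * (C * exp (K * Rabs t)) * (/ 2) ^ n).
 { intros t. apply (geometric_limit (fun n => fst (picard n t))). intros n. apply picard_step. }
 assert (Hy : forall t n, Rabs (snd (picard n t) - y t) <= 2 * (C * exp (K * Rabs t)) * (/ 2) ^ n).
 { intros t. apply (geometric_limit (fun n => snd (picard n t))). intros n. apply picard_step. }
 assert (Lx : forall (p : R * R -> R) (z : R -> R),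
  (forall t n, Rabs (p (picard n t) - z t) <= 2 * (C * exp (K * Rabs t)) * (/ 2) ^ n) ->
  (forall n s t, Rabs (p (picard n s) - p (picard n t)) <= B * Rabs (s - t)) ->
  forall s t, Rabs (z s - z t) <= B * Rabs (s - t)).
 { intros p z Hz Hp s t. apply Rnot_lt_le. intros N.
  assert (E : Rabs (z s - z t) - B * Rabs (s - t) = 0); [|lra].
  apply half_pow_zero with
   (2 * (C * exp (K * Rabs s)) + 2 * (C * exp (K * Rabs t))). intros n.
  rewrite Rabs_pos_eq by lra.
  specialize (Hp n s t). pose proof (Hz s n) as Hs. pose proof (Hz t n) as Ht.
  assert (Rabs (z s - z t) <= Rabs (p (picard n s) - z s) + Rabs (p (picard n t) - z t)
   + Rabs (p (picard n s) - p (picard n t))); [|lra].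
  replace (z s - z t) with (- (p (picard n s) - z s) + (p (picard n t) - z t) +
   (p (picard n s) - p (picard n t))) by ring.
  eapply Rle_trans; [apply Rabs_triang|]. apply Rplus_le_compat_r.
  eapply Rle_trans; [apply Rabs_triang|]. rewrite Rabs_Ropp. lra. }
 assert (Lipx := Lx fst x Hx (fun n s t => proj1 (picard_lipschitz n s t))).
 assert (Lipy := Lx snd y Hy (fun n s t => proj2 (picard_lipschitz n s t))).
 (* Both sides are within a multiple of (1/2)^n of the iterate of index n + 1, so the integral
    equation passes to the limit. *)
 assert (Eq : forall (F : R -> R -> R) (p : R * R -> R) (z : R -> R) z0,
  (forall x y x' y', Rabs (F x y - F x' y') <= L * (Rabs (x - x') + Rabs (y - y'))) ->
  (forall t n, Rabs (p (picard n t) - z t) <= 2 * (C * exp (K * Rabs t)) * (/ 2) ^ n) ->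
  (forall n t, p (picard (S n) t) = z0 +
    RInt (fun s => F (fst (picard n s)) (snd (picard n s))) 0 t) ->
  forall t, z t = z0 + RInt (fun s => F (x s) (y s)) 0 t).
 { intros F p z z0 HF Hz HS t.
  enough (z t - (z0 + RInt (fun s => F (x s) (y s)) 0 t) = 0) by lra.
  apply half_pow_zero with (2 * (C * exp (K * Rabs t))). intros n.
  assert (E1 := Hz t (S n)). rewrite HS in E1. 
  assert (E2 : Rabs (RInt (fun s => F (fst (picard n s)) (snd (picard n s))) 0 t -
   RInt (fun s => F (x s) (y s)) 0 t) <= (2 * C * (/ 2) ^ n) / 2 * exp (K * Rabs t)).
  { apply (RInt_field_diff F (fun s => fst (picard n s)) (fun s => snd (picard n s)));
    try assumption; try (intros; apply picard_lipschitz);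
    intros s; [eapply Rle_trans; [apply Hx|]|eapply Rle_trans; [apply Hy|]]; right; ring. }
  simpl in E1. apply Rabs_le_iff in E1. apply Rabs_le_iff in E2. apply Rabs_le_iff. lra. }
 exists x, y.
 assert (D : forall (F : R -> R -> R) z z0,
  (forall x y x' y', Rabs (F x y - F x' y') <= L * (Rabs (x - x') + Rabs (y - y'))) ->
  (forall t, z t = z0 + RInt (fun s => F (x s) (y s)) 0 t) ->
  z 0 = z0 /\ forall t, is_derive z t (F (x t) (y t))).
 { intros F z z0 HF E.
  assert (Cf := field_along_lipschitz F x y HF Lipx Lipy).
  split; [rewrite E, RInt_point; unfold zero; simpl; ring|].
  intros t. apply (is_derive_ext (fun t => z0 + RInt (fun s => F (x s) (y s)) 0 t));
   [intros; now rewrite E|].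
  replace (F (x t) (y t)) with (plus 0 (F (x t) (y t))) by (unfold plus; simpl; ring).
  apply (is_derive_plus (V := R_NormedModule) (fun _ => z0));
   [apply (is_derive_const (V := R_NormedModule))|].
  apply (is_derive_RInt (V := R_NormedModule) (fun s => F (x s) (y s)) _ 0).
  - apply filter_forall. intros s. apply (RInt_correct (V := R_CompleteNormedModule)),
   (ex_RInt_continuous (V := R_CompleteNormedModule)). auto.
  - apply Cf. }
 destruct (D F1 x x0 Lip1) as [Dx1 Dx2]; [now apply (Eq F1 fst)|].
 destruct (D F2 y y0 Lip2) as [Dy1 Dy2]; [now apply (Eq F2 snd)|].
 conj3; [assumption|assumption| ]. intros t. split; [apply Dx2|apply Dy2].
Qed.
End Picard.

(** * Planar flows with bounded Lipschitz fields *)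

(** Clamping to [-N, N] is 1-Lipschitz and keeps signs, so truncation bounds the field without
    changing where the abscissa grows. *)
Definition cl (N v : R) : R := Rmax (- N) (Rmin N v).

Lemma cl_bounds N v : 0 <= N -> - N <= cl N v <= N.
Proof.
 intros H. split; [apply Rmax_l|].
 apply Rmax_lub; [lra|apply Rmin_l].
Qed.

Lemma cl_id N v : - N <= v <= N -> cl N v = v.
Proof. intros H. unfold cl. rewrite Rmin_right, Rmax_right; lra. Qed.

Lemma cl_lipschitz N v w : Rabs (cl N v - cl N w) <= Rabs (v - w).
Proof.
 unfold cl, Rmax, Rmin, Rabs.
 repeat (destruct Rle_dec || destruct Rcase_abs); lra.
Qed.

Lemma cl_pos N v : 0 < N -> 0 < v -> 0 < cl N v.
Proof. intros. unfold cl, Rmax, Rmin. repeat destruct Rle_dec; lra. Qed.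

Lemma cl_neg N v : 0 < N -> v < 0 -> cl N v < 0.
Proof. intros. unfold cl, Rmax, Rmin. repeat destruct Rle_dec; lra. Qed.

Lemma cl_nonneg N v : 0 <= N -> 0 <= v -> 0 <= cl N v.
Proof. intros. unfold cl, Rmax, Rmin. repeat destruct Rle_dec; lra. Qed.

Lemma cl_0 N : 0 <= N -> cl N 0 = 0.
Proof. intros. apply cl_id. lra. Qed.

Lemma cl_opp N v : 0 <= N -> cl N (- v) = - cl N v.
Proof. intros. unfold cl, Rmax, Rmin. repeat destruct Rle_dec; lra. Qed.

Lemma cl_incr N v w : v <= w -> cl N v <= cl N w.
Proof. intros. unfold cl, Rmax, Rmin. repeat destruct Rle_dec; lra. Qed.

Definition lip2 (L : R) (F : R -> R -> R) : Prop := forall x y x' y',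
 Rabs (F x y - F x' y') <= L * (Rabs (x - x') + Rabs (y - y')).

(** The sign is prescribed on the positive axis alone, since the quadrant lemmas concern the right
    half plane; the left one is treated after a reflection. *)
Record field (F : R -> R -> R) : Prop := {
 field_lip : exists L, 1 <= L /\ lip2 L F;
 field_bd : exists B, forall x y, Rabs (F x y) <= B;
 field_neg : forall x, 0 < x -> F x 0 < 0;
 field_zero : F 0 0 = 0 }.

(** The first equation uses the clamped velocity so that the whole field is bounded, as Picard
    iteration on the line requires; the sign of the derivative of [x] is still that of [y]. *)
Definition sol (N : R) (F : R -> R -> R) (I : R -> Prop) (x y : R -> R) : Prop :=
 forall t, I t -> is_derive x t (cl N (y t)) /\ is_derive y t (F (x t) (y t)).

Definition flow (N : R) (F : R -> R -> R) : (R -> R) -> (R -> R) -> Prop :=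
 sol N F (fun _ => True).

Lemma flow_exists N F x0 y0 : 0 < N -> field F ->
 exists x y, x 0 = x0 /\ y 0 = y0 /\ flow N F x y.
Proof.
 intros HN [[L [HL Lip]] [B HB] _ _].
 destruct (picard_existence (fun _ y => cl N y) F L (Rmax N B) x0 y0)
  as [x [y [H1 [H2 H3]]]].
 - lra.
 - intros x y x' y'. eapply Rle_trans; [apply cl_lipschitz|].
  pose proof (Rabs_pos (x - x')). pose proof (Rabs_pos (y - y')). nra.
 - exact Lip.
 - intros _ y. apply Rle_trans with N; [|apply Rmax_l].
  apply Rabs_le_iff, cl_bounds. lra.
 - intros x y. apply Rle_trans with B; [apply HB|apply Rmax_r].
 - exists x, y. conj3; [assumption|assumption| ]. intros t _. apply H3.
Qed.

Lemma flow_shift N F x y a : flow N F x y ->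
 flow N F (fun t => x (t + a)) (fun t => y (t + a)).
Proof.
 intros H t _. destruct (H (t + a) Logic.I) as [H1 H2].
 split; now apply is_derive_shift.
Qed.

Lemma sol_cont_x N F (I : R -> Prop) x y t : sol N F I x y -> I t -> continuous x t.
Proof. intros H Ht. eapply is_derive_continuous, (proj1 (H t Ht)). Qed.

Lemma sol_cont_y N F (I : R -> Prop) x y t : sol N F I x y -> I t -> continuous y t.
Proof. intros H Ht. eapply is_derive_continuous, (proj2 (H t Ht)). Qed.

Lemma flow_cont_x N F x y t : flow N F x y -> continuous x t.
Proof. intros H. now apply (sol_cont_x N F _ x y t H). Qed.

Lemma flow_cont_y N F x y t : flow N F x y -> continuous y t.
Proof. intros H. now apply (sol_cont_y N F _ x y t H). Qed.

(** * Uniqueness and continuous dependence on the initial point *)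

Definition dist2 (x y x' y' : R -> R) (t : R) : R :=
 (x t - x' t) * (x t - x' t) + (y t - y' t) * (y t - y' t).

Lemma dist2_derive x y x' y' t a b a' b' :
 is_derive x t a -> is_derive y t b -> is_derive x' t a' -> is_derive y' t b' ->
 is_derive (dist2 x y x' y') t
  (2 * ((x t - x' t) * (a - a') + (y t - y' t) * (b - b'))).
Proof.
 intros H1 H2 H3 H4. unfold dist2.
 assert (E1 : Derive (fun u => x u) t = a) by now apply is_derive_unique.
 assert (E2 : Derive (fun u => y u) t = b) by now apply is_derive_unique.
 assert (E3 : Derive (fun u => x' u) t = a') by now apply is_derive_unique.
 assert (E4 : Derive (fun u => y' u) t = b') by now apply is_derive_unique.
 auto_derive.
 - repeat split; try (now exists a); try (now exists b); try (now exists a');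
  now exists b'.
 - rewrite E1, E2, E3, E4. ring.
Qed.

(** Squares are used because they are differentiable; (|u| + |v|)^2 <= 2 (u^2 + v^2) accounts for
    the constant [4 * L]. *)
Lemma dist2_growth L dx dy da db : 0 <= L ->
 Rabs da <= L * (Rabs dx + Rabs dy) -> Rabs db <= L * (Rabs dx + Rabs dy) ->
 Rabs (2 * (dx * da + dy * db)) <= 4 * L * (dx * dx + dy * dy).
Proof.
 intros HL Ha Hb. rewrite Rabs_mult, (Rabs_pos_eq 2) by lra.
 assert (Rabs (dx * da + dy * db) <= Rabs dx * Rabs da + Rabs dy * Rabs db).
 { eapply Rle_trans; [apply Rabs_triang|]. rewrite !Rabs_mult. lra. }
 assert (Ex : Rabs dx * Rabs dx = dx * dx) by (rewrite <- Rabs_mult; apply Rabs_pos_eq; nra).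
 assert (Ey : Rabs dy * Rabs dy = dy * dy) by (rewrite <- Rabs_mult; apply Rabs_pos_eq; nra).
 pose proof (Rabs_pos dx). pose proof (Rabs_pos dy).
 
 assert ((Rabs dx + Rabs dy) * (Rabs dx + Rabs dy) <= 2 * (dx * dx + dy * dy)).
 { rewrite <- Ex, <- Ey. pose proof (Rle_0_sqr (Rabs dx - Rabs dy)). unfold Rsqr in *. nra. }
 nra.
Qed.

Lemma sol_dist N F L x y x' y' a b : 1 <= L -> lip2 L F -> a <= b ->
 sol N F (fun t => a <= t <= b) x y -> sol N F (fun t => a <= t <= b) x' y' ->
 dist2 x y x' y' b <= dist2 x y x' y' a * exp (4 * L * (b - a)) /\
 dist2 x y x' y' a <= dist2 x y x' y' b * exp (4 * L * (b - a)).
Proof.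
 intros HL Lip Hab H H'.
 assert (G : forall t, Rabs (2 * ((x t - x' t) * (cl N (y t) - cl N (y' t)) +
   (y t - y' t) * (F (x t) (y t) - F (x' t) (y' t)))) <= 4 * L * dist2 x y x' y' t).
 { intros t. apply dist2_growth; [lra| |apply Lip].
  eapply Rle_trans; [apply cl_lipschitz|].
  pose proof (Rabs_pos (x t - x' t)). pose proof (Rabs_pos (y t - y' t)). nra. }
 split.
 - eapply gronwall; [assumption| |].
  + intros t Ht. destruct (H t Ht), (H' t Ht). apply dist2_derive; eassumption.
  + intros t Ht. specialize (G t). apply Rabs_le_iff in G. lra.
 - eapply gronwall_back; [assumption| |].
  + intros t Ht. destruct (H t Ht), (H' t Ht). apply dist2_derive; eassumption.
  + intros t Ht. specialize (G t). apply Rabs_le_iff in G. lra.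
Qed.

Lemma dist2_zero x y x' y' t : dist2 x y x' y' t <= 0 -> x t = x' t /\ y t = y' t.
Proof.
 unfold dist2. intros H.
 pose proof (Rle_0_sqr (x t - x' t)) as H1. pose proof (Rle_0_sqr (y t - y' t)) as H2.
 fold (Rsqr (x t - x' t)) in H. fold (Rsqr (y t - y' t)) in H.
 assert (E1 := Rsqr_0_uniq (x t - x' t)). assert (E2 := Rsqr_0_uniq (y t - y' t)).
 lra.
Qed.

Lemma sol_unique N F x y x' y' a b c : field F -> a <= c <= b ->
 sol N F (fun t => a <= t <= b) x y -> sol N F (fun t => a <= t <= b) x' y' ->
 x c = x' c -> y c = y' c -> forall t, a <= t <= b -> x t = x' t /\ y t = y' t.
Proof.
 intros [[L [HL Lip]] _ _ _] Hc H H' Ex Ey t Ht.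
 assert (E : dist2 x y x' y' c = 0) by (unfold dist2; rewrite Ex, Ey; ring).
 apply dist2_zero. destruct (Rle_or_lt c t) as [Hct|Hct].
 - destruct (sol_dist N F L x y x' y' c t) as [D _]; auto.
  + intros s Hs. apply H. lra.
  + intros s Hs. apply H'. lra.
  + rewrite E in D. lra.
 - destruct (sol_dist N F L x y x' y' t c) as [_ D]; auto; try lra.
  + intros s Hs. apply H. lra.
  + intros s Hs. apply H'. lra.
  + rewrite E in D. lra.
Qed.

Lemma flow_sol N F x y I : flow N F x y -> sol N F I x y.
Proof. intros H t _. now apply H. Qed.

Lemma flow_unique N F x y x' y' c : field F ->
 flow N F x y -> flow N F x' y' -> x c = x' c -> y c = y' c ->
 forall t, x t = x' t /\ y t = y' t.
Proof.
 intros HF H H' Ex Ey t.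
 apply (sol_unique N F x y x' y' (Rmin c t) (Rmax c t) c HF); auto using flow_sol.
 - split; [apply Rmin_l|apply Rmax_l].
 - split; [apply Rmin_r|apply Rmax_r].
Qed.

Lemma exp_nondecr a b : a <= b -> exp a <= exp b.
Proof. intros [H| ->]; [left; now apply exp_increasing|lra]. Qed.

Lemma square_lt_abs u e : 0 < e -> u * u < e * e -> Rabs u < e.
Proof.
 intros He H. apply Rnot_le_lt. intros Q.
 assert (e * e <= Rabs u * Rabs u) by nra.
 rewrite <- Rabs_mult, Rabs_pos_eq in H0 by nra. lra.
Qed.

Lemma square_lt u e : Rabs u < e -> u * u < e * e.
Proof.
 intros H. replace (u * u) with (Rabs u * Rabs u)
  by (rewrite <- Rabs_mult; apply Rabs_pos_eq, Rle_0_sqr).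
 pose proof (Rabs_pos u). nra.
Qed.

Lemma dist2_pos x y x' y' t : 0 <= dist2 x y x' y' t.
Proof.
 unfold dist2. pose proof (Rle_0_sqr (x t - x' t)). pose proof (Rle_0_sqr (y t - y' t)).
 unfold Rsqr in *. lra.
Qed.

(** The starting time [t0] is anywhere in [-T, T], hence the length [2 * T] in the growth factor
    [E]. Since [E >= 1], the choice [d = eps / (2 * E)] gives [2 * d^2 * E <= eps^2] without a root
    of [E]. *)
Lemma flow_continuous_dependence N F x y T eps : field F -> flow N F x y ->
 0 <= T -> 0 < eps -> exists d, 0 < d /\ forall x' y' t0, flow N F x' y' ->
  Rabs t0 <= T -> Rabs (x' t0 - x t0) < d -> Rabs (y' t0 - y t0) < d ->
  forall t, Rabs t <= T -> Rabs (x' t - x t) < eps /\ Rabs (y' t - y t) < eps.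
Proof.
 intros [[L [HL Lip]] _ _ _] H HT He.
 set (E := exp (4 * L * (2 * T))).
 assert (HE : 1 <= E).
 { unfold E. pose proof (exp_ineq1_le (4 * L * (2 * T))). nra. }
 exists (eps / (2 * E)). split; [apply Rdiv_lt_0_compat; lra|].
 intros x' y' t0 H' Ht0 Hx Hy t Ht.
 assert (D0 : dist2 x' y' x y t0 < 2 * (eps / (2 * E)) ^ 2).
 { unfold dist2. apply square_lt in Hx. apply square_lt in Hy. lra. }
 assert (P0 : 0 <= dist2 x' y' x y t0) by apply dist2_pos.
 assert (D1 : dist2 x' y' x y t <= dist2 x' y' x y t0 * E).
 { apply Rabs_le_iff in Ht0. apply Rabs_le_iff in Ht.
  destruct (Rle_or_lt t0 t) as [L0|L0].
  - destruct (sol_dist N F L x' y' x y t0 t) as [D _]; auto using flow_sol.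
   apply Rle_trans with (1 := D), Rmult_le_compat_l; [assumption|].
   apply exp_nondecr. nra.
  - destruct (sol_dist N F L x' y' x y t t0) as [_ D]; auto using flow_sol; [lra|].
   apply Rle_trans with (1 := D), Rmult_le_compat_l; [assumption|].
   apply exp_nondecr. nra. }
 assert (D2 : dist2 x' y' x y t < eps ^ 2).
 { apply Rle_lt_trans with (1 := D1).
  apply Rlt_le_trans with (2 * (eps / (2 * E)) ^ 2 * E); [apply Rmult_lt_compat_r; lra|].
  replace (2 * (eps / (2 * E)) ^ 2 * E) with (eps ^ 2 * / (2 * E)) by (field; lra).
  rewrite <- (Rmult_1_r (eps ^ 2)) at 2. apply Rmult_le_compat_l; [nra|].
  rewrite <- Rinv_1. apply Rinv_le_contravar; lra. }
 unfold dist2 in D2.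
 pose proof (Rle_0_sqr (x' t - x t)) as S1. pose proof (Rle_0_sqr (y' t - y t)) as S2.
 unfold Rsqr in S1, S2. split; apply square_lt_abs; try assumption; simpl in D2; lra.
Qed.

Lemma flow_rest N F x y t0 : 0 < N -> field F -> flow N F x y ->
 x t0 = 0 -> y t0 = 0 -> forall t, x t = 0 /\ y t = 0.
Proof.
 intros HN HF H Ex Ey. apply (flow_unique N F x y (fun _ => 0) (fun _ => 0) t0 HF H);
  [|assumption|assumption].
 intros t _. rewrite cl_0, (field_zero F HF) by lra.
 split; apply (is_derive_const (V := R_NormedModule)).
Qed.

Definition tends (h : R -> R) (l : R) : Prop :=
 forall eps, 0 < eps -> exists T, forall t, T <= t -> Rabs (h t - l) < eps.

Lemma tends_unique h l l' : tends h l -> tends h l' -> l = l'.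
Proof.
 intros H H'. destruct (Req_dec l l') as [|N]; [assumption|exfalso].
 assert (P : 0 < Rabs (l - l')) by (apply Rabs_pos_lt; lra).
 destruct (H (Rabs (l - l') / 2)) as [T HT]; [lra|].
 destruct (H' (Rabs (l - l') / 2)) as [T' HT']; [lra|].
 specialize (HT (Rmax T T') (Rmax_l _ _)). specialize (HT' (Rmax T T') (Rmax_r _ _)).
 assert (Rabs (l - l') <= Rabs (h (Rmax T T') - l) + Rabs (h (Rmax T T') - l')); [|lra].
 replace (l - l') with (- (h (Rmax T T') - l) + (h (Rmax T T') - l')) by ring.
 eapply Rle_trans; [apply Rabs_triang|]. rewrite Rabs_Ropp. lra.
Qed.

Lemma tends_shift h l a : tends h l <-> tends (fun t => h (t + a)) l.
Proof.
 split; intros H eps He; destruct (H eps He) as [T HT].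
 - exists (T - a). intros t Ht. apply HT. lra.
 - exists (T + a). intros t Ht. replace t with ((t - a) + a) by ring. apply HT. lra.
Qed.

Lemma tends_opp h l : tends h l -> tends (fun t => - h t) (- l).
Proof.
 intros H eps He. destruct (H eps He) as [T HT]. exists T. intros t Ht.
 replace (- h t - - l) with (- (h t - l)) by ring. rewrite Rabs_Ropp. auto.
Qed.

Lemma tends_ext h k l : (forall t, h t = k t) -> tends h l -> tends k l.
Proof.
 intros E H eps He. destruct (H eps He) as [T HT]. exists T. intros t Ht.
 rewrite <- E. auto.
Qed.

Lemma tends_le h l c T : tends h l -> (forall t, T <= t -> h t <= c) -> l <= c.
Proof.
 intros H Hc. apply Rnot_lt_le. intros N. destruct (H (l - c)) as [T' HT]; [lra|].
 specialize (HT (Rmax T T') (Rmax_r _ _)). specialize (Hc (Rmax T T') (Rmax_l _ _)).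
 apply Rabs_lt_iff in HT. lra.
Qed.

Lemma tends_ge h l c T : tends h l -> (forall t, T <= t -> c <= h t) -> c <= l.
Proof.
 intros H Hc. apply Rnot_lt_le. intros N. destruct (H (c - l)) as [T' HT]; [lra|].
 specialize (HT (Rmax T T') (Rmax_r _ _)). specialize (Hc (Rmax T T') (Rmax_l _ _)).
 apply Rabs_lt_iff in HT. lra.
Qed.

Lemma tends_nondecr h M : (forall s t, 0 <= s <= t -> h s <= h t) ->
 (forall t, 0 <= t -> h t <= M) -> exists l, tends h l /\ forall t, 0 <= t -> h t <= l.
Proof.
 intros Hm HM. destruct (completeness (fun v => exists t, 0 <= t /\ v = h t)) as [l [H1 H2]].
 - exists M. intros v [t [Ht ->]]. auto.
 - exists (h 0), 0. split; [lra|reflexivity].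
 - exists l. split.
  + intros eps He. apply NNPP. intros N.
   assert (l <= l - eps); [|lra]. apply H2. intros v [t [Ht ->]].
   apply Rnot_lt_le. intros Q. apply N. exists t. intros s Hs.
   assert (h t <= h s) by (apply Hm; lra).
   assert (h s <= l) by (apply H1; exists s; split; [lra|reflexivity]).
   apply Rabs_lt_iff. lra.
  + intros t Ht. apply H1. now exists t.
Qed.

(* Barbalat's argument: [y] is uniformly continuous and the integral of [cl N y] converges. *)
Lemma flow_limit N F x y l : 0 < N -> field F -> flow N F x y -> tends x l ->
 tends y 0 /\ F l 0 = 0.
Proof.
 intros HN HF H Hx.
 destruct (field_bd F HF) as [B0 HB0].
 set (B := Rmax 1 B0).
 assert (HB : forall a b, Rabs (F a b) <= B).
 { intros a b. apply Rle_trans with B0; [apply HB0|apply Rmax_r]. }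
 assert (B1 : 1 <= B) by apply Rmax_l. 
 assert (Ly : forall s t, Rabs (y s - y t) <= B * Rabs (s - t)).
 { assert (Q : forall s t, t < s -> Rabs (y s - y t) <= B * Rabs (s - t)).
  { intros s t Hst. destruct (mvt y (fun r => F (x r) (y r)) t s Hst) as [c [_ Ec]].
   - intros r _. now apply H.
   - rewrite Ec, Rabs_mult. apply Rmult_le_compat_r; [apply Rabs_pos|apply HB]. }
  intros s t. destruct (Rtotal_order t s) as [L|[->|L]]; [now apply Q| |].
  - rewrite !Rminus_diag, Rabs_R0. lra.
  - rewrite Rabs_minus_sym, (Rabs_minus_sym s). now apply Q. }
 assert (Hy : tends y 0).
 (* If [|y t| >= eps], then [|y| >= eps / 2] during a time [h], because [y] is [B]-Lipschitz; so [x]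
    moves by at least [k] there, against its convergence. *)
 { intros eps He. set (h := eps / (2 * B)).
  assert (Hh : 0 < h) by (apply Rdiv_lt_0_compat; lra).
  assert (Bh : B * h = eps / 2) by (unfold h; field; lra).
  set (k := cl N (eps / 2) * h).
  assert (Hk : 0 < k) by (apply Rmult_lt_0_compat; [apply cl_pos; lra|assumption]).
  destruct (Hx (k / 2)) as [T HT]; [lra|]. exists T. intros t Ht.
  rewrite Rminus_0_r. apply Rnot_le_lt. intros Ny.
  assert (Hc : Rabs (x (t + h) - x t) < k).
  { pose proof (HT t Ht) as A1. assert (A2 := HT (t + h)).
   assert (A3 : Rabs (x (t + h) - l) < k / 2) by (apply A2; lra).
   apply Rabs_lt_iff in A1. apply Rabs_lt_iff in A3. apply Rabs_lt_iff. lra. }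
  destruct (mvt x (fun r => cl N (y r)) t (t + h)) as [c [Hcc Ec]]; [lra|intros r _; now apply H|].
  assert (Hyc : Rabs (y c - y t) <= eps / 2).
  { eapply Rle_trans; [apply Ly|]. rewrite <- Bh. apply Rmult_le_compat_l; [lra|].
   apply Rabs_le_iff. lra. }
  replace (t + h - t) with h in Ec by ring. rewrite Ec, Rabs_mult, (Rabs_pos_eq h) in Hc by lra.
  assert (cl N (eps / 2) <= Rabs (cl N (y c))).
  { apply Rabs_le_iff in Hyc. unfold Rabs in Ny. destruct (Rcase_abs (y t)) as [Q|Q].
   - assert (W := cl_incr N (y c) (- (eps / 2))). rewrite cl_opp in W by lra.
    
    assert (0 < cl N (eps / 2)) by (apply cl_pos; lra).
    rewrite Rabs_left; lra.
   - assert (W := cl_incr N (eps / 2) (y c)).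
    assert (cl N (eps / 2) <= cl N (y c)) by (apply W; lra).
    eapply Rle_trans; [eassumption|apply Rle_abs]. }
  unfold k in Hc. nra. }
 split; [assumption|].
 (* Were [F l 0] nonzero, [y] would change by about [F l 0] within a unit of time, although it tends
    to 0. *)
 destruct (Req_dec (F l 0) 0) as [|Nz]; [assumption|exfalso].
 destruct (field_lip F HF) as [L [HL Lip]].
 assert (P : 0 < Rabs (F l 0)) by now apply Rabs_pos_lt.
 set (e := Rabs (F l 0) / (8 * L)).
 assert (He : 0 < e) by (apply Rdiv_lt_0_compat; lra).
 destruct (Hx e He) as [T1 HT1]. destruct (Hy e He) as [T2 HT2].
 set (t := Rmax T1 T2).
 destruct (mvt y (fun r => F (x r) (y r)) t (t + 1)) as [c [Hcc Ec]]; [lra|intros r _;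
  now apply H|].
 assert (T1 <= t) by apply Rmax_l. assert (T2 <= t) by apply Rmax_r.
 assert (A1 := HT2 t). assert (A2 := HT2 (t + 1)). assert (A3 := HT1 c). assert (A4 := HT2 c).
 assert (Q := Lip (x c) (y c) l 0).
 
 
 assert (B2 : Rabs (y (t + 1) - 0) < e) by (apply A2; lra).
 assert (B5 : Rabs (y t - 0) < e) by (apply A1; lra).
 assert (Q' : Rabs (F (x c) (y c) - F l 0) <= Rabs (F l 0) / 4).
 { eapply Rle_trans; [apply Q|]. apply Rle_trans with (L * (2 * e)); [nra|].
  right. unfold e. field. lra. }
 assert (Q2 : Rabs (F (x c) (y c)) < 2 * e).
 { replace (F (x c) (y c)) with (y (t + 1) - y t) by (rewrite Ec; ring).
  apply Rabs_lt_iff in B2. apply Rabs_lt_iff in B5. apply Rabs_lt_iff. lra. }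
 assert (Q3 : 2 * e <= Rabs (F l 0) / 4).
 { unfold e. apply Rmult_le_reg_r with (4 * L); [lra|].
  replace (2 * (Rabs (F l 0) / (8 * L)) * (4 * L)) with (Rabs (F l 0)) by (field; lra). nra. }
 assert (Rabs (F l 0) <= Rabs (F (x c) (y c)) + Rabs (F (x c) (y c) - F l 0)); [|lra].
 replace (F l 0) with (F (x c) (y c) + - (F (x c) (y c) - F l 0)) at 1 by ring.
 eapply Rle_trans; [apply Rabs_triang|]. rewrite Rabs_Ropp. lra.
Qed.

(** * Passage of orbits through the quadrants of the right half plane *)

Lemma flow_x_incr N F x y a b : 0 < N -> flow N F x y -> a < b ->
 (forall t, a < t < b -> 0 < y t) -> x a < x b.
Proof.
 intros HN H Hab Hy. apply (derive_incr x (fun t => cl N (y t))); [assumption| |].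
 - intros t _. now apply H.
 - intros t Ht. apply cl_pos; auto.
Qed.

Lemma flow_x_decr N F x y a b : 0 < N -> flow N F x y -> a < b ->
 (forall t, a < t < b -> y t < 0) -> x b < x a.
Proof.
 intros HN H Hab Hy. apply (derive_decr x (fun t => cl N (y t))); [assumption| |].
 - intros t _. now apply H.
 - intros t Ht. apply cl_neg; auto.
Qed.

(** In the upper half plane [x] increases. If the orbit does not come down to the axis and [x] were
    bounded, its limit would be a rest point of positive abscissa, which the sign of [F] on the
    positive axis excludes. *)
Lemma upper_forward N F x y : 0 < N -> field F -> flow N F x y -> 0 <= x 0 -> 0 < y 0 ->
 (exists T, 0 < T /\ y T = 0 /\ 0 < x T /\ forall t, 0 <= t < T -> 0 < y t) \/
 ((forall t, 0 <= t -> 0 < y t) /\ forall M, exists t, 0 <= t /\ M < x t).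
Proof.
 intros HN HF H Hx Hy.
 destruct (classic (exists b, 0 <= b /\ y b <= 0)) as [[b [Hb1 Hb2]]|Np].
 - left. destruct (first_zero y 0 b Hb1) as [T [HT1 [HT2 HT3]]]; auto.
  + intros t _. now apply (flow_cont_y N F x y).
  + exists T. repeat split; try assumption; [lra|].
   assert (x 0 < x T); [|lra]. apply (flow_x_incr N F x y); auto; [lra|].
   intros t Ht. apply HT3. lra.
 - right. assert (P : forall t, 0 <= t -> 0 < y t).
  { intros t Ht. apply Rnot_le_lt. intros Q. apply Np. now exists t. }
  split; [assumption|]. intros M. apply NNPP. intros NM.
  destruct (tends_nondecr x M) as [l [Hl1 Hl2]].
  + intros s t Hst. destruct (Req_dec s t) as [->|]; [lra|]. left.
   apply (flow_x_incr N F x y); auto; [lra|]. intros r Hr. apply P. lra.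
  + intros t Ht. apply Rnot_lt_le. intros Q. apply NM. now exists t.
  + destruct (flow_limit N F x y l HN HF H Hl1) as [_ E].
   assert (x 0 < x 1). { apply (flow_x_incr N F x y); auto; [lra|]. intros r Hr. apply P. lra. }
   specialize (Hl2 1). assert (F l 0 < 0) by (apply (field_neg F HF); lra). lra.
Qed.

(** On the positive axis [y] has negative derivative, so this axis can only be crossed downwards. *)
Lemma lower_stays N F x y T : field F -> flow N F x y -> y 0 <= 0 ->
 (forall t, 0 <= t <= T -> 0 < x t) -> forall t, 0 < t <= T -> y t < 0.
Proof.
 intros HF H Hy Hx t Ht.
 assert (Z : forall s, 0 <= s <= T -> y s = 0 -> exists d, 0 < d /\
   (forall r, s < r < s + d -> y r < 0) /\ (forall r, s - d < r < s -> 0 < y r)).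
 { intros s Hs E. destruct (derive_neg_right y s (F (x s) (y s))) as [d Hd].
  - now apply H.
  - rewrite E. apply (field_neg F HF). auto.
  - rewrite E in Hd. now exists d. }
 assert (S0 : exists d, 0 < d /\ forall r, 0 < r < d -> y r < 0).
 { destruct (Req_dec (y 0) 0) as [E|E].
  - destruct (Z 0) as [d [Hd1 [Hd2 _]]]; [lra|assumption|]. exists d.
   split; [assumption|]. intros r Hr. apply Hd2. lra.
  - destruct (continuous_neg y 0) as [d [Hd1 Hd2]]; [now apply (flow_cont_y N F x y)|lra|].
   exists d. split; [assumption|]. intros r Hr. apply Hd2, Rabs_lt_iff. lra. }
 destruct S0 as [d [Hd1 Hd2]]. apply Rnot_le_lt. intros Q.
 set (a := Rmin (d / 2) t).
 assert (Ha : 0 < a <= t /\ a <= d / 2).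
 { repeat split; [apply Rmin_glb_lt; lra | apply Rmin_r | apply Rmin_l]. }
 destruct (first_zero (fun s => - y s) a t) as [c [Hc1 [Hc2 Hc3]]].
 - lra.
 - intros s _. apply (continuous_opp (V := R_NormedModule)). now apply (flow_cont_y N F x y).
 - assert (y a < 0) by (apply Hd2; lra). lra.
 - lra.
 - destruct (Z c) as [d' [Hd'1 [_ Hd'2]]]; [lra|lra|].
  set (r := Rmax a (c - d' / 2)).
  assert (Hr : a <= r < c /\ c - d' / 2 <= r).
  { repeat split; [apply Rmax_l | apply Rmax_lub_lt; lra | apply Rmax_r]. }
  assert (0 < y r) by (apply Hd'2; lra). assert (0 < - y r) by (apply Hc3; lra). lra.
Qed.

(** In the fourth quadrant [x] decreases. Either it vanishes at some time, and [y] is then nonzero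
    because the origin is a rest point, or it converges to the abscissa of a rest point, which must
    be 0. *)
Lemma lower_forward_or_rest N F x y : 0 < N -> field F -> flow N F x y -> 0 < x 0 -> y 0 <= 0 ->
 (exists T, 0 < T /\ x T = 0 /\ y T < 0 /\ forall t, 0 < t < T -> 0 < x t /\ y t < 0) \/
 ((forall t, 0 < t -> 0 < x t /\ y t < 0) /\ tends x 0 /\ tends y 0).
Proof.
 intros HN HF H Hx Hy.
 destruct (classic (exists b, 0 <= b /\ x b <= 0)) as [[b [Hb1 Hb2]]|Np].
 - left. destruct (first_zero x 0 b Hb1) as [T [HT1 [HT2 HT3]]]; auto.
  + intros t _. now apply (flow_cont_x N F x y).
  + assert (Q : forall t, 0 < t < T -> 0 < x t /\ y t < 0).
   { intros t Ht. split; [apply HT3; lra|].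
    apply (lower_stays N F x y t HF H Hy); [|lra]. intros s Hs. apply HT3. lra. }
   exists T. conj4; [lra|assumption| |exact Q].
   destruct (Rtotal_order (y T) 0) as [L|[L|L]]; [assumption|exfalso|exfalso].
   * destruct (flow_rest N F x y T HN HF H HT2 L 0). lra.
   * destruct (continuous_pos y T) as [d [Hd1 Hd2]]; [now apply (flow_cont_y N F x y)|assumption|].
    set (r := Rmax (T / 2) (T - d / 2)).
    assert (Hr : T / 2 <= r < T /\ T - d / 2 <= r).
    { repeat split; [apply Rmax_l | apply Rmax_lub_lt; lra | apply Rmax_r]. }
    assert (0 < y r) by (apply Hd2, Rabs_lt_iff; lra).
    assert (y r < 0) by (apply Q; lra). lra.
 - right. assert (P : forall t, 0 <= t -> 0 < x t).
  { intros t Ht. apply Rnot_le_lt. intros Q. apply Np. now exists t. }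
  assert (Py : forall t, 0 < t -> y t < 0).
  { intros t Ht. apply (lower_stays N F x y t HF H Hy); [|lra]. intros s Hs. apply P. lra. }
  split; [intros t Ht; split; [apply P; lra|now apply Py]|].
  destruct (tends_nondecr (fun t => - x t) 0) as [l [Hl1 Hl2]].
  + intros s t Hst. destruct (Req_dec s t) as [->|]; [lra|].
   assert (x t < x s); [|lra]. apply (flow_x_decr N F x y); auto; [lra|].
   intros r Hr. apply Py. lra.
  + intros t Ht. specialize (P t Ht). lra.
  + apply tends_opp in Hl1.
   apply (tends_ext _ x) in Hl1; [|intros; apply Ropp_involutive].
   destruct (flow_limit N F x y _ HN HF H Hl1) as [Ey E].
   assert (0 <= - l).
   { apply (tends_ge x (- l) 0 0 Hl1). intros t Ht. left. auto. }
   assert (El : - l = 0).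
   { destruct (Req_dec (- l) 0) as [|Nl]; [assumption|].
    assert (F (- l) 0 < 0) by (apply (field_neg F HF); lra). lra. }
   rewrite El in Hl1. now split.
Qed.

(** Time reversal together with the change of [y] into [- y] preserves the class [field], so that
    statements about the past follow from those about the future. *)
Definition flipF (F : R -> R -> R) (x y : R) : R := F x (- y).

Lemma flip_field F : field F -> field (flipF F).
Proof.
 intros [[L [HL Lip]] [B HB] Hn Hz]. split.
 - exists L. split; [assumption|]. intros x y x' y'. 
  eapply Rle_trans; [apply Lip|].
  replace (- y - - y') with (- (y - y')) by ring. rewrite Rabs_Ropp. lra.
 - exists B. intros. apply HB.
 - intros x Hx. unfold flipF. rewrite Ropp_0. auto.
 - unfold flipF. now rewrite Ropp_0.
Qed.

Lemma flip_flow N F x y : 0 < N -> flow N F x y ->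
 flow N (flipF F) (fun t => x (- t)) (fun t => - y (- t)).
Proof.
 intros HN H t _. destruct (H (- t) Logic.I) as [H1 H2]. unfold flipF.
 rewrite cl_opp, Ropp_involutive by lra. split.
 - now apply is_derive_reverse.
 - rewrite <- (Ropp_involutive (F _ _)). apply is_derive_neg. now apply is_derive_reverse.
Qed.

Lemma upper_backward N F x y : 0 < N -> field F -> flow N F x y -> 0 < x 0 -> 0 <= y 0 ->
 (exists T, T < 0 /\ x T = 0 /\ 0 < y T /\ forall t, T < t < 0 -> 0 < x t /\ 0 < y t) \/
 ((forall t, t < 0 -> 0 < x t /\ 0 < y t) /\
  tends (fun t => x (- t)) 0 /\ tends (fun t => y (- t)) 0).
Proof.
 intros HN HF H Hx Hy.
 assert (H' := flip_flow N F x y HN H). assert (HF' := flip_field F HF).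
 destruct (lower_forward_or_rest N (flipF F) _ _ HN HF' H') as [[T [H1 [H2 [H3 H4]]]]|[H1 [H2 H3]]].
 - now rewrite Ropp_0.
 - rewrite Ropp_0. lra.
 - left. exists (- T). split; [lra|]. split; [assumption|]. split; [lra|].
  intros t Ht. specialize (H4 (- t)). rewrite Ropp_involutive in H4.
  destruct H4; [lra|]. split; lra.
 - right. conj3; [ |assumption| ].
  + intros t Ht. specialize (H1 (- t)). rewrite Ropp_involutive in H1.
   destruct H1; [lra|]. split; lra.
  + apply tends_opp in H3. rewrite Ropp_0 in H3.
   apply (tends_ext _ _ 0) with (2 := H3). intros. apply Ropp_involutive.
Qed.

Lemma lower_backward N F x y : 0 < N -> field F -> flow N F x y -> 0 <= x 0 -> y 0 < 0 ->
 (exists T, T < 0 /\ y T = 0 /\ 0 < x T /\ forall t, T < t <= 0 -> y t < 0) \/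
 ((forall t, t <= 0 -> y t < 0) /\ forall M, exists t, t <= 0 /\ M < x t).
Proof.
 intros HN HF H Hx Hy.
 assert (H' := flip_flow N F x y HN H). assert (HF' := flip_field F HF).
 destruct (upper_forward N (flipF F) _ _ HN HF' H') as [[T [H1 [H2 [H3 H4]]]]|[H1 H2]].
 - now rewrite Ropp_0.
 - rewrite Ropp_0. lra.
 - left. exists (- T). split; [lra|]. split; [lra|]. split; [assumption|].
  intros t Ht. specialize (H4 (- t)). rewrite Ropp_involutive in H4. lra.
 - right. split.
  + intros t Ht. specialize (H1 (- t)). rewrite Ropp_involutive in H1. lra.
  + intros M. destruct (H2 M) as [t [Ht1 Ht2]]. exists (- t). split; [lra|assumption].
Qed.

(** * Orbits emanating from the origin into the right half plane *)

(** The inequality on [y 0] is not strict, so that time 0 may be placed where the orbit turns over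
    on the positive axis. *)
Definition emanates (x y : R -> R) : Prop :=
 0 < x 0 /\ 0 <= y 0 /\ (forall t, t < 0 -> 0 < x t /\ 0 < y t) /\
 tends (fun t => x (- t)) 0 /\ tends (fun t => y (- t)) 0.

Lemma emanates_or_hits N F x y : 0 < N -> field F -> flow N F x y -> 0 < x 0 -> 0 <= y 0 ->
 emanates x y \/
 (exists T, T < 0 /\ x T = 0 /\ 0 < y T /\ forall t, T < t < 0 -> 0 < x t /\ 0 < y t).
Proof.
 intros HN HF H Hx Hy. destruct (upper_backward N F x y HN HF H Hx Hy) as [Q|Q].
 - now right.
 - left. split; [assumption|split; assumption].
Qed.

Lemma emanates_of_pos N F x y : 0 < N -> field F -> flow N F x y -> 0 < x 0 -> 0 <= y 0 ->
 (forall t, t < 0 -> 0 < x t) -> emanates x y.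
Proof.
 intros HN HF H Hx Hy P.
 destruct (emanates_or_hits N F x y HN HF H Hx Hy) as [Q|[T [H1 [H2 _]]]]; [assumption|].
 specialize (P T H1). lra.
Qed.

Lemma emanates_x_incr N F x y : 0 < N -> flow N F x y -> emanates x y ->
 forall s t, s < t <= 0 -> x s < x t.
Proof.
 intros HN H E s t Hst. apply (flow_x_incr N F x y); auto; [lra|].
 intros r Hr. apply E. lra.
Qed.

Lemma tends_back_shift h l a : tends (fun t => h (- t)) l <-> tends (fun t => h (- t + a)) l.
Proof.
 rewrite (tends_shift (fun t => h (- t)) l (- a)).
 split; apply tends_ext; intros t; f_equal; ring.
Qed.

Lemma emanates_shift N F x y a : 0 < N -> flow N F x y -> emanates x y -> a <= 0 ->
 emanates (fun t => x (t + a)) (fun t => y (t + a)).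
Proof.
 intros HN H E Ha. destruct (E) as [E1 [E2 [E3 [E4 E5]]]]. rewrite <- (Rplus_0_l a) in Ha.
 assert (Q : 0 < x (0 + a) /\ 0 <= y (0 + a)).
 { rewrite Rplus_0_l in *. destruct (Req_dec a 0) as [->|]; [now split|].
  destruct (E3 a); lra. }
 conj5; [apply Q|apply Q| | | ].
 - intros t Ht. apply E3. lra.
 - now apply (tends_back_shift x).
 - now apply (tends_back_shift y).
Qed.

(** [U] picks the parameter by choice and is 0 off the range of [X]. Continuity at [X t] holds
    because a strictly increasing continuous function maps neighborhoods of [t] onto neighborhoods
    of [X t]. *)
Lemma inverse_graph (X Y : R -> R) : (forall t, continuous X t) -> (forall t, continuous Y t) ->
 (forall s t, s < t -> X s < X t) ->
 exists U : R -> R, (forall t, U (X t) = Y t) /\ (forall t, continuous U (X t)).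
Proof.
 intros CX CY Inc.
 assert (Inj : forall s t, X s = X t -> s = t).
 { intros s t E. destruct (Rtotal_order s t) as [L|[L|L]]; [|assumption|];
   apply Inc in L; lra. }
 set (U := fun v => match excluded_middle_informative (exists t, X t = v) with
  | left H => Y (proj1_sig (constructive_indefinite_description _ H)) | right _ => 0 end).
 assert (EU : forall t, U (X t) = Y t).
 { intros t. unfold U. destruct excluded_middle_informative as [H|N].
  - destruct constructive_indefinite_description as [s Es]. simpl. now apply Inj in Es as ->.
  - exfalso. apply N. now exists t. }
 exists U. split; [assumption|]. intros t. apply continuous_eps. intros eps He.
 destruct (proj1 (continuous_eps Y t) (CY t) eps He) as [d [Hd1 Hd2]].
 assert (L1 := Inc (t - d / 2) t). assert (L2 := Inc t (t + d / 2)).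
 exists (Rmin (X t - X (t - d / 2)) (X (t + d / 2) - X t)).
 split; [apply Rmin_glb_lt; lra|]. intros v Hv.
 assert (M1 := Rmin_l (X t - X (t - d / 2)) (X (t + d / 2) - X t)).
 assert (M2 := Rmin_r (X t - X (t - d / 2)) (X (t + d / 2) - X t)).
 apply Rabs_lt_iff in Hv.
 destruct (ivt X (t - d / 2) (t + d / 2) v) as [s [Hs Es]]; [lra|auto|lra|].
 rewrite <- Es, !EU. apply Hd2, Rabs_lt_iff. lra.
Qed.

(** The graph is continued by 0 on the left and by the constant [y 0] on the right, which makes [U]
    continuous on the line, so that it can be composed freely with any orbit. *)
Record graph_of (x y U : R -> R) : Prop := {
 graph_cont : forall v, continuous U v;
 graph_left : forall v, v <= 0 -> U v = 0;
 graph_right : forall v, x 0 <= v -> U v = y 0;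
 graph_eq : forall t, t <= 0 -> U (x t) = y t;
 graph_onto : forall v, 0 < v <= x 0 -> exists t, t <= 0 /\ x t = v }.

Lemma continuous_ext_loc_eps (h k : R -> R) t d : 0 < d ->
 (forall s, Rabs (s - t) < d -> h s = k s) -> continuous h t -> continuous k t.
Proof.
 intros Hd E C. apply continuous_eps. intros eps He.
 destruct (proj1 (continuous_eps h t) C eps He) as [d' [H1 H2]].
 exists (Rmin d d'). split; [now apply Rmin_glb_lt|]. intros s Hs.
 assert (M1 := Rmin_l d d'). assert (M2 := Rmin_r d d').
 rewrite <- !E by (try rewrite Rminus_diag, Rabs_R0; lra). apply H2. lra.
Qed.

Lemma emanates_graph N F x y : 0 < N -> flow N F x y -> emanates x y ->
 exists U, graph_of x y U.
Proof.
 intros HN H E. pose proof (emanates_x_incr N F x y HN H E) as Inc.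
 destruct E as [E1 [E2 [E3 [E4 E5]]]].
 assert (Cmin : forall t, continuous (fun t => Rmin t 0) t).
 { apply continuous_lipschitz with 1. intros s t. unfold Rmin, Rabs.
  repeat (destruct Rle_dec || destruct Rcase_abs); lra. }
 assert (Cmax : forall t, continuous (fun t => Rmax t 0) t).
 { apply continuous_lipschitz with 1. intros s t. unfold Rmax, Rabs.
  repeat (destruct Rle_dec || destruct Rcase_abs); lra. }
 (* Past time 0 the abscissa is prolonged with slope 1; it is then strictly increasing on the whole
    line, with range (0, infinity). *)
 destruct (inverse_graph (fun t => x (Rmin t 0) + Rmax t 0) (fun t => y (Rmin t 0)))
  as [U0 [HU1 HU2]].
 - intros t. apply (continuous_plus (V := R_NormedModule)); [|auto].
  apply (continuous_comp (fun t => Rmin t 0) x); [auto|now apply (flow_cont_x N F x y)].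
 - intros t.
  apply (continuous_comp (fun t => Rmin t 0) y); [auto|now apply (flow_cont_y N F x y)].
 - intros s t Hst. unfold Rmin, Rmax. repeat destruct Rle_dec; try lra.
  + specialize (Inc s t). lra.
  + destruct (Req_dec s 0) as [->|]; [lra|]. specialize (Inc s 0). lra.
 - assert (Onto : forall v, 0 < v <= x 0 -> exists t, t <= 0 /\ x t = v).
  { intros v Hv. destruct (E4 v) as [T HT]; [lra|].
   specialize (HT (Rmax T 0) (Rmax_l _ _)).
   assert (0 <= Rmax T 0) by apply Rmax_r. rewrite Rminus_0_r in HT.
   apply Rabs_lt_iff in HT.
   destruct (ivt x (- Rmax T 0) 0 v) as [t [Ht Et]]; [lra| |lra|].
   - intros t _. now apply (flow_cont_x N F x y).
   - exists t. split; [lra|assumption]. }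
  assert (Ev : forall t, t <= 0 -> U0 (x t) = y t).
  { intros t Ht. specialize (HU1 t). rewrite Rmin_left, Rmax_right, Rplus_0_r in HU1 by lra.
   assumption. }
  assert (Er : forall v, x 0 <= v -> U0 v = y 0).
  { intros v Hv. specialize (HU1 (v - x 0)). rewrite Rmin_right, Rmax_left in HU1 by lra.
   now replace (x 0 + (v - x 0)) with v in HU1 by ring. }
  assert (C0 : forall v, 0 < v -> continuous U0 v).
  { intros v Hv. destruct (Rle_or_lt v (x 0)) as [L|L].
   - destruct (Onto v) as [t [Ht Et]]; [lra|]. specialize (HU2 t).
    rewrite Rmin_left, Rmax_right, Rplus_0_r, Et in HU2 by lra. assumption.
   - specialize (HU2 (v - x 0)). rewrite Rmin_right, Rmax_left in HU2 by lra.
    now replace (x 0 + (v - x 0)) with v in HU2 by ring. }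
  set (U := fun v => if Rle_dec v 0 then 0 else U0 v).
  assert (UP : forall v, 0 < v -> U v = U0 v).
  { intros v Hv. unfold U. destruct Rle_dec; lra. }
  exists U. split.
  + intros v. destruct (Rtotal_order v 0) as [L|[->|L]].
   * apply (continuous_ext_loc_eps (fun _ => 0) U v (- v)); [lra| |apply continuous_const].
    intros s Hs. apply Rabs_lt_iff in Hs. unfold U. destruct Rle_dec; lra.
   (* At 0 continuity comes from the past limit of [y]: points of the graph with small abscissa are
      visited at very negative times. *)
   * apply continuous_eps. intros eps He. destruct (E5 eps He) as [T HT].
    assert (0 <= Rmax T 0) by apply Rmax_r.
    assert (Hp : 0 < x (- Rmax T 0)).
    { destruct (Req_dec (Rmax T 0) 0) as [->|]; [now rewrite Ropp_0|]. apply E3. lra. }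
    exists (x (- Rmax T 0)). split; [assumption|]. intros s Hs.
    rewrite Rminus_0_r in Hs. apply Rabs_lt_iff in Hs.
    assert (Z : U 0 = 0) by (unfold U; destruct Rle_dec; lra). rewrite Z.
    destruct (Rle_or_lt s 0) as [Ls|Ls].
    { unfold U. destruct Rle_dec; [|lra]. now rewrite Rminus_0_r, Rabs_R0. }
    rewrite UP by assumption.
    assert (Hx0 : x (- Rmax T 0) <= x 0).
    { destruct (Req_dec (Rmax T 0) 0) as [->|]; [rewrite Ropp_0; lra|].
     left. apply Inc. lra. }
    destruct (Onto s) as [t [Ht Et]]; [lra|]. rewrite <- Et, Ev by assumption.
    specialize (HT (- t)). rewrite Ropp_involutive in HT. apply HT.
    apply Rle_trans with (Rmax T 0); [apply Rmax_l|].
    apply Rnot_lt_le. intros Q. assert (Hi := Inc (- Rmax T 0) t). lra.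
   * apply (continuous_ext_loc_eps U0 U v v); [lra| |auto].
    intros s Hs. apply Rabs_lt_iff in Hs. symmetry. apply UP. lra.
  + intros v Hv. unfold U. destruct Rle_dec; lra.
  + intros v Hv. rewrite UP by lra. auto.
  + intros t Ht. rewrite UP; [auto|]. destruct (Req_dec t 0) as [->|]; [assumption|].
   apply E3. lra.
  + assumption.
Qed.

Lemma graph_pos x y U : emanates x y -> graph_of x y U ->
 forall v, 0 < v < x 0 -> 0 < U v.
Proof.
 intros [_ [_ [E _]]] HU v Hv. destruct (graph_onto _ _ _ HU v) as [t [Ht Et]]; [lra|].
 rewrite <- Et, (graph_eq _ _ _ HU t Ht).
 apply E. destruct (Req_dec t 0) as [->|]; lra.
Qed.

Lemma graph_nonneg x y U : emanates x y -> graph_of x y U -> forall v, 0 <= U v.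
Proof.
 intros E HU v. destruct (Rle_or_lt v 0) as [L|L].
 - rewrite (graph_left _ _ _ HU v L). lra.
 - destruct (Rlt_or_le v (x 0)).
  + left. apply (graph_pos x y U E HU). lra.
  + rewrite (graph_right _ _ _ HU v) by assumption. apply E.
Qed.

Lemma continuous_le (h : R -> R) a t c : continuous h t -> a < t ->
 (forall s, a <= s < t -> h s <= c) -> h t <= c.
Proof.
 intros C Hat Hs. apply Rnot_lt_le. intros Q.
 destruct (continuous_pos (fun s => h s - c) t) as [d [Hd1 Hd2]].
 - apply (continuous_minus (V := R_NormedModule)); [assumption|apply continuous_const].
 - lra.
 - set (r := Rmax a (t - d / 2)).
  assert (Hr : a <= r < t /\ t - d / 2 <= r).
  { unfold r. repeat split; [apply Rmax_l | apply Rmax_lub_lt; lra | apply Rmax_r]. }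
  assert (0 < h r - c) by (apply Hd2, Rabs_lt_iff; lra).
  assert (h r <= c) by (apply Hs; lra). lra.
Qed.

(* An orbit cannot cross the graph of another orbit: once it touches it, it follows it. *)
Lemma graph_trap N F xq yq (J : R -> Prop) U x y S dir sg : field F ->
 flow N F xq yq -> flow N F x y -> (dir = 1 \/ dir = -1) -> (sg = 1 \/ sg = -1) ->
 (forall v, continuous U v) ->
 (forall t, J t -> exists e, 0 < e /\ forall s, Rabs (s - t) < e -> J s) ->
 (forall t, J t -> U (xq t) = yq t) ->
 (forall s, 0 <= s < S -> sg * (y (dir * s) - U (x (dir * s))) <= 0 ->
   y (dir * s) = U (x (dir * s)) ->
   exists t, J t /\ xq t = x (dir * s) /\ yq t = y (dir * s)) ->
 sg * (y 0 - U (x 0)) <= 0 ->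
 forall s, 0 <= s <= S -> sg * (y (dir * s) - U (x (dir * s))) <= 0.
Proof.
 intros HF Hq H Hdir Hsg CU OJ EU HP H0.
 assert (C : forall s, continuous (fun s => sg * (y (dir * s) - U (x (dir * s)))) s).
 { intros s. apply (continuous_scal_r (V := R_NormedModule) sg).
  assert (Cl : continuous (fun s => dir * s) s)
   by (apply (continuous_scal_r (V := R_NormedModule) dir), continuous_id).
  apply (continuous_minus (V := R_NormedModule)).
  - apply (continuous_comp (fun s => dir * s) y); [assumption|now apply (flow_cont_y N F x y)].
  - apply (continuous_comp (fun s => x (dir * s)) U); [|apply CU].
   apply (continuous_comp (fun s => dir * s) x); [assumption|now apply (flow_cont_x N F x y)]. }
 apply real_induction.
 - now rewrite Rmult_0_r.
 - intros s Hs IH. assert (Q := IH s ltac:(lra)).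
  destruct (Req_dec (y (dir * s)) (U (x (dir * s)))) as [E|E].
  + destruct (HP s Hs Q E) as [t [Jt [Ex Ey]]]. destruct (OJ t Jt) as [e [He1 He2]].
   exists e. split; [assumption|]. intros r Hr _.
   destruct (flow_unique N F x y (fun u => xq (u + (t - dir * s)))
    (fun u => yq (u + (t - dir * s))) (dir * s) HF H) with (t := dir * r) as [Q1 Q2].
   * now apply flow_shift.
   * rewrite <- Ex. f_equal. ring.
   * rewrite <- Ey. f_equal. ring.
   * rewrite Q1, Q2, EU; [rewrite Rminus_diag; lra|].
    apply He2. apply Rabs_lt_iff. destruct Hdir as [->| ->]; lra.
  + destruct (continuous_neg _ s (C s)) as [d [Hd1 Hd2]].
   * destruct Hsg as [->| ->]; lra.
   * exists d. split; [assumption|]. intros r Hr _. left. apply Hd2, Rabs_lt_iff. lra.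
 - intros s Hs IH. apply (continuous_le _ 0 s 0 (C s)); [lra|assumption].
Qed.

Lemma neg_open t : t < 0 -> exists e, 0 < e /\ forall s, Rabs (s - t) < e -> s < 0.
Proof.
 intros Ht. exists (- t). split; [lra|]. intros s Hs. apply Rabs_lt_iff in Hs. lra.
Qed.

Lemma Ropp1_mul s : -1 * - s = s.
Proof. ring. Qed.

(** The end of the arc is not an interior parameter, so [graph_trap] cannot deal with a contact
    there; such a contact means that the two orbits coincide, which is settled separately. *)
Lemma graph_side N F xq yq U x y T sg : 0 < N -> field F -> flow N F xq yq -> flow N F x y ->
 graph_of xq yq U -> (sg = 1 \/ sg = -1) -> T <= 0 ->
 (forall t, T < t < 0 -> 0 < x t /\ 0 < y t) -> 0 < x 0 <= xq 0 ->
 sg * (y 0 - U (x 0)) <= 0 -> forall t, T <= t <= 0 -> sg * (y t - U (x t)) <= 0.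
Proof.
 intros HN HF Hq H HU Hsg HT P Hx H0 t Ht.
 destruct (classic (x 0 = xq 0 /\ y 0 = yq 0)) as [[Ex Ey]|Ne].
 - destruct (flow_unique N F x y xq yq 0 HF H Hq Ex Ey t) as [-> ->].
  rewrite (graph_eq _ _ _ HU) by lra. rewrite Rminus_diag. lra.
 - rewrite <- (Ropp1_mul t).
  apply (graph_trap N F xq yq (fun t => t < 0) U x y (- T) (-1) sg); auto; [apply HU| | | |].
  + apply neg_open.
  + intros s Hs. apply (graph_eq _ _ _ HU). lra.
  + intros s Hs _ E. replace (-1 * s) with (- s) in * by ring.
   assert (Hxs : 0 < x (- s) <= xq 0 /\ (s <> 0 -> x (- s) < xq 0)).
   { destruct (Req_dec s 0) as [->|Hs0]; [rewrite Ropp_0; split; [assumption|now intros []]|].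
    assert (x (- s) < x 0).
    { apply (flow_x_incr N F x y); auto; [lra|]. intros r Hr. apply P. lra. }
    assert (0 < x (- s)) by (apply P; lra). split; lra. }
   destruct (graph_onto _ _ _ HU (x (- s))) as [t' [Ht' Et']]; [apply Hxs|].
   assert (Ey' : yq t' = y (- s)) by (rewrite E, <- Et'; symmetry; now apply (graph_eq _ _ _ HU)).
   exists t'. split; [|split; assumption].
   destruct (Req_dec t' 0) as [->|]; [exfalso|lra].
   destruct (Req_dec s 0) as [->|Hs0]; [|apply Hxs in Hs0; lra].
   rewrite Ropp_0 in *. apply Ne. now split.
  + lra.
Qed.

(** An orbit below the graph cannot have come from the vertical axis: it would have been there with
    [y > 0], whereas the graph passes through the origin. *)
Lemma emanates_below N F xq yq U x y : 0 < N -> field F -> flow N F xq yq -> flow N F x y ->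
 graph_of xq yq U -> 0 < x 0 <= xq 0 -> 0 <= y 0 <= U (x 0) ->
 emanates x y /\ forall t, t <= 0 -> y t <= U (x t).
Proof.
 intros HN HF Hq H HU Hx Hy.
 destruct (emanates_or_hits N F x y HN HF H) as [E|[T [H1 [H2 [H3 H4]]]]]; [lra|lra| |].
 - split; [assumption|]. intros t Ht.
  assert (1 * (y t - U (x t)) <= 0); [|lra].
  apply (graph_side N F xq yq U x y t 1); auto; [|lra|lra].
  intros s Hs. apply E. lra.
 - exfalso. assert (Q : 1 * (y T - U (x T)) <= 0).
  { apply (graph_side N F xq yq U x y T 1); auto; lra. }
  rewrite H2, (graph_left _ _ _ HU) in Q by lra. lra.
Qed.

Lemma emanates_above N F xq yq U x y : 0 < N -> field F -> flow N F xq yq -> flow N F x y ->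
 graph_of xq yq U -> emanates x y -> x 0 <= xq 0 -> U (x 0) <= y 0 ->
 forall t, t <= 0 -> U (x t) <= y t.
Proof.
 intros HN HF Hq H HU E Hx Hy t Ht. destruct (E) as [E1 [_ [E2 _]]].
 assert (-1 * (y t - U (x t)) <= 0); [|lra].
 apply (graph_side N F xq yq U x y t (-1)); auto; [|lra|lra].
 intros s Hs. apply E2. lra.
Qed.

(** * Loops through the negative vertical axis *)

(** The right half of a homoclinic orbit, with time 0 at its passage through the negative vertical
    axis. *)
Definition loop (x y : R -> R) : Prop :=
 x 0 = 0 /\ y 0 < 0 /\ (forall t, t < 0 -> 0 < x t) /\
 tends (fun t => x (- t)) 0 /\ tends (fun t => y (- t)) 0.

(** Backward from the axis, [x] grows as long as [y < 0]. If [y] never vanished, [x] could not tend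
    to 0 in the past. So there is a turning point [T]; it has the largest abscissa, and up to it the
    orbit emanates. *)
Lemma loop_crossing N F x y : 0 < N -> field F -> flow N F x y -> loop x y ->
 exists T, T < 0 /\ y T = 0 /\ 0 < x T /\ (forall t, T < t <= 0 -> y t < 0) /\
  (forall t, t <= 0 -> x t <= x T) /\ emanates (fun t => x (t + T)) (fun t => y (t + T)).
Proof.
 intros HN HF H [L1 [L2 [L3 [L4 L5]]]].
 destruct (lower_backward N F x y HN HF H) as [[T [H1 [H2 [H3 H4]]]]|[H1 H2]]; [lra|assumption| |].
 - exists T. assert (E : emanates (fun t => x (t + T)) (fun t => y (t + T))).
  { apply (emanates_of_pos N F); auto; [now apply flow_shift| | |].
   - rewrite Rplus_0_l. apply L3. lra.
   - rewrite Rplus_0_l. lra.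
   - intros t Ht. apply L3. lra. }
  repeat (split; [assumption|]). split; [|assumption].
  intros t Ht. destruct (Rtotal_order t T) as [Q|[->|Q]]; [|lra|].
  + left. apply (flow_x_incr N F x y); auto. intros r Hr.
   destruct E as [_ [_ [E _]]]. specialize (E (r - T)).
   replace (r - T + T) with r in E by ring. apply E. lra.
  + left. apply (flow_x_decr N F x y); auto. intros r Hr. apply H4. lra.
 - exfalso. destruct (L5 1) as [T1 HT1]; [lra|]. 
  assert (E : tends (fun t => - x (- t)) 0) by (rewrite <- Ropp_0; now apply tends_opp).
  destruct (L4 1) as [T0 HT0]; [lra|].
  destruct (H2 (x (- Rmax 0 T0) + 1)) as [t [Ht1 Ht2]].
  assert (M1 := Rmax_l 0 T0). assert (M2 := Rmax_r 0 T0).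
  assert (Hd : forall s, s < 0 -> x 0 < x s).
  { intros s Hs. apply (flow_x_decr N F x y); auto. intros r Hr. apply H1. lra. }
  assert (Hd' : forall s r, s < r <= 0 -> x r < x s).
  { intros s r Hs. apply (flow_x_decr N F x y); auto; [lra|]. intros q Hq. apply H1. lra. }
  assert (L0 : 0 < x (- 1)) by (apply L3; lra).
  destruct (L4 (x (-1))) as [T2 HT2]; [lra|].
  specialize (HT2 (Rmax 2 T2) (Rmax_r _ _)). rewrite Rminus_0_r in HT2.
  assert (M3 := Rmax_l 2 T2). apply Rabs_lt_iff in HT2.
  specialize (Hd' (- Rmax 2 T2) (-1)). lra.
Qed.

(** Time is reversed to make [x] increasing, and beyond the ends of the arc the curve is prolonged
    with slope 1 in [x] and constant [y]. On the right this yields the value 0. *)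
Lemma lower_arc_graph N F x y T : 0 < N -> flow N F x y -> T < 0 -> x 0 = 0 -> y T = 0 ->
 (forall t, T < t <= 0 -> y t < 0) ->
 exists Lw, (forall v, continuous Lw v) /\ (forall t, T <= t <= 0 -> Lw (x t) = y t) /\
  (forall v, x T <= v -> Lw v = 0).
Proof.
 intros HN H HT Hx Hy Hn.
 assert (Dec : forall s t, T <= s < t -> t <= 0 -> x t < x s).
 { intros s t Hs Ht. apply (flow_x_decr N F x y); auto; [lra|]. intros r Hr. apply Hn. lra. }
 set (k := fun t => Rmax T (Rmin 0 t)).
 assert (Ck : forall t, continuous k t).
 { apply continuous_lipschitz with 1. intros s t. unfold k, Rmin, Rmax, Rabs.
  repeat (destruct Rle_dec || destruct Rcase_abs); lra. }
 assert (Hk : forall t, T <= k t <= 0).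
 { intros t. unfold k, Rmin, Rmax. repeat destruct Rle_dec; lra. }
 destruct (inverse_graph (fun s => x (k (- s)) + (k (- s) - (- s))) (fun s => y (k (- s)))) as [U
  [HU1 HU2]].
 - intros t. assert (C1 : continuous (fun s => k (- s)) t).
  { apply (continuous_comp (fun s => - s) k); [|apply Ck].
   apply (continuous_opp (V := R_NormedModule)), continuous_id. }
  apply (continuous_plus (V := R_NormedModule)).
  + apply (continuous_comp (fun s => k (- s)) x); [assumption|now apply (flow_cont_x N F x y)].
  + apply (continuous_minus (V := R_NormedModule)); [assumption|].
   apply (continuous_opp (V := R_NormedModule)), continuous_id.
 - intros t. apply (continuous_comp (fun s => k (- s)) y); [|now apply (flow_cont_y N F x y)].
  apply (continuous_comp (fun s => - s) k); [|apply Ck].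
  apply (continuous_opp (V := R_NormedModule)), continuous_id.
 - intros s t Hst. assert (A : k (- t) <= k (- s) /\ k (- s) - - s <= k (- t) - - t /\
   (k (- t) = k (- s) -> k (- s) - - s < k (- t) - - t)).
  { unfold k, Rmin, Rmax. repeat destruct Rle_dec; repeat split; lra. }
  destruct A as [A1 [A2 A3]]. destruct (Req_dec (k (- t)) (k (- s))) as [E|E].
  + rewrite E. specialize (A3 E). lra.
  + assert (P1 := Hk (- s)). assert (P2 := Hk (- t)).
   assert (P3 := Dec (k (- t)) (k (- s))). lra.
 - assert (E1 : forall t, T <= t <= 0 -> k t = t).
  { intros t Ht. unfold k, Rmin, Rmax. repeat destruct Rle_dec; lra. }
  exists U. conj3.
  + intros v.
   assert (Q : exists s, x (k (- s)) + (k (- s) - - s) = v).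
   { destruct (Rle_or_lt v 0) as [Q|Q]; [|destruct (Rle_or_lt v (x T)) as [Q'|Q']].
    - exists v. assert (Ek : k (- v) = 0) by (unfold k, Rmin, Rmax; repeat destruct Rle_dec; lra).
     rewrite Ek, Hx. ring.
    - destruct (ivt_decr x T 0 v) as [t [Ht Et]]; [lra| |lra|].
     + intros t _. now apply (flow_cont_x N F x y).
     + exists (- t). rewrite Ropp_involutive, E1, Et by assumption. ring.
    - exists (v - x T - T).
     assert (Ek : k (- (v - x T - T)) = T) by (unfold k, Rmin, Rmax; repeat destruct Rle_dec; lra).
     rewrite Ek. ring. }
   destruct Q as [s <-]. apply HU2.
  + intros t Ht. specialize (HU1 (- t)). rewrite Ropp_involutive, E1 in HU1 by assumption.
   now rewrite Rminus_diag, Rplus_0_r in HU1.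
  + intros v Hv. specialize (HU1 (v - x T - T)).
   assert (Ek : k (- (v - x T - T)) = T) by (unfold k, Rmin, Rmax; repeat destruct Rle_dec; lra).
   rewrite Ek, Hy in HU1. rewrite <- HU1. f_equal. ring.
Qed.

Lemma lower_arc_onto N F x y T v : flow N F x y -> T < 0 -> x 0 = 0 -> 0 <= v <= x T ->
 exists t, T <= t <= 0 /\ x t = v.
Proof.
 intros H HT Hx Hv. apply ivt_decr; [lra| |lra].
 intros t _. now apply (flow_cont_x N F x y).
Qed.

Lemma between_open a b t : a < t < b -> exists e, 0 < e /\ forall s, Rabs (s - t) < e -> a < s < b.
Proof.
 intros Ht. exists (Rmin (t - a) (b - t)). split; [apply Rmin_glb_lt; lra|].
 intros s Hs. assert (M1 := Rmin_l (t - a) (b - t)). assert (M2 := Rmin_r (t - a) (b - t)).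
 apply Rabs_lt_iff in Hs. lra.
Qed.

(** The comparison by uniqueness works at parameters strictly between [T] and 0, so a start on one
    of the coordinate axes has to lie strictly above the arc. In the open fourth quadrant every
    contact is at such a parameter. *)
Lemma lower_arc_side N F xq yq T Lw x y S dir : 0 < N -> field F ->
 flow N F xq yq -> flow N F x y -> T < 0 -> xq 0 = 0 -> yq T = 0 ->
 (forall t, T < t <= 0 -> yq t < 0) -> (forall v, continuous Lw v) ->
 (forall t, T <= t <= 0 -> Lw (xq t) = yq t) -> (forall v, xq T <= v -> Lw v = 0) ->
 (dir = 1 \/ dir = -1) ->
 (forall s, 0 < s < S -> 0 < x (dir * s) /\ y (dir * s) < 0) ->
 0 <= x 0 -> Lw (x 0) <= y 0 -> (x 0 = 0 \/ y 0 = 0 -> Lw (x 0) < y 0) ->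
 forall s, 0 <= s <= S -> Lw (x (dir * s)) <= y (dir * s).
Proof.
 intros HN HF Hq H HT Hx0 HyT Hn CL EL RL Hdir P Hx Hy Hne s Hs.
 assert (-1 * (y (dir * s) - Lw (x (dir * s))) <= 0); [|lra].
 apply (graph_trap N F xq yq (fun t => T < t < 0) Lw x y S dir (-1)); auto.
 - intros t. apply between_open.
 - intros t Ht. apply EL. lra.
 - intros r Hr _ E.
  assert (Q : 0 < x (dir * r) /\ y (dir * r) < 0).
  { destruct (Req_dec r 0) as [->|]; [|apply P; lra].
   rewrite Rmult_0_r in *. 
   assert (x 0 <> 0) by (intros Z; specialize (Hne (or_introl Z)); lra).
   split; [lra|]. destruct (Rtotal_order (y 0) 0) as [L|[L|L]]; [assumption| |].
   - specialize (Hne (or_intror L)). lra.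
   - destruct (Rle_or_lt (xq T) (x 0)) as [M|M].
    + rewrite (RL _ M) in E. lra.
    + destruct (lower_arc_onto N F xq yq T (x 0) Hq HT Hx0) as [t [Ht Et]]; [lra|].
     rewrite <- Et, EL in E by assumption.
     destruct (Req_dec t T) as [->|]; [lra|]. specialize (Hn t). lra. }
  assert (M : x (dir * r) < xq T).
  { apply Rnot_le_lt. intros M. rewrite (RL _ M) in E. lra. }
  destruct (lower_arc_onto N F xq yq T (x (dir * r)) Hq HT Hx0) as [t [Ht Et]]; [lra|].
  assert (Ey : yq t = y (dir * r)) by (rewrite E, <- Et; symmetry; now apply EL).
  exists t. split; [|now split].
  destruct (Req_dec t T) as [->|]; [lra|]. destruct (Req_dec t 0) as [->|]; lra.
 - lra.
Qed.

Definition inbox (M : R) (x y : R -> R) (I : R -> Prop) : Prop :=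
 forall t, I t -> Rabs (x t) <= M /\ Rabs (y t) <= M.

(** Followed backward, the inner orbit stays above the lower arc of the given loop, so it turns over
    at an abscissa at most [xq T]; from there it lies below the emanating graph [U] and emanates
    too. The box is inherited because the two arcs enclose it. *)
Lemma sub_loop N F xq yq x y M : 0 < N -> field F -> flow N F xq yq -> flow N F x y ->
 loop xq yq -> inbox M xq yq (fun t => t <= 0) -> x 0 = 0 -> yq 0 <= y 0 < 0 ->
 loop x y /\ inbox M x y (fun t => t <= 0).
Proof.
 intros HN HF Hq H Lq Bq Hx Hy. destruct (Req_dec (y 0) (yq 0)) as [Ey|Ny].
 { assert (Hx0 : x 0 = xq 0) by (destruct Lq as [Lq _]; lra).
  assert (E := flow_unique N F x y xq yq 0 HF H Hq Hx0 Ey).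
  destruct Lq as [L1 [L2 [L3 [L4 L5]]]]. split.
  - repeat split; [assumption|lra| | |].
   + intros t Ht. destruct (E t) as [-> _]. auto.
   + apply (tends_ext (fun t => xq (- t))); [|assumption]. intros t. symmetry. apply E.
   + apply (tends_ext (fun t => yq (- t))); [|assumption]. intros t. symmetry. apply E.
  - intros t Ht. destruct (E t) as [-> ->]. auto. }
 destruct (loop_crossing N F xq yq HN HF Hq Lq) as [T [HT1 [HT2 [HT3 [HT4 [HT5 HE]]]]]].
 destruct Lq as [L1 [L2 [L3 _]]].
 destruct (lower_arc_graph N F xq yq T HN Hq HT1 L1 HT2 HT4) as [Lw [CL [EL RL]]].
 assert (HeT : flow N F (fun t => xq (t + T)) (fun t => yq (t + T))) by now apply flow_shift.
 destruct (emanates_graph N F _ _ HN HeT HE) as [U HU].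
 assert (L0 : Lw 0 = yq 0) by (rewrite <- L1 at 1; apply EL; lra).
 assert (Side : forall S, (forall s, 0 < s < S -> y (- s) < 0) ->
  forall s, 0 <= s <= S -> Lw (x (- s)) <= y (- s)).
 { intros S HS s Hs. replace (- s) with (-1 * s) by ring.
  apply (lower_arc_side N F xq yq T Lw x y S (-1)); auto; try lra.
  - intros r Hr. replace (-1 * r) with (- r) by ring. split; [|apply HS; lra].
   rewrite <- Hx. apply (flow_x_decr N F x y); auto; [lra|]. intros q Hq'.
   specialize (HS (- q)). rewrite Ropp_involutive in HS. apply HS. lra.
  - rewrite Hx, L0. lra.
  - intros _. rewrite Hx, L0. lra. }
 assert (LB : forall v, 0 <= v -> - M <= Lw v).
 { intros v Hv. destruct (Rle_or_lt (xq T) v) as [Q|Q].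
  - rewrite (RL v Q). destruct (Bq 0); [lra|]. pose proof (Rabs_pos (xq 0)). lra.
  - destruct (lower_arc_onto N F xq yq T v Hq HT1 L1) as [t [Ht <-]]; [lra|].
   rewrite EL by assumption. destruct (Bq t) as [_ Q']; [lra|]. apply Rabs_le_iff in Q'. lra. }
 assert (UB : forall v, 0 <= v -> U v <= M).
 { intros v Hv. destruct (Rle_or_lt v 0) as [Q|Q].
  - rewrite (graph_left _ _ _ HU v Q). destruct (Bq 0); [lra|]. pose proof (Rabs_pos (xq 0)). lra.
  - destruct (Rle_or_lt v (xq (0 + T))) as [Q'|Q'].
   + destruct (graph_onto _ _ _ HU v) as [t [Ht <-]]; [lra|].
    rewrite (graph_eq _ _ _ HU t Ht). destruct (Bq (t + T)) as [_ Z]; [lra|].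
    apply Rabs_le_iff in Z. lra.
   + rewrite (graph_right _ _ _ HU) by lra. rewrite Rplus_0_l, HT2.
    destruct (Bq 0); [lra|]. pose proof (Rabs_pos (xq 0)). lra. }
 assert (XM : xq T <= M).
 { destruct (Bq T) as [Z _]; [lra|]. apply Rabs_le_iff in Z. lra. }
 destruct (lower_backward N F x y HN HF H) as [[T' [H1 [H2 [H3 H4]]]]|[H1 H2]]; [lra|lra| |].
 - assert (XT : forall t, T' < t <= 0 -> x t < xq T).
  { intros t Ht. apply Rnot_le_lt. intros Q. assert (W := Side (- T')).
   specialize (W ltac:(intros s Hs; apply H4; lra) (- t) ltac:(lra)).
   rewrite Ropp_involutive, (RL _ Q) in W. specialize (H4 t Ht). lra. }
  assert (XT' : x T' <= xq T).
  { assert (x (- - T') <= xq T); [|now rewrite Ropp_involutive in *].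
   apply (continuous_le (fun s => x (- s)) 0 (- T')); [|lra|].
   - apply (continuous_comp (fun s => - s) x).
    + apply (continuous_opp (V := R_NormedModule)), continuous_id.
    + now apply (flow_cont_x N F x y).
   - intros s Hs. left. apply XT. lra. }
  destruct (emanates_below N F _ _ U (fun t => x (t + T')) (fun t => y (t + T')) HN HF HeT) as [E1
   E2].
  + now apply flow_shift.
  + assumption.
  + rewrite !Rplus_0_l. lra.
  + rewrite !Rplus_0_l, H2. split; [lra|].
   apply (graph_nonneg _ _ U HE HU).
  + destruct (E1) as [E3 [E4 [E5 [E6 E7]]]].
   assert (Q : forall t, T' <= t <= 0 -> 0 <= x t).
   { intros t Ht. destruct (Req_dec t 0) as [->|]; [lra|]. left. rewrite <- Hx.
    apply (flow_x_decr N F x y); auto; [lra|]. intros r Hr. apply H4. lra. }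
   split.
   * conj5; [assumption|lra| | | ].
    -- intros t Ht. destruct (Rle_or_lt T' t) as [Z|Z].
      ++ rewrite <- Hx. apply (flow_x_decr N F x y); auto. intros r Hr. apply H4. lra.
      ++ specialize (E5 (t - T')). replace (t - T' + T') with t in E5 by ring. apply E5. lra.
    -- now apply (tends_back_shift x 0 T').
    -- now apply (tends_back_shift y 0 T').
   * intros t Ht. destruct (Rle_or_lt T' t) as [Z|Z].
    -- assert (x t <= xq T).
      { destruct (Req_dec t T') as [->|]; [lra|]. left. apply XT. lra. }
      assert (y t <= 0).
      { destruct (Req_dec t T') as [->|]; [lra|]. left. apply H4. lra. }
      specialize (Q t ltac:(lra)). assert (W := Side (- T')).
      specialize (W ltac:(intros s Hs; apply H4; lra) (- t) ltac:(lra)).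
      rewrite Ropp_involutive in W. specialize (LB (x t) Q).
      split; apply Rabs_le_iff; lra.
    -- specialize (E2 (t - T')). specialize (E5 (t - T')).
      replace (t - T' + T') with t in * by ring.
      assert (x t < x T').
      { apply (flow_x_incr N F x y); auto. intros r Hr.
       destruct E1 as [_ [_ [E1 _]]]. specialize (E1 (r - T')).
       replace (r - T' + T') with r in E1 by ring. apply E1. lra. }
      specialize (UB (x t)). split; apply Rabs_le_iff; lra.
 - exfalso. destruct (H2 (xq T)) as [t [Ht1 Ht2]]. assert (W := Side (- t)).
  specialize (W ltac:(intros s Hs; apply H1; lra) (- t) ltac:(lra)).
  rewrite Ropp_involutive, (RL (x t)) in W by lra. specialize (H1 t Ht1). lra.
Qed.

(** Excludes the second alternative of [lower_forward_or_rest]; for the system it is obtained from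
    an energy estimate. *)
Definition no_rest N F : Prop := forall x y, flow N F x y ->
 ~ ((forall t, 0 < t -> 0 < x t /\ y t < 0) /\ tends x 0 /\ tends y 0).

Lemma lower_forward N F x y : 0 < N -> field F -> no_rest N F -> flow N F x y ->
 0 < x 0 -> y 0 <= 0 ->
 exists T, 0 < T /\ x T = 0 /\ y T < 0 /\ forall t, 0 < t < T -> 0 < x t /\ y t < 0.
Proof.
 intros HN HF NR H Hx Hy.
 destruct (lower_forward_or_rest N F x y HN HF H Hx Hy) as [Q|Q]; [assumption|].
 now elim (NR x y H).
Qed.

(* The orbit [xq yq] bounds a region together with the vertical axis: its upper arc is the graph
  of [U], its lower arc is run through on [T, 0]. *)
Lemma inside_arc N F xq yq T U (J : R -> Prop) x y : 0 < N -> field F -> no_rest N F ->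
 flow N F xq yq -> flow N F x y -> T < 0 -> xq 0 = 0 -> yq 0 < 0 -> yq T = 0 ->
 (forall t, T < t <= 0 -> yq t < 0) -> (forall v, continuous U v) ->
 (forall v, xq T <= v -> U v = 0) ->
 (forall t, J t -> exists e, 0 < e /\ forall s, Rabs (s - t) < e -> J s) ->
 (forall t, J t -> U (xq t) = yq t) -> (forall v, 0 < v < xq T -> exists t, J t /\ xq t = v) ->
 0 <= x 0 <= xq T -> 0 <= y 0 <= U (x 0) -> (x 0 = 0 -> 0 < y 0 < U 0) ->
 exists T', 0 < T' /\ x T' = 0 /\ yq 0 <= y T' < 0.
Proof.
 intros HN HF NR Hq H HT L1 L2 HyT Hn CU UR OJ UJ J1 Hx Hy Hxy.
 assert (A : exists T1, 0 <= T1 /\ y T1 = 0 /\ 0 < x T1 <= xq T).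
 { destruct (Req_dec (y 0) 0) as [E|E]; [exists 0; conj3; [lra|lra| ]; destruct (Req_dec (x 0) 0);
  [specialize (Hxy H0)|]; lra|].
  assert (Side : forall S, (forall s, 0 <= s < S -> 0 < y s) ->
   forall s, 0 <= s <= S -> y s <= U (x s)).
  { intros S HS s Hs. assert (W : 1 * (y (1 * s) - U (x (1 * s))) <= 0); [|rewrite !Rmult_1_l in W;
   lra].
   apply (graph_trap N F xq yq J U x y S 1 1 HF Hq H); auto; [|lra].
   intros r Hr Q Er. rewrite !Rmult_1_l in Q. rewrite !Rmult_1_l in Er. rewrite !Rmult_1_l.
   assert (P := HS r Hr).
   assert (M : x r < xq T). { apply Rnot_le_lt. intros M. rewrite (UR _ M) in Er. lra. }
   assert (M0 : 0 < x r).
   { destruct (Req_dec r 0) as [->|Nr].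
    - destruct (Req_dec (x 0) 0) as [Z|Z]; [specialize (Hxy Z); rewrite Z in Er|]; lra.
    - apply Rle_lt_trans with (x 0); [lra|].
     apply (flow_x_incr N F x y 0 r HN H); [lra|]. intros w Hw. apply HS. lra. }
   destruct (J1 (x r) ltac:(lra)) as [t [Ht Et]].
   exists t. conj3; [assumption|assumption| ]. rewrite Er, <- Et. symmetry. now apply UJ. }
  destruct (upper_forward N F x y HN HF H) as [[T1 [H1 [H2 [H3 H4]]]]|[H1 H2]]; [lra|lra| |].
  - exists T1. conj4; [lra|assumption|assumption| ].
   apply (continuous_le x 0 T1); [now apply (flow_cont_x N F x y)|assumption|].
   intros s Hs. apply Rnot_lt_le. intros M.
   assert (W := Side T1 H4 s ltac:(lra)). rewrite UR in W by lra. specialize (H4 s Hs). lra.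
  - exfalso. destruct (H2 (xq T)) as [t [Ht1 Ht2]].
   assert (W := Side t ltac:(intros; apply H1; lra) t ltac:(lra)).
   rewrite UR in W by lra. specialize (H1 t Ht1). lra. }
 destruct A as [T1 [HT1 [Hy1 Hx1]]].
 assert (H' := flow_shift N F x y T1 H).
 (* Turning over at the same point as the bounding orbit means being that orbit, so the arrival on
    the axis is read off from it. *)
 destruct (Req_dec (x T1) (xq T)) as [Ex|Nx].
 - assert (Eq := flow_unique N F _ _ _ _ 0 HF H' (flow_shift N F xq yq T Hq)). simpl in Eq.
  rewrite !Rplus_0_l in Eq. specialize (Eq Ex ltac:(congruence) (- T)).
  replace (- T + T) with 0 in Eq by ring.
  exists (- T + T1). destruct Eq as [-> ->]. lra.
 - destruct (lower_arc_graph N F xq yq T HN Hq HT L1 HyT Hn) as [Lw [CL [EL RL]]].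
  destruct (lower_forward N F _ _ HN HF NR H') as [T2 [H1 [H2 [H3 H4]]]];
   [rewrite Rplus_0_l; lra|rewrite Rplus_0_l; lra|].
  exists (T2 + T1). conj4; [lra|assumption| |assumption].
  assert (LN : Lw (x T1) < 0).
  { destruct (lower_arc_onto N F xq yq T (x T1) Hq HT L1) as [t [Ht Et]]; [lra|].
   rewrite <- Et, EL by assumption. apply Hn.
   destruct (Req_dec t T) as [->|]; lra. }
  assert (W := lower_arc_side N F xq yq T Lw (fun t => x (t + T1)) (fun t => y (t + T1)) T2 1).
  simpl in W. rewrite Rplus_0_l, Hy1 in W.
  specialize (W HN HF Hq H' HT L1 HyT Hn CL EL RL (or_introl eq_refl)).
  specialize (W ltac:(intros s Hs; rewrite Rmult_1_l; now apply H4)).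
  specialize (W ltac:(lra) ltac:(lra) ltac:(lra) T2 ltac:(lra)).
  rewrite Rmult_1_l, H2, <- L1, EL in W by lra. lra.
Qed.

Lemma inside_loop N F xq yq T U x y : 0 < N -> field F -> no_rest N F ->
 flow N F xq yq -> flow N F x y -> loop xq yq -> T < 0 -> yq T = 0 ->
 (forall t, T < t <= 0 -> yq t < 0) ->
 graph_of (fun t => xq (t + T)) (fun t => yq (t + T)) U ->
 0 < x 0 <= xq T -> 0 <= y 0 <= U (x 0) ->
 exists T', 0 < T' /\ x T' = 0 /\ yq 0 <= y T' < 0.
Proof.
 intros HN HF NR Hq H Lq HT HyT Hn HU Hx Hy. destruct Lq as [L1 [L2 _]].
 apply (inside_arc N F xq yq T U (fun t => t < T) x y HN HF NR Hq H HT L1 L2 HyT Hn); try lra.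
 - apply HU.
 - intros v Hv. rewrite (graph_right _ _ _ HU) by now rewrite Rplus_0_l. now rewrite Rplus_0_l.
 - intros t Ht. exists (T - t). split; [lra|]. intros s Hs. apply Rabs_lt_iff in Hs. lra.
 - intros t Ht. assert (E := graph_eq _ _ _ HU (t - T) ltac:(lra)). cbv beta in E.
  now replace (t - T + T) with t in E by ring.
 - intros v Hv. destruct (graph_onto _ _ _ HU v) as [t [Ht Et]]; [rewrite Rplus_0_l; lra|].
  exists (t + T). split; [|assumption].
  destruct (Req_dec t 0) as [->|]; [rewrite Rplus_0_l in Et|]; lra.
Qed.

(** * The truncated Lienard field *)

(** Clamping both arguments makes the field bounded and globally Lipschitz although [f] and [g] are
    only locally so. *)
Definition vf (N : R) (g : R -> R) (f : R -> R -> R) (x y : R) : R :=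
 - g (cl N x) - f (cl N x) (cl N y) * cl N y.

Record half (g : R -> R) (f : R -> R -> R) : Prop := {
 half_sign : forall x, x <> 0 -> 0 < x * g x;
 half_glip : forall N, exists L, 0 <= L /\ forall x x', Rabs x <= N -> Rabs x' <= N ->
  Rabs (g x - g x') <= L * Rabs (x - x');
 half_flip : forall N, exists L, 0 <= L /\ forall x y x' y',
  Rabs x <= N -> Rabs y <= N -> Rabs x' <= N -> Rabs y' <= N ->
  Rabs (f x y - f x' y') <= L * (Rabs (x - x') + Rabs (y - y')) }.

(** It comes from [f x 0 <= 0] and a Lipschitz constant of [f] in [y]. The bound is one-sided
    because negative damping only increases the energy. *)
Definition one_sided (f : R -> R -> R) (d L : R) : Prop :=
 0 < d /\ 0 <= L /\ forall x y, 0 < x <= d -> Rabs y <= d -> f x y <= L * Rabs y.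

Section Half.
Variables (g : R -> R) (f : R -> R -> R).
Hypothesis Hgf : half g f.

Lemma half_g_cont x : continuous g x.
Proof.
 destruct (half_glip g f Hgf (Rabs x + 1)) as [L [HL Lip]].
 apply continuous_eps. intros eps He.
 exists (Rmin 1 (eps / (L + 1))).
 split; [apply Rmin_glb_lt; [lra|apply Rdiv_lt_0_compat; lra]|].
 intros s Hs. assert (M1 := Rmin_l 1 (eps / (L + 1))). assert (M2 := Rmin_r 1 (eps / (L + 1))).
 assert (Rabs s <= Rabs x + 1).
 { replace s with (x + (s - x)) by ring. eapply Rle_trans; [apply Rabs_triang|]. lra. }
 apply Rle_lt_trans with (L * Rabs (s - x)); [apply Lip; lra|].
 pose proof (Rabs_pos (s - x)).
 apply Rle_lt_trans with ((L + 1) * Rabs (s - x)); [nra|].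
 apply Rlt_le_trans with ((L + 1) * (eps / (L + 1))); [apply Rmult_lt_compat_l; lra|].
 right. field. lra.
Qed.

Lemma half_pos x : 0 < x -> 0 < g x.
Proof. intros H. assert (0 < x * g x) by (apply (half_sign g f Hgf); lra). nra. Qed.

Lemma half_neg x : x < 0 -> g x < 0.
Proof. intros H. assert (0 < x * g x) by (apply (half_sign g f Hgf); lra). nra. Qed.

Lemma half_zero : g 0 = 0.
Proof.
 destruct (Rtotal_order (g 0) 0) as [L|[L|L]]; [|assumption|]; exfalso.
 - destruct (continuous_neg g 0 (half_g_cont 0) L) as [d [H1 H2]].
  assert (g (d / 2) < 0) by (apply H2, Rabs_lt_iff; lra).
  assert (0 < g (d / 2)) by (apply half_pos; lra). lra.
 - destruct (continuous_pos g 0 (half_g_cont 0) L) as [d [H1 H2]].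
  assert (0 < g (- (d / 2))) by (apply H2, Rabs_lt_iff; lra).
  assert (g (- (d / 2)) < 0) by (apply half_neg; lra). lra.
Qed.

Lemma cl_abs N v : 0 <= N -> Rabs (cl N v) <= N.
Proof. intros. apply Rabs_le_iff, cl_bounds. assumption. Qed.

Lemma vf_field N : 0 < N -> field (vf N g f).
Proof.
 intros HN. destruct (half_glip g f Hgf N) as [Lg [HLg Lipg]].
 destruct (half_flip g f Hgf N) as [Lf [HLf Lipf]].
 set (B := Rabs (f 0 0) + Lf * (2 * N)).
 assert (HB : forall x y, Rabs x <= N -> Rabs y <= N -> Rabs (f x y) <= B).
 { intros x y Hx Hy. replace (f x y) with (f 0 0 + (f x y - f 0 0)) by ring.
  eapply Rle_trans; [apply Rabs_triang|]. apply Rplus_le_compat_l.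
  eapply Rle_trans; [apply Lipf; try assumption; rewrite Rabs_R0; lra|].
  rewrite !Rminus_0_r. apply Rmult_le_compat_l; lra. }
 assert (PB : 0 <= B) by (unfold B; pose proof (Rabs_pos (f 0 0)); nra).
 split.
 - exists (1 + Lg + Lf * N + B). split; [nra|]. intros x y x' y'. unfold vf.
  assert (A1 := cl_abs N x ltac:(lra)). assert (A2 := cl_abs N x' ltac:(lra)).
  assert (A3 := cl_abs N y ltac:(lra)). assert (A4 := cl_abs N y' ltac:(lra)).
  assert (C1 := cl_lipschitz N x x'). assert (C2 := cl_lipschitz N y y').
  assert (G := Lipg _ _ A1 A2). assert (K := Lipf _ _ _ _ A1 A3 A2 A4).
  assert (Bf := HB _ _ A2 A4).
  replace (- g (cl N x) - f (cl N x) (cl N y) * cl N y -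
   (- g (cl N x') - f (cl N x') (cl N y') * cl N y')) with
   (- (g (cl N x) - g (cl N x')) - (f (cl N x) (cl N y) - f (cl N x') (cl N y')) * cl N y
    - f (cl N x') (cl N y') * (cl N y - cl N y')) by ring.
  assert (T : forall a b c, Rabs (- a - b - c) <= Rabs a + Rabs b + Rabs c).
  { intros a b c. unfold Rabs. repeat destruct Rcase_abs; lra. }
  eapply Rle_trans; [apply T|]. rewrite !Rabs_mult.
  pose proof (Rabs_pos (x - x')). pose proof (Rabs_pos (y - y')).
  pose proof (Rabs_pos (cl N x - cl N x')). pose proof (Rabs_pos (cl N y - cl N y')).
  set (D := Rabs (x - x') + Rabs (y - y')).
  assert (Rabs (g (cl N x) - g (cl N x')) <= Lg * D).
  { eapply Rle_trans; [apply G|]. apply Rmult_le_compat_l; unfold D; lra. }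
  assert (Rabs (f (cl N x) (cl N y) - f (cl N x') (cl N y')) <= Lf * D).
  { eapply Rle_trans; [apply K|]. apply Rmult_le_compat_l; unfold D; lra. }
  assert (Rabs (f (cl N x) (cl N y) - f (cl N x') (cl N y')) * Rabs (cl N y) <= Lf * D * N).
  { apply Rmult_le_compat; auto using Rabs_pos. }
  assert (Rabs (f (cl N x') (cl N y')) * Rabs (cl N y - cl N y') <= B * D).
  { apply Rmult_le_compat; auto using Rabs_pos. unfold D. lra. }
  assert (0 <= D) by (unfold D; lra). nra.
 - exists (Rabs (g 0) + Lg * N + B * N). intros x y. unfold vf.
  assert (A1 := cl_abs N x ltac:(lra)). assert (A3 := cl_abs N y ltac:(lra)).
  assert (T : forall a b, Rabs (- a - b) <= Rabs a + Rabs b).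
  { intros a b. unfold Rabs. repeat destruct Rcase_abs; lra. }
  eapply Rle_trans; [apply T|]. rewrite Rabs_mult.
  apply Rplus_le_compat; [|apply Rmult_le_compat; auto using Rabs_pos].
  replace (g (cl N x)) with (g 0 + (g (cl N x) - g 0)) by ring.
  eapply Rle_trans; [apply Rabs_triang|]. apply Rplus_le_compat_l.
  eapply Rle_trans; [apply Lipg; [assumption|rewrite Rabs_R0; lra]|].
  rewrite Rminus_0_r. apply Rmult_le_compat_l; assumption.
 - intros x Hx. unfold vf. rewrite cl_0 by lra.
  assert (0 < g (cl N x)) by (apply half_pos, cl_pos; lra). lra.
 - unfold vf. rewrite cl_0, half_zero by lra. ring.
Qed.

(** * The potential, the energy and estimates near the origin *)

Definition Gp (x : R) : R := RInt g 0 x.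

Lemma Gp_derive x : is_derive Gp x (g x).
Proof.
 apply (is_derive_RInt (V := R_NormedModule) g Gp 0); [|apply half_g_cont].
 apply filter_forall. intros s. apply (RInt_correct (V := R_CompleteNormedModule)).
 apply (ex_RInt_continuous (V := R_CompleteNormedModule)). intros z _. apply half_g_cont.
Qed.

Lemma Gp_0 : Gp 0 = 0.
Proof. unfold Gp. rewrite RInt_point. reflexivity. Qed.

Lemma Gp_cont x : continuous Gp x.
Proof. eapply is_derive_continuous, Gp_derive. Qed.

Lemma Gp_incr a b : 0 <= a < b -> Gp a < Gp b.
Proof.
 intros H. apply (derive_incr Gp g); [lra| |].
 - intros t _. apply Gp_derive.
 - intros t Ht. apply half_pos. lra.
Qed.

Lemma Gp_pos a : 0 < a -> 0 < Gp a.
Proof. intros H. rewrite <- Gp_0. apply Gp_incr. lra. Qed.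

Lemma Gp_nonneg a : 0 <= a -> 0 <= Gp a.
Proof. intros [H| <-]; [left; now apply Gp_pos|rewrite Gp_0; lra]. Qed.

Definition En (x y : R) : R := y * y / 2 + Gp x.

Lemma energy_derive N x y k t : 0 < N -> flow N (vf N g f) x y ->
 Rabs (x t) <= N -> Rabs (y t) <= N ->
 is_derive (fun s => exp (k * x s) * En (x s) (y s)) t
  (exp (k * x t) * (k * y t * En (x t) (y t) - f (x t) (y t) * (y t * y t))).
Proof.
 intros HN H Bx By. destruct (H t Logic.I) as [H1 H2]. unfold vf in H2.
 apply Rabs_le_iff in Bx. apply Rabs_le_iff in By.
 rewrite !cl_id in * by lra. unfold En.
 assert (E1 : Derive (fun u => x u) t = y t) by now apply is_derive_unique.
 assert (E2 : Derive (fun u => y u) t = - g (x t) - f (x t) (y t) * y t) by now apply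
  is_derive_unique.
 assert (E3 : Derive (fun u => Gp u) (x t) = g (x t)) by apply is_derive_unique, Gp_derive.
 auto_derive.
 - repeat split; try (now exists (y t)); try (now exists (- g (x t) - f (x t) (y t) * y t)).
  exists (g (x t)). apply Gp_derive.
 - rewrite E1, E2, E3. field.
Qed.

(* The weight [exp (2 L sg x)] absorbs the one-sided bound on the damping. *)
Lemma energy_incr N d L x y sg a b : 0 < N -> flow N (vf N g f) x y -> one_sided f d L ->
 (sg = 1 \/ sg = -1) -> a <= b ->
 (forall t, a <= t <= b -> Rabs (x t) <= N /\ Rabs (y t) <= N) ->
 (forall t, a < t < b -> 0 < x t <= d /\ Rabs (y t) <= d /\ 0 <= sg * y t) ->
 exp (2 * L * sg * x a) * En (x a) (y a) <= exp (2 * L * sg * x b) * En (x b) (y b).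
Proof.
 intros HN H [Hd [HL HO]] Hsg Hab HB HP.
 apply (derive_nondecr (fun s => exp (2 * L * sg * x s) * En (x s) (y s))
  (fun t => exp (2 * L * sg * x t) * (2 * L * sg * y t * En (x t) (y t) - f (x t) (y t) * (y t * y
   t))));
  [assumption| |].
 - intros t Ht. destruct (HB t Ht). now apply (energy_derive N).
 - intros t Ht. destruct (HP t Ht) as [P1 [P2 P3]].
  apply Rmult_le_pos; [left; apply exp_pos|].
  assert (E1 : sg * y t = Rabs (y t)).
  { unfold Rabs. destruct (Rcase_abs (y t)); destruct Hsg as [->| ->]; lra. }
  replace (2 * L * sg * y t) with (2 * L * Rabs (y t)) by (rewrite <- E1; ring).
  specialize (HO (x t) (y t) P1 P2).
  assert (Rabs (y t) * Rabs (y t) = y t * y t) by (rewrite <- Rabs_mult; apply Rabs_pos_eq,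
   Rle_0_sqr).
  assert (G0 := Gp_nonneg (x t) ltac:(lra)). unfold En.
  pose proof (Rabs_pos (y t)) as A0. pose proof (Rle_0_sqr (y t)) as S0. unfold Rsqr in S0.
  assert (f (x t) (y t) * (y t * y t) <= L * Rabs (y t) * (y t * y t)) by (apply Rmult_le_compat_r;
   assumption).
  assert (0 <= L * Rabs (y t) * Gp (x t)) by (apply Rmult_le_pos; [apply Rmult_le_pos|];
   assumption).
  lra.
Qed.

(** Along such an orbit the energy with weight exp(- 2 L x) would be positive and nondecreasing from
    some time on, and yet tend to 0. *)
Lemma vf_no_rest N d L : 0 < N -> one_sided f d L -> no_rest N (vf N g f).
Proof.
 intros HN HO x y H [P [Tx Ty]]. destruct (HO) as [Hd [HL _]].
 set (m := Rmin N d). assert (Hm : 0 < m /\ m <= N /\ m <= d).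
 { unfold m. conj3; [now apply Rmin_glb_lt|apply Rmin_l|apply Rmin_r]. }
 destruct (Tx m) as [T1 HT1]; [lra|]. destruct (Ty m) as [T2 HT2]; [lra|].
 set (T := Rmax 1 (Rmax T1 T2)).
 assert (HT : 1 <= T /\ T1 <= T /\ T2 <= T).
 { unfold T. conj3; [apply Rmax_l| | ]; (eapply Rle_trans; [|apply Rmax_r]);
  [apply Rmax_l|apply Rmax_r]. }
 assert (Small : forall t, T <= t -> Rabs (x t) < m /\ Rabs (y t) < m).
 { intros t Ht. specialize (HT1 t ltac:(lra)). specialize (HT2 t ltac:(lra)).
  rewrite Rminus_0_r in *. now split. }
 set (Z := exp (2 * L * -1 * x T) * En (x T) (y T)).
 assert (HZ : 0 < Z).
 { apply Rmult_lt_0_compat; [apply exp_pos|]. unfold En.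
  destruct (P T) as [Px _]; [lra|]. assert (0 < Gp (x T)) by now apply Gp_pos.
  pose proof (Rle_0_sqr (y T)). unfold Rsqr in *. lra. }
 assert (CE := proj1 (continuous_eps Gp 0) (Gp_cont 0) (Z / 2) ltac:(lra)).
 destruct CE as [e [He1 He2]].
 destruct (Tx e He1) as [T3 HT3]. destruct (Ty (Rmin 1 (Z / 2))) as [T4 HT4]; [apply Rmin_glb_lt;
  lra|].
 set (t := Rmax T (Rmax T3 T4)).
 assert (Ht : T <= t /\ T3 <= t /\ T4 <= t).
 { unfold t. conj3; [apply Rmax_l| | ]; (eapply Rle_trans; [|apply Rmax_r]);
  [apply Rmax_l|apply Rmax_r]. }
 specialize (HT3 t ltac:(lra)). specialize (HT4 t ltac:(lra)).
 assert (G1 := He2 (x t) HT3). rewrite Gp_0, Rminus_0_r in G1. apply Rabs_lt_iff in G1.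
 rewrite Rminus_0_r in HT4.
 assert (M1 := Rmin_l 1 (Z / 2)). assert (M2 := Rmin_r 1 (Z / 2)).
 assert (Y2 : y t * y t < Z / 2).
 { replace (y t * y t) with (Rabs (y t) * Rabs (y t)) by (rewrite <- Rabs_mult; apply Rabs_pos_eq,
  Rle_0_sqr).
  pose proof (Rabs_pos (y t)). nra. }
 assert (I := energy_incr N d L x y (-1) T t HN H HO (or_intror eq_refl)).
 assert (exp (2 * L * -1 * x t) <= 1).
 { rewrite <- exp_0. apply exp_nondecr. destruct (P t) as [Px _]; [lra|].
  assert (0 <= L * x t) by (apply Rmult_le_pos; lra). lra. }
 assert (I' : Z <= exp (2 * L * -1 * x t) * En (x t) (y t)).
 { apply I; [lra| |].
  - intros s Hs. destruct (Small s); lra.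
  - intros s Hs. destruct (Small s) as [A1 A2]; [lra|]. destruct (P s) as [A3 A4]; [lra|].
   apply Rabs_lt_iff in A1. conj3; [lra|lra|lra]. }
 assert (E1 : 0 <= En (x t) (y t)).
 { unfold En. destruct (P t) as [Px _]; [lra|]. assert (0 < Gp (x t)) by now apply Gp_pos.
  pose proof (Rle_0_sqr (y t)). unfold Rsqr in *. lra. }
 assert (E2 : En (x t) (y t) < Z) by (unfold En; lra).
 pose proof (exp_pos (2 * L * -1 * x t)). nra.
Qed.

(* Below the curve [En x y = c exp (2 L x)], which meets the axis at [X0], backward
  orbits of the lower quadrant cannot escape. *)
Definition pocket (L e c X0 : R) : Prop :=
 0 < c /\ 0 < X0 <= e /\ Gp X0 = c * exp (2 * L * X0) /\
 (forall x, 0 <= x < X0 -> Gp x < c * exp (2 * L * x)) /\ 2 * c * exp (2 * L * e) <= e * e.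

(** [X0] is the first point where the potential meets [c * exp (2 * L * x)]. The bound [c1] makes
    this happen no later than [e], and [c2] yields the inequality that keeps [|y| <= e] in the
    pocket. *)
Lemma pocket_exists L e : 0 <= L -> 0 < e -> exists c0, 0 < c0 /\
 forall c, 0 < c <= c0 -> exists X0, pocket L e c X0.
Proof.
 intros HL He. assert (HG := Gp_pos e He). assert (HE := exp_pos (2 * L * e)).
 set (c1 := Gp e / exp (2 * L * e)). set (c2 := e * e / (2 * exp (2 * L * e))).
 assert (H1 : 0 < c1) by now apply Rdiv_lt_0_compat.
 assert (H2 : 0 < c2) by (apply Rdiv_lt_0_compat; nra).
 exists (Rmin c1 c2). split; [now apply Rmin_glb_lt|]. intros c Hc.
 assert (M1 := Rmin_l c1 c2). assert (M2 := Rmin_r c1 c2).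
 assert (C1 : c * exp (2 * L * e) <= Gp e).
 { apply Rle_trans with (c1 * exp (2 * L * e)); [apply Rmult_le_compat_r; lra|].
  right. unfold c1. field. lra. }
 assert (C2 : 2 * c * exp (2 * L * e) <= e * e).
 { apply Rle_trans with (2 * c2 * exp (2 * L * e)); [apply Rmult_le_compat_r; lra|].
  right. unfold c2. field. lra. }
 destruct (first_zero (fun x => c * exp (2 * L * x) - Gp x) 0 e) as [X0 [A1 [A2 A3]]].
 - lra.
 - intros t _. apply (continuous_minus (V := R_NormedModule)); [|apply Gp_cont].
  apply (is_derive_continuous _ _ (c * (2 * L * exp (2 * L * t)))). auto_derive; [trivial|ring].
 - rewrite Gp_0, Rmult_0_r, exp_0. lra.
 - lra.
 - exists X0. conj5; [lra|lra|lra| |assumption].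
  intros x Hx. specialize (A3 x ltac:(lra)). lra.
Qed.

Definition in_pocket (L c X0 x y : R) : Prop := 0 <= x <= X0 /\ En x y <= c * exp (2 * L * x).

Lemma in_pocket_small L e c X0 x y : 0 <= L -> 0 < e -> pocket L e c X0 -> in_pocket L c X0 x y ->
 Rabs x <= e /\ Rabs y <= e.
Proof.
 intros HL He [P1 [P2 [P3 [P4 P5]]]] [Q1 Q2]. split; [apply Rabs_le_iff; lra|].
 apply Rnot_lt_le. intros Q. unfold En in Q2. assert (G0 := Gp_nonneg x ltac:(lra)).
 assert (exp (2 * L * x) <= exp (2 * L * e)) by (apply exp_nondecr; nra).
 assert (c * exp (2 * L * x) <= c * exp (2 * L * e)) by (apply Rmult_le_compat_l; lra).
 assert (Rabs y * Rabs y = y * y) by (rewrite <- Rabs_mult; apply Rabs_pos_eq, Rle_0_sqr).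
 nra.
Qed.

(** A bootstrap: the energy estimate holds while [|y| <= min N d], and there the level [W] yields
    [|y| <= e], which is strictly smaller. Hence [|y|] never reaches [min N d] on the way back. *)
Lemma energy_trap N d L e x y sg T W : 0 < N -> one_sided f d L -> 0 < e -> e < N -> e < d ->
 flow N (vf N g f) x y -> (sg = 1 \/ sg = -1) -> (forall t, T <= t <= 0 -> 0 <= x t <= e) ->
 (forall t, T < t < 0 -> 0 < x t /\ 0 <= sg * y t) ->
 exp (2 * L * sg * x 0) * En (x 0) (y 0) <= W ->
 (forall u v, 0 <= u <= e -> exp (2 * L * sg * u) * En u v <= W -> Rabs v <= e) ->
 forall t, T <= t <= 0 -> Rabs (y t) <= e /\ exp (2 * L * sg * x t) * En (x t) (y t) <= W.
Proof.
 intros HN HO He HeN Hed H Hsg Hx Hp H0 HW t Ht.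
 set (m := Rmin N d). assert (Hm : e < m /\ m <= N /\ m <= d).
 { unfold m. conj3; [now apply Rmin_glb_lt|apply Rmin_l|apply Rmin_r]. }
 assert (Step : forall r, T <= r <= 0 -> (forall s, r <= s <= 0 -> Rabs (y s) <= m) ->
  Rabs (y r) <= e /\ exp (2 * L * sg * x r) * En (x r) (y r) <= W).
 { intros r Hr Hy. assert (I := energy_incr N d L x y sg r 0 HN H HO Hsg (proj2 Hr)).
  assert (Q : exp (2 * L * sg * x r) * En (x r) (y r) <= W).
  { apply Rle_trans with (2 := H0). apply I; intros s Hs; specialize (Hy s ltac:(lra));
   specialize (Hx s ltac:(lra)).
   - rewrite Rabs_pos_eq by lra. lra.
   - destruct (Hp s); lra. }
  split; [|assumption]. apply (HW (x r)); [now apply Hx|assumption]. }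
 apply Step; [assumption|]. intros s Hs. apply Rnot_lt_le. intros Z.
 destruct (first_zero (fun r => m - Rabs (y (- r))) 0 (- s)) as [r [R1 [R2 R3]]].
 - lra.
 - intros r _. apply (continuous_minus (V := R_NormedModule)); [apply continuous_const|].
  apply (continuous_comp (fun r => y (- r)) Rabs); [|apply continuous_Rabs].
  apply (continuous_comp Ropp y); [apply (continuous_opp (V := R_NormedModule)), continuous_id|].
  now apply (flow_cont_y N (vf N g f) x y).
 - rewrite Ropp_0. assert (Rabs (y 0) <= e) by (apply (HW (x 0)); [apply Hx; lra|assumption]). lra.
 - rewrite Ropp_involutive. lra.
 - destruct (Step (- r)) as [Q _]; [lra| |lra]. intros q Hq. destruct (Req_dec q (- r)) as [->|];
  [lra|].
  specialize (R3 (- q) ltac:(lra)). rewrite Ropp_involutive in R3. lra.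
Qed.

Lemma weight_iff L c u v : exp (2 * L * -1 * u) * En u v <= c <-> En u v <= c * exp (2 * L * u).
Proof.
 replace (2 * L * -1 * u) with (- (2 * L * u)) by ring. rewrite exp_Ropp.
 assert (P := exp_pos (2 * L * u)). split; intros H.
 - apply Rmult_le_reg_l with (/ exp (2 * L * u)); [now apply Rinv_0_lt_compat|].
  rewrite (Rmult_comm c), <- Rmult_assoc, Rinv_l by lra. lra.
 - apply Rmult_le_reg_l with (exp (2 * L * u)); [assumption|]. rewrite <- Rmult_assoc,
  Rinv_r by lra. lra.
Qed.

(** At [x = X0] the potential alone exhausts the allowed energy, so the pocket has no point with
    [y < 0] there. The backward orbit therefore cannot pass [X0], its abscissa stays bounded, and it
    must turn over. *)
Lemma pocket_backward N d L e c X0 x y : 0 < N -> one_sided f d L -> 0 < e -> e < N -> e < d ->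
 pocket L e c X0 -> flow N (vf N g f) x y -> y 0 < 0 -> in_pocket L c X0 (x 0) (y 0) ->
 exists T, T < 0 /\ y T = 0 /\ 0 < x T /\ (forall t, T < t <= 0 -> y t < 0) /\
  forall t, T <= t <= 0 -> in_pocket L c X0 (x t) (y t).
Proof.
 intros HN HO He HeN Hed HP H Hy Hin. assert (HL : 0 <= L) by apply HO.
 destruct HP as [P1 [P2 [P3 [P4 P5]]]].
 assert (Dec : forall a b, a < b <= 0 -> (forall t, a < t <= 0 -> y t < 0) -> x b < x a).
 { intros a b Hab Hn. apply (flow_x_decr N (vf N g f) x y); auto; [lra|]. intros r Hr. apply Hn.
  lra. }
 assert (Trap : forall T, T <= 0 -> (forall t, T < t <= 0 -> y t < 0) -> x T <= X0 ->
  forall t, T <= t <= 0 -> in_pocket L c X0 (x t) (y t)).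
 { intros T HT Hn HX.
  assert (XB : forall t, T <= t <= 0 -> 0 <= x t <= X0).
  { intros t Ht. destruct Hin as [Hin _]. split.
   - destruct (Req_dec t 0) as [->|]; [lra|]. assert (x 0 < x t); [|lra].
    apply Dec; [lra|]. intros r Hr. apply Hn. lra.
   - destruct (Req_dec t T) as [->|]; [lra|]. assert (x t < x T); [|lra]. now apply Dec; [lra|]. }
  intros t Ht. split; [now apply XB|]. apply weight_iff.
  apply (energy_trap N d L e x y (-1) T c HN HO He HeN Hed H); auto.
  - intros s Hs. specialize (XB s Hs). lra.
  - intros s Hs. assert (Hs' := Hn s ltac:(lra)). split; [|lra]. destruct Hin as [Hin _].
   assert (x 0 < x s); [|lra]. apply Dec; [lra|]. intros r Hr. apply Hn. lra.
  - apply weight_iff. apply Hin.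
  - intros u v Hu Q. apply weight_iff in Q. unfold En in Q. apply Rnot_lt_le. intros Z.
   assert (G0 := Gp_nonneg u (proj1 Hu)).
   assert (exp (2 * L * u) <= exp (2 * L * e)) by (apply exp_nondecr; nra).
   assert (c * exp (2 * L * u) <= c * exp (2 * L * e)) by (apply Rmult_le_compat_l; lra).
   assert (Rabs v * Rabs v = v * v) by (rewrite <- Rabs_mult; apply Rabs_pos_eq, Rle_0_sqr). nra. }
 assert (Corner : forall v, v < 0 -> ~ En X0 v <= c * exp (2 * L * X0)) by (intros v Hv Q;
  unfold En in Q; nra).
 assert (X0b : forall T, T <= 0 -> (forall t, T < t <= 0 -> y t < 0) -> x T <= X0).
 { intros T HT Hn. apply Rnot_lt_le. intros Z.
  destruct (first_zero (fun s => X0 - x (- s)) 0 (- T)) as [s [S1 [S2 _]]].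
  - lra.
  - intros s _. apply (continuous_minus (V := R_NormedModule)); [apply continuous_const|].
   apply (continuous_comp Ropp x); [apply (continuous_opp (V := R_NormedModule)), continuous_id|].
   now apply (flow_cont_x N (vf N g f) x y).
  - rewrite Ropp_0. destruct (Req_dec (x 0) X0) as [E|]; [|destruct Hin; lra].
   destruct Hin as [_ Q]. rewrite E in Q. now apply Corner in Q.
  - rewrite Ropp_involutive. lra.
  - assert (Ns : - s <> T) by (intros E; rewrite E in S2; lra).
   destruct (Trap (- s)) with (t := - s) as [_ Q]; [lra|intros r Hr; apply Hn; lra|lra|lra|].
   replace (x (- s)) with X0 in Q by lra. revert Q. apply Corner, Hn. lra. }
 destruct (lower_backward N (vf N g f) x y HN (vf_field N HN) H) as [[T [H1 [H2 [H3 H4]]]]|[H1 H2]];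
  [apply Hin|assumption| |].
 - exists T. conj5; [assumption|assumption|assumption|assumption| ].
  apply Trap; [lra|assumption|]. apply X0b; [lra|assumption].
 - exfalso. destruct (H2 X0) as [t [Ht1 Ht2]]. assert (x t <= X0); [|lra]. apply X0b; [assumption|].
  intros r Hr. apply H1. lra.
Qed.

(** Backward in the first quadrant neither [x] nor the energy with weight exp(2 L x) increases; the
    factor 2 in the hypothesis turns the energy bound into [y^2 <= e^2]. *)
Lemma upper_backward_small N d L e x y T : 0 < N -> one_sided f d L -> 0 < e -> e < N -> e < d ->
 flow N (vf N g f) x y -> T <= 0 -> (forall t, T < t < 0 -> 0 < x t /\ 0 < y t) ->
 0 <= x 0 <= e -> 0 <= y 0 -> 2 * exp (2 * L * x 0) * En (x 0) (y 0) <= e * e ->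
 forall t, T <= t <= 0 -> Rabs (x t) <= e /\ Rabs (y t) <= e.
Proof.
 intros HN HO He HeN Hed H HT P Hx Hy HE.
 assert (HL : 0 <= L) by apply HO.
 assert (Inc : forall a b, T <= a < b -> b <= 0 -> x a < x b).
 { intros a b Hab Hb. apply (flow_x_incr N (vf N g f) x y); auto; [lra|]. intros r Hr. apply P.
  lra. }
 assert (X1 : forall t, T <= t <= 0 -> 0 <= x t <= e).
 { assert (X0 : 0 <= x T).
  { destruct (Req_dec T 0) as [->|]; [lra|]. apply Rnot_lt_le. intros Z.
   destruct (continuous_neg x T (flow_cont_x N (vf N g f) x y T H) Z) as [dl [D1 D2]].
   set (s := Rmin (T + dl / 2) (T / 2)). assert (M1 := Rmin_l (T + dl / 2) (T / 2)).
   assert (M2 := Rmin_r (T + dl / 2) (T / 2)). assert (T < s) by (apply Rmin_glb_lt; lra).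
    fold s in M1, M2.
   specialize (D2 s ltac:(apply Rabs_lt_iff; lra)). destruct (P s); lra. }
  intros t Ht. split.
  - destruct (Req_dec t T) as [->|]; [lra|]. assert (x T < x t) by (apply Inc; lra). lra.
  - destruct (Req_dec t 0) as [->|]; [lra|]. assert (x t < x 0) by (apply Inc; lra). lra. }
 intros t Ht. split; [apply Rabs_le_iff; specialize (X1 t Ht); lra|].
 apply (energy_trap N d L e x y 1 T (e * e / 2) HN HO He HeN Hed H); auto.
 - intros s Hs. destruct (P s Hs). lra.
 - replace (2 * L * 1 * x 0) with (2 * L * x 0) by ring. lra.
 - intros u v Hu Q. assert (1 <= exp (2 * L * 1 * u)).
  { rewrite <- exp_0 at 1. apply exp_nondecr. assert (0 <= L * u) by (apply Rmult_le_pos; lra).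
   lra. }
  assert (G0 := Gp_nonneg u (proj1 Hu)). pose proof (Rle_0_sqr v) as S0. unfold Rsqr in S0.
   unfold En in Q.
  assert (W : 0 <= (exp (2 * L * 1 * u) - 1) * (v * v / 2 + Gp u)) by (apply Rmult_le_pos; lra).
  apply Rnot_lt_le. intros Z.
  assert (Rabs v * Rabs v = v * v) by (rewrite <- Rabs_mult; apply Rabs_pos_eq, Rle_0_sqr). nra.
Qed.
End Half.

(** * Conjugation of two right half systems by the potential *)

(** The potential is prolonged by the identity on the left to be strictly increasing on the line.
    The derivative is taken at positive points, since [g 0 = 0] makes the inverse vertical at 0. *)
Lemma inverse_potential g f : half g f -> exists U : R -> R,
 (forall t, 0 <= t -> U (Gp g t) = t) /\ (forall t, 0 <= t -> continuous U (Gp g t)) /\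
 (forall t, 0 < t -> is_derive U (Gp g t) (/ g t)).
Proof.
 intros Hgf. set (G := fun t => Gp g (Rmax t 0) + Rmin t 0).
 assert (GE : forall t, 0 <= t -> G t = Gp g t).
 { intros t Ht. unfold G. rewrite Rmax_left, Rmin_right by lra. ring. }
 assert (CG : forall t, continuous G t).
 { intros t. apply (continuous_plus (V := R_NormedModule)).
  - apply (continuous_comp (fun t => Rmax t 0) (Gp g)); [|apply (Gp_cont g f Hgf)].
   revert t. apply continuous_lipschitz with 1. intros s t. unfold Rmax, Rabs.
   repeat (destruct Rle_dec || destruct Rcase_abs); lra.
  - revert t. apply continuous_lipschitz with 1. intros s t. unfold Rmin, Rabs.
   repeat (destruct Rle_dec || destruct Rcase_abs); lra. }
 assert (IG : forall s t, s < t -> G s < G t).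
 { intros s t Hst. unfold G, Rmax, Rmin. repeat destruct Rle_dec; try lra.
  - assert (H := Gp_incr g f Hgf 0 t). lra.
  - assert (H := Gp_incr g f Hgf s t). lra. }
 destruct (inverse_graph G (fun t => t) CG) as [U [U1 U2]];
  [intros; apply continuous_id|exact IG|].
 exists U. conj3.
 - intros t Ht. rewrite <- GE by assumption. apply U1.
 - intros t Ht. rewrite <- GE by assumption. apply U2.
 - intros t Ht. assert (Pg := half_pos g f Hgf t Ht).
  assert (Et : U (Gp g t) = t) by (rewrite <- GE by lra; apply U1).
  apply is_derive_Reals. intros eps He.
  assert (D := proj1 (is_derive_Reals (Gp g) t (g t)) (Gp_derive g f Hgf t)).
  destruct (D (Rmin (g t / 2) (eps * (g t * g t) / 4))) as [d Hd].
  { apply Rmin_glb_lt; [lra|]. assert (0 < g t * g t) by nra. nra. }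
  assert (CU : continuous U (Gp g t)) by (rewrite <- GE by lra; apply U2).
  destruct (proj1 (continuous_eps _ _) CU (Rmin d t)) as [e1 [E1 E1']].
  { apply Rmin_glb_lt; [apply cond_pos|assumption]. }
  assert (Q1 := Gp_incr g f Hgf (t / 2) t). assert (Q2 := Gp_incr g f Hgf t (t + 1)).
  set (e := Rmin e1 (Rmin (Gp g t - Gp g (t / 2)) (Gp g (t + 1) - Gp g t))).
  assert (He' : 0 < e /\ e <= e1 /\ e <= Gp g t - Gp g (t / 2) /\ e <= Gp g (t + 1) - Gp g t).
  { conj4.
   - repeat apply Rmin_glb_lt; lra.
   - apply Rmin_l.
   - eapply Rle_trans; [apply Rmin_r|apply Rmin_l].
   - eapply Rle_trans; [apply Rmin_r|apply Rmin_r]. }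
  exists (mkposreal e (proj1 He')). intros h Hh Hhe. simpl in Hhe.
  set (k := U (Gp g t + h) - t).
  assert (Hk : Rabs k < Rmin d t).
  { unfold k. rewrite <- Et at 2. apply E1'.
   replace (Gp g t + h - Gp g t) with h by ring. lra. }
  assert (Mk1 := Rmin_l d t). 
  apply Rabs_lt_iff in Hhe.
  destruct (ivt (Gp g) (t / 2) (t + 1) (Gp g t + h)) as [r [Hr Er]]; [lra| |lra|].
  { intros s _. apply (Gp_cont g f Hgf). }
  assert (Ek : Gp g (t + k) - Gp g t = h).
  { unfold k. rewrite <- Er, <- (GE r), U1 by lra.
   replace (t + (r - t)) with r by ring. lra. }
  assert (Nk : k <> 0).
  { intros Z. rewrite Z, Rplus_0_r in Ek. lra. }
  specialize (Hd k Nk ltac:(lra)). rewrite Ek in Hd.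
  set (q := h / k) in *.
  assert (Mq1 := Rmin_l (g t / 2) (eps * (g t * g t) / 4)).
  assert (Mq2 := Rmin_r (g t / 2) (eps * (g t * g t) / 4)).
  assert (Hq : g t / 2 < q) by (apply Rabs_lt_iff in Hd; lra).
  rewrite Et. fold k. replace (k / h) with (/ q) by (unfold q; field; now split).
  replace (/ q - / g t) with ((g t - q) / (q * g t)) by (field; lra).
  assert (Hqg : 0 < q * g t) by nra.
  unfold Rdiv. rewrite Rabs_mult, Rabs_inv, (Rabs_pos_eq (q * g t)), Rabs_minus_sym by lra.
  apply Rmult_lt_reg_r with (q * g t); [assumption|].
  rewrite Rmult_assoc, Rinv_l, Rmult_1_r by lra.
  assert (eps * (g t * g t) / 4 < eps * (q * g t)); [|lra].
  replace (eps * (g t * g t) / 4) with (eps * (g t / 4 * g t)) by field.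
  apply Rmult_lt_compat_l; [assumption|]. apply Rmult_lt_compat_r; lra.
Qed.

(** The quotients [f / g] agree at points of equal potential, written without division. In the
    variable z = G(x) both systems then have the same orbit equation dy/dz = - (1 + (f/g) y) / y. *)
Definition conj_half (g1 : R -> R) (f1 : R -> R -> R) (g2 : R -> R) (f2 : R -> R -> R) : Prop :=
 forall x x2 y, 0 < x -> 0 < x2 -> Gp g1 x = Gp g2 x2 -> f1 x y * g2 x2 = f2 x2 y * g1 x.

Lemma conj_half_sym g1 f1 g2 f2 : conj_half g1 f1 g2 f2 -> conj_half g2 f2 g1 f1.
Proof. intros H x x2 y Hx Hx2 E. symmetry. now apply H. Qed.

Definition convex (J : R -> Prop) : Prop :=
 forall a b t, J a -> J b -> a <= t <= b -> J t.

Definition is_open (J : R -> Prop) : Prop :=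
 forall t, J t -> exists e, 0 < e /\ forall s, Rabs (s - t) < e -> J s.

Lemma is_derive_comp_R (u s : R -> R) t a b :
 is_derive u (s t) a -> is_derive s t b -> is_derive (fun r => u (s r)) t (b * a).
Proof.
 intros H1 H2. apply (is_derive_comp (K := R_AbsRing) (V := R_NormedModule) u s t a b H1 H2).
Qed.

Lemma continuous_mult_R (u v : R -> R) t :
 continuous u t -> continuous v t -> continuous (fun s => u s * v s) t.
Proof. intros. now apply (continuous_mult (K := R_AbsRing)). Qed.

(** Carrying the abscissa to the point [m] of equal potential gives the second field multiplied by
    [lam = g1 x / g2 m]. The new time [s] is the integral of [lam]. As [lam] need not be bounded
    near the axis, the Gronwall weights are exponentials of [s] and not of [t]. *)
Lemma mirror_main N (J : R -> Prop) g1 f1 g2 f2 x y t0 B : half g1 f1 -> half g2 f2 ->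
 conj_half g1 f1 g2 f2 -> 0 < N -> flow N (vf N g1 f1) x y -> convex J -> is_open J -> J t0 ->
 0 <= B <= N ->
 (forall t, J t -> 0 < x t <= N /\ Rabs (y t) <= N /\ Gp g1 (x t) <= Gp g2 B) ->
 exists s x2 y2, flow N (vf N g2 f2) x2 y2 /\ s t0 = 0 /\
  (forall t, J t -> y2 (s t) = y t /\ 0 < x2 (s t) <= B /\ Gp g2 (x2 (s t)) = Gp g1 (x t)) /\
  (forall t t', J t -> J t' -> t < t' -> s t < s t') /\ (forall t, J t -> continuous s t).
Proof.
 intros H1 H2 HC HN H CJ OJ Jt0 HB HJ.
 destruct (inverse_potential g2 f2 H2) as [U [U1 [U2 U3]]].
 set (m := fun t => U (Gp g1 (x t))).
 assert (Hm : forall t, J t -> 0 < m t <= B /\ Gp g2 (m t) = Gp g1 (x t)).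
 { intros t Jt. destruct (HJ t Jt) as [A1 [A2 A3]].
  assert (P := Gp_pos g1 f1 H1 (x t) ltac:(lra)).
  destruct (ivt (Gp g2) 0 B (Gp g1 (x t))) as [r [Hr Er]]; [lra| |rewrite Gp_0; lra|].
  { intros s _. apply (Gp_cont g2 f2 H2). }
  assert (E : m t = r) by (unfold m; rewrite <- Er; apply U1; lra).
  rewrite E. split; [|assumption]. split; [|lra].
  destruct (Req_dec r 0) as [->|]; [rewrite Gp_0 in Er|]; lra. }
 set (lam := fun t => g1 (x t) / g2 (m t)).
 assert (Pg : forall t, J t -> 0 < g1 (x t) /\ 0 < g2 (m t)).
 { intros t Jt. split; [apply (half_pos g1 f1 H1); apply HJ, Jt|].
  apply (half_pos g2 f2 H2), Hm, Jt. }
 assert (Pl : forall t, J t -> 0 < lam t).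
 { intros t Jt. destruct (Pg t Jt). now apply Rdiv_lt_0_compat. }
 assert (Dm : forall t, J t -> is_derive m t (lam t * cl N (y t))).
 { intros t Jt. destruct (Hm t Jt) as [M1 M2]. destruct (H t Logic.I) as [Dx _].
  assert (D1 := is_derive_comp_R (Gp g1) x t _ _ (Gp_derive g1 f1 H1 (x t)) Dx).
  assert (D2 := U3 (m t) ltac:(lra)). rewrite M2 in D2.
  assert (D3 := is_derive_comp_R U (fun t => Gp g1 (x t)) t _ _ D2 D1).
  replace (lam t * cl N (y t)) with (cl N (y t) * g1 (x t) * / g2 (m t)) by (unfold lam, Rdiv;
   ring).
  exact D3. }
 assert (Cl : forall t, J t -> continuous lam t).
 { intros t Jt. apply (continuous_mult_R (fun t => g1 (x t))).
  - apply (continuous_comp x g1);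
   [now apply (flow_cont_x N (vf N g1 f1) x y)|apply (half_g_cont g1 f1 H1)].
  - apply (continuous_comp (fun t => g2 (m t)) Rinv).
   + apply (continuous_comp m g2); [|apply (half_g_cont g2 f2 H2)].
    eapply is_derive_continuous. now apply Dm.
   + apply continuity_pt_filterlim, continuity_pt_inv; [apply derivable_continuous_pt,
    derivable_pt_id|].
    destruct (Pg t Jt). lra. }
 set (s := fun t => RInt lam t0 t : R).
 assert (Xl : forall t, J t -> ex_RInt lam t0 t).
 { intros t Jt. apply (ex_RInt_continuous (V := R_CompleteNormedModule)). intros z Hz. apply Cl.
  unfold Rmin, Rmax in Hz. destruct (Rle_dec t0 t) in Hz; [apply (CJ t0 t z)|apply (CJ t t0 z)];
   assumption || lra. }
 assert (Ds : forall t, J t -> is_derive s t (lam t)).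
 { intros t Jt. apply (is_derive_RInt (V := R_NormedModule) lam s t0); [|now apply Cl].
  destruct (OJ t Jt) as [e [He1 He2]]. exists (mkposreal e He1). intros r Hr.
  apply (RInt_correct (V := R_CompleteNormedModule)), Xl, He2, Hr. }
 assert (F2 := vf_field g2 f2 H2 N HN).
 destruct (flow_exists N (vf N g2 f2) (m t0) (y t0) HN F2) as [x2 [y2 [I1 [I2 I3]]]].
 assert (s0 : s t0 = 0) by (unfold s; apply (RInt_point (V := R_CompleteNormedModule))).
 assert (Dy : forall t, J t -> is_derive y t (lam t * vf N g2 f2 (m t) (y t))).
 { intros t Jt. destruct (H t Logic.I) as [_ Dy]. destruct (Hm t Jt) as [M1 M2].
  destruct (HJ t Jt) as [A1 [A2 A3]]. apply Rabs_le_iff in A2.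
  replace (lam t * vf N g2 f2 (m t) (y t)) with (vf N g1 f1 (x t) (y t)); [exact Dy|].
  unfold vf. rewrite !cl_id by lra. unfold lam.
  assert (E := HC (x t) (m t) (y t) ltac:(lra) ltac:(lra) (eq_sym M2)).
  destruct (Pg t Jt) as [P1 P2].
  replace (f1 (x t) (y t)) with (f2 (m t) (y t) * g1 (x t) / g2 (m t)).
  - field. lra.
  - rewrite <- E. field. lra. }
 destruct (field_lip _ F2) as [L [HL Lip]].
 set (D := dist2 m y (fun t => x2 (s t)) (fun t => y2 (s t))).
 set (D' := fun t => 2 * ((m t - x2 (s t)) * (lam t * cl N (y t) - lam t * cl N (y2 (s t))) +
  (y t - y2 (s t)) * (lam t * vf N g2 f2 (m t) (y t) - lam t * vf N g2 f2 (x2 (s t)) (y2 (s t))))).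
 assert (DD : forall t, J t -> is_derive D t (D' t)).
 { intros t Jt. apply (dist2_derive m y (fun t => x2 (s t)) (fun t => y2 (s t)) t
   (lam t * cl N (y t)) _ (lam t * cl N (y2 (s t))) _); [now apply Dm|now apply Dy| |].
  - apply (is_derive_comp_R x2 s); [apply (I3 (s t) Logic.I)|now apply Ds].
  - apply (is_derive_comp_R y2 s); [apply (I3 (s t) Logic.I)|now apply Ds]. }
 assert (DB : forall t, J t -> Rabs (D' t) <= lam t * (4 * L * D t)).
 { intros t Jt. unfold D'.
  replace (2 * _) with (lam t * (2 * ((m t - x2 (s t)) * (cl N (y t) - cl N (y2 (s t))) +
   (y t - y2 (s t)) * (vf N g2 f2 (m t) (y t) - vf N g2 f2 (x2 (s t)) (y2 (s t)))))) by ring.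
  rewrite Rabs_mult, (Rabs_pos_eq (lam t)) by (left; now apply Pl).
  apply Rmult_le_compat_l; [left; now apply Pl|].
  apply dist2_growth; [lra| |apply Lip].
  eapply Rle_trans; [apply cl_lipschitz|].
  pose proof (Rabs_pos (m t - x2 (s t))). pose proof (Rabs_pos (y t - y2 (s t))). nra. }
 assert (D0 : D t0 = 0) by (unfold D, dist2; rewrite s0, I1, I2; ring).
 assert (DE : forall k t, J t -> is_derive (fun t => D t * exp (k * s t)) t
  ((D' t + k * lam t * D t) * exp (k * s t))).
 { intros k t Jt. assert (A := DD t Jt). assert (A' := Ds t Jt).
  assert (E1 : Derive (fun u => D u) t = D' t) by now apply is_derive_unique.
  assert (E2 : Derive (fun u => s u) t = lam t) by now apply is_derive_unique.
  auto_derive; [conj3; [now exists (D' t)|now exists (lam t)|trivial]|].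
  rewrite E1, E2. ring. }
 assert (DZ : forall t, J t -> D t = 0).
 { intros t Jt. assert (Dn : 0 <= D t) by apply dist2_pos.
  destruct (Rle_or_lt t0 t) as [Q|Q].
  - assert (K : D t * exp (- (4 * L) * s t) <= D t0 * exp (- (4 * L) * s t0)).
   { apply (derive_nonincr (fun t => D t * exp (- (4 * L) * s t))
     (fun t => (D' t + - (4 * L) * lam t * D t) * exp (- (4 * L) * s t))); [assumption| |].
    - intros r Hr. apply DE, (CJ t0 t r); assumption.
    - intros r Hr. assert (Jr : J r) by (apply (CJ t0 t r); try assumption; lra).
     specialize (DB r Jr). apply Rabs_le_iff in DB.
     pose proof (exp_pos (- (4 * L) * s r)). nra. }
   rewrite D0, Rmult_0_l in K. pose proof (exp_pos (- (4 * L) * s t)). nra.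
  - assert (K : D t * exp (4 * L * s t) <= D t0 * exp (4 * L * s t0)).
   { apply (derive_nondecr (fun t => D t * exp (4 * L * s t))
     (fun t => (D' t + 4 * L * lam t * D t) * exp (4 * L * s t))); [lra| |].
    - intros r Hr. apply DE, (CJ t t0 r); assumption.
    - intros r Hr. assert (Jr : J r) by (apply (CJ t t0 r); try assumption; lra).
     specialize (DB r Jr). apply Rabs_le_iff in DB.
     pose proof (exp_pos (4 * L * s r)). nra. }
   rewrite D0, Rmult_0_l in K. pose proof (exp_pos (4 * L * s t)). nra. }
 exists s, x2, y2. conj5; [assumption|assumption| | | ].
 - intros t Jt. destruct (dist2_zero m y (fun t => x2 (s t)) (fun t => y2 (s t)) t) as [E1 E2].
  { rewrite DZ by assumption. lra. }
  destruct (Hm t Jt) as [M1 M2]. rewrite <- E1, <- E2. now repeat split.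
 - intros t t' Jt Jt' Htt'. apply (derive_incr s lam); [assumption| |].
  + intros r Hr. apply Ds, (CJ t t' r); assumption.
  + intros r Hr. apply Pl, (CJ t t' r); try assumption; lra.
 - intros t Jt. eapply is_derive_continuous. now apply Ds.
Qed.

(** The new time may have a finite or an infinite supremum over [J]. In the first case the image
    passes through the limit point at the supremum [c]; in the second it converges to it. *)
Lemma end_right N F x2 y2 (J : R -> Prop) s t0 a b : flow N F x2 y2 -> convex J -> J t0 ->
 (forall t, J t -> continuous s t) -> (forall t t', J t -> J t' -> t < t' -> s t < s t') ->
 (forall t, J t -> exists t', J t' /\ t < t') ->
 (forall eps, 0 < eps -> exists t1, J t1 /\ forall t, J t -> t1 <= t ->
   Rabs (x2 (s t) - a) < eps /\ Rabs (y2 (s t) - b) < eps) ->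
 (exists c, x2 c = a /\ y2 c = b /\ (forall t, J t -> s t < c) /\
   forall r, s t0 <= r < c -> exists t, J t /\ t0 <= t /\ s t = r) \/
 (tends x2 a /\ tends y2 b /\ forall r, s t0 <= r -> exists t, J t /\ t0 <= t /\ s t = r).
Proof.
 intros H CJ Jt0 Cs Is NL L.
 assert (IV : forall r t', J t' -> s t0 <= r -> r < s t' -> exists t, J t /\ t0 <= t /\ s t = r).
 { intros r t' Jt' H1 H2. assert (t0 < t').
  { apply Rnot_le_lt. intros Q. destruct (Req_dec t' t0) as [->|]; [lra|].
   assert (s t' < s t0) by (apply Is; try assumption; lra). lra. }
  destruct (ivt s t0 t' r) as [t [Ht Et]]; [lra| |lra|].
  - intros q Hq. apply Cs, (CJ t0 t' q); assumption.
  - exists t. conj3; [apply (CJ t0 t' t); assumption|lra|assumption]. }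
 destruct (classic (exists M, forall t, J t -> s t <= M)) as [[M HM]|NM].
 - left. destruct (completeness (fun r => exists t, J t /\ r = s t)) as [c [C1 C2]].
  + exists M. intros r [t [Jt ->]]. auto.
  + exists (s t0), t0. now split.
  + assert (LT : forall t, J t -> s t < c).
   { intros t Jt. destruct (NL t Jt) as [t' [Jt' Htt']].
    apply Rlt_le_trans with (s t'); [now apply Is|]. apply C1. now exists t'. }
   assert (AP : forall eps, 0 < eps -> exists t1, J t1 /\ c - eps < s t1).
   { intros eps He. apply NNPP. intros Q. assert (c <= c - eps); [|lra].
    apply C2. intros r [t [Jt ->]]. apply Rnot_lt_le. intros Z. apply Q. now exists t. }
   assert (LIM : forall eps, 0 < eps -> Rabs (x2 c - a) < 2 * eps /\ Rabs (y2 c - b) < 2 * eps).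
   { intros eps He. destruct (L eps He) as [t1 [J1 K1]].
    destruct (proj1 (continuous_eps x2 c) (flow_cont_x N F x2 y2 c H) eps He) as [d1 [D1 D1']].
    destruct (proj1 (continuous_eps y2 c) (flow_cont_y N F x2 y2 c H) eps He) as [d2 [D2 D2']].
    destruct (AP (Rmin d1 d2)) as [t2 [J2 K2]]; [now apply Rmin_glb_lt|].
    assert (M1 := Rmin_l d1 d2). assert (M2 := Rmin_r d1 d2).
    set (t := Rmax t1 t2).
    assert (Jt : J t) by (unfold t, Rmax; destruct Rle_dec; assumption).
    assert (T1 : t1 <= t) by apply Rmax_l. assert (T2 : t2 <= t) by apply Rmax_r.
    assert (s t2 <= s t).
    { destruct (Req_dec t2 t) as [<-|]; [lra|]. left. apply Is; try assumption. lra. }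
    specialize (LT t Jt). destruct (K1 t Jt T1) as [A1 A2].
    specialize (D1' (s t) ltac:(apply Rabs_lt_iff; lra)).
    specialize (D2' (s t) ltac:(apply Rabs_lt_iff; lra)).
    apply Rabs_lt_iff in A1. apply Rabs_lt_iff in A2.
    apply Rabs_lt_iff in D1'. apply Rabs_lt_iff in D2'.
    split; apply Rabs_lt_iff; lra. }
   assert (Z : forall u v, (forall eps, 0 < eps -> Rabs (u - v) < 2 * eps) -> u = v).
   { intros u v Q. destruct (Req_dec u v) as [|Nuv]; [assumption|exfalso].
    assert (P : 0 < Rabs (u - v)) by (apply Rabs_pos_lt; lra).
    specialize (Q (Rabs (u - v) / 2)). lra. }
   exists c. conj3; [apply Z; intros; now apply LIM|apply Z; intros; now apply LIM| ].
   split; [assumption|]. intros r Hr.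
   destruct (AP (c - r)) as [t1 [J1 K1]]; [lra|]. apply (IV r t1); [assumption|lra|lra].
 - right. assert (UB : forall r, exists t, J t /\ r < s t).
  { intros r. apply NNPP. intros Q. apply NM. exists r. intros t Jt.
   apply Rnot_lt_le. intros Z. apply Q. now exists t. }
  assert (ON : forall r, s t0 <= r -> exists t, J t /\ t0 <= t /\ s t = r).
  { intros r Hr. destruct (UB r) as [t1 [J1 K1]]. now apply (IV r t1). }
  assert (TT : forall eps, 0 < eps -> exists T, forall r, T <= r ->
    Rabs (x2 r - a) < eps /\ Rabs (y2 r - b) < eps).
  { intros eps He. destruct (L eps He) as [t1 [J1 K1]].
   exists (Rmax (s t0) (s t1)). intros r Hr.
   assert (M1 := Rmax_l (s t0) (s t1)). assert (M2 := Rmax_r (s t0) (s t1)).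
   destruct (ON r) as [t [Jt [Ht <-]]]; [lra|]. apply K1; [assumption|].
   apply Rnot_lt_le. intros Q. assert (s t < s t1) by now apply Is. lra. }
  conj3; [ | |assumption]; intros eps He; destruct (TT eps He) as [T HT];
   exists T; intros t Ht; now apply HT.
Qed.

Lemma end_left N F x2 y2 (J : R -> Prop) s t0 a b : 0 < N -> flow N F x2 y2 -> convex J -> J t0 ->
 (forall t, J t -> continuous s t) -> (forall t t', J t -> J t' -> t < t' -> s t < s t') ->
 (forall t, J t -> exists t', J t' /\ t' < t) ->
 (forall eps, 0 < eps -> exists t1, J t1 /\ forall t, J t -> t <= t1 ->
   Rabs (x2 (s t) - a) < eps /\ Rabs (y2 (s t) - b) < eps) ->
 (exists c, x2 c = a /\ y2 c = b /\ (forall t, J t -> c < s t) /\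
   forall r, c < r <= s t0 -> exists t, J t /\ t <= t0 /\ s t = r) \/
 (tends (fun r => x2 (- r)) a /\ tends (fun r => y2 (- r)) b /\
   forall r, r <= s t0 -> exists t, J t /\ t <= t0 /\ s t = r).
Proof.
 intros HN H CJ Jt0 Cs Is NL L.
 destruct (end_right N (flipF F) (fun r => x2 (- r)) (fun r => - y2 (- r))
  (fun t => J (- t)) (fun t => - s (- t)) (- t0) a (- b)) as [[c [C1 [C2 [C3 C4]]]]|[C1 [C2 C3]]].
 - now apply flip_flow.
 - intros u v t Hu Hv Ht. apply (CJ (- v) (- u)); try assumption; lra.
 - now rewrite Ropp_involutive.
 - intros t Jt. apply (continuous_opp (V := R_NormedModule)).
  apply (continuous_comp (fun t => - t) s); [|now apply Cs].
  apply (continuous_opp (V := R_NormedModule)), continuous_id.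
 - intros t t' Jt Jt' Htt'. apply Ropp_lt_contravar, Is; try assumption; lra.
 - intros t Jt. destruct (NL (- t) Jt) as [t' [Jt' Ht']]. exists (- t').
  rewrite Ropp_involutive. split; [assumption|lra].
 - intros eps He. destruct (L eps He) as [t1 [J1 K1]]. exists (- t1).
  rewrite Ropp_involutive. split; [assumption|]. intros t Jt Ht.
  rewrite Ropp_involutive. destruct (K1 (- t) Jt ltac:(lra)) as [A1 A2].
  split; [assumption|]. replace (- y2 (s (- t)) - - b) with (- (y2 (s (- t)) - b)) by ring.
  now rewrite Rabs_Ropp.
 - left. exists (- c). conj4; [assumption|lra| | ].
  + intros t Jt. specialize (C3 (- t)). rewrite Ropp_involutive in C3. specialize (C3 Jt). lra.
  + intros r Hr. destruct (C4 (- r)) as [t [Jt [Ht Et]]]; [rewrite Ropp_involutive; lra|].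
   exists (- t). split; [assumption|split; lra].
 - right. conj3; [assumption| | ].
  + apply tends_opp in C2. rewrite Ropp_involutive in C2.
   apply (tends_ext _ _ b) with (2 := C2). intros. apply Ropp_involutive.
  + intros r Hr. destruct (C3 (- r)) as [t [Jt [Ht Et]]]; [rewrite Ropp_involutive; lra|].
   exists (- t). split; [assumption|split; lra].
Qed.

(** A relation between sets of points, so that the change of time is not carried along. *)
Definition corresponds g1 (x y : R -> R) (I1 : R -> Prop) g2 (x2 y2 : R -> R) (I2 : R -> Prop) :
 Prop :=
 forall t, I1 t -> exists t', I2 t' /\ Gp g2 (x2 t') = Gp g1 (x t) /\ y2 t' = y t.

Section Mirror.
Variables (g1 : R -> R) (f1 : R -> R -> R) (g2 : R -> R) (f2 : R -> R -> R) (N B : R).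
Hypothesis H1 : half g1 f1.
Hypothesis H2 : half g2 f2.
Hypothesis HC : conj_half g1 f1 g2 f2.
Hypothesis HN : 0 < N.
Hypothesis HB : 0 <= B <= N.

Lemma mirror_x_bound v v2 : 0 <= v2 <= N -> 0 <= v -> Gp g2 v2 = Gp g1 v ->
 forall e, 0 < e -> Gp g1 v < Gp g2 e -> v2 < e.
Proof.
 intros A1 A2 E e He Q. apply Rnot_le_lt. intros Z.
 destruct (Req_dec e v2) as [->|]; [lra|].
 assert (Gp g2 e < Gp g2 v2) by (apply (Gp_incr g2 f2 H2); lra). lra.
Qed.

Lemma Gp_small eps : 0 < eps -> exists d, 0 < d /\ forall v, Rabs v < d -> Gp g1 v < Gp g2 eps.
Proof.
 intros He. assert (P := Gp_pos g2 f2 H2 eps He).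
 destruct (proj1 (continuous_eps (Gp g1) 0) (Gp_cont g1 f1 H1 0) _ P) as [d [D1 D2]].
 exists d. split; [assumption|]. intros v Hv.
 specialize (D2 v). rewrite Rminus_0_r in D2. specialize (D2 Hv).
 rewrite Gp_0 in D2. apply Rabs_lt_iff in D2. lra.
Qed.

(** At the past end the image tends to [O], which it cannot reach in finite time because [O] is a
    rest point. At the other end the limit has [y < 0], which [flow_limit] forbids for convergence
    in infinite time; so the image crosses the axis. *)
Lemma mirror_loop x y : flow N (vf N g1 f1) x y -> loop x y -> inbox N x y (fun t => t <= 0) ->
 (forall t, t < 0 -> Gp g1 (x t) <= Gp g2 B) ->
 exists x2 y2, flow N (vf N g2 f2) x2 y2 /\ loop x2 y2 /\ y2 0 = y 0 /\
  inbox N x2 y2 (fun t => t <= 0) /\ (forall t, t <= 0 -> x2 t <= B) /\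
  corresponds g1 x y (fun t => t < 0) g2 x2 y2 (fun t => t < 0) /\
  corresponds g2 x2 y2 (fun t => t < 0) g1 x y (fun t => t < 0).
Proof.
 intros H [L1 [L2 [L3 [L4 L5]]]] Hb HG.
 destruct (mirror_main N (fun t => t < 0) g1 f1 g2 f2 x y (-1) B)
  as [s [x2 [y2 [I1 [I2 [I3 [I4 I5]]]]]]]; auto.
 - intros a b t Ha Hb' Ht. lra.
 - intros t. apply neg_open.
 - lra.
 - intros t Ht. destruct (Hb t) as [A1 A2]; [lra|]. apply Rabs_le_iff in A1.
  specialize (L3 t Ht). conj3; [lra|assumption|now apply HG].
 - assert (CJ : convex (fun t => t < 0)) by (intros a b t Ha Hb' Ht; lra).
  assert (F2 := vf_field g2 f2 H2 N HN).
  destruct (end_left N (vf N g2 f2) x2 y2 (fun t => t < 0) s (-1) 0 0) as [[c [C1 [C2 _]]]|[C1 [C2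
   C3]]]; auto.
  { lra. }
  { intros t Ht. exists (t - 1). lra. }
  { intros eps He. destruct (Gp_small eps He) as [d [D1 D2]].
   destruct (L4 d D1) as [T1 HT1]. destruct (L5 eps He) as [T2 HT2].
   exists (- Rmax 1 (Rmax T1 T2)). assert (M1 := Rmax_l 1 (Rmax T1 T2)).
   assert (M2 := Rmax_r 1 (Rmax T1 T2)). assert (M3 := Rmax_l T1 T2). assert (M4 := Rmax_r T1 T2).
   split; [lra|]. intros t Jt Ht. specialize (HT1 (- t) ltac:(lra)).
    specialize (HT2 (- t) ltac:(lra)).
   rewrite !Rminus_0_r. rewrite Ropp_involutive, Rminus_0_r in HT1. rewrite Ropp_involutive,
    Rminus_0_r in HT2.
   destruct (I3 t Jt) as [E1 [E2 E3]]. rewrite E1. split; [|assumption].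
   assert (x2 (s t) < eps).
   { apply (mirror_x_bound (x t) (x2 (s t))); [lra|left;
    now apply L3|assumption|assumption|now apply D2]. }
   apply Rabs_lt_iff. lra. }
  { exfalso. destruct (flow_rest N (vf N g2 f2) x2 y2 c HN F2 I1 C1 C2 (s (-1))) as [Q _].
   destruct (I3 (-1)) as [_ [Q' _]]; lra. }
  destruct (end_right N (vf N g2 f2) x2 y2 (fun t => t < 0) s (-1) 0 (y 0)) as [[c [K1 [K2 [K3
   K4]]]]|[K1 [K2 K3]]]; auto.
  { lra. }
  { intros t Ht. exists (t / 2). lra. }
  { intros eps He. destruct (Gp_small eps He) as [d [D1 D2]].
   destruct (proj1 (continuous_eps x 0) (flow_cont_x N (vf N g1 f1) x y 0 H) d D1) as [d1 [X1 X2]].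
   destruct (proj1 (continuous_eps y 0) (flow_cont_y N (vf N g1 f1) x y 0 H) eps He) as [d2 [Y1
    Y2]].
   assert (M1 := Rmin_l d1 d2). assert (M2 := Rmin_r d1 d2).
   assert (M3 : 0 < Rmin d1 d2) by now apply Rmin_glb_lt.
   exists (- Rmin d1 d2 / 2). split; [lra|]. intros t Jt Ht.
   specialize (X2 t ltac:(apply Rabs_lt_iff; lra)). specialize (Y2 t ltac:(apply Rabs_lt_iff; lra)).
   rewrite L1, Rminus_0_r in X2.
   destruct (I3 t Jt) as [E1 [E2 E3]]. rewrite E1. split; [|assumption].
   assert (x2 (s t) < eps).
   { apply (mirror_x_bound (x t) (x2 (s t))); [lra|left;
    now apply L3|assumption|assumption|now apply D2]. }
   apply Rabs_lt_iff. lra. }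
  + assert (ON : forall r, r < c -> exists t, t < 0 /\ s t = r).
   { intros r Hr. destruct (Rle_or_lt (s (-1)) r) as [Q|Q].
    - destruct (K4 r) as [t [Jt [_ Et]]]; [lra|]. now exists t.
    - destruct (C3 r) as [t [Jt [_ Et]]]; [lra|]. now exists t. }
   exists (fun t => x2 (t + c)), (fun t => y2 (t + c)).
   assert (PB : forall t, t < 0 -> 0 < x2 (t + c) <= B /\ Rabs (y2 (t + c)) <= N).
   { intros t Ht. destruct (ON (t + c)) as [r [Hr Er]]; [lra|].
    destruct (I3 r Hr) as [E1 [E2 E3]]. rewrite <- Er, E1. split; [assumption|].
    destruct (Hb r); [lra|]. assumption. }
   conj7; [now apply flow_shift| | | | | | ].
   * conj5; [now rewrite Rplus_0_l|rewrite Rplus_0_l; lra| | | ].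
    -- intros t Ht. apply PB, Ht.
    -- now apply (tends_back_shift x2 0 c).
    -- now apply (tends_back_shift y2 0 c).
   * now rewrite Rplus_0_l.
   * intros t Ht. destruct (Req_dec t 0) as [->|].
    -- rewrite Rplus_0_l, K1, K2, Rabs_R0. destruct (Hb 0); [lra|]. split; [lra|assumption].
    -- destruct (PB t) as [Q1 Q2]; [lra|]. split; [apply Rabs_le_iff; lra|assumption].
   * intros t Ht. destruct (Req_dec t 0) as [->|]; [rewrite Rplus_0_l; lra|]. apply PB. lra.
   * intros t Ht. destruct (I3 t Ht) as [E1 [E2 E3]]. exists (s t - c).
    replace (s t - c + c) with (s t) by ring. split; [specialize (K3 t Ht); lra|now split].
   * intros t Ht. destruct (ON (t + c)) as [r [Hr Er]]; [lra|].
    destruct (I3 r Hr) as [E1 [E2 E3]]. exists r. rewrite <- Er. now repeat split.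
  + exfalso. destruct (flow_limit N (vf N g2 f2) x2 y2 0 HN F2 I1 K1) as [Q _].
   assert (E := tends_unique _ _ _ K2 Q). lra.
Qed.

(** Both end points have nonzero [y], so by [flow_limit] the image reaches the vertical axis in
    finite time in both directions. *)
Lemma mirror_arc x y T : flow N (vf N g1 f1) x y -> T < 0 -> x 0 = 0 -> y 0 < 0 -> x T = 0 ->
 0 < y T -> (forall t, T < t < 0 -> 0 < x t) -> inbox N x y (fun t => T <= t <= 0) ->
 (forall t, T < t < 0 -> Gp g1 (x t) <= Gp g2 B) ->
 exists x2 y2 T2, flow N (vf N g2 f2) x2 y2 /\ T2 < 0 /\ x2 0 = 0 /\ y2 0 = y 0 /\
  x2 T2 = 0 /\ y2 T2 = y T /\ (forall t, T2 < t < 0 -> 0 < x2 t) /\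
  inbox N x2 y2 (fun t => T2 <= t <= 0).
Proof.
 intros H HT X0 Y0 XT YT HP Hb HG.
 set (J := fun t => T < t < 0). set (t0 := T / 2). assert (Jt0 : J t0) by (unfold J, t0; lra).
 assert (CJ : convex J) by (intros a b t Ha Hb' Ht; unfold J in *; lra).
 destruct (mirror_main N J g1 f1 g2 f2 x y t0 B)
  as [s [x2 [y2 [I1 [I2 [I3 [I4 I5]]]]]]]; auto.
 - intros t. apply between_open.
 - intros t Ht. destruct (Hb t) as [A1 A2]; [unfold J in Ht; lra|]. apply Rabs_le_iff in A1.
  specialize (HP t Ht). conj3; [lra|assumption|now apply HG].
 - assert (F2 := vf_field g2 f2 H2 N HN).
  assert (Lim : forall c, T <= c <= 0 -> x c = 0 -> forall eps, 0 < eps -> exists d, 0 < d /\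
   forall t, J t -> Rabs (t - c) < d -> Rabs (x2 (s t) - 0) < eps /\ Rabs (y2 (s t) - y c) < eps).
  { intros c Hc Xc eps He. destruct (Gp_small eps He) as [d [D1 D2]].
   destruct (proj1 (continuous_eps x c) (flow_cont_x N (vf N g1 f1) x y c H) d D1) as [d1 [X1 X2]].
   destruct (proj1 (continuous_eps y c) (flow_cont_y N (vf N g1 f1) x y c H) eps He) as [d2 [Y1
    Y2]].
   assert (M1 := Rmin_l d1 d2). assert (M2 := Rmin_r d1 d2).
   exists (Rmin d1 d2). split; [now apply Rmin_glb_lt|]. intros t Jt Ht.
   specialize (X2 t ltac:(lra)). specialize (Y2 t ltac:(lra)).
   rewrite Xc, Rminus_0_r in X2.
   destruct (I3 t Jt) as [E1 [E2 E3]]. rewrite E1. split; [|assumption].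
   assert (x2 (s t) < eps).
   { apply (mirror_x_bound (x t) (x2 (s t))); [lra|left;
    now apply HP|assumption|assumption|now apply D2]. }
   rewrite Rminus_0_r. apply Rabs_lt_iff. lra. }
  destruct (end_left N (vf N g2 f2) x2 y2 J s t0 0 (y T)) as [[b [C1 [C2 [C3 C4]]]]|[C1 [C2 C3]]];
   auto.
  { intros t Ht. exists ((t + T) / 2). unfold J in *. lra. }
  { intros eps He. destruct (Lim T ltac:(lra) XT eps He) as [d [D1 D2]].
   exists (Rmax (T + Rmin d (- T) / 2) (T + 0)). rewrite Rplus_0_r.
   assert (M1 := Rmin_l d (- T)). assert (M2 := Rmin_r d (- T)).
   assert (0 < Rmin d (- T)) by (apply Rmin_glb_lt; lra).
   rewrite Rmax_left by lra. split; [unfold J; lra|]. intros t Jt Ht.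
   apply D2; [assumption|]. unfold J in Jt. apply Rabs_lt_iff. lra. }
  2:{ exfalso. assert (H' := flip_flow N _ x2 y2 HN I1).
    destruct (flow_limit N (flipF (vf N g2 f2)) _ _ 0 HN (flip_field _ F2) H' C1) as [Q _].
    apply tends_opp in C2. assert (E := tends_unique _ _ _ C2 Q). lra. }
  destruct (end_right N (vf N g2 f2) x2 y2 J s t0 0 (y 0)) as [[c [K1 [K2 [K3 K4]]]]|[K1 [K2 K3]]];
   auto.
  { intros t Ht. exists (t / 2). unfold J in *. lra. }
  { intros eps He. destruct (Lim 0 ltac:(lra) X0 eps He) as [d [D1 D2]].
   assert (M1 := Rmin_l d (- T)). assert (M2 := Rmin_r d (- T)).
   assert (0 < Rmin d (- T)) by (apply Rmin_glb_lt; lra).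
   exists (- (Rmin d (- T) / 2)). split; [unfold J; lra|]. intros t Jt Ht.
   apply D2; [assumption|]. unfold J in Jt. apply Rabs_lt_iff. lra. }
  + assert (ON : forall r, b < r < c -> exists t, J t /\ s t = r).
   { intros r Hr. destruct (Rle_or_lt (s t0) r) as [Q|Q].
    - destruct (K4 r) as [t [Jt [_ Et]]]; [lra|]. now exists t.
    - destruct (C4 r) as [t [Jt [_ Et]]]; [lra|]. now exists t. }
   specialize (K3 t0 Jt0). specialize (C3 t0 Jt0).
   exists (fun t => x2 (t + c)), (fun t => y2 (t + c)), (b - c).
   replace (b - c + c) with b by ring. rewrite Rplus_0_l.
   repeat (split; [first [now apply flow_shift|assumption|lra]|]).
   assert (PB : forall t, b - c < t < 0 -> 0 < x2 (t + c) <= B /\ Rabs (y2 (t + c)) <= N).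
   { intros t Ht. destruct (ON (t + c)) as [r [Hr Er]]; [lra|].
    destruct (I3 r Hr) as [E1 [E2 E3]]. rewrite <- Er, E1. split; [assumption|].
    destruct (Hb r); [unfold J in Hr; lra|]. assumption. }
   split; [intros t Ht; now apply PB|]. intros t Ht.
   destruct (Req_dec t 0) as [->|N0]; [|destruct (Req_dec t (b - c)) as [->|Nb]].
   * rewrite Rplus_0_l, K1, K2, Rabs_R0. destruct (Hb 0); [lra|]. split; [lra|assumption].
   * replace (b - c + c) with b by ring. rewrite C1, C2, Rabs_R0.
    destruct (Hb T); [lra|]. split; [lra|assumption].
   * destruct (PB t) as [Q1 Q2]; [lra|]. split; [apply Rabs_le_iff; lra|assumption].
  + exfalso. destruct (flow_limit N (vf N g2 f2) x2 y2 0 HN F2 I1 K1) as [Q _].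
   assert (E := tends_unique _ _ _ K2 Q). lra.
Qed.

(** The strict inequalities at time 0 let the interval be prolonged a little beyond it; it is then
    open and contains 0. *)
Lemma mirror_emanates x y : flow N (vf N g1 f1) x y -> emanates x y ->
 inbox N x y (fun t => t <= 0) -> x 0 < N -> Rabs (y 0) < N -> Gp g1 (x 0) < Gp g2 B ->
 exists x2 y2, flow N (vf N g2 f2) x2 y2 /\ emanates x2 y2 /\
  Gp g2 (x2 0) = Gp g1 (x 0) /\ y2 0 = y 0 /\ 0 < x2 0 <= B.
Proof.
 intros H E Hb Bx By HG. pose proof (emanates_x_incr N _ x y HN H E) as Inc.
 destruct E as [E1 [E2 [E3 [E4 E5]]]].
 assert (OP : exists e, 0 < e /\ forall t,
  Rabs t < e -> 0 < x t < N /\ Rabs (y t) < N /\ Gp g1 (x t) < Gp g2 B).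
 { assert (Cx := flow_cont_x N (vf N g1 f1) x y 0 H).
  assert (Cy := flow_cont_y N (vf N g1 f1) x y 0 H).
  destruct (continuous_pos x 0 Cx E1) as [d1 [P1 Q1]].
  destruct (continuous_neg (fun t => x t - N) 0) as [d2 [P2 Q2]]; [|lra|].
  { apply (continuous_minus (V := R_NormedModule)); [assumption|apply continuous_const]. }
  destruct (continuous_neg (fun t => Rabs (y t) - N) 0) as [d3 [P3 Q3]]; [|lra|].
  { apply (continuous_minus (V := R_NormedModule)); [|apply continuous_const].
   apply (continuous_comp y Rabs); [assumption|apply continuous_Rabs]. }
  destruct (continuous_neg (fun t => Gp g1 (x t) - Gp g2 B) 0) as [d4 [P4 Q4]]; [|lra|].
  { apply (continuous_minus (V := R_NormedModule)); [|apply continuous_const].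
   apply (continuous_comp x (Gp g1)); [assumption|apply (Gp_cont g1 f1 H1)]. }
  exists (Rmin (Rmin d1 d2) (Rmin d3 d4)). split; [repeat apply Rmin_glb_lt; assumption|].
  intros t Ht. assert (M1 := Rmin_l (Rmin d1 d2) (Rmin d3 d4)).
   assert (M2 := Rmin_r (Rmin d1 d2) (Rmin d3 d4)).
  assert (M3 := Rmin_l d1 d2). assert (M4 := Rmin_r d1 d2). assert (M5 := Rmin_l d3 d4).
   assert (M6 := Rmin_r d3 d4).
  rewrite <- (Rminus_0_r t) in Ht.
  specialize (Q1 t ltac:(lra)). specialize (Q2 t ltac:(lra)). specialize (Q3 t ltac:(lra)).
   specialize (Q4 t ltac:(lra)).
  lra. }
 destruct OP as [e [He HO]].
 set (J := fun t => t < e).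
 assert (CJ : convex J) by (intros a b t Ha Hb' Ht; unfold J in *; lra).
 assert (J0 : J 0) by (unfold J; lra).
 destruct (mirror_main N J g1 f1 g2 f2 x y 0 B)
  as [s [x2 [y2 [I1 [I2 [I3 [I4 I5]]]]]]]; auto.
 - intros t Ht. exists (e - t). unfold J in *. split; [lra|]. intros r Hr.
  apply Rabs_lt_iff in Hr. lra.
 - intros t Ht. unfold J in Ht. destruct (Rle_or_lt 0 t) as [Q|Q].
  + destruct (HO t) as [A1 [A2 A3]]; [apply Rabs_lt_iff; lra|]. split; [lra|split; lra].
  + destruct (E3 t Q) as [A1 A2]. destruct (Hb t ltac:(lra)) as [A3 A4].
   specialize (Inc t 0 ltac:(lra)). apply Rabs_le_iff in A3.
   assert (Gp g1 (x t) < Gp g1 (x 0)) by (apply (Gp_incr g1 f1 H1); lra).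
   conj3; [lra|assumption|lra].
 - assert (F2 := vf_field g2 f2 H2 N HN).
  destruct (end_left N (vf N g2 f2) x2 y2 J s 0 0 0) as [[c [C1 [C2 _]]]|[C1 [C2 C3]]]; auto.
  { intros t Ht. exists (t - 1). unfold J in *. lra. }
  { intros eps Hep. destruct (Gp_small eps Hep) as [d [D1 D2]].
   destruct (E4 d D1) as [T1 HT1]. destruct (E5 eps Hep) as [T2 HT2].
   exists (- Rmax 1 (Rmax T1 T2)). assert (M1 := Rmax_l 1 (Rmax T1 T2)).
   assert (M2 := Rmax_r 1 (Rmax T1 T2)). assert (M3 := Rmax_l T1 T2). assert (M4 := Rmax_r T1 T2).
   split; [unfold J; lra|]. intros t Jt Ht. specialize (HT1 (- t) ltac:(lra)).
    specialize (HT2 (- t) ltac:(lra)).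
   rewrite !Rminus_0_r. rewrite Ropp_involutive, Rminus_0_r in HT1. rewrite Ropp_involutive,
    Rminus_0_r in HT2.
   destruct (I3 t Jt) as [A1 [A2 A3]]. rewrite A1. split; [|assumption].
   assert (x2 (s t) < eps).
   { apply (mirror_x_bound (x t) (x2 (s t))); [lra|left; apply E3;
    lra|assumption|assumption|now apply D2]. }
   apply Rabs_lt_iff. lra. }
  { exfalso. destruct (flow_rest N (vf N g2 f2) x2 y2 c HN F2 I1 C1 C2 (s 0)) as [Q _].
   destruct (I3 0) as [_ [Q' _]]; [assumption|lra]. }
  destruct (I3 0 J0) as [A1 [A2 A3]]. rewrite I2 in *.
  exists x2, y2. conj3; [assumption| |now repeat split].
  apply (emanates_of_pos N (vf N g2 f2)); auto; [lra|lra|].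
  intros r Hr. destruct (C3 r ltac:(lra)) as [t [Jt [_ <-]]]. apply (I3 t Jt).
Qed.
End Mirror.

(** * Homoclinic orbits *)

(** Together with [fT], the system in the coordinates (-x, y) with time reversed: the left half
    plane becomes a right one and the sense of rotation is kept. *)
Definition gT (g : R -> R) (x : R) : R := - g (- x).
Definition fT (f : R -> R -> R) (x y : R) : R := - f (- x) y.

Lemma gT_gT g : gT (gT g) = g.
Proof. apply functional_extensionality. intros x. unfold gT. now rewrite !Ropp_involutive. Qed.

Lemma fT_fT f : fT (fT f) = f.
Proof.
 apply functional_extensionality. intros x. apply functional_extensionality. intros y.
 unfold fT. now rewrite !Ropp_involutive.
Qed.

Lemma half_T g f : half g f -> half (gT g) (fT f).
Proof.
 intros [H1 H2 H3]. split.
 - intros x Hx. unfold gT. specialize (H1 (- x) ltac:(lra)). lra.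
 - intros N. destruct (H2 N) as [L [HL Lip]]. exists L. split; [assumption|].
  intros x x' Hx Hx'. unfold gT.
  replace (- g (- x) - - g (- x')) with (- (g (- x) - g (- x'))) by ring.
  replace (x - x') with (- (- x - - x')) by ring. rewrite !Rabs_Ropp.
  apply Lip; now rewrite Rabs_Ropp.
 - intros N. destruct (H3 N) as [L [HL Lip]]. exists L. split; [assumption|].
  intros x y x' y' Hx Hy Hx' Hy'. unfold fT.
  replace (- f (- x) y - - f (- x') y') with (- (f (- x) y - f (- x') y')) by ring.
  replace (x - x') with (- (- x - - x')) by ring. rewrite !Rabs_Ropp.
  apply Lip; try assumption; now rewrite Rabs_Ropp.
Qed.

Lemma flow_T N g f x y : 0 < N -> flow N (vf N g f) x y ->
 flow N (vf N (gT g) (fT f)) (fun t => - x (- t)) (fun t => y (- t)).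
Proof.
 intros HN H t _. destruct (H (- t) Logic.I) as [H1 H2]. split.
 - rewrite <- (Ropp_involutive (cl N _)). apply is_derive_neg. now apply is_derive_reverse.
 - replace (vf N (gT g) (fT f) (- x (- t)) (y (- t))) with (- vf N g f (x (- t)) (y (- t))).
  + now apply is_derive_reverse.
  + unfold vf, gT, fT. rewrite cl_opp, !Ropp_involutive by lra. ring.
Qed.

(** The one-sided bound is imposed on both halves to make the record invariant under the passage to
    [gT] and [fT]. *)
Record sys (g : R -> R) (f : R -> R -> R) (d L : R) : Prop := {
 sys_half : half g f;
 sys_right : one_sided f d L;
 sys_left : one_sided (fT f) d L;
 sys_conj : conj_half g f (gT g) (fT f) }.

Lemma sys_T g f d L : sys g f d L -> sys (gT g) (fT f) d L.
Proof.
 intros [H1 H2 H3 H4]. split; [now apply half_T|assumption| |].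
 - now rewrite fT_fT.
 - rewrite fT_fT, gT_gT. now apply conj_half_sym.
Qed.

Lemma vf_box N N' M g f x y : 0 <= M <= N -> M <= N' -> Rabs x <= M -> Rabs y <= M ->
 cl N y = cl N' y /\ vf N g f x y = vf N' g f x y.
Proof.
 intros H1 H2 Hx Hy. apply Rabs_le_iff in Hx. apply Rabs_le_iff in Hy.
 unfold vf. rewrite !cl_id by lra. now split.
Qed.

Lemma sol_box N N' M g f I x y : M <= N -> M <= N' ->
 sol N (vf N g f) I x y -> inbox M x y I -> sol N' (vf N' g f) I x y.
Proof.
 intros H1 H2 H HB t It. destruct (H t It) as [D1 D2]. destruct (HB t It) as [B1 B2].
 pose proof (Rabs_pos (x t)).
 destruct (vf_box N N' M g f (x t) (y t)) as [E1 E2]; try assumption; [lra|].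
 rewrite <- E1, <- E2. now split.
Qed.

(** Inside the common box both truncated fields equal the original one, so uniqueness applies across
    truncation levels. *)
Lemma flow_box_unique N N' M g f x y x' y' I c : half g f -> 0 < N' -> M <= N -> M <= N' ->
 flow N (vf N g f) x y -> inbox M x y I -> flow N' (vf N' g f) x' y' -> I c -> convex I ->
 x c = x' c -> y c = y' c -> forall t, I t -> x t = x' t /\ y t = y' t.
Proof.
 intros Hgf HN' H1 H2 H HB H' Ic CI Ex Ey t It.
 assert (S : sol N' (vf N' g f) I x y).
 { apply (sol_box N N' M); try assumption. now apply flow_sol. }
 apply (sol_unique N' (vf N' g f) x y x' y' (Rmin c t) (Rmax c t) c (vf_field g f Hgf N' HN'));
  auto.
 - split; [apply Rmin_l|apply Rmax_l].
 - intros s Hs. apply S. unfold Rmin, Rmax in Hs.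
  destruct (Rle_dec c t) in Hs; [apply (CI c t)|apply (CI t c)]; assumption || lra.
 - now apply flow_sol.
 - split; [apply Rmin_r|apply Rmax_r].
Qed.

(** The past is a loop on the right and the future, seen in the reflected system, a loop as well;
    the box makes the orbit one of the original system. *)
Definition homloop (g : R -> R) (f : R -> R -> R) (N : R) (x y : R -> R) : Prop :=
 0 < N /\ flow N (vf N g f) x y /\ loop x y /\ loop (fun t => - x (- t)) (fun t => y (- t)) /\
 inbox N x y (fun _ => True).

Definition hom g f (a b : R) : Prop :=
 exists N x y t, homloop g f N x y /\ x t = a /\ y t = b.

Lemma homloop_T g f N x y : homloop g f N x y ->
 homloop (gT g) (fT f) N (fun t => - x (- t)) (fun t => y (- t)).
Proof.
 intros [H1 [H2 [H3 [H4 H5]]]].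
 assert (E : (fun t => - - x (- - t)) = x).
 { apply functional_extensionality. intros t. now rewrite !Ropp_involutive. }
 assert (E' : (fun t => y (- - t)) = y).
 { apply functional_extensionality. intros t. now rewrite !Ropp_involutive. }
 conj5; [assumption|now apply flow_T|assumption| | ].
 - now rewrite E, E'.
 - intros t _. rewrite Rabs_Ropp. now apply H5.
Qed.

Lemma hom_T g f a b : hom g f a b <-> hom (gT g) (fT f) (- a) b.
Proof.
 assert (Q : forall g f a b, hom g f a b -> hom (gT g) (fT f) (- a) b).
 { clear. intros g f a b [N [x [y [t [H [Ex Ey]]]]]].
  exists N, (fun t => - x (- t)), (fun t => y (- t)), (- t).
  split; [now apply homloop_T|]. rewrite Ropp_involutive. split; [lra|assumption]. }
 split; [apply Q|]. intros H. apply Q in H. now rewrite gT_gT, fT_fT, Ropp_involutive in H.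
Qed.

Lemma homloop_larger g f N N' x y : N <= N' -> homloop g f N x y -> homloop g f N' x y.
Proof.
 intros HN [H1 [H2 [H3 [H4 H5]]]]. conj5; [lra| |assumption|assumption| ].
 - now apply (sol_box N N' N); [lra| | |].
 - intros t Ht. destruct (H5 t Ht). lra.
Qed.

(** A value of the first potential that the second does not reach bounds the second from above. This
    decides from which side arcs always have a mirror image. *)
Lemma potential_cases g1 g2 : (forall x, 0 <= x -> exists B, 0 <= B /\ Gp g1 x <= Gp g2 B) \/
 (forall x, 0 <= x -> exists B, 0 <= B /\ Gp g2 x <= Gp g1 B).
Proof.
 destruct (classic (forall x, 0 <= x -> exists B, 0 <= B /\ Gp g1 x <= Gp g2 B)) as [|N];
  [now left|].
 right. apply not_all_ex_not in N. destruct N as [x0 N]. apply imply_to_and in N.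
 destruct N as [Hx N]. intros x Hx'. exists x0. split; [assumption|].
 apply Rnot_lt_le. intros Q. apply N. exists x. split; [assumption|lra].
Qed.

Lemma loop_ext x y x' y' : (forall t, t <= 0 -> x t = x' t /\ y t = y' t) -> loop x y -> loop x' y'.
Proof.
 intros E [L1 [L2 [L3 [L4 L5]]]].
 destruct (E 0 ltac:(lra)) as [E1 E2]. conj5; [lra|lra| | | ].
 - intros t Ht. destruct (E t ltac:(lra)) as [<- _]. auto.
 - intros eps He. destruct (L4 eps He) as [T HT]. exists (Rmax 0 T). intros t Ht.
  assert (M1 := Rmax_l 0 T). assert (M2 := Rmax_r 0 T).
  destruct (E (- t) ltac:(lra)) as [<- _]. apply HT. lra.
 - intros eps He. destruct (L5 eps He) as [T HT]. exists (Rmax 0 T). intros t Ht.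
  assert (M1 := Rmax_l 0 T). assert (M2 := Rmax_r 0 T).
  destruct (E (- t) ltac:(lra)) as [_ <-]. apply HT. lra.
Qed.

Lemma convex_le0 : convex (fun t => t <= 0).
Proof. intros a b t Ha Hb Ht. lra. Qed.

(** By uniqueness the reflection of the left loop continues the right one, because both pass through
    the same point of the vertical axis. *)
Lemma homloop_glue g f N x y x2 y2 : half g f -> 0 < N -> flow N (vf N g f) x y -> loop x y ->
 inbox N x y (fun t => t <= 0) -> flow N (vf N (gT g) (fT f)) x2 y2 -> loop x2 y2 ->
 y2 0 = y 0 -> inbox N x2 y2 (fun t => t <= 0) -> homloop g f N x y.
Proof.
 intros Hgf HN H L B H2 L2 E B2.
 assert (Eq : forall t, x2 t = - x (- t) /\ y2 t = y (- t)).
 { apply (flow_unique N (vf N (gT g) (fT f)) x2 y2 _ _ 0 (vf_field _ _ (half_T g f Hgf) N HN) H2).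
  - now apply flow_T.
  - rewrite Ropp_0. destruct L as [-> _]. destruct L2 as [-> _]. ring.
  - now rewrite Ropp_0. }
 conj5; [assumption|assumption|assumption| | ].
 - apply (loop_ext x2 y2); [|assumption]. intros t _. apply Eq.
 - intros t _. destruct (Rle_or_lt t 0) as [Q|Q]; [now apply B|].
  destruct (Eq (- t)) as [E1 E2]. rewrite Ropp_involutive in E1, E2.
  rewrite <- E2. replace (x t) with (- x2 (- t)) by lra. rewrite Rabs_Ropp. apply B2. lra.
Qed.

(** The mirror image of the right half and the reflected left half are orbits of the same system
    through the same point of the axis, hence equal. *)
Lemma hom_corr_aux g f d L N x y : sys g f d L -> homloop g f N x y ->
 (forall x, 0 <= x -> exists B, 0 <= B /\ Gp g x <= Gp (gT g) B) ->
 corresponds g x y (fun t => t < 0) (gT g) (fun t => - x (- t)) (fun t => y (- t)) (fun t => t < 0)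
  /\
 corresponds (gT g) (fun t => - x (- t)) (fun t => y (- t)) (fun t => t < 0) g x y (fun t => t < 0).
Proof.
 intros [S1 S2 S3 S4] HL CA.
 destruct (CA N) as [B [B0 HB]]; [destruct HL; lra|].
 assert (M1 := Rmax_l N B). assert (M2 := Rmax_r N B).
 apply (homloop_larger g f N (Rmax N B)) in HL as HL'; [|assumption].
 destruct HL as [_ [_ [_ [_ Bx]]]].
 destruct HL' as [H1 [H2 [H3 [H4 H5]]]].
 destruct (mirror_loop g f (gT g) (fT f) (Rmax N B) B S1 (half_T _ _ S1) S4 H1 ltac:(lra) x y H2 H3)
  as [x2 [y2 [K1 [K2 [K3 [K4 [K5 [K6 K7]]]]]]]].
 - intros t _. now apply H5.
 - intros t Ht. apply Rle_trans with (2 := HB). destruct (Bx t Logic.I) as [Q _].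
  apply Rabs_le_iff in Q. destruct H3 as [_ [_ [H3 _]]]. specialize (H3 t Ht).
  destruct (Req_dec (x t) N) as [->|]; [lra|]. left. apply (Gp_incr g f S1). lra.
 - assert (Eq : forall t, x2 t = - x (- t) /\ y2 t = y (- t)).
  { apply (flow_unique _ (vf (Rmax N B) (gT g) (fT f)) x2 y2 _ _ 0 (vf_field _ _ (half_T g f S1) _
   H1) K1).
   - now apply flow_T.
   - rewrite Ropp_0. destruct H3 as [-> _]. destruct K2 as [-> _]. ring.
   - now rewrite Ropp_0. }
  split.
  + intros t Ht. destruct (K6 t Ht) as [t' [Q1 [Q2 Q3]]]. exists t'.
   destruct (Eq t') as [<- <-]. now repeat split.
  + intros t Ht. destruct (Eq t) as [<- <-]. now apply K7.
Qed.

Lemma hom_corr g f d L N x y : sys g f d L -> homloop g f N x y ->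
 corresponds g x y (fun t => t < 0) (gT g) (fun t => - x (- t)) (fun t => y (- t)) (fun t => t < 0)
  /\
 corresponds (gT g) (fun t => - x (- t)) (fun t => y (- t)) (fun t => t < 0) g x y (fun t => t < 0).
Proof.
 intros S HL. destruct (potential_cases g (gT g)) as [CA|CB].
 - now apply (hom_corr_aux g f d L N).
 - destruct (hom_corr_aux (gT g) (fT f) d L N _ _ (sys_T _ _ _ _ S) (homloop_T _ _ _ _ _ HL)) as
  [Q1 Q2].
  + now rewrite gT_gT.
  + rewrite gT_gT in *.
   assert (E : (fun t => - - x (- - t)) = x).
   { apply functional_extensionality. intros t. now rewrite !Ropp_involutive. }
   assert (E' : (fun t => y (- - t)) = y).
   { apply functional_extensionality. intros t. now rewrite !Ropp_involutive. }
   rewrite E, E' in *. now split.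
Qed.

(** The turning point on the right corresponds to a point that the orbit visits on the left, so its
    potential is attained there. Going one unit further left leaves room for slightly larger
    orbits. *)
Lemma hom_gap g f d L N x y : sys g f d L -> homloop g f N x y ->
 exists xi k B, 0 < k /\ 0 <= B /\ 0 < xi <= N /\ (forall t,
  x t <= xi) /\ Gp g (xi + k) <= Gp (gT g) B.
Proof.
 intros S HL. destruct (hom_corr g f d L N x y S HL) as [C _].
 destruct HL as [H1 [H2 [H3 [H4 H5]]]]. assert (Hh := sys_half _ _ _ _ S).
 destruct (loop_crossing N _ x y H1 (vf_field g f Hh N H1) H2 H3) as [T [T1 [T2 [T3 [T4 [T5 _]]]]]].
 destruct (C T T1) as [t' [Q1 [Q2 Q3]]].
 set (B := - x (- t') + 1). assert (PB : 0 < - x (- t')) by now apply H4.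
 assert (G : Gp g (x T) < Gp (gT g) B).
 { rewrite <- Q2. apply (Gp_incr _ _ (half_T g f Hh)). unfold B. lra. }
 destruct (continuous_neg (fun v => Gp g v - Gp (gT g) B) (x T)) as [e [E1 E2]].
 - apply (continuous_minus (V := R_NormedModule)); [apply (Gp_cont g f Hh)|apply continuous_const].
 - lra.
 - exists (x T), (e / 2), B. conj5; [lra|unfold B; lra| | | ].
  + split; [assumption|]. destruct (H5 T Logic.I) as [Z _]. apply Rabs_le_iff in Z. lra.
  + intros t. destruct (Rle_or_lt t 0) as [Z|Z]; [now apply T5|].
   destruct H4 as [_ [_ [H4 _]]]. specialize (H4 (- t) ltac:(lra)). cbv beta in H4.
    rewrite Ropp_involutive in H4. lra.
  + specialize (E2 (x T + e / 2) ltac:(apply Rabs_lt_iff; lra)). lra.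
Qed.

Definition em g f N (a b : R) : Prop := exists x y, flow N (vf N g f) x y /\ x 0 = a /\ y 0 = b /\
 emanates x y /\ inbox N x y (fun t => t <= 0).

Lemma em_larger g f N N' a b : half g f -> 0 < N -> N <= N' -> em g f N a b -> em g f N' a b.
Proof.
 intros Hgf HN HN' [x [y [H [Ex [Ey [E B]]]]]].
 destruct (flow_exists N' (vf N' g f) a b) as [x' [y' [Ex' [Ey' H']]]]; [lra|apply vf_field;
  [assumption|lra]|].
 assert (Eq := flow_box_unique N N' N g f x y x' y' _ 0 Hgf ltac:(lra) ltac:(lra) HN' H B H'
  (Rle_refl 0) convex_le0 ltac:(lra) ltac:(lra)).
 exists x', y'. conj5; [assumption|assumption|assumption| | ].
 - destruct E as [E1 [E2 [E3 _]]]. apply (emanates_of_pos N' (vf N' g f)); auto; try lra.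
  + apply vf_field; [assumption|lra].
  + intros t Ht. destruct (Eq t ltac:(lra)) as [<- _]. now apply E3.
 - intros t Ht. destruct (Eq t Ht) as [<- <-]. destruct (B t Ht). lra.
Qed.

Lemma upper_to_axis N F x y t0 : 0 < N -> field F -> no_rest N F -> flow N F x y ->
 0 <= x t0 -> 0 <= y t0 -> 0 < x t0 + y t0 -> (exists M, forall t, t0 <= t -> x t <= M) ->
 exists T, t0 < T /\ x T = 0 /\ y T < 0 /\ forall t, t0 < t < T -> 0 < x t.
Proof.
 intros HN HF NR H Hx Hy Hxy [M HM].
 assert (H' := flow_shift N F x y t0 H).
 assert (A : exists T1, t0 <= T1 /\ y T1 = 0 /\ 0 < x T1 /\ forall t, t0 < t < T1 -> 0 < x t).
 { destruct Hy as [Hy|Hy]; [|exists t0; repeat split; [lra|now symmetry|lra|intros; lra]].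
  destruct (upper_forward N F _ _ HN HF H') as [[T [T1 [T2 [T3 T4]]]]|[_ Q]].
  - now rewrite Rplus_0_l.
  - now rewrite Rplus_0_l.
  - exists (T + t0). conj4; [lra|assumption|assumption| ].
   intros t Ht. apply Rle_lt_trans with (x t0); [assumption|].
   apply (flow_x_incr N F x y); auto; [lra|]. intros r Hr.
   specialize (T4 (r - t0)). replace (r - t0 + t0) with r in T4 by ring. apply T4. lra.
  - exfalso. destruct (Q M) as [t [Ht1 Ht2]]. specialize (HM (t + t0)). lra. }
 destruct A as [T1 [A1 [A2 [A3 A4]]]].
 destruct (lower_forward N F _ _ HN HF NR (flow_shift N F x y T1 H)) as [T [B1 [B2 [B3 B4]]]].
 - now rewrite Rplus_0_l.
 - rewrite Rplus_0_l. lra.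
 - exists (T + T1). conj4; [lra|assumption|assumption| ].
  intros t Ht. destruct (Rtotal_order t T1) as [Q|[->|Q]]; [apply A4; lra|assumption|].
  specialize (B4 (t - T1)). replace (t - T1 + T1) with t in B4 by ring. apply B4. lra.
Qed.

(** A nearby emanating orbit follows the given one until time 1, when the latter is in [x < 0]; so
    it crosses the vertical axis, necessarily with [y < 0], and forms a loop. [hom_gap] provides the
    mirror image that closes this loop. *)
Lemma hom_open g f d L N x y tq N1 : sys g f d L -> homloop g f N x y -> tq < 0 -> 0 <= y tq ->
 0 < N1 -> exists eps, 0 < eps /\ forall b, Rabs (b - y tq) < eps -> 0 <= b ->
  em g f N1 (x tq) b -> hom g f (x tq) b.
Proof.
 intros S HL Htq Hyq HN1. assert (Hh := sys_half _ _ _ _ S).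
 destruct (hom_gap g f d L N x y S HL) as [xi [k [B [Hk [HB [Hxi [Hx HG]]]]]]].
 set (N3 := Rmax (Rmax N N1 + 1) B).
 assert (M : N + 1 <= N3 /\ N1 <= N3 /\ B <= N3).
 { unfold N3. assert (A1 := Rmax_l N N1). assert (A2 := Rmax_r N N1).
  assert (A3 := Rmax_l (Rmax N N1 + 1) B). assert (A4 := Rmax_r (Rmax N N1 + 1) B). lra. }
 assert (HN : 0 < N) by apply HL. assert (HN3 : 0 < N3) by lra.
  assert (HF := vf_field g f Hh N3 HN3).
 assert (Bx : inbox N x y (fun _ => True)) by apply HL.
 apply (homloop_larger g f N N3) in HL; [|lra].
 destruct HL as [_ [H2 [H3 [H4 H5]]]].
 assert (X1 : x 1 < 0).
 { destruct H4 as [_ [_ [H4 _]]]. specialize (H4 (-1) ltac:(lra)). cbv beta in H4.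
  replace (- (-1)) with 1 in H4 by ring. lra. }
 set (T := Rmax (- tq) 1).
 assert (MT : - tq <= T /\ 1 <= T) by (unfold T; split; [apply Rmax_l|apply Rmax_r]).
 (* The three bounds keep the abscissa below [xi + k], the orbit in the box of size [N + 1], and
    [x' 1] negative. *)
 set (eps := Rmin k (Rmin 1 (- x 1))).
 assert (Me : 0 < eps /\ eps <= k /\ eps <= 1 /\ eps <= - x 1).
 { unfold eps. split; [repeat apply Rmin_glb_lt; lra|]. split; [apply Rmin_l|].
  split; (eapply Rle_trans; [apply Rmin_r|]); [apply Rmin_l|apply Rmin_r]. }
 destruct (flow_continuous_dependence N3 _ x y T eps HF H2) as [dl [D1 D2]]; [lra|lra|].
 exists dl. split; [assumption|]. intros b Hb Hb0 Eb.
 destruct (em_larger g f N1 N3 _ _ Hh HN1 ltac:(lra) Eb) as [xe [ye [He [Exe [Eye [Ee Be]]]]]].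
 set (x' := fun t => xe (t + - tq)). set (y' := fun t => ye (t + - tq)).
 assert (H' : flow N3 (vf N3 g f) x' y') by now apply flow_shift.
 assert (E0 : x' tq = x tq /\ y' tq = b).
 { unfold x', y'. rewrite Rplus_opp_r. now split. }
 assert (Near : forall t, tq <= t <= 1 -> Rabs (x' t - x t) < eps /\ Rabs (y' t - y t) < eps).
 { intros t Ht. apply (D2 x' y' tq H').
  - apply Rabs_le_iff. lra.
  - destruct E0 as [-> _]. now rewrite Rminus_diag, Rabs_R0.
  - destruct E0 as [_ ->]. assumption.
  - apply Rabs_le_iff. lra. }
 assert (X1' : x' 1 < 0).
 { destruct (Near 1 ltac:(lra)) as [Q _]. apply Rabs_lt_iff in Q. lra. }
 assert (Pq : 0 < x tq) by (apply H3, Htq).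
 assert (NR := vf_no_rest g f Hh N3 d L HN3 (sys_right _ _ _ _ S)).
 assert (A : exists T2, tq < T2 /\ x' T2 = 0 /\ y' T2 < 0 /\ forall t, tq < t < T2 -> 0 < x' t).
 { assert (A : exists T1, tq <= T1 /\ y' T1 = 0 /\ 0 < x' T1 /\ forall t, tq < t < T1 -> 0 < x' t).
  { destruct Hb0 as [Hb0|<-]; [|exists tq; destruct E0 as [-> ->]; repeat split;
   [lra|assumption|intros; lra]].
   destruct (upper_forward N3 _ _ _ HN3 HF (flow_shift _ _ x' y' tq H')) as [[U [U1 [U2 [U3
    U4]]]]|[Q _]].
   - rewrite Rplus_0_l. destruct E0 as [-> _]. lra.
   - rewrite Rplus_0_l. destruct E0 as [_ ->]. lra.
   - exists (U + tq). conj4; [lra|assumption|assumption| ].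
    intros t Ht. apply Rlt_trans with (x' tq); [destruct E0 as [-> _]; assumption|].
    apply (flow_x_incr N3 (vf N3 g f) x' y'); auto; [lra|]. intros r Hr.
    specialize (U4 (r - tq)). replace (r - tq + tq) with r in U4 by ring. apply U4. lra.
   - exfalso. assert (x' tq < x' 1); [|destruct E0 as [E0 _]; lra].
    apply (flow_x_incr N3 (vf N3 g f) x' y'); auto; [lra|]. intros r Hr.
    specialize (Q (r - tq)). replace (r - tq + tq) with r in Q by ring. apply Q. lra. }
  destruct A as [T1 [A1 [A2 [A3 A4]]]].
  destruct (lower_forward N3 _ _ _ HN3 HF NR (flow_shift _ _ x' y' T1 H')) as [T2 [B1 [B2 [B3
   B4]]]].
  - now rewrite Rplus_0_l.
  - rewrite Rplus_0_l. lra.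
  - exists (T2 + T1). conj4; [lra|assumption|assumption| ].
   intros t Ht. destruct (Rtotal_order t T1) as [Q|[->|Q]]; [apply A4; lra|assumption|].
   specialize (B4 (t - T1)). replace (t - T1 + T1) with t in B4 by ring. apply B4. lra. }
 destruct A as [T2 [A1 [A2 [A3 A4]]]].
 assert (T21 : T2 < 1).
 { apply Rnot_le_lt. intros Q. destruct (Req_dec T2 1) as [Z|Z]; [rewrite Z in A2; lra|].
  specialize (A4 1 ltac:(lra)). lra. }
 assert (Bk : forall t, t <= tq -> 0 < x' t <= x tq /\ Rabs (x' t) <= N3 /\ Rabs (y' t) <= N3).
 { intros t Ht. destruct (Be (t + - tq) ltac:(lra)) as [Q1 Q2].
  split; [|now split]. unfold x'. destruct (Req_dec t tq) as [->|Z].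
  - rewrite Rplus_opp_r. rewrite Exe. lra.
  - split; [apply Ee; lra|]. rewrite <- Exe. left.
   apply (emanates_x_incr N3 (vf N3 g f) xe ye); auto. lra. }
 assert (Fw : forall t, tq <= t <= T2 -> x' t <= xi + k /\ Rabs (x' t) <= N3 /\ Rabs (y' t) <= N3).
 { intros t Ht. destruct (Near t ltac:(lra)) as [Q1 Q2]. destruct (Bx t Logic.I) as [Q3 Q4].
  specialize (Hx t). apply Rabs_lt_iff in Q1. apply Rabs_lt_iff in Q2.
  apply Rabs_le_iff in Q3. apply Rabs_le_iff in Q4.
  split; [lra|split; apply Rabs_le_iff; lra]. }
 set (xl := fun t => x' (t + T2)). set (yl := fun t => y' (t + T2)).
 assert (Hl : flow N3 (vf N3 g f) xl yl) by now apply flow_shift.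
 assert (Pl : forall t, t < 0 -> 0 < xl t <= xi + k).
 { intros t Ht. unfold xl. destruct (Rle_or_lt (t + T2) tq) as [Q|Q].
  - destruct (Bk _ Q) as [Q1 _]. specialize (Hx tq). lra.
  - split; [apply A4; lra|]. apply Fw. lra. }
 assert (Ll : loop xl yl).
 { conj5; [unfold xl; now rewrite Rplus_0_l|unfold yl; now rewrite Rplus_0_l| | | ].
  - intros t Ht. now apply Pl.
  - apply (tends_back_shift x' 0 T2). apply (tends_back_shift xe 0 (- tq)). apply Ee.
  - apply (tends_back_shift y' 0 T2). apply (tends_back_shift ye 0 (- tq)). apply Ee. }
 assert (Bl : inbox N3 xl yl (fun t => t <= 0)).
 { intros t Ht. unfold xl, yl. destruct (Rle_or_lt (t + T2) tq) as [Q|Q].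
  - now apply Bk.
  - apply Fw. lra. }
 destruct (mirror_loop g f (gT g) (fT f) N3 B Hh (half_T _ _ Hh) (sys_conj _ _ _ _ S) HN3
  ltac:(lra) xl yl Hl Ll Bl)
  as [x2 [y2 [K1 [K2 [K3 [K4 _]]]]]].
 - intros t Ht. specialize (Pl t Ht). apply Rle_trans with (2 := HG).
  destruct (Req_dec (xl t) (xi + k)) as [->|]; [lra|]. left. apply (Gp_incr g f Hh). lra.
 - exists N3, xl, yl, (tq - T2). split.
  + now apply (homloop_glue g f N3 xl yl x2 y2).
  + unfold xl, yl. replace (tq - T2 + T2) with tq by ring. apply E0.
Qed.

Lemma hom_inside_axis g f d L N x y c : sys g f d L -> homloop g f N x y -> y 0 <= c < 0 ->
 exists x' y', homloop g f N x' y' /\ y' 0 = c.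
Proof.
 intros S HL Hc. assert (Hh := sys_half _ _ _ _ S). assert (HhT := half_T _ _ Hh).
 destruct HL as [HN [H2 [H3 [H4 H5]]]].
 assert (HF := vf_field g f Hh N HN). assert (HFT := vf_field _ _ HhT N HN).
 destruct (flow_exists N (vf N g f) 0 c HN HF) as [x' [y' [E1 [E2 H']]]].
 destruct (flow_exists N (vf N (gT g) (fT f)) 0 c HN HFT) as [x2 [y2 [E3 [E4 H'']]]].
 destruct (sub_loop N _ x y x' y' N HN HF H2 H' H3) as [L1 B1]; [|assumption|lra|].
 { intros t _. now apply H5. }
 destruct (sub_loop N _ (fun t => - x (- t)) (fun t => y (- t)) x2 y2 N HN HFT) as [L2 B2];
  try assumption.
 - now apply flow_T.
 - intros t _. rewrite Rabs_Ropp. now apply H5.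
 - rewrite Ropp_0. lra.
 - exists x', y'. split; [|assumption]. apply (homloop_glue g f N x' y' x2 y2); auto. congruence.
Qed.

Lemma hom_inside g f d L N x y T U a b : sys g f d L -> homloop g f N x y -> T < 0 -> y T = 0 ->
 (forall t, T < t <= 0 -> y t < 0) -> emanates (fun t => x (t + T)) (fun t => y (t + T)) ->
 graph_of (fun t => x (t + T)) (fun t => y (t + T)) U ->
 0 < a <= x T -> 0 <= b <= U a -> hom g f a b.
Proof.
 intros S HL HT HyT Hn HE HU Ha Hb. assert (Hh := sys_half _ _ _ _ S).
 assert (HL' := HL). destruct HL as [HN [H2 [H3 [H4 H5]]]].
 assert (HF := vf_field g f Hh N HN).
 assert (NR := vf_no_rest g f Hh N d L HN (sys_right _ _ _ _ S)).
 destruct (flow_exists N (vf N g f) a b HN HF) as [x' [y' [E1 [E2 H']]]].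
 destruct (inside_loop N _ x y T U x' y' HN HF NR H2 H' H3 HT HyT Hn HU) as [T' [T1 [T2 T3]]];
  [lra|rewrite E1; lra|].
 destruct (hom_inside_axis g f d L N x y (y' T') S HL' T3) as [x3 [y3 [L3 E3]]].
 exists N, x3, y3, (- T'). split; [assumption|].
 destruct L3 as [_ [F3 [L3 _]]].
 destruct (flow_unique N _ x3 y3 (fun t => x' (t + T')) (fun t => y' (t + T')) 0 HF F3) with (t :=
  - T') as [Q1 Q2].
 - now apply flow_shift.
 - rewrite Rplus_0_l. destruct L3 as [-> _]. lra.
 - now rewrite Rplus_0_l.
 - rewrite Q1, Q2. replace (- T' + T') with 0 by ring. now split.
Qed.

(** Passing twice through a point makes the orbit periodic, and a periodic function that tends to 0
    in the past vanishes. *)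
Lemma flow_recurrent_rest N F x y a b : field F -> flow N F x y -> a < b -> x a = x b -> y a = y b
 ->
 tends (fun t => x (- t)) 0 -> tends (fun t => y (- t)) 0 -> x a = 0 /\ y a = 0.
Proof.
 intros HF H Hab Ex Ey Tx Ty. set (p := b - a).
 assert (P : forall t, x t = x (t + p) /\ y t = y (t + p)).
 { apply (flow_unique N F x y _ _ a HF H).
  - now apply flow_shift.
  - unfold p. replace (a + (b - a)) with b by ring. assumption.
  - unfold p. replace (a + (b - a)) with b by ring. assumption. }
 assert (Q : forall n, x (a - INR n * p) = x a /\ y (a - INR n * p) = y a).
 { induction n as [|n [IH1 IH2]].
  - simpl. now rewrite Rmult_0_l, Rminus_0_r.
  - rewrite S_INR. destruct (P (a - (INR n + 1) * p)) as [-> ->].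
   replace (a - (INR n + 1) * p + p) with (a - INR n * p) by ring. now split. }
 assert (Z : forall h, (forall n,
  h (a - INR n * p) = h a) -> tends (fun t => h (- t)) 0 -> h a = 0).
 { intros h Hh T. destruct (Req_dec (h a) 0) as [|Nz]; [assumption|exfalso].
  destruct (T (Rabs (h a))) as [T0 HT0]; [now apply Rabs_pos_lt|].
  destruct (INR_unbounded ((T0 + a) / p)) as [n Hn].
  assert (Hp : 0 < p) by (unfold p; lra).
  specialize (HT0 (- (a - INR n * p))). rewrite Ropp_involutive, Hh, Rminus_0_r in HT0.
  assert (Rabs (h a) < Rabs (h a)); [|lra]. apply HT0.
  apply Rmult_lt_compat_r with (r := p) in Hn; [|assumption].
  unfold Rdiv in Hn. rewrite Rmult_assoc, Rinv_l in Hn by lra. lra. }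
 split; apply Z; try assumption; intros n; apply Q.
Qed.

(** * Homoclinic orbits pass once through each half plane *)

Section Structure.
Variables (g : R -> R) (f : R -> R -> R) (d L : R).
Hypothesis HS : sys g f d L.

Let Hh : half g f := sys_half _ _ _ _ HS.
Let HhT : half (gT g) (fT f) := half_T _ _ (sys_half _ _ _ _ HS).

(** Read in the reflected system, the orbit moves forward in the right half plane, where the
    quadrant lemmas apply; the bound on [x] rules out escape to infinity. *)
Lemma left_back N x y t M : 0 < N -> flow N (vf N g f) x y ->
 (forall s, s <= t -> - M <= x s) -> x t <= 0 -> ~ (x t = 0 /\ y t <= 0) ->
 exists t', t' < t /\ x t' = 0 /\ y t' < 0 /\ forall s, t' < s < t -> x s < 0.
Proof.
 intros HN H HM Hx Hne.
 assert (HT := flow_T N g f x y HN H). assert (HF := vf_field _ _ HhT N HN).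
 assert (NR := vf_no_rest _ _ HhT N d L HN (sys_left _ _ _ _ HS)).
 assert (A : exists U, - t < U /\ - x (- U) = 0 /\ y (- U) < 0 /\ forall s,
  - t < s < U -> 0 < - x (- s)).
 { destruct (Rle_or_lt 0 (y t)) as [Q|Q].
  - apply (upper_to_axis N _ (fun t => - x (- t)) (fun t => y (- t)) (- t) HN HF NR HT);
    rewrite ?Ropp_involutive; [lra|assumption| |].
   + destruct (Req_dec (x t) 0) as [E|E]; [|lra]. destruct (Req_dec (y t) 0) as [E'|E']; [|lra].
    elim Hne. lra.
   + exists M. intros s Hs. specialize (HM (- s)). lra.
  - destruct (lower_forward N _ _ _ HN HF NR (flow_shift _ _ _ _ (- t) HT)) as [U [U1 [U2 [U3
   U4]]]];
    rewrite ?Rplus_0_l, ?Ropp_involutive.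
   + destruct (Req_dec (x t) 0) as [E|E]; [|lra]. elim Hne. lra.
   + lra.
   + exists (U + - t). conj4; [lra|assumption|assumption| ].
    intros s Hs. specialize (U4 (s - - t)). replace (s - - t + - t) with s in U4 by ring.
    apply U4. lra. }
 destruct A as [U [U1 [U2 [U3 U4]]]]. exists (- U). conj4; [lra|lra|assumption| ].
 intros s Hs. specialize (U4 (- s)). rewrite Ropp_involutive in U4. lra.
Qed.

(** An orbit coming from [O] cannot keep winding around it: the mirror image of a small arc in the
    left half plane is an arc on the right through the same point of the axis, so the orbit would
    close up, be periodic, and not tend to [O] in the past. *)
Lemma emanates_eventually N x y T0 : 0 < N -> flow N (vf N g f) x y -> (x 0 <> 0 \/ y 0 <> 0) ->
 tends (fun t => x (- t)) 0 -> tends (fun t => y (- t)) 0 ->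
 exists t0, t0 <= T0 /\ emanates (fun t => x (t + t0)) (fun t => y (t + t0)).
Proof.
 intros HN H Hne Tx Ty. assert (HF := vf_field _ _ Hh N HN).
 assert (NR : forall t, ~ (x t = 0 /\ y t = 0)).
 { intros t [E1 E2]. destruct (flow_rest N _ x y t HN HF H E1 E2 0) as [Q1 Q2]. lra. }
 (* The potentials of small points on the left are attained on the right within [N], as the mirror
    image of a left arc requires. *)
 destruct (Gp_small (gT g) (fT f) g f HhT Hh N HN) as [e [E1 E2]].
 set (r := Rmin (e / 2) N).
 assert (Hr : 0 < r /\ r <= e / 2 /\ r <= N).
 { unfold r. conj3; [apply Rmin_glb_lt; lra|apply Rmin_l|apply Rmin_r]. }
 destruct (Tx r) as [U1 HU1]; [lra|]. destruct (Ty r) as [U2 HU2]; [lra|].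
 set (T1 := Rmin T0 (- Rmax U1 U2)).
 assert (Small : forall t, t <= T1 -> Rabs (x t) <= r /\ Rabs (y t) <= r).
 { intros t Ht. assert (M1 := Rmax_l U1 U2). assert (M2 := Rmax_r U1 U2).
  assert (M3 := Rmin_r T0 (- Rmax U1 U2)). fold T1 in M3.
  specialize (HU1 (- t) ltac:(lra)). specialize (HU2 (- t) ltac:(lra)).
  rewrite Ropp_involutive, Rminus_0_r in HU1. rewrite Ropp_involutive, Rminus_0_r in HU2. lra. }
 assert (BL : forall t, t <= T1 -> - r <= x t <= r).
 { intros t Ht. destruct (Small t Ht) as [Q _]. now apply Rabs_le_iff in Q. }
 assert (Right : forall t, t <= T1 -> 0 <= x t -> y t < 0 -> exists t',
  t' < t /\ 0 < x t' /\ y t' = 0).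
 { intros t Ht Hx Hy. destruct (lower_backward N _ _ _ HN HF (flow_shift _ _ x y t H)) as [[T [A1
  [A2 [A3 _]]]]|[_ A]].
  - now rewrite Rplus_0_l.
  - now rewrite Rplus_0_l.
  - exists (T + t). split; [lra|now split].
  - exfalso. destruct (A r) as [s [S1 S2]]. specialize (BL (s + t)). lra. }
 assert (Start : exists t, t <= T1 /\ 0 < x t /\ 0 <= y t).
 { destruct (Rle_or_lt (x T1) 0) as [Q|Q].
  - assert (B : exists t, t <= T1 /\ x t = 0 /\ y t < 0).
   { destruct (Req_dec (x T1) 0) as [Z|Z]; [destruct (Rlt_or_le (y T1) 0) as [Z'|Z']|].
    - exists T1. lra.
    - destruct (left_back N x y T1 r HN H) as [t' [A1 [A2 [A3 _]]]].
     + intros s Hs. now apply BL.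
     + assumption.
     + intros [_ W]. apply (NR T1). lra.
     + exists t'. lra.
    - destruct (left_back N x y T1 r HN H) as [t' [A1 [A2 [A3 _]]]].
     + intros s Hs. now apply BL.
     + assumption.
     + intros [W _]. lra.
     + exists t'. lra. }
   destruct B as [t [B1 [B2 B3]]]. destruct (Right t B1) as [t' [C1 [C2 C3]]]; [lra|assumption|].
   exists t'. lra.
  - destruct (Rle_or_lt 0 (y T1)) as [Q'|Q']; [exists T1; lra|].
   destruct (Right T1) as [t' [C1 [C2 C3]]]; [lra|lra|assumption|]. exists t'. lra. }
 destruct Start as [t2 [S1 [S2 S3]]].
 destruct (emanates_or_hits N _ _ _ HN HF (flow_shift _ _ x y t2 H)) as [E|[T [A1 [A2 [A3 A4]]]]].
 - now rewrite Rplus_0_l.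
 - now rewrite Rplus_0_l.
 - exists t2. split; [|assumption]. assert (M := Rmin_l T0 (- Rmax U1 U2)). fold T1 in M. lra.
 - exfalso. set (t3 := T + t2) in *.
  destruct (left_back N x y t3 r HN H) as [t4 [B1 [B2 [B3 B4]]]].
  + intros s Hs. apply BL. unfold t3 in Hs. lra.
  + lra.
  + lra.
  + assert (T31 : t3 <= T1) by (unfold t3; lra).
   destruct (mirror_arc (gT g) (fT f) g f N N HhT Hh) with
    (x := fun t => - x (- (t + - t4))) (y := fun t => y (- (t + - t4))) (T := - t3 + t4)
    as [x2 [y2 [T2 [K1 [K2 [K3 [K4 [K5 [K6 [K7 K8]]]]]]]]]].
   * apply conj_half_sym. apply (sys_conj _ _ _ _ HS).
   * assumption.
   * lra.
   * apply (flow_shift N _ (fun t => - x (- t)) (fun t => y (- t))). now apply flow_T.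
   * lra.
   * replace (- (0 + - t4)) with t4 by ring. lra.
   * replace (- (0 + - t4)) with t4 by ring. assumption.
   * replace (- (- t3 + t4 + - t4)) with t3 by ring. lra.
   * replace (- (- t3 + t4 + - t4)) with t3 by ring. assumption.
   * intros t Ht. specialize (B4 (- (t + - t4))). lra.
   * intros t Ht. rewrite Rabs_Ropp. destruct (Small (- (t + - t4))) as [Q1 Q2]; [lra|]. lra.
   * intros t Ht. left. apply E2. rewrite Rabs_Ropp. destruct (Small (- (t + - t4))) as [Q1 Q2];
    [lra|]. lra.
   * replace (- (0 + - t4)) with t4 in K4 by ring.
    replace (- (- t3 + t4 + - t4)) with t3 in K6 by ring.
    destruct (flow_unique N _ x2 y2 (fun t => x (t + t4)) (fun t => y (t + t4)) 0 HF K1) with (t :=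
     T2) as [Q1 Q2].
    -- now apply flow_shift.
    -- rewrite Rplus_0_l. lra.
    -- now rewrite Rplus_0_l.
    -- destruct (flow_recurrent_rest N _ x y (T2 + t4) t3 HF H) as [Z1 Z2]; try assumption; try lra.
Qed.

(** The orbit emanates on the right and descends to the negative axis, which gives a loop. On the
    left, in the reflected system, it either emanates too or comes from the upper vertical axis. The
    latter is refuted by a mirror image: of the loop if the left potential attains its level, of the
    left arc otherwise. *)
Lemma homoclinic_structure M x y : 0 < M -> flow M (vf M g f) x y -> inbox M x y (fun _ => True) ->
 (x 0 <> 0 \/ y 0 <> 0) -> tends x 0 -> tends y 0 ->
 tends (fun t => x (- t)) 0 -> tends (fun t => y (- t)) 0 ->
 exists N t0, homloop g f N (fun t => x (t + t0)) (fun t => y (t + t0)).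
Proof.
 intros HM H HB Hne Tx Ty Bx By.
 (* One of the two potentials attains all values of the other on [0, M]; this selects the mirror
    image used at the end. *)
 assert (CAS : exists B, 0 <= B /\ (Gp g M <= Gp (gT g) B \/ Gp (gT g) M <= Gp g B) /\
  ((forall v, 0 <= v <= M -> Gp g v <= Gp (gT g) B) \/ (forall v,
   0 <= v <= M -> Gp (gT g) v <= Gp g B))).
 { destruct (potential_cases g (gT g)) as [C|C]; destruct (C M) as [B [HB0 HB1]]; try lra; exists B;
   (conj3; [assumption|tauto| ]); [left|right]; intros v Hv; apply Rle_trans with (2 := HB1);
   (destruct (Req_dec v M) as [->|]; [lra|left]);
   [apply (Gp_incr g f Hh)|apply (Gp_incr _ _ HhT)]; lra. }
 destruct CAS as [B [HB0 [_ CAS]]].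
 set (N := Rmax M B). assert (HMN : M <= N) by apply Rmax_l. assert (HBN : B <= N) by apply Rmax_r.
 assert (HN : 0 < N) by lra.
 assert (H' : flow N (vf N g f) x y) by (apply (sol_box M N M);
  [lra|assumption|assumption|assumption]).
 assert (HF := vf_field _ _ Hh N HN). assert (HFT := vf_field _ _ HhT N HN).
 assert (NR := vf_no_rest _ _ Hh N d L HN (sys_right _ _ _ _ HS)).
 assert (BM : forall t, - M <= x t <= M).
 { intros t. destruct (HB t Logic.I) as [Q _]. now apply Rabs_le_iff in Q. }
 destruct (emanates_eventually N x y 0 HN H' Hne Bx By) as [t0 [_ E]].
 destruct (upper_to_axis N _ x y t0 HN HF NR H') as [t1 [A1 [A2 [A3 A4]]]].
 - destruct E as [E _]. rewrite Rplus_0_l in E. lra.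
 - destruct E as [_ [E _]]. now rewrite Rplus_0_l in E.
 - destruct E as [E1 [E2 _]]. rewrite Rplus_0_l in E1, E2. lra.
 - exists M. intros t _. apply BM.
 - set (xl := fun t => x (t + t1)). set (yl := fun t => y (t + t1)).
  assert (Hl : flow N (vf N g f) xl yl) by now apply flow_shift.
  assert (Ll : loop xl yl).
  { conj5; [unfold xl; now rewrite Rplus_0_l|unfold yl; now rewrite Rplus_0_l| | | ].
   - intros t Ht. unfold xl. destruct E as [E1 [_ [E3 _]]]. rewrite Rplus_0_l in E1.
    destruct (Rtotal_order (t + t1) t0) as [Q|[->|Q]]; [|assumption|apply A4; lra].
    specialize (E3 (t + t1 - t0)). replace (t + t1 - t0 + t0) with (t + t1) in E3 by ring.
     apply E3. lra.
   - now apply (tends_back_shift x 0 t1).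
   - now apply (tends_back_shift y 0 t1). }
  assert (Bl : inbox M xl yl (fun _ => True)) by (intros t _; apply HB; trivial).
  assert (HT : flow N (vf N (gT g) (fT f)) (fun t => - xl (- t)) (fun t => yl (- t))) by now apply
   flow_T.
  assert (BlT : inbox N (fun t => - xl (- t)) (fun t => yl (- t)) (fun _ => True)).
  { intros t _. rewrite Rabs_Ropp. destruct (Bl (- t) Logic.I). lra. }
  assert (X0 : - xl (- 0) = 0) by (rewrite Ropp_0; destruct Ll as [-> _]; ring).
  assert (Y0 : yl (- 0) < 0) by (rewrite Ropp_0; apply Ll).
  exists N, t1. fold xl yl. conj5; [assumption|assumption|assumption| | ].
  2:{ intros t _. destruct (Bl t Logic.I). lra. }
  destruct (lower_backward N _ _ _ HN HFT HT) as [[T [B1 [B2 [B3 B4]]]]|[_ Q]]; [lra|assumption| |].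
  2:{ exfalso. destruct (Q M) as [t [_ Q']]. destruct (Bl (- t) Logic.I) as [Q'' _].
   apply Rabs_le_iff in Q''. lra. }
  assert (LowX : forall t, T <= t < 0 -> 0 < - xl (- t)).
  { intros t Ht. rewrite <- X0. apply (flow_x_decr N _ _ _ t 0 HN HT); [lra|].
   intros r Hr. apply B4. lra. }
  destruct (emanates_or_hits N _ _ _ HN HFT (flow_shift _ _ _ _ T HT)) as [Em|[U [C1 [C2 [C3
   C4]]]]].
  + rewrite Rplus_0_l. assumption.
  + rewrite Rplus_0_l, B2. lra.
  + conj5; [assumption|assumption| | | ].
   * intros t Ht. destruct (Rle_or_lt T t) as [Q|Q]; [apply LowX; lra|].
    destruct Em as [_ [_ [Em _]]]. specialize (Em (t - T) ltac:(lra)).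
    replace (t - T + T) with t in Em by ring. apply Em.
   * destruct Em as [_ [_ [_ [Em _]]]]. now apply (tends_back_shift (fun t => - xl (- t)) 0 T).
   * destruct Em as [_ [_ [_ [_ Em]]]]. now apply (tends_back_shift (fun t => yl (- t)) 0 T).
  + exfalso. set (W := U + T) in *.
   assert (PT : forall t, W < t < 0 -> 0 < - xl (- t)).
   { intros t Ht. destruct (Rle_or_lt T t) as [Q|Q]; [apply LowX; lra|].
    specialize (C4 (t - T)). replace (t - T + T) with t in C4 by ring. apply C4. unfold W in Ht.
     lra. }
   destruct CAS as [CA|CB].
   * destruct (mirror_loop g f (gT g) (fT f) N B Hh HhT (sys_conj _ _ _ _ HS) HN ltac:(lra) xl yl
    Hl Ll)
     as [x2 [y2 [K1 [K2 [K3 _]]]]].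
    -- intros t _. destruct (Bl t Logic.I). lra.
    -- intros t Ht. apply CA. destruct (Bl t Logic.I) as [Q _]. apply Rabs_le_iff in Q.
      destruct Ll as [_ [_ [Ll _]]]. specialize (Ll t Ht). lra.
    -- destruct (flow_unique N _ x2 y2 _ _ 0 HFT K1 HT) with (t := W) as [Q _].
      ++ destruct K2 as [-> _]. now symmetry.
      ++ now rewrite Ropp_0.
      ++ destruct K2 as [_ [_ [K2 _]]]. specialize (K2 W ltac:(unfold W; lra)). lra.
   * destruct (mirror_arc (gT g) (fT f) g f N B HhT Hh) with
     (x := fun t => - xl (- t)) (y := fun t => yl (- t)) (T := W)
     as [x2 [y2 [T2 [K1 [K2 [K3 [K4 [K5 _]]]]]]]]; try assumption.
    -- apply conj_half_sym. apply (sys_conj _ _ _ _ HS).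
    -- lra.
    -- unfold W. lra.
    -- intros t _. now apply BlT.
    -- intros t Ht. apply CB. specialize (PT t Ht). destruct (Bl (- t) Logic.I) as [Q _].
     apply Rabs_le_iff in Q. lra.
    -- rewrite Ropp_0 in K4.
      destruct (flow_unique N _ x2 y2 xl yl 0 HF K1 Hl) with (t := T2) as [Q _].
      ++ destruct Ll as [-> _]. assumption.
      ++ assumption.
      ++ destruct Ll as [_ [_ [Ll _]]]. specialize (Ll T2 K2). lra.
Qed.
End Structure.

(** * From plane curves to coordinates *)

Lemma is_derive_fst (c : R -> plane) t v : is_derive c t v -> is_derive (fun s => fst (c s)) t (fst
 v).
Proof.
 intros H. unfold is_derive in *.
 apply (filterdiff_comp' (K := R_AbsRing) (U := R_NormedModule)
  (V := prod_NormedModule R_AbsRing R_NormedModule R_NormedModule) (W := R_NormedModule)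
  c fst t (fun s => scal s v) fst H).
 apply filterdiff_linear, is_linear_fst.
Qed.

Lemma is_derive_snd (c : R -> plane) t v : is_derive c t v -> is_derive (fun s => snd (c s)) t (snd
 v).
Proof.
 intros H. unfold is_derive in *.
 apply (filterdiff_comp' (K := R_AbsRing) (U := R_NormedModule)
  (V := prod_NormedModule R_AbsRing R_NormedModule R_NormedModule) (W := R_NormedModule)
  c snd t (fun s => scal s v) snd H).
 apply filterdiff_linear, is_linear_snd.
Qed.

Lemma is_derive_pair (x y : R -> R) t a b : is_derive x t a -> is_derive y t b ->
 is_derive (fun s => (x s, y s) : plane) t ((a, b) : plane).
Proof.
 intros H1 H2. unfold is_derive in *.
 apply (filterdiff_comp'_2 (K := R_AbsRing) (T := R_NormedModule) (U := R_NormedModule)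
  (V := R_NormedModule) (W := prod_NormedModule R_AbsRing R_NormedModule R_NormedModule)
  x y (fun u v => (u, v)) t _ _ (fun u v => (u, v)) H1 H2).
 apply (filterdiff_ext (fun p => p)); [intros [u v]; reflexivity|].
 eapply filterdiff_ext_lin; [apply filterdiff_id|]. intros [u v]. reflexivity.
Qed.

Lemma filterlim_origin (c : R -> plane) : filterlim c (Rbar_locally p_infty) (locally origin) <->
 tends (fun t => fst (c t)) 0 /\ tends (fun t => snd (c t)) 0.
Proof.
 split.
 - intros H. assert (K := proj1 (filterlim_locally c origin) H).
  split; intros eps He; destruct (K (mkposreal eps He)) as [M HM]; exists (M + 1); intros t Ht;
   destruct (HM t ltac:(lra)) as [Q1 Q2]; assumption.
 - intros [H1 H2]. apply filterlim_locally. intros eps.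
  destruct (H1 eps (cond_pos eps)) as [T1 HT1]. destruct (H2 eps (cond_pos eps)) as [T2 HT2].
  exists (Rmax T1 T2). intros t Ht. assert (M1 := Rmax_l T1 T2). assert (M2 := Rmax_r T1 T2).
  split; [apply (HT1 t); lra|apply (HT2 t); lra].
Qed.

Lemma filterlim_origin_back (c : R -> plane) : filterlim c (Rbar_locally m_infty) (locally origin)
 <->
 tends (fun t => fst (c (- t))) 0 /\ tends (fun t => snd (c (- t))) 0.
Proof.
 split.
 - intros H. assert (K := proj1 (filterlim_locally c origin) H).
  split; intros eps He; destruct (K (mkposreal eps He)) as [M HM]; exists (- M + 1); intros t Ht;
   destruct (HM (- t) ltac:(lra)) as [Q1 Q2]; assumption.
 - intros [H1 H2]. apply filterlim_locally. intros eps.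
  destruct (H1 eps (cond_pos eps)) as [T1 HT1]. destruct (H2 eps (cond_pos eps)) as [T2 HT2].
  exists (- Rmax T1 T2). intros t Ht. assert (M1 := Rmax_l T1 T2). assert (M2 := Rmax_r T1 T2).
  specialize (HT1 (- t) ltac:(lra)). specialize (HT2 (- t) ltac:(lra)).
  rewrite Ropp_involutive in HT1, HT2. split; assumption.
Qed.

Definition xsol (g : R -> R) (f : R -> R -> R) (I : R -> Prop) (x y : R -> R) : Prop :=
 forall t, I t -> is_derive x t (y t) /\ is_derive y t (- g (x t) - f (x t) (y t) * y t).

Lemma xsol_of_curve g f (I : R -> Prop) (c : R -> plane) :
 (forall t, I t -> is_derive c t (lienard g f (c t))) ->
 xsol g f I (fun t => fst (c t)) (fun t => snd (c t)).
Proof.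
 intros H t It. split; [apply (is_derive_fst _ _ _ (H t It))|apply (is_derive_snd _ _ _ (H t It))].
Qed.

Lemma curve_of_xsol g f I x y : xsol g f I x y ->
 forall t, I t -> is_derive (fun t => (x t, y t) : plane) t (lienard g f (x t, y t)).
Proof. intros H t It. destruct (H t It). now apply is_derive_pair. Qed.

Lemma sol_of_xsol N g f I x y : xsol g f I x y -> inbox N x y I -> sol N (vf N g f) I x y.
Proof.
 intros H HB t It. destruct (H t It) as [D1 D2]. destruct (HB t It) as [B1 B2].
 apply Rabs_le_iff in B1. apply Rabs_le_iff in B2. unfold vf. rewrite !cl_id by lra. now split.
Qed.

Lemma xsol_of_sol N g f I x y : sol N (vf N g f) I x y -> inbox N x y I -> xsol g f I x y.
Proof.
 intros H HB t It. destruct (H t It) as [D1 D2]. destruct (HB t It) as [B1 B2].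
 apply Rabs_le_iff in B1. apply Rabs_le_iff in B2. unfold vf in D2. rewrite !cl_id in * by lra.
  now split.
Qed.

Lemma bounded_on (h : R -> R) a b : a <= b -> (forall t, a <= t <= b -> continuous h t) ->
 exists M, forall t, a <= t <= b -> Rabs (h t) <= M.
Proof.
 intros Hab C.
 destruct (continuity_ab_maj h a b Hab) as [u [Hu _]].
 { intros t Ht. now apply continuity_pt_filterlim, C. }
 destruct (continuity_ab_min h a b Hab) as [v [Hv _]].
 { intros t Ht. now apply continuity_pt_filterlim, C. }
 exists (Rmax (h u) (- h v)). intros t Ht. specialize (Hu t Ht). specialize (Hv t Ht).
 assert (M1 := Rmax_l (h u) (- h v)). assert (M2 := Rmax_r (h u) (- h v)). apply Rabs_le_iff. lra.
Qed.

Lemma bounded_all (h : R -> R) : (forall t,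
 continuous h t) -> tends h 0 -> tends (fun t => h (- t)) 0 ->
 exists M, forall t, Rabs (h t) <= M.
Proof.
 intros C T1 T2. destruct (T1 1 ltac:(lra)) as [U1 HU1]. destruct (T2 1 ltac:(lra)) as [U2 HU2].
 destruct (bounded_on h (- Rmax 0 U2) (Rmax 0 U1)) as [M HM].
 - assert (A1 := Rmax_l 0 U1). assert (A2 := Rmax_l 0 U2). lra.
 - intros t _. apply C.
 - exists (Rmax M 1). intros t. assert (M1 := Rmax_l M 1). assert (M2 := Rmax_r M 1).
  assert (A3 := Rmax_r 0 U1). assert (A4 := Rmax_r 0 U2).
  destruct (Rle_or_lt t (Rmax 0 U1)) as [Q|Q].
  + destruct (Rle_or_lt (- Rmax 0 U2) t) as [Q'|Q'].
   * specialize (HM t). lra.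
   * specialize (HU2 (- t) ltac:(lra)). rewrite Ropp_involutive, Rminus_0_r in HU2. lra.
  + specialize (HU1 t ltac:(lra)). rewrite Rminus_0_r in HU1. lra.
Qed.

Lemma homloop_tends g f N x y : homloop g f N x y -> tends x 0 /\ tends y 0 /\
 tends (fun t => x (- t)) 0 /\ tends (fun t => y (- t)) 0.
Proof.
 intros [_ [_ [[_ [_ [_ [L1 L2]]]] [[_ [_ [_ [L3 L4]]]] _]]]].
 conj3; [ | |split; assumption].
 - apply tends_opp in L3. rewrite Ropp_0 in L3. apply (tends_ext _ _ 0) with (2 := L3).
  intros t. now rewrite !Ropp_involutive.
 - apply (tends_ext _ _ 0) with (2 := L4). intros t. now rewrite Ropp_involutive.
Qed.

(** A homoclinic curve is bounded, hence an orbit of some truncated flow; conversely the box in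
    [homloop] removes the truncation. *)
Lemma homoclinic_hom g f d L p : sys g f d L ->
 (homoclinic (lienard g f) p <-> hom g f (fst p) (snd p)).
Proof.
 intros S. assert (Hh := sys_half _ _ _ _ S). split.
 - intros [Hp [c [C0 [C1 [C2 C3]]]]].
  apply filterlim_origin in C2. destruct C2 as [Tx Ty].
  apply filterlim_origin_back in C3. destruct C3 as [Bx By].
  set (x := fun t => fst (c t)) in *. set (y := fun t => snd (c t)) in *.
  assert (X : xsol g f (fun _ => True) x y) by (apply xsol_of_curve; intros; apply C1).
  destruct (bounded_all x) as [M1 HM1]; try assumption.
  { intros t. exact (is_derive_continuous _ _ _ (proj1 (X t Logic.I))). }
  destruct (bounded_all y) as [M2 HM2]; try assumption.
  { intros t. exact (is_derive_continuous _ _ _ (proj2 (X t Logic.I))). }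
  set (M := Rmax 1 (Rmax M1 M2)).
  assert (MM : 1 <= M /\ M1 <= M /\ M2 <= M).
  { unfold M. split; [apply Rmax_l|split; (eapply Rle_trans; [|apply Rmax_r]);
   [apply Rmax_l|apply Rmax_r]]. }
  assert (B : inbox M x y (fun _ => True)).
  { intros t _. specialize (HM1 t). specialize (HM2 t). lra. }
  destruct (homoclinic_structure g f d L S M x y) as [N [t0 HL]]; try assumption; [lra| | |].
  + now apply sol_of_xsol.
  + unfold x, y. rewrite C0. destruct p as [a b]. simpl.
   destruct (Req_dec a 0) as [->|]; [|now left]. destruct (Req_dec b 0) as [->|]; [|now right].
   now elim Hp.
  + exists N, (fun t => x (t + t0)), (fun t => y (t + t0)), (- t0). split; [assumption|].
   replace (- t0 + t0) with 0 by ring. unfold x, y. now rewrite C0.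
 - intros [N [x [y [t0 [HL [Ex Ey]]]]]].
  destruct (homloop_tends g f N x y HL) as [T1 [T2 [T3 T4]]].
  destruct HL as [HN [H [HL [_ HB]]]].
  split.
  + intros Hp. assert (Z := f_equal fst Hp). assert (Z' := f_equal snd Hp). simpl in Z, Z'.
   destruct (flow_rest N _ x y t0 HN (vf_field g f Hh N HN) H) with (t := 0) as [_ Q]; [lra|lra|].
   destruct HL as [_ [HL _]]. lra.
  + assert (X := xsol_of_sol N g f _ x y H HB).
   exists (fun t => (x (t + t0), y (t + t0))). conj4.
   * rewrite Rplus_0_l, Ex, Ey. now destruct p.
   * intros t. apply (curve_of_xsol g f (fun _ => True) (fun t => x (t + t0)) (fun t => y (t +
    t0))); [|trivial].
    intros s _. destruct (X (s + t0) Logic.I). split; now apply is_derive_shift.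
   * apply filterlim_origin. split; simpl;
    [now apply (tends_shift x 0 t0)|now apply (tends_shift y 0 t0)].
   * apply filterlim_origin_back. split; simpl;
    [now apply (tends_back_shift x)|now apply (tends_back_shift y)].
Qed.

(** * The outermost emanating orbit and the boundary of the homoclinic region *)

Ltac conj_all := repeat match goal with |- _ /\ _ => split end; first [assumption | reflexivity |
 lra].

(** The comparison is with emanating orbits ending at any abscissa up to [X], not only on the
    section [x = X]. *)
Definition topmost (N : R) F (X : R) (A : R -> R) : Prop :=
 (exists xt yt, flow N F xt yt /\ emanates xt yt /\ xt 0 = X /\ graph_of xt yt A) /\
 (forall x y, flow N F x y -> emanates x y -> x 0 <= X -> y 0 <= A (x 0)).

Lemma emanates_to_section N F x y v : 0 < N -> flow N F x y -> emanates x y -> 0 < v <= x 0 ->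
 exists t, t <= 0 /\ x t = v.
Proof.
 intros HN H E Hv. destruct (emanates_graph N F x y HN H E) as [U HU].
  now apply (graph_onto _ _ _ HU).
Qed.

(** A contact with the graph at a later time would propagate back to the start, both curves being
    orbits; so the strict inequality survives until the orbit reaches the section or turns over. *)
Lemma forward_to_section N F xq yq U x y sg : 0 < N -> field F -> flow N F xq yq -> flow N F x y ->
 emanates xq yq -> graph_of xq yq U -> (sg = 1 \/ sg = -1) -> 0 < x 0 <= xq 0 ->
 0 < y 0 -> sg * (y 0 - U (x 0)) < 0 ->
 exists t, 0 <= t /\ 0 <= y t /\ (forall s, 0 <= s < t -> 0 < y s) /\
  (forall s, 0 <= s <= t -> sg * (y s - U (x s)) < 0) /\
  (forall s, 0 <= s <= t -> x 0 <= x s <= xq 0) /\ (x t = xq 0 \/ y t = 0).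
Proof.
 intros HN HF Hq H Eq HU Hsg Hx Hy H0.
 assert (Cx : forall t, continuous x t) by (intros; now apply (flow_cont_x N F x y)).
 assert (A : exists t, 0 <= t /\ 0 <= y t /\ (forall s, 0 <= s < t -> 0 < y s) /\ x t <= xq 0 /\
  (x t = xq 0 \/ y t = 0)).
 { assert (Reach : forall T, 0 <= T -> (forall s,
  0 <= s < T -> 0 < y s) -> 0 <= y T -> xq 0 <= x T ->
   exists t, 0 <= t /\ 0 <= y t /\ (forall s,
    0 <= s < t -> 0 < y s) /\ x t <= xq 0 /\ (x t = xq 0 \/ y t = 0)).
  { intros T HT P PT HxT. destruct (ivt x 0 T (xq 0)) as [t [Ht Et]]; [assumption|auto|lra|].
   exists t. conj5; [lra| | |lra|now left].
   - destruct (Req_dec t T) as [->|]; [assumption|]. left. apply P. lra.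
   - intros s Hs. apply P. lra. }
  destruct (upper_forward N F x y HN HF H) as [[T [T1 [T2 [T3 T4]]]]|[Q1 Q2]]; [lra|assumption| |].
  - destruct (Rle_or_lt (xq 0) (x T)) as [Q|Q]; [apply (Reach T); auto; lra|].
   exists T. conj5; [lra|lra|assumption|lra|now right].
  - destruct (Q2 (xq 0)) as [T [T1 T2]]. apply (Reach T); try lra.
   + intros s Hs. apply Q1. lra.
   + left. now apply Q1. }
 destruct A as [t [A1 [A2 [A3 [A4 A5]]]]].
 assert (Inc : forall s r, 0 <= s < r -> r <= t -> x s < x r).
 { intros s r Hs Hr. apply (flow_x_incr N F x y); auto; [lra|]. intros q Hq'. apply A3. lra. }
 exists t. conj6; [assumption|assumption|assumption| | |assumption].
 2:{ intros s Hs. split.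
   - destruct (Req_dec s 0) as [->|]; [lra|]. left. apply Inc; lra.
   - destruct (Req_dec s t) as [->|]; [lra|]. specialize (Inc s t). lra. }
 intros s Hs. assert (W : sg * (y (1 * s) - U (x (1 * s))) <= 0).
 { apply (graph_trap N F xq yq (fun t => t < 0) U x y t 1 sg HF Hq H); auto; [apply HU| | | |lra].
  - apply neg_open.
  - intros r Hr. apply (graph_eq _ _ _ HU). lra.
  - intros r Hr _ E. rewrite !Rmult_1_l in *.
   assert (Xr : 0 < x r < xq 0).
   { assert (I1 := Inc r t ltac:(lra)). destruct (Req_dec r 0) as [->|]; [lra|].
    assert (x 0 < x r) by (apply Inc; lra). lra. }
   destruct (graph_onto _ _ _ HU (x r)) as [u [Hu Eu]]; [lra|].
   exists u. conj3; [ |assumption| ].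
   + destruct (Req_dec u 0) as [->|]; lra.
   + rewrite E, <- Eu. symmetry. now apply (graph_eq _ _ _ HU). }
 rewrite !Rmult_1_l in W. destruct (Req_dec (y s) (U (x s))) as [E|E];
  [exfalso|destruct Hsg as [->| ->]; lra].
 (* touching forces the two orbits to coincide up to the start *)
 assert (Xs : 0 < x s <= xq 0).
 { destruct (Req_dec s 0) as [->|]; [lra|]. assert (x 0 < x s) by (apply Inc; lra).
  destruct (Req_dec s t) as [->|]; [lra|]. assert (x s < x t) by (apply Inc; lra). lra. }
 destruct (graph_onto _ _ _ HU (x s)) as [u [Hu Eu]]; [assumption|].
 assert (Eu' : yq u = y s) by (rewrite E, <- Eu; symmetry; now apply (graph_eq _ _ _ HU)).
 destruct (flow_unique N F x y (fun r => xq (r + (u - s))) (fun r => yq (r + (u - s))) s HF H) with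
  (t := 0) as [Q1 Q2].
 - now apply flow_shift.
 - replace (s + (u - s)) with u by ring. now symmetry.
 - replace (s + (u - s)) with u by ring. now symmetry.
 - assert (y 0 = U (x 0)).
  { rewrite Q1, Q2. symmetry. apply (graph_eq _ _ _ HU). lra. }
  rewrite H1, Rminus_diag in H0. lra.
Qed.

(** The orbit leaving the vertical axis at (0, 1) bounds the heights of emanating orbits, so they
    have a supremum [b] on the section. The orbit through [b] emanates: if it came from [x < 0], so
    would those just below it. An emanating orbit above the graph somewhere would reach the section
    above [b]. *)
Lemma topmost_exists N F x1 y1 : 0 < N -> field F -> flow N F x1 y1 -> emanates x1 y1 ->
 exists X0, 0 < X0 /\ forall X, 0 < X <= X0 -> exists A, topmost N F X A.
Proof.
 intros HN HF H1 E1.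
 destruct (flow_exists N F 0 1 HN HF) as [xh [yh [Ih [Jh Hh]]]].
 destruct (continuous_pos yh 0) as [tau [Ht1 Ht2]]; [now apply (flow_cont_y N F xh yh)|lra|].
 assert (Xh : 0 < xh (tau / 2)).
 { rewrite <- Ih. apply (flow_x_incr N F xh yh); auto; [lra|]. intros r Hr. apply Ht2, Rabs_lt_iff.
  lra. }
 exists (Rmin (x1 0) (xh (tau / 2))). split; [apply Rmin_glb_lt; [exact (proj1 E1)|assumption]|].
 intros X HX. assert (M1 := Rmin_l (x1 0) (xh (tau / 2))).
  assert (M2 := Rmin_r (x1 0) (xh (tau / 2))).
 destruct (ivt xh 0 (tau / 2) X) as [s [Hs Es]]; [lra| |lra|].
 { intros t _. now apply (flow_cont_x N F xh yh). }
 assert (s0 : 0 < s) by (destruct (Req_dec s 0) as [->|]; lra).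
 assert (Ys : 0 < yh s) by (apply Ht2, Rabs_lt_iff; lra).
 set (E := fun b => exists x y, flow N F x y /\ x 0 = X /\ y 0 = b /\ emanates x y).
 assert (UB : forall b, E b -> b <= yh s).
 { intros b [x [y [H [Ex [Ey Em]]]]]. apply Rnot_lt_le. intros Q.
  destruct (emanates_graph N F x y HN H Em) as [U HU].
  destruct (emanates_below N F x y U (fun t => xh (t + s)) (fun t => yh (t + s)) HN HF H) as [[_ [_
   [P _]]] _].
  - now apply flow_shift.
  - assumption.
  - rewrite Rplus_0_l, Es, Ex. lra.
  - rewrite Rplus_0_l, Es, <- Ex. rewrite (graph_eq _ _ _ HU 0) by lra. lra.
  - specialize (P (- s) ltac:(lra)). replace (- s + s) with 0 in P by ring. lra. }
 assert (NE : exists b, E b).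
 { destruct (emanates_to_section N F x1 y1 X HN H1 E1) as [t [Ht Et]]; [lra|].
  exists (y1 t), (fun r => x1 (r + t)), (fun r => y1 (r + t)).
  rewrite !Rplus_0_l. conj4; [now apply flow_shift|assumption|reflexivity| ].
  now apply (emanates_shift N F). }
 destruct (completeness E) as [b [B1 B2]]; [exists (yh s); intros b Hb; now apply UB|assumption|].
 assert (Bn : 0 <= b).
 { destruct NE as [b' Hb']. apply Rle_trans with b'; [|now apply B1].
  destruct Hb' as [x [y [_ [_ [<- Em]]]]]. apply Em. }
 destruct (flow_exists N F X b HN HF) as [xt [yt [It [Jt Ht]]]].
 assert (Et : emanates xt yt).
 { destruct (emanates_or_hits N F xt yt HN HF Ht) as [|[T [T1 [T2 [T3 T4]]]]];
  [lra|lra|assumption|exfalso].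
  destruct (continuous_pos yt T) as [d [D1 D2]]; [now apply (flow_cont_y N F xt yt)|assumption|].
  set (u := T - d / 2).
  assert (Xu : xt u < 0).
  { rewrite <- T2. apply (flow_x_incr N F xt yt); auto; [unfold u; lra|].
   intros r Hr. apply D2. unfold u in Hr. apply Rabs_lt_iff. lra. }
  destruct (flow_continuous_dependence N F xt yt (- u) (- xt u) HF Ht) as [k [K1 K2]]; [unfold u;
   lra|lra|].
  assert (exists b', E b' /\ b - k < b') as [b' [Eb Hb]].
  { apply NNPP. intros Q. assert (b <= b - k); [|lra]. apply B2. intros b' Hb'.
   apply Rnot_lt_le. intros Z. apply Q. now exists b'. }
  assert (Hbb : b' <= b) by now apply B1.
  destruct Eb as [x [y [H [Ex [Ey Em]]]]].
  destruct (K2 x y 0 H) with (t := u) as [Q _].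
  - rewrite Rabs_R0. unfold u. lra.
  - rewrite Ex, It, Rminus_diag, Rabs_R0. assumption.
  - rewrite Ey, Jt. apply Rabs_lt_iff. lra.
  - rewrite Rabs_left; unfold u; lra.
  - apply Rabs_lt_iff in Q. destruct Em as [_ [_ [Em _]]]. destruct (Em u); [unfold u; lra|]. lra. }
 destruct (emanates_graph N F xt yt HN Ht Et) as [A HA].
 exists A. split; [exists xt, yt; conj_all|].
 intros x y H Em Hx. apply Rnot_lt_le. intros Q.
 assert (An := graph_nonneg _ _ _ Et HA (x 0)).
 destruct (forward_to_section N F xt yt A x y (-1) HN HF Ht H Et HA) as [t [A1 [A2 [A3 [A4 [A5
  A6]]]]]].
 - now right.
 - split; [exact (proj1 Em)|lra].
 - lra.
 - lra.
 - assert (Xt : x t = xt 0).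
  { destruct A6 as [A6|A6]; [assumption|]. specialize (A4 t ltac:(lra)). 
   assert (0 <= A (x t)) by (apply (graph_nonneg _ _ _ Et HA)). lra. }
  assert (y t <= b).
  { apply B1. exists (fun r => x (r + t)), (fun r => y (r + t)). rewrite !Rplus_0_l.
   conj4; [now apply flow_shift|lra|reflexivity| ].
   apply (emanates_of_pos N F); auto; rewrite ?Rplus_0_l; [now apply flow_shift|rewrite Xt, It;
    lra|assumption|].
   intros r Hr. destruct (Rle_or_lt 0 (r + t)) as [Z|Z].
   - specialize (A5 (r + t) ltac:(lra)). destruct Em as [Em _]. lra.
   - now apply Em. }
  specialize (A4 t ltac:(lra)). rewrite Xt, (graph_eq _ _ _ HA 0) in A4 by lra. lra.
Qed.

Lemma emanates_small N F x y e : 0 < N -> flow N F x y -> emanates x y -> 0 < e ->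
 exists t0, t0 <= 0 /\ forall t, t <= t0 -> Rabs (x t) < e /\ Rabs (y t) < e.
Proof.
 intros HN H E He. destruct E as [_ [_ [_ [E1 E2]]]].
 destruct (E1 e He) as [T1 HT1]. destruct (E2 e He) as [T2 HT2].
 exists (- Rmax 0 (Rmax T1 T2)). assert (M1 := Rmax_l 0 (Rmax T1 T2)).
  assert (M2 := Rmax_r 0 (Rmax T1 T2)).
 assert (M3 := Rmax_l T1 T2). assert (M4 := Rmax_r T1 T2). split; [lra|].
 intros t Ht. specialize (HT1 (- t) ltac:(lra)). specialize (HT2 (- t) ltac:(lra)).
 rewrite Ropp_involutive, Rminus_0_r in HT1. rewrite Ropp_involutive, Rminus_0_r in HT2. now split.
Qed.

Definition has_em N F : Prop := exists x y, flow N F x y /\ emanates x y.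

Lemma has_em_small N F e : 0 < N -> has_em N F -> 0 < e ->
 exists x y, flow N F x y /\ emanates x y /\ inbox e x y (fun t => t <= 0).
Proof.
 intros HN [x [y [H E]]] He. destruct (emanates_small N F x y e HN H E He) as [t0 [Ht0 Q]].
 exists (fun t => x (t + t0)), (fun t => y (t + t0)). conj3; [now apply flow_shift| | ].
 - now apply (emanates_shift N F).
 - intros t Ht. destruct (Q (t + t0)); lra.
Qed.

Lemma em_below_box N F xq yq U x y M : 0 < N -> field F -> flow N F xq yq -> flow N F x y ->
 graph_of xq yq U -> 0 < x 0 <= xq 0 -> 0 <= y 0 <= U (x 0) -> inbox M xq yq (fun t => t <= 0) ->
 emanates x y /\ inbox M x y (fun t => t <= 0) /\ forall t, t <= 0 -> y t <= U (x t).
Proof.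
 intros HN HF Hq H HU Hx Hy HB.
 destruct (emanates_below N F xq yq U x y HN HF Hq H HU Hx Hy) as [E B].
 conj3; [assumption| |assumption]. intros t Ht.
 assert (Xt : 0 < x t <= xq 0 /\ 0 <= y t).
 { destruct (Req_dec t 0) as [->|]; [lra|].
  assert (x t < x 0) by (apply (emanates_x_incr N F x y HN H E); lra).
  destruct E as [_ [_ [E _]]]. destruct (E t); lra. }
 destruct (graph_onto _ _ _ HU (x t)) as [u [Hu Eu]]; [lra|].
 specialize (B t Ht). rewrite <- Eu, (graph_eq _ _ _ HU u Hu) in B.
 destruct (HB u Hu) as [B1 B2]. rewrite Eu in B1. apply Rabs_le_iff in B1. apply Rabs_le_iff in B2.
 split; apply Rabs_le_iff; lra.
Qed.

(** * Homoclinic orbits close to the origin *)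

Section Local.
Variables (g : R -> R) (f : R -> R -> R) (d L : R).
Hypothesis HS : sys g f d L.

(** Near [O] the potentials of one side are attained on the other, so a small emanating orbit has a
    mirror image. *)
Lemma has_em_T N : 0 < N -> has_em N (vf N g f) -> has_em N (vf N (gT g) (fT f)).
Proof.
 intros HN He. assert (Hh := sys_half _ _ _ _ HS). assert (HhT := half_T _ _ Hh).
 destruct (Gp_small g f (gT g) (fT f) Hh HhT N HN) as [e [E1 E2]].
 set (e' := Rmin (e / 2) (N / 2)).
 assert (M : 0 < e' /\ e' <= e / 2 /\ e' <= N / 2).
 { conj3; [apply Rmin_glb_lt; lra|apply Rmin_l|apply Rmin_r]. }
 destruct (has_em_small N _ e' HN He) as [x [y [H [E B]]]]; [lra|].
 destruct (B 0 ltac:(lra)) as [B1 B2].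
 destruct (mirror_emanates g f (gT g) (fT f) N N Hh HhT (sys_conj _ _ _ _ HS) HN ltac:(lra) x y H E)
  as [x2 [y2 [K1 [K2 _]]]].
 - intros t Ht. destruct (B t Ht). lra.
 - apply Rabs_le_iff in B1. lra.
 - lra.
 - apply E2. lra.
 - now exists x2, y2.
Qed.

(** The starting point has energy [c] and lies in the pocket. Backward the orbit turns over on the
    axis at an abscissa at most [x1 0], hence below a known emanating graph, and so it emanates. *)
Lemma small_loop_right e : 0 < e -> e < d -> forall N, e < N -> has_em N (vf N g f) ->
 exists c0, 0 < c0 /\ forall c, 0 < c <= c0 -> forall x y, flow N (vf N g f) x y ->
  x 0 = 0 -> y 0 = - sqrt (2 * c) -> loop x y /\ inbox e x y (fun t => t <= 0).
Proof.
 intros He Hed N HeN Hem. assert (HN : 0 < N) by lra. assert (Hh := sys_half _ _ _ _ HS).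
 assert (HO := sys_right _ _ _ _ HS). assert (HL : 0 <= L) by apply HO.
 assert (HF := vf_field g f Hh N HN).
 destruct (has_em_small N _ e HN Hem He) as [x1 [y1 [H1 [E1 B1]]]].
 destruct (emanates_graph N _ x1 y1 HN H1 E1) as [U HU].
 assert (X1e : x1 0 <= e). { destruct (B1 0 ltac:(lra)) as [Q _]. apply Rabs_le_iff in Q. lra. }
 assert (X1p : 0 < x1 0) by exact (proj1 E1).
 destruct (pocket_exists g f Hh L (x1 0) HL X1p) as [c0 [C0 HC]].
 exists c0. split; [assumption|]. intros c Hc x y H Ex Ey.
 destruct (HC c Hc) as [X0 HP].
 assert (Sq : 0 < sqrt (2 * c)) by (apply sqrt_lt_R0; lra).
 assert (In0 : in_pocket g L c X0 (x 0) (y 0)).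
 { destruct HP as [_ [HP _]]. rewrite Ex, Ey. split; [lra|]. unfold En. rewrite Gp_0, Rmult_0_r,
  exp_0.
  replace (- sqrt (2 * c) * - sqrt (2 * c)) with (sqrt (2 * c) * sqrt (2 * c)) by ring.
  rewrite sqrt_sqrt by lra. lra. }
 destruct (pocket_backward g f Hh N d L (x1 0) c X0 x y HN HO X1p ltac:(lra) ltac:(lra) HP H) as [T
  [T1 [T2 [T3 [T4 T5]]]]].
 { lra. }
 { assumption. }
 assert (XT : x T <= X0) by (apply T5; lra).
 assert (X0e : X0 <= x1 0) by apply HP.
 destruct (em_below_box N _ x1 y1 U (fun t => x (t + T)) (fun t => y (t + T)) e HN HF H1
  (flow_shift _ _ _ _ T H) HU)
  as [A1 [A2 A3]].
 { rewrite Rplus_0_l. lra. }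
 { rewrite !Rplus_0_l, T2. split; [lra|]. apply (graph_nonneg _ _ _ E1 HU). }
 { assumption. }
 split.
 - conj5; [assumption|lra| | | ].
  + intros t Ht. destruct (Rle_or_lt T t) as [Q|Q].
   * rewrite <- Ex. apply (flow_x_decr N _ x y t 0 HN H Ht). intros r Hr. apply T4. lra.
   * destruct A1 as [_ [_ [A1 _]]]. specialize (A1 (t - T) ltac:(lra)).
    replace (t - T + T) with t in A1 by ring. apply A1.
  + destruct A1 as [_ [_ [_ [A1 _]]]]. now apply (tends_back_shift x 0 T).
  + destruct A1 as [_ [_ [_ [_ A1]]]]. now apply (tends_back_shift y 0 T).
 - intros t Ht. destruct (Rle_or_lt T t) as [Q|Q].
  + destruct (in_pocket_small g f Hh L (x1 0) c X0 _ _ HL X1p HP (T5 t ltac:(lra))). lra.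
  + specialize (A2 (t - T) ltac:(lra)). cbv beta in A2;
   now replace (t - T + T) with t in A2 by ring.
Qed.
End Local.

Section Boundary.
Variables (g : R -> R) (f : R -> R -> R) (d L : R).
Hypothesis HS : sys g f d L.

Let Hh : half g f := sys_half _ _ _ _ HS.
Let HhT : half (gT g) (fT f) := half_T _ _ (sys_half _ _ _ _ HS).

(** The two half loops start at the same height [- sqrt (2 * c)], with [c] small enough for both
    sides, and are glued there. *)
Lemma small_homloop N : 0 < N -> has_em N (vf N g f) -> exists x y, homloop g f N x y.
Proof.
 intros HN He. assert (HeT := has_em_T g f d L HS N HN He).
 assert (Hd : 0 < d) by apply (sys_right _ _ _ _ HS).
 set (e := Rmin (d / 2) (N / 2)).
 assert (M : 0 < e /\ e <= d / 2 /\ e <= N / 2).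
 { conj3; [apply Rmin_glb_lt; lra|apply Rmin_l|apply Rmin_r]. }
 destruct (small_loop_right g f d L HS e ltac:(lra) ltac:(lra) N ltac:(lra) He) as [c1 [C1 Q1]].
 destruct (small_loop_right _ _ d L (sys_T _ _ _ _ HS) e ltac:(lra) ltac:(lra) N ltac:(lra) HeT) as
  [c2 [C2 Q2]].
 set (c := Rmin c1 c2). assert (Mc : 0 < c /\ c <= c1 /\ c <= c2).
 { conj3; [now apply Rmin_glb_lt|apply Rmin_l|apply Rmin_r]. }
 destruct (flow_exists N _ 0 (- sqrt (2 * c)) HN (vf_field _ _ Hh N HN)) as [x [y [Ex [Ey H]]]].
 destruct (flow_exists N _ 0 (- sqrt (2 * c)) HN (vf_field _ _ HhT N HN)) as [x2 [y2 [Ex2 [Ey2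
  H2]]]].
 destruct (Q1 c ltac:(lra) x y H Ex Ey) as [L1 B1].
  destruct (Q2 c ltac:(lra) x2 y2 H2 Ex2 Ey2) as [L2 B2].
 exists x, y. apply (homloop_glue g f N x y x2 y2); auto; [| congruence |].
 - intros t Ht. destruct (B1 t Ht). lra.
 - intros t Ht. destruct (B2 t Ht). lra.
Qed.

Lemma hom_axis N : 0 < N -> has_em N (vf N g f) -> exists X1, 0 < X1 /\ forall v,
 0 < v <= X1 -> hom g f v 0.
Proof.
 intros HN He. destruct (small_homloop N HN He) as [x [y HL]]. assert (HL' := HL).
 destruct HL' as [_ [H [Ll _]]].
 destruct (loop_crossing N _ x y HN (vf_field g f Hh N HN) H Ll) as [T [T1 [T2 [T3 [T4 [T5 T6]]]]]].
 destruct (emanates_graph N _ _ _ HN (flow_shift _ _ _ _ T H) T6) as [U HU].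
 exists (x T). split; [assumption|]. intros v Hv.
 apply (hom_inside g f d L N x y T U); auto. split; [lra|]. apply (graph_nonneg _ _ _ T6 HU).
Qed.

(** Being homoclinic is a property of the orbit; the box lets the arc be compared across truncation
    levels. *)
Lemma hom_segment N x y a b : 0 < N -> flow N (vf N g f) x y -> a <= b ->
 inbox N x y (fun t => a <= t <= b) -> (hom g f (x a) (y a) <-> hom g f (x b) (y b)).
Proof.
 intros HN H Hab HB.
 assert (Q : forall s t, a <= s <= b -> a <= t <= b -> hom g f (x s) (y s) -> hom g f (x t) (y t)).
 { intros s t Hs Ht [N' [x' [y' [r [HL [Ex Ey]]]]]].
  assert (M1 := Rmax_l N N'). assert (M2 := Rmax_r N N').
  apply (homloop_larger g f N' (Rmax N N')) in HL; [|assumption].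
  exists (Rmax N N'), x', y', (t + (r - s)). split; [assumption|].
  destruct HL as [HN' [H' _]].
  destruct (flow_box_unique N (Rmax N N') N g f x y (fun u => x' (u + (r - s))) (fun u => y' (u +
   (r - s)))
   (fun t => a <= t <= b) s Hh HN' ltac:(lra) M1 H HB) with (t := t) as [Q1 Q2]; auto.
  - now apply flow_shift.
  - intros u v w Hu Hv Hw. lra.
  - replace (s + (r - s)) with r by ring. now symmetry.
  - replace (s + (r - s)) with r by ring. now symmetry. }
 split; apply Q; lra.
Qed.

Lemma hom_upper_time N x y t : homloop g f N x y -> 0 < x t -> 0 <= y t ->
 exists T U, t <= T /\ T < 0 /\ y T = 0 /\ (forall t, T < t <= 0 -> y t < 0) /\
  emanates (fun t => x (t + T)) (fun t => y (t + T)) /\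
  graph_of (fun t => x (t + T)) (fun t => y (t + T)) U /\ x t <= x T /\ U (x t) = y t.
Proof.
 intros [HN [H [L1 [L2 HB]]]] Hx Hy.
 destruct (loop_crossing N _ x y HN (vf_field g f Hh N HN) H L1) as [T [T1 [T2 [T3 [T4 [T5 T6]]]]]].
 destruct (emanates_graph N _ _ _ HN (flow_shift _ _ _ _ T H) T6) as [U HU].
 assert (t0 : t < 0).
 { apply Rnot_le_lt. intros Q. destruct (Req_dec t 0) as [->|].
  - destruct L1 as [Z _]. lra.
  - destruct L2 as [_ [_ [L2 _]]]. specialize (L2 (- t) ltac:(lra)). 
   rewrite Ropp_involutive in L2. lra. }
 assert (tT : t <= T) by (apply Rnot_lt_le; intros Q; specialize (T4 t ltac:(lra)); lra).
 exists T, U. repeat (split; [first [assumption|apply T5; lra]|]).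
 assert (E := graph_eq _ _ _ HU (t - T) ltac:(lra)). cbv beta in E.
 now replace (t - T + T) with t in E by ring.
Qed.

Lemma hom_below a b b' : hom g f a b -> 0 < a -> 0 <= b' <= b -> hom g f a b'.
Proof.
 intros [N [x [y [t [HL [Ex Ey]]]]]] Ha Hb.
 destruct (hom_upper_time N x y t HL) as [T [U [Q1 [Q2 [Q3 [Q4 [Q5 [Q6 [Q7 Q8]]]]]]]]]; [lra|lra|].
 apply (hom_inside g f d L N x y T U); auto; [lra|]. rewrite <- Ex, Q8. lra.
Qed.

(* [xq yq] is an emanating orbit in the box; everything strictly below it that is homoclinic on the
  section [x = xq 0] and on the axis spreads backward. *)
Lemma hom_spread N xq yq U : 0 < N -> flow N (vf N g f) xq yq -> emanates xq yq ->
 graph_of xq yq U -> inbox N xq yq (fun t => t <= 0) ->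
 (forall v, 0 < v <= xq 0 -> hom g f v 0) -> (forall b, 0 <= b < U (xq 0) -> hom g f (xq 0) b) ->
 forall a b, 0 < a <= xq 0 -> 0 <= b < U a -> hom g f a b.
Proof.
 intros HN Hq Eq HU HB Hax Hsec a b Ha Hb. assert (HF := vf_field g f Hh N HN).
 destruct (Req_dec b 0) as [->|Nb]; [now apply Hax|].
 destruct (flow_exists N _ a b HN HF) as [x [y [Ex [Ey H]]]].
 destruct (forward_to_section N _ xq yq U x y 1 HN HF Hq H Eq HU (or_introl eq_refl))
  as [t [A1 [A2 [A3 [A4 [A5 A6]]]]]]; [lra|lra|rewrite Ex, Ey; lra|].
 assert (UB : forall v, 0 < v <= xq 0 -> U v <= N).
 { intros v Hv. destruct (graph_onto _ _ _ HU v Hv) as [u [Hu <-]].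
  rewrite (graph_eq _ _ _ HU u Hu).
  destruct (HB u Hu) as [_ Q]. apply Rabs_le_iff in Q. lra. }
 assert (XN : xq 0 <= N). { destruct (HB 0 ltac:(lra)) as [Q _]. apply Rabs_le_iff in Q. lra. }
 rewrite <- Ex, <- Ey. apply (hom_segment N x y 0 t HN H A1).
 - intros s Hs. specialize (A4 s Hs). specialize (A5 s Hs). specialize (UB (x s) ltac:(lra)).
  assert (0 <= y s).
  { destruct (Req_dec s t) as [->|]; [assumption|]. left. apply A3. lra. }
  split; apply Rabs_le_iff; lra.
 - specialize (A4 t ltac:(lra)). specialize (A5 t ltac:(lra)). destruct A6 as [A6|A6].
  + rewrite A6 in *. apply Hsec. lra.
  + rewrite A6. apply Hax. lra.
Qed.

(** The case without parabolic sectors: homoclinic points fill everything below the topmost graph.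
    In [PPr] they stop at a lower emanating graph [B], which is itself not homoclinic. *)
Definition EHr N X : Prop := exists A, topmost N (vf N g f) X A /\
 forall a b, 0 < a <= X -> 0 <= b < A a -> hom g f a b.

Definition PPr N X : Prop := exists A B, topmost N (vf N g f) X A /\
 (exists xs ys, flow N (vf N g f) xs ys /\ emanates xs ys /\ xs 0 = X /\ graph_of xs ys B) /\
 (forall a, 0 < a <= X -> B a < A a) /\
 (forall a b, 0 < a <= X -> 0 <= b < B a -> hom g f a b) /\
 (forall a b, 0 < a <= X -> B a <= b <= A a -> ~ hom g f a b).

Lemma topmost_unique N F X X' A A' v : topmost N F X A -> topmost N F X' A' -> 0 < N ->
 0 < v -> v <= X -> v <= X' -> A v = A' v.
Proof.
 assert (Q : forall X X' A A', topmost N F X A -> topmost N F X' A' -> 0 < N ->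
  0 < v -> v <= X -> v <= X' -> A v <= A' v).
 { clear. intros X X' A A' [[xt [yt [H [E [E0 HA]]]]] _] [_ T] HN Hv HX HX'.
  destruct (graph_onto _ _ _ HA v) as [t [Ht Et]]; [lra|].
  rewrite <- Et at 1. rewrite (graph_eq _ _ _ HA t Ht).
  specialize (T (fun s => xt (s + t)) (fun s => yt (s + t))). cbv beta in T. rewrite !Rplus_0_l,
   Et in T.
  apply T; [now apply flow_shift|now apply (emanates_shift N F)|assumption]. }
 intros H1 H2 HN Hv HX HX'. apply Rle_antisym; [now apply (Q X X')|now apply (Q X' X)].
Qed.

(** A common point would identify the orbits up to a time shift, and their heights at [xr 0] would
    agree; a positive shift is impossible because [xr 0 <= xq 0]. *)
Lemma emanating_orbits_order N F xq yq U xr yr V : 0 < N -> field F -> flow N F xq yq -> flow N F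
 xr yr ->
 graph_of xq yq U -> graph_of xr yr V -> emanates xq yq -> emanates xr yr -> xr 0 <= xq 0 ->
 V (xr 0) < U (xr 0) -> forall a, 0 < a <= xr 0 -> V a < U a.
Proof.
 intros HN HF Hq Hr HU HV Eq Er Hx H0 a Ha.
 rewrite (graph_eq _ _ _ HV 0) in H0 by lra.
 destruct (emanates_below N F xq yq U xr yr HN HF Hq Hr HU) as [_ B].
 - split; [exact (proj1 Er)|assumption].
 - split; [exact (proj1 (proj2 Er))|lra].
 - destruct (graph_onto _ _ _ HV a Ha) as [t [Ht <-]]. rewrite (graph_eq _ _ _ HV t Ht).
  destruct (B t Ht) as [|E]; [assumption|exfalso].
  assert (Xt : 0 < xr t <= xq 0).
  { destruct (Req_dec t 0) as [->|]; [lra|]. split; [apply Er; lra|].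
   lra. }
  destruct (graph_onto _ _ _ HU _ Xt) as [s [Hs Es]].
  rewrite <- Es, (graph_eq _ _ _ HU s Hs) in E.
  assert (W := flow_unique N F xr yr (fun r => xq (r + (s - t))) (fun r => yq (r + (s - t))) t HF
   Hr (flow_shift _ _ _ _ _ Hq)).
  cbv beta in W. replace (t + (s - t)) with s in W by ring. specialize (W ltac:(now symmetry) E 0).
   rewrite Rplus_0_l in W.
  destruct W as [W1 W2].
  assert (st : s - t <= 0).
  { apply Rnot_lt_le. intros Q.
   assert (W3 := flow_unique N F xr yr (fun r => xq (r + (s - t))) (fun r => yq (r + (s - t))) t HF
    Hr (flow_shift _ _ _ _ _ Hq)).
   cbv beta in W3. replace (t + (s - t)) with s in W3 by ring.
    specialize (W3 ltac:(now symmetry) E).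
   destruct (W3 (t - s)) as [W4 W5]. replace (t - s + (s - t)) with 0 in W4, W5 by ring.
   assert (xr (t - s) < xr 0) by (apply (emanates_x_incr N F xr yr HN Hr Er); lra). lra. }
  rewrite W1, W2, (graph_eq _ _ _ HU (s - t) st) in H0. lra.
Qed.

(** On a section [x = Z] the homoclinic heights form an interval starting at 0. If some point below
    [A] fails to be homoclinic, its backward orbit exhibits such a height on every smaller section.
    The supremum [w] is not homoclinic, because the condition is open, and the emanating orbit
    through [w] is the graph [B]. *)
Lemma dichotomy N : 0 < N -> has_em N (vf N g f) ->
 exists X0, 0 < X0 /\ ((forall X, 0 < X <= X0 -> EHr N X) \/ (forall X, 0 < X <= X0 -> PPr N X)).
Proof.
 intros HN He. assert (HF := vf_field g f Hh N HN).
 destruct (has_em_small N _ N HN He HN) as [x1 [y1 [H1 [E1 _]]]].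
 destruct (topmost_exists N _ x1 y1 HN HF H1 E1) as [X2 [HX2 Top]].
 destruct (hom_axis N HN He) as [X1 [HX1 Hax]].
 destruct (Top X2 ltac:(lra)) as [A2 T2].
 assert (T2' := T2). destruct T2' as [[x2 [y2 [H2 [E2 [I2 G2]]]]] _].
 destruct (emanates_small N _ x2 y2 N HN H2 E2 HN) as [t2 [Ht2 B2]].
 assert (Xt2 : 0 < x2 t2).
 { destruct (Req_dec t2 0) as [->|]; [exact (proj1 E2)|]. apply E2. lra. }
 set (X3 := Rmin X1 (Rmin X2 (x2 t2))).
 assert (M3 : 0 < X3 /\ X3 <= X1 /\ X3 <= X2 /\ X3 <= x2 t2).
 { conj3; [repeat apply Rmin_glb_lt; lra|apply Rmin_l| ].
  split; (eapply Rle_trans; [apply Rmin_r|]); [apply Rmin_l|apply Rmin_r]. }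
 (* Topmost graphs over different sections agree where both are defined, so one small orbit bounds
    them all. *)
 assert (Box : forall X A, 0 < X <= X3 -> topmost N (vf N g f) X A ->
  forall xt yt, flow N (vf N g f) xt yt -> emanates xt yt -> xt 0 = X -> graph_of xt yt A ->
   inbox N xt yt (fun t => t <= 0)).
 { intros X A HX TA xt yt Ht Et It GA t Ht0.
  assert (Xt : 0 < xt t <= X).
  { destruct (Req_dec t 0) as [->|]; [lra|]. split; [apply Et; lra|].
   assert (xt t < xt 0) by (apply (emanates_x_incr N _ xt yt HN Ht Et); lra). lra. }
  rewrite <- (graph_eq _ _ _ GA t Ht0).
  rewrite (topmost_unique N _ X X2 A A2 (xt t) TA T2 HN) by lra.
  destruct (graph_onto _ _ _ G2 (xt t)) as [s [Hs Es]]; [lra|].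
  rewrite <- Es, (graph_eq _ _ _ G2 s Hs).
  assert (s <= t2).
  { apply Rnot_lt_le. intros Q. assert (x2 t2 < x2 s) by (apply (emanates_x_incr N _ x2 y2 HN H2
   E2); lra). lra. }
  destruct (B2 s H). lra. }
 destruct (classic (forall X, 0 < X <= X3 -> EHr N X)) as [C|C]; [exists X3; split;
  [lra|now left]|].
 apply not_all_ex_not in C. destruct C as [X C]. apply imply_to_and in C. destruct C as [HX C].
 destruct (Top X ltac:(lra)) as [A TA].
 assert (NH : exists a b, 0 < a <= X /\ 0 <= b < A a /\ ~ hom g f a b).
 { apply NNPP. intros Q. apply C. exists A. split; [assumption|]. intros a b Ha Hb.
  apply NNPP. intros Z. apply Q. exists a, b. conj_all. }
 destruct NH as [a [b [Ha [Hb Hn]]]].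
 exists a. split; [lra|right]. intros Z HZ.
 destruct (Top Z ltac:(lra)) as [AZ TZ]. exists AZ.
 assert (TA' := TA). destruct TA' as [[xt [yt [Ht [Et [It GA]]]]] _].
 assert (TZ' := TZ). destruct TZ' as [[xz [yz [Hz [Ez [Iz GZ]]]]] _].
 assert (BA := Box X A HX TA xt yt Ht Et It GA).
 assert (BZ := Box Z AZ ltac:(lra) TZ xz yz Hz Ez Iz GZ).
 assert (NZ : exists bz, 0 <= bz < AZ Z /\ ~ hom g f Z bz).
 { destruct (flow_exists N _ a b HN HF) as [xb [yb [Ixb [Iyb Hb']]]].
  destruct (em_below_box N _ xt yt A xb yb N HN HF Ht Hb' GA) as [Eb [Bb Ub]]; [lra|rewrite Ixb;
   lra|assumption|].
  destruct (emanates_graph N _ xb yb HN Hb' Eb) as [V HV].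
  destruct (graph_onto _ _ _ HV Z) as [t [Ht' Et']]; [lra|].
  assert (Vb : V a = b) by (rewrite <- Ixb at 1; rewrite (graph_eq _ _ _ HV 0) by lra; assumption).
  exists (V Z). split; [split|].
  - apply (graph_nonneg _ _ _ Eb HV).
  - rewrite (topmost_unique N _ Z X AZ A Z TZ TA HN) by lra.
   apply (emanating_orbits_order N _ xt yt A xb yb V HN HF Ht Hb' GA HV Et Eb); [lra|rewrite Ixb,
    Vb; lra|lra].
  - intros Q. apply Hn. rewrite <- Ixb, <- Iyb. apply (hom_segment N xb yb t 0 HN Hb' Ht').
   + intros s Hs. apply Bb. lra.
   + rewrite <- (graph_eq _ _ _ HV t Ht'), Et'. assumption. }
 destruct NZ as [bz [Hbz Nbz]].
 destruct (completeness (fun v => 0 <= v /\ hom g f Z v)) as [w [W1 W2]].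
 { exists bz. intros v [Hv Q]. apply Rnot_lt_le. intros Z'. apply Nbz. apply (hom_below Z v bz Q);
  lra. }
 { exists 0. split; [lra|]. apply Hax. lra. }
 assert (w0 : 0 <= w) by (apply W1; split; [lra|apply Hax; lra]).
 assert (wb : w <= bz).
 { apply W2. intros v [Hv Q]. apply Rnot_lt_le. intros Z'. apply Nbz. apply (hom_below Z v bz Q);
  lra. }
 assert (wl : forall v, 0 <= v < w -> hom g f Z v).
 { intros v Hv. apply NNPP. intros Q. assert (w <= v); [|lra]. apply W2. intros u [Hu Qu].
  apply Rnot_lt_le. intros Z'. apply Q. apply (hom_below Z u v Qu); lra. }
 assert (EmZ : forall v, 0 <= v <= AZ Z -> em g f N Z v).
 { intros v Hv. destruct (flow_exists N _ Z v HN HF) as [xv [yv [Iv [Jv Hv']]]].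
  destruct (em_below_box N _ xz yz AZ xv yv N HN HF Hz Hv' GZ) as [Ev [Bv Uv]]; [lra|rewrite Iv;
   lra|assumption|].
  exists xv, yv. now repeat (split; [assumption|]). }
 assert (wn : ~ hom g f Z w).
 { intros Q. assert (w < bz). { destruct wb as [|E]; [assumption|]. rewrite E in Q. contradiction. }
  destruct Q as [N' [x' [y' [t' [HL [Ex Ey]]]]]].
  assert (t' < 0).
  { destruct (hom_upper_time N' x' y' t' HL) as [T [U [Q1 [Q2 _]]]]; lra. }
  destruct (hom_open g f d L N' x' y' t' N HS HL) as [eps [He1 He2]]; [assumption|lra|lra|].
  rewrite Ex, Ey in He2. set (v := Rmin bz (w + eps / 2)).
  assert (Mv : w < v /\ v <= bz /\ v <= w + eps / 2).
  { conj3; [apply Rmin_glb_lt; lra|apply Rmin_l|apply Rmin_r]. }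
  assert (hom g f Z v).
  { apply He2; [apply Rabs_lt_iff; lra|lra|apply EmZ; lra]. }
  assert (v <= w) by (apply W1; split; [lra|assumption]). lra. }
 assert (wp : 0 < w).
 { destruct w0 as [|<-]; [assumption|]. elim wn. apply Hax. lra. }
 destruct (flow_exists N _ Z w HN HF) as [xs [ys [Is [Js Hs]]]].
 destruct (em_below_box N _ xz yz AZ xs ys N HN HF Hz Hs GZ) as [Es [Bs Us]]; [lra|rewrite Is;
  lra|assumption|].
 destruct (emanates_graph N _ xs ys HN Hs Es) as [B HB].
 assert (BZw : B Z = w) by (rewrite <- Is; rewrite (graph_eq _ _ _ HB 0) by lra; assumption).
 exists B. conj5; [assumption|exists xs, ys; conj_all| | | ].
 - intros v Hv. apply (emanating_orbits_order N _ xz yz AZ xs ys B HN HF Hz Hs GZ HB Ez Es);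
  [lra|rewrite Is; lra|lra].
 - intros u v Hu Hv. apply (hom_spread N xs ys B HN Hs Es HB Bs); [| |lra|assumption].
  + intros r Hr. apply Hax. lra.
  + rewrite Is, BZw. exact wl.
 - intros u v Hu Hv Q. apply wn. rewrite <- Is, <- Js.
  destruct (graph_onto _ _ _ HB u) as [t [Ht' Et']]; [lra|].
  apply (hom_segment N xs ys t 0 HN Hs Ht').
  + intros s Hs'. apply Bs. lra.
  + rewrite <- (graph_eq _ _ _ HB t Ht'), Et'. apply (hom_below u v); [assumption|lra|].
   split; [apply (graph_nonneg _ _ _ Es HB)|lra].
Qed.

(** Continuous induction on the height along a section, with [hom_open] for openness. For
    closedness, the common bound [M] passes to the limit orbit, which therefore does not escape; nor
    can it reenter the right half plane, because its homoclinic neighbours leave it once and for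
    all. *)
Lemma bounded_hom N x y : 0 < N -> flow N (vf N g f) x y -> emanates x y -> inbox N x y (fun t => t
 <= 0) ->
 (exists M, forall a b, hom g f a b -> Rabs a <= M /\ Rabs b <= M) -> hom g f (x 0) (y 0).
Proof.
 intros HN H E HB [M HM]. assert (HF := vf_field g f Hh N HN).
 destruct (hom_axis N HN) as [X1 [HX1 Hax]]; [now exists x, y|].
 destruct (emanates_graph N _ x y HN H E) as [U HU].
 set (v := Rmin X1 (x 0)). assert (Mv : 0 < v /\ v <= X1 /\ v <= x 0).
 { conj3; [apply Rmin_glb_lt; [assumption|exact (proj1 E)]|apply Rmin_l|apply Rmin_r]. }
 destruct (graph_onto _ _ _ HU v) as [t0 [Ht0 Et0]]; [lra|].
 apply (hom_segment N x y t0 0 HN H Ht0); [intros s Hs; apply HB; lra|].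
 assert (M0 : 0 <= M). { destruct (HM v 0 (Hax v ltac:(lra))) as [Q _]. pose proof (Rabs_pos v).
  lra. }
 assert (Yn : 0 <= y t0) by (rewrite <- (graph_eq _ _ _ HU t0 Ht0);
  apply (graph_nonneg _ _ _ E HU)).
 assert (Em : forall b, 0 <= b <= y t0 -> em g f N v b).
 { intros b Hb. destruct (flow_exists N _ v b HN HF) as [xv [yv [Iv [Jv Hv']]]].
  destruct (em_below_box N _ x y U xv yv N HN HF H Hv' HU) as [Ev [Bv Uv]].
  - lra.
  - rewrite Iv, Jv, <- Et0, (graph_eq _ _ _ HU t0 Ht0). lra.
  - assumption.
  - exists xv, yv. now repeat (split; [assumption|]). }
 rewrite Et0. apply (real_induction (fun b => hom g f v b) 0 (y t0)); [apply Hax; lra| | |lra].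
 - intros b Hb IH. destruct (IH b ltac:(lra)) as [N' [x' [y' [t' [HL [Ex Ey]]]]]].
  assert (t' < 0).
  { destruct (hom_upper_time N' x' y' t' HL) as [T [V [Q1 [Q2 _]]]]; lra. }
  destruct (hom_open g f d L N' x' y' t' N HS HL) as [eps [He1 He2]]; [assumption|lra|lra|].
  rewrite Ex, Ey in He2. exists eps. split; [assumption|]. intros s Hs Hs'.
  apply He2; [apply Rabs_lt_iff; lra|lra|apply Em; lra].
 - intros b Hb IH.
  set (N' := Rmax N (M + 1)). assert (M1 : N <= N' /\ M + 1 <= N').
  { split; [apply Rmax_l|apply Rmax_r]. }
  assert (HN' : 0 < N') by lra. assert (HF' := vf_field g f Hh N' HN').
   assert (HFT' := vf_field _ _ HhT N' HN').
  destruct (em_larger g f N N' v b Hh HN ltac:(lra) (Em b ltac:(lra))) as [xb [yb [Hxb [Ixb [Iyb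
   [Eb Bb]]]]]].
  (* On every bounded time interval the limit orbit is approximated by homoclinic orbits; each lies
     in [x > 0] before its crossing time [c] and in [x < 0] after it. *)
  assert (Approx : forall T eps, 0 <= T -> 0 < eps -> exists x' y' c, flow N' (vf N' g f) x' y' /\
   (forall t, t < c -> 0 < x' t) /\ (forall t,
    c < t -> x' t < 0) /\ inbox M x' y' (fun _ => True) /\
   forall t, Rabs t <= T -> Rabs (x' t - xb t) < eps /\ Rabs (y' t - yb t) < eps).
  { intros T eps HT He.
   destruct (flow_continuous_dependence N' _ xb yb T eps HF' Hxb HT He) as [dl [D1 D2]].
   set (s := Rmax 0 (b - dl / 2)).
   assert (Ms : 0 <= s < b /\ b - dl / 2 <= s).
   { split; [split; [apply Rmax_l|apply Rmax_lub_lt; lra]|apply Rmax_r]. }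
   destruct (IH s ltac:(lra)) as [N2 [x' [y' [t' [HL [Ex Ey]]]]]].
   assert (B' : inbox M x' y' (fun _ => True)).
   { intros t _. apply HM. now exists N2, x', y', t. }
   destruct HL as [HN2 [H' [L1 [L2 B2]]]].
   assert (H'' : flow N' (vf N' g f) x' y').
   { destruct (Rle_or_lt M N2) as [Q|Q].
    - apply (sol_box N2 N' M); try assumption; lra.
    - apply (sol_box N2 N' N2); try assumption; lra. }
   exists (fun t => x' (t + t')), (fun t => y' (t + t')), (- t').
   conj5; [now apply flow_shift| | | | ].
   - intros t Ht. apply L1. lra.
   - intros t Ht. destruct L2 as [_ [_ [L2 _]]]. specialize (L2 (- (t + t')) ltac:(lra)).
    rewrite Ropp_involutive in L2. lra.
   - intros t _. now apply B'.
   - apply (D2 _ _ 0 (flow_shift _ _ _ _ t' H'')).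
    + now rewrite Rabs_R0.
    + now rewrite Rplus_0_l, Ex, Ixb, Rminus_diag, Rabs_R0.
    + rewrite Rplus_0_l, Ey, Iyb. apply Rabs_lt_iff. lra. }
  assert (BM : inbox M xb yb (fun _ => True)).
  { intros t _. split; apply Rnot_lt_le; intros Q.
   - destruct (Approx (Rabs t) (Rabs (xb t) - M)) as [x' [y' [c [_ [_ [_ [B' D']]]]]]];
    [apply Rabs_pos|lra|].
    destruct (D' t ltac:(lra)) as [Q' _]. destruct (B' t Logic.I) as [Q'' _].
    assert (Rabs (xb t) <= Rabs (x' t) + Rabs (x' t - xb t)); [|lra].
    replace (xb t) with (x' t + - (x' t - xb t)) at 1 by ring.
    eapply Rle_trans; [apply Rabs_triang|]. rewrite Rabs_Ropp. lra.
   - destruct (Approx (Rabs t) (Rabs (yb t) - M)) as [x' [y' [c [_ [_ [_ [B' D']]]]]]];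
    [apply Rabs_pos|lra|].
    destruct (D' t ltac:(lra)) as [_ Q']. destruct (B' t Logic.I) as [_ Q''].
    assert (Rabs (yb t) <= Rabs (y' t) + Rabs (y' t - yb t)); [|lra].
    replace (yb t) with (y' t + - (y' t - yb t)) at 1 by ring.
    eapply Rle_trans; [apply Rabs_triang|]. rewrite Rabs_Ropp. lra. }
  assert (NR := vf_no_rest _ _ Hh N' d L HN' (sys_right _ _ _ _ HS)).
  destruct (upper_to_axis N' _ xb yb 0 HN' HF' NR Hxb) as [t1 [A1 [A2 [A3 A4]]]]; [lra|lra|lra| |].
  { exists M. intros t _. destruct (BM t Logic.I) as [Q _]. apply Rabs_le_iff in Q. lra. }
  set (xl := fun t => xb (t + t1)). set (yl := fun t => yb (t + t1)).
  assert (Hl : flow N' (vf N' g f) xl yl) by now apply flow_shift.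
  assert (Ll : loop xl yl).
  { conj5; [unfold xl; now rewrite Rplus_0_l|unfold yl; now rewrite Rplus_0_l| | | ].
   - intros t Ht. unfold xl. destruct (Rtotal_order (t + t1) 0) as [Q|[->|Q]];
    [now apply Eb|lra|apply A4; lra].
   - destruct Eb as [_ [_ [_ [Eb _]]]]. now apply (tends_back_shift xb 0 t1).
   - destruct Eb as [_ [_ [_ [_ Eb]]]]. now apply (tends_back_shift yb 0 t1). }
  assert (Bl : inbox N' xl yl (fun _ => True)).
  { intros t _. destruct (BM (t + t1) Logic.I). unfold xl, yl. lra. }
  assert (HT : flow N' (vf N' (gT g) (fT f)) (fun t => - xl (- t)) (fun t => yl (- t))) by now
   apply flow_T.
  assert (X0 : - xl (- 0) = 0) by (rewrite Ropp_0; destruct Ll as [-> _]; ring).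
  assert (Y0 : yl (- 0) < 0) by (rewrite Ropp_0; apply Ll).
  exists N', xl, yl, (- t1). split; [|unfold xl, yl; now replace (- t1 + t1) with 0 by ring].
  conj5; [assumption|assumption|assumption| |assumption].
  destruct (lower_backward N' _ _ _ HN' HFT' HT) as [[T [B1 [B2 [B3 B4]]]]|[_ Q]]; [lra|assumption|
   |].
  2:{ exfalso. destruct (Q M) as [t [_ Q']]. destruct (BM (- t + t1) Logic.I) as [Q'' _].
    apply Rabs_le_iff in Q''. unfold xl in Q'. lra. }
  assert (LowX : forall t, T <= t < 0 -> 0 < - xl (- t)).
  { intros t Ht. rewrite <- X0. apply (flow_x_decr N' _ _ _ t 0 HN' HT); [lra|].
   intros r Hr. apply B4. lra. }
  destruct (emanates_or_hits N' _ _ _ HN' HFT' (flow_shift _ _ _ _ T HT)) as [Em'|[V [C1 [C2 [C3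
   C4]]]]].
  + rewrite Rplus_0_l. assumption.
  + rewrite Rplus_0_l, B2. lra.
  + conj5; [assumption|assumption| | | ].
   * intros t Ht. destruct (Rle_or_lt T t) as [Q|Q]; [apply LowX; lra|].
    destruct Em' as [_ [_ [Em' _]]]. specialize (Em' (t - T) ltac:(lra)).
    replace (t - T + T) with t in Em' by ring. apply Em'.
   * destruct Em' as [_ [_ [_ [Em' _]]]]. now apply (tends_back_shift (fun t => - xl (- t)) 0 T).
   * destruct Em' as [_ [_ [_ [_ Em']]]]. now apply (tends_back_shift (fun t => yl (- t)) 0 T).
  + exfalso. set (W := V + T) in *.
   (* the orbit enters the right half plane again, and so do its homoclinic neighbours *)
   destruct (continuous_pos (fun t => yl (- t)) W) as [e [e1 e2]].
   { now apply (flow_cont_y N' _ _ _ W HT). }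
   { assumption. }
   assert (XW : - xl (- (W - e / 2)) < 0).
   { rewrite <- C2. apply (flow_x_incr N' _ (fun t => - xl (- t)) (fun t => yl (- t)) (W - e / 2) W
    HN' HT); [lra|].
    intros r Hr. apply e2. apply Rabs_lt_iff. lra. }
   assert (XT := LowX T ltac:(lra)).
   set (s1 := - T + t1). set (s2 := - (W - e / 2) + t1).
   assert (Q1 : xb s1 < 0) by (unfold s1; unfold xl in XT; lra).
   assert (Q2 : 0 < xb s2) by (unfold s2; unfold xl in XW; lra).
   assert (s12 : 0 < s1 < s2) by (unfold s1, s2, W; lra).
   destruct (Approx s2 (Rmin (- xb s1) (xb s2))) as [x' [y' [c [_ [P1 [P2 [_ D']]]]]]];
    [lra|apply Rmin_glb_lt; lra|].
   assert (m1 := Rmin_l (- xb s1) (xb s2)). assert (m2 := Rmin_r (- xb s1) (xb s2)).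
   destruct (D' s1 ltac:(rewrite Rabs_pos_eq; lra)) as [R1 _].
   destruct (D' s2 ltac:(rewrite Rabs_pos_eq; lra)) as [R2 _].
   apply Rabs_lt_iff in R1. apply Rabs_lt_iff in R2.
   destruct (Rlt_or_le s1 c) as [Z|Z]; [specialize (P1 s1 Z); lra|].
   specialize (P2 s2 ltac:(lra)). lra.
Qed.

(** By [hom_corr] the homoclinic orbit has a point of the same height and potential in the other
    half plane, and the potential is injective on the positive axis. *)
Lemma hom_mirror a a2 b : 0 < a -> 0 < a2 -> Gp g a = Gp (gT g) a2 -> 0 <= b ->
 hom (gT g) (fT f) a2 b -> hom g f a b.
Proof.
 intros Ha Ha2 E Hb [N [x [y [t [HL [Ex Ey]]]]]].
 assert (ST := sys_T _ _ _ _ HS).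
 assert (t0 : t < 0).
 { destruct HL as [_ [_ [L1 [L2 _]]]]. apply Rnot_le_lt. intros Q. destruct (Req_dec t 0) as [->|].
  - destruct L1 as [L1 _]. lra.
  - destruct L2 as [_ [_ [L2 _]]]. specialize (L2 (- t) ltac:(lra)). 
   rewrite Ropp_involutive in L2. lra. }
 destruct (hom_corr _ _ d L N x y ST HL) as [C _]. rewrite gT_gT in C.
 destruct (C t t0) as [t' [Q1 [Q2 Q3]]]. rewrite Ex, <- E in Q2.
 apply homloop_T in HL. rewrite gT_gT, fT_fT in HL.
 exists N, (fun t => - x (- t)), (fun t => y (- t)), t'. split; [assumption|].
 split; [|lra]. assert (P : 0 < - x (- t')).
 { destruct HL as [_ [_ [HL _]]]. now apply HL. }
 destruct (Rtotal_order (- x (- t')) a) as [Z|[Z|Z]]; [|assumption|].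
 - assert (Gp g (- x (- t')) < Gp g a) by (apply (Gp_incr g f Hh); lra). lra.
 - assert (Gp g a < Gp g (- x (- t'))) by (apply (Gp_incr g f Hh); lra). lra.
Qed.
End Boundary.

(** The mirror image of the topmost orbit on the right emanates on the left. A point of the lower
    boundary [B] is therefore matched with a point strictly below the topmost graph of the left,
    which is homoclinic; mirrored back, the point of [B] would be homoclinic. *)
Lemma dichotomy_consistent g f d L N X0 X0' : sys g f d L -> 0 < N -> 0 < X0 -> 0 < X0' ->
 (forall X, 0 < X <= X0 -> PPr g f N X) -> (forall X,
  0 < X <= X0' -> EHr (gT g) (fT f) N X) -> False.
Proof.
 intros S HN HX0 HX0' HP HE.
 assert (Hh := sys_half _ _ _ _ S). assert (HhT := half_T _ _ Hh).
 
 destruct (HE X0' ltac:(lra)) as [A' [[_ T'] HA']].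
 set (r := Rmin X0' N).
 assert (Mr : 0 < r /\ r <= X0' /\ r <= N).
 { conj3; [now apply Rmin_glb_lt|apply Rmin_l|apply Rmin_r]. }
 destruct (Gp_small g f (gT g) (fT f) Hh HhT r ltac:(lra)) as [e [E1 E2]].
 destruct (HP X0 ltac:(lra)) as [A [B [[[xt [yt [Ht [Et [It GA]]]]] Top]
  [[xs [ys [Hs [Es [Is GB]]]]] [BA [_ NH]]]]]].
 set (e' := Rmin (e / 2) (N / 2)).
 assert (Me : 0 < e' /\ e' <= e / 2 /\ e' <= N / 2).
 { conj3; [apply Rmin_glb_lt; lra|apply Rmin_l|apply Rmin_r]. }
 destruct (emanates_small N _ xt yt e' HN Ht Et ltac:(lra)) as [t1 [Ht1 S1]].
 destruct (emanates_small N _ xs ys e' HN Hs Es ltac:(lra)) as [t2 [Ht2 S2]].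
 assert (P1 : 0 < xt t1). { destruct (Req_dec t1 0) as [->|]; [exact (proj1 Et)|apply Et; lra]. }
 assert (P2 : 0 < xs t2). { destruct (Req_dec t2 0) as [->|]; [exact (proj1 Es)|apply Es; lra]. }
 assert (L1 : xt t1 <= X0).
 { destruct (Req_dec t1 0) as [->|]; [lra|]. rewrite <- It. left.
  apply (emanates_x_incr N _ xt yt HN Ht Et). lra. }
 set (a := Rmin (xt t1) (xs t2)).
 assert (Ma : 0 < a /\ a <= xt t1 /\ a <= xs t2).
 { conj3; [now apply Rmin_glb_lt|apply Rmin_l|apply Rmin_r]. }
 assert (Mirror : forall x y U,
  flow N (vf N g f) x y -> emanates x y -> x 0 = X0 -> graph_of x y U ->
  forall t0, t0 <= 0 -> (forall t, t <= t0 -> Rabs (x t) < e' /\ Rabs (y t) < e') -> a <= x t0 ->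
  exists x2 y2, flow N (vf N (gT g) (fT f)) x2 y2 /\ emanates x2 y2 /\ Gp (gT g) (x2 0) = Gp g a /\
   y2 0 = U a /\ 0 < x2 0 <= r).
 { intros x y U H E I G t0 Ht0 Sm Hat.
  assert (Xt0 : x t0 <= X0).
  { destruct (Req_dec t0 0) as [->|]; [lra|]. rewrite <- I. left.
   apply (emanates_x_incr N _ x y HN H E). lra. }
  destruct (graph_onto _ _ _ G a) as [t [Ht' Eta]]; [lra|].
  assert (t <= t0).
  { apply Rnot_lt_le. intros Q. assert (x t0 < x t) by (apply (emanates_x_incr N _ x y HN H E);
   lra). lra. }
  destruct (mirror_emanates g f (gT g) (fT f) N r Hh HhT (sys_conj _ _ _ _ S) HN ltac:(lra)
   (fun s => x (s + t)) (fun s => y (s + t))) as [x2 [y2 [K1 [K2 [K3 [K4 K5]]]]]].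
  - now apply flow_shift.
  - now apply (emanates_shift N (vf N g f)).
  - intros s Hs'. destruct (Sm (s + t) ltac:(lra)). lra.
  - rewrite Rplus_0_l. destruct (Sm t ltac:(lra)) as [Q _]. apply Rabs_lt_iff in Q. lra.
  - rewrite Rplus_0_l. destruct (Sm t ltac:(lra)) as [_ Q]. lra.
  - rewrite Rplus_0_l. apply E2. destruct (Sm t ltac:(lra)) as [Q _]. lra.
  - exists x2, y2. rewrite Rplus_0_l in K3, K4. rewrite Eta in K3.
   conj5; [assumption|assumption|assumption| |assumption].
   rewrite K4, <- Eta. symmetry. now apply (graph_eq _ _ _ G). }
 destruct (Mirror xt yt A Ht Et It GA t1 Ht1 S1 ltac:(lra)) as [x2 [y2 [K1 [K2 [K3 [K4 K5]]]]]].
 destruct (Mirror xs ys B Hs Es Is GB t2 Ht2 S2 ltac:(lra)) as [x3 [y3 [J1 [J2 [J3 [J4 J5]]]]]].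
 assert (Q1 := T' x2 y2 K1 K2 ltac:(lra)). rewrite K4 in Q1.
 assert (BAa := BA a ltac:(lra)).
 apply (NH a (B a)); [lra|lra|].
 assert (Bn := graph_nonneg _ _ _ Es GB a).
 apply (hom_mirror g f d L S a (x2 0) (B a)); [lra|lra|now symmetry|assumption|].
 apply HA'; lra.
Qed.

(** * A polar chart adapted to two curves through the origin *)

(* The chart straightens the strip [- l x <= y <= A x + k] over [- x1 <= x <= x0] to a square,
  whose boundary is run through clockwise by [tau] in [0, 10], starting from the graph of [A]
  on the right; the graph of [S <= A] is hit at [tau = 1] and [tau = 5], that of [A] again at
  [tau = 6]. *)
Definition c01 (v : R) : R := Rmax 0 (Rmin 1 v).
Definition angU (t : R) : R := Rmax (cl 1 (3 - t)) (cl 1 (t - 8)).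
Definition angW (t : R) : R := c01 (Rmin (t - 1) (5 - t)).
Definition angS (t : R) : R := c01 (Rmin t (6 - t)).
Definition angV (t : R) : R := c01 (Rmin (t - 6) (10 - t)).

Lemma c01_low v : v <= 0 -> c01 v = 0.
Proof. intros. unfold c01, Rmax, Rmin. repeat destruct Rle_dec; lra. Qed.

Lemma c01_high v : 1 <= v -> c01 v = 1.
Proof. intros. unfold c01, Rmax, Rmin. repeat destruct Rle_dec; lra. Qed.

Lemma c01_mid v : 0 <= v <= 1 -> c01 v = v.
Proof. intros. unfold c01, Rmax, Rmin. repeat destruct Rle_dec; lra. Qed.

Ltac angles :=
 intros; unfold angU, angV, angS, angW; repeat match goal with |- _ /\ _ => split end;
 [unfold cl, Rmax, Rmin; repeat destruct Rle_dec; lra|..];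
 unfold Rmin; destruct Rle_dec;
 solve [rewrite c01_low; lra|rewrite c01_mid; lra|rewrite c01_high; lra].

Lemma ang1 t : 0 <= t <= 1 -> angU t = 1 /\ angV t = 0 /\ angS t = t /\ angW t = 0.
Proof. angles. Qed.

Lemma ang2 t : 1 <= t <= 2 -> angU t = 1 /\ angV t = 0 /\ angS t = 1 /\ angW t = t - 1.
Proof. angles. Qed.

Lemma ang3 t : 2 <= t <= 4 -> angU t = 3 - t /\ angV t = 0 /\ angS t = 1 /\ angW t = 1.
Proof. angles. Qed.

Lemma ang4 t : 4 <= t <= 5 -> angU t = -1 /\ angV t = 0 /\ angS t = 1 /\ angW t = 5 - t.
Proof. angles. Qed.

Lemma ang5 t : 5 <= t <= 6 -> angU t = -1 /\ angV t = 0 /\ angS t = 6 - t /\ angW t = 0.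
Proof. angles. Qed.

Lemma ang6 t : 6 <= t <= 7 -> angU t = -1 /\ angV t = t - 6 /\ angS t = 0 /\ angW t = 0.
Proof. angles. Qed.

Lemma ang7 t : 7 <= t <= 9 -> angU t = t - 8 /\ angV t = 1 /\ angS t = 0 /\ angW t = 0.
Proof. angles. Qed.

Lemma ang8 t : 9 <= t <= 10 -> angU t = 1 /\ angV t = 10 - t /\ angS t = 0 /\ angW t = 0.
Proof. angles. Qed.

Lemma angle_cases t : 0 <= t <= 10 ->
 (0 <= t <= 1 /\ angU t = 1 /\ angV t = 0 /\ angS t = t /\ angW t = 0) \/
 (1 <= t <= 2 /\ angU t = 1 /\ angV t = 0 /\ angS t = 1 /\ angW t = t - 1) \/
 (2 <= t <= 4 /\ angU t = 3 - t /\ angV t = 0 /\ angS t = 1 /\ angW t = 1) \/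
 (4 <= t <= 5 /\ angU t = -1 /\ angV t = 0 /\ angS t = 1 /\ angW t = 5 - t) \/
 (5 <= t <= 6 /\ angU t = -1 /\ angV t = 0 /\ angS t = 6 - t /\ angW t = 0) \/
 (6 <= t <= 7 /\ angU t = -1 /\ angV t = t - 6 /\ angS t = 0 /\ angW t = 0) \/
 (7 <= t <= 9 /\ angU t = t - 8 /\ angV t = 1 /\ angS t = 0 /\ angW t = 0) \/
 (9 <= t <= 10 /\ angU t = 1 /\ angV t = 10 - t /\ angS t = 0 /\ angW t = 0).
Proof.
 intros Ht.
 destruct (Rle_or_lt t 1); [left; split; [lra|apply ang1; lra]|right].
 destruct (Rle_or_lt t 2); [left; split; [lra|apply ang2; lra]|right].
 destruct (Rle_or_lt t 4); [left; split; [lra|apply ang3; lra]|right].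
 destruct (Rle_or_lt t 5); [left; split; [lra|apply ang4; lra]|right].
 destruct (Rle_or_lt t 6); [left; split; [lra|apply ang5; lra]|right].
 destruct (Rle_or_lt t 7); [left; split; [lra|apply ang6; lra]|right].
 destruct (Rle_or_lt t 9); [left; split; [lra|apply ang7; lra]|right].
 split; [lra|apply ang8; lra].
Qed.

Lemma lipschitz1_continuous (h : R -> R) : (forall s t, Rabs (h s - h t) <= 1 * Rabs (s - t)) ->
 forall t, continuous h t.
Proof. apply continuous_lipschitz. Qed.

Ltac lip1 := apply lipschitz1_continuous; intros ? ?; unfold angU, angW, angS, angV, c01, cl, Rmax,
 Rmin, Rabs;
 repeat (destruct Rle_dec || destruct Rcase_abs); lra.

Lemma cl_cont N t : continuous (cl N) t.
Proof.
 revert t. apply lipschitz1_continuous. intros s t. rewrite Rmult_1_l. apply cl_lipschitz.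
Qed.

Lemma Rmax_cont (u v : R -> R) t : continuous u t -> continuous v t -> continuous (fun s => Rmax (u
 s) (v s)) t.
Proof.
 intros Hu Hv. apply continuous_eps. intros eps He.
 destruct (proj1 (continuous_eps u t) Hu eps He) as [d1 [D1 E1]].
 destruct (proj1 (continuous_eps v t) Hv eps He) as [d2 [D2 E2]].
 exists (Rmin d1 d2). split; [now apply Rmin_glb_lt|]. intros s Hs.
 assert (M1 := Rmin_l d1 d2). assert (M2 := Rmin_r d1 d2).
 specialize (E1 s ltac:(lra)). specialize (E2 s ltac:(lra)).
 apply Rabs_lt_iff in E1. apply Rabs_lt_iff in E2. apply Rabs_lt_iff.
 unfold Rmax. repeat destruct Rle_dec; lra.
Qed.

Lemma c01_cont t : continuous c01 t.
Proof. revert t. lip1. Qed.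

Lemma angU_cont t : continuous angU t.
Proof.
 apply (Rmax_cont (fun t => cl 1 (3 - t)) (fun t => cl 1 (t - 8))).
 - apply (continuous_comp (fun t => 3 - t) (cl 1)); [|apply cl_cont].
  apply (is_derive_continuous _ _ (-1)). auto_derive; [trivial|ring].
 - apply (continuous_comp (fun t => t - 8) (cl 1)); [|apply cl_cont].
  apply (is_derive_continuous _ _ 1). auto_derive; [trivial|ring].
Qed.

Lemma tent_cont a b t : continuous (fun t => c01 (Rmin (t - a) (b - t))) t.
Proof.
 apply (continuous_comp (fun t => Rmin (t - a) (b - t)) c01); [|apply c01_cont].
 revert t. lip1.
Qed.

Lemma angS_cont t : continuous angS t.
Proof.
 apply (continuous_ext (fun t => c01 (Rmin (t - 0) (6 - t)))); [|apply tent_cont].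
 intros s. unfold angS. now rewrite Rminus_0_r.
Qed.

Lemma cont2_comp (h : R -> R) (u : R * R -> R) z : continuous u z -> continuous h (u z) ->
 continuous (fun w => h (u w)) z.
Proof. intros. now apply (continuous_comp u h). Qed.

Lemma cont2_mult (u v : R * R -> R) z : continuous u z -> continuous v z ->
 continuous (fun w => u w * v w) z.
Proof. intros. now apply (continuous_mult (K := R_AbsRing)). Qed.

Lemma cont2_plus (u v : R * R -> R) z : continuous u z -> continuous v z ->
 continuous (fun w => u w + v w) z.
Proof. intros. now apply (continuous_plus (V := R_NormedModule)). Qed.

Lemma cont2_minus (u v : R * R -> R) z : continuous u z -> continuous v z ->
 continuous (fun w => u w - v w) z.
Proof. intros. now apply (continuous_minus (V := R_NormedModule)). Qed.

Lemma continuous_pair {T : UniformSpace} (u v : T -> R) (z : T) : continuous u z -> continuous v z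
 ->
 continuous (fun w => (u w, v w) : plane) z.
Proof.
 intros Hu Hv. apply filterlim_locally. intros eps.
 assert (A := proj1 (filterlim_locally u (u z)) Hu eps).
 assert (B := proj1 (filterlim_locally v (v z)) Hv eps).
 generalize (filter_and _ _ A B). apply filter_imp. intros w [H1 H2]. now split.
Qed.

Lemma continuous_on_all {T : UniformSpace} (D : T -> Prop) (h : T -> plane) :
 (forall z, continuous h z) -> continuous_on D h.
Proof.
 intros H z _ P HP. apply (filter_le_within (F := locally z)). exact (H z P HP).
Qed.

Lemma ang_upper t : 6 <= t <= 10 -> angS t = 0 /\ angW t = 0 /\ (6 < t < 10 -> 0 < angV t).
Proof.
 intros Ht. destruct (Rle_or_lt t 7); [destruct (ang6 t ltac:(lra)) as [_ [-> [-> ->]]]; lra|].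
 destruct (Rle_or_lt t 9); [destruct (ang7 t ltac:(lra)) as [_ [-> [-> ->]]]; lra|].
 destruct (ang8 t ltac:(lra)) as [_ [-> [-> ->]]]; lra.
Qed.

Lemma ang_lower t : 1 <= t <= 5 -> angV t = 0 /\ angS t = 1 /\ (1 < t < 5 -> 0 < angW t).
Proof.
 intros Ht. destruct (Rle_or_lt t 2); [destruct (ang2 t ltac:(lra)) as [_ [-> [-> ->]]]; lra|].
 destruct (Rle_or_lt t 4); [destruct (ang3 t ltac:(lra)) as [_ [-> [-> ->]]]; lra|].
 destruct (ang4 t ltac:(lra)) as [_ [-> [-> ->]]]; lra.
Qed.

(** The reflection of the angle exchanges the arcs [6, 10] and [1, 5], so [half_square] parametrizes
    both halves of the square. *)
Lemma ang_flip t : angU (11 - t) = angU t /\ angW (11 - t) = angV t.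
Proof.
 unfold angU, angW, angV. replace (3 - (11 - t)) with (t - 8) by ring.
  replace (11 - t - 8) with (3 - t) by ring.
 replace (11 - t - 1) with (10 - t) by ring. replace (5 - (11 - t)) with (t - 6) by ring.
 split; [apply Rmax_comm|f_equal; apply Rmin_comm].
Qed.

Lemma min3 a b c : 0 < a -> 0 < b -> 0 < c -> exists e, 0 < e /\ e <= a /\ e <= b /\ e <= c.
Proof.
 intros. exists (Rmin a (Rmin b c)). pose proof (Rmin_l a (Rmin b c)).
  pose proof (Rmin_r a (Rmin b c)).
 pose proof (Rmin_l b c). pose proof (Rmin_r b c).
 split; [repeat apply Rmin_glb_lt; assumption|lra].
Qed.

Lemma div_range v w : 0 <= v <= w -> 0 < w -> 0 <= v / w <= 1.
Proof.
 intros Hv Hw. split; [apply Rdiv_le_0_compat; lra|].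
 apply Rmult_le_reg_r with w; [assumption|]. unfold Rdiv. rewrite Rmult_assoc, Rinv_l; lra.
Qed.

(** Polar coordinates for the maximum norm: the three cases are the points seen through the right,
    the left and the top edge of the half square. *)
Lemma half_square u v : -1 <= u <= 1 -> 0 <= v <= 1 -> (u <> 0 \/ v <> 0) ->
 exists r t, 0 < r <= 1 /\ 6 <= t <= 10 /\ r * angU t = u /\ r * angV t = v.
Proof.
 intros Hu Hv Hne. destruct (Rle_or_lt v u) as [Q|Q]; [|destruct (Rle_or_lt v (- u)) as [Q'|Q']].
 - assert (W := div_range v u ltac:(lra) ltac:(lra)). exists u, (10 - v / u). conj3; [lra|lra| ].
  destruct (ang8 (10 - v / u) ltac:(lra)) as [-> [-> _]]. split; field; lra.
 - assert (W := div_range v (- u) ltac:(lra) ltac:(lra)). exists (- u), (6 + v / - u). conj3;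
  [lra|lra| ].
  destruct (ang6 (6 + v / - u) ltac:(lra)) as [-> [-> _]]. split; field; lra.
 - assert (W := div_range (u + v) (2 * v) ltac:(lra) ltac:(lra)). exists v,
  (7 + 2 * ((u + v) / (2 * v))).
  conj3; [lra|lra| ].
  destruct (ang7 (7 + 2 * ((u + v) / (2 * v))) ltac:(lra)) as [-> [-> _]]. split; field; lra.
Qed.

Section Chart.
Variables (x0 x1 k : R) (A S l : R -> R).
Hypothesis Hx0 : 0 < x0.
Hypothesis Hx1 : 0 < x1.
Hypothesis Hk : 0 < k.
Hypothesis CA : forall x, continuous A x.
Hypothesis CS : forall x, continuous S x.
Hypothesis Cl : forall x, continuous l x.
Hypothesis A0 : A 0 = 0.
Hypothesis S0 : S 0 = 0.
Hypothesis SA : forall x, - x1 <= x <= x0 -> x <> 0 -> S x < A x.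
Hypothesis lS : forall x, - x1 <= x <= x0 -> - l x < S x.

(** Piecewise linear, with slope [x0] on the right and [x1] on the left, since the strip need not be
    symmetric. *)
Definition chX (u : R) : R := x0 * Rmax u 0 - x1 * Rmax (- u) 0.

(** The height starts from the graph of [A], and [angS] moves it down to that of [S]. The last term,
    proportional to the radius, goes up to [k] above [A] or down by up to [S + l] below [S]. *)
Definition chY (r t : R) : R :=
 A (chX (r * angU t)) - angS t * (A (chX (r * angU t)) - S (chX (r * angU t)))
 + r * (k * angV t - angW t * (S (chX (r * angU t)) + l (chX (r * angU t)))).

(** The angle is counted in turns and [tau] is ten times as large, hence the angles with denominator
    10 below. *)
Definition chart (z : R * R) : plane :=
 (chX (fst z * angU (10 * snd z)), chY (fst z) (10 * snd z)).

Lemma chX_pos u : 0 <= u -> chX u = x0 * u.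
Proof. intros. unfold chX. rewrite Rmax_left, Rmax_right by lra. ring. Qed.

Lemma chX_neg u : u <= 0 -> chX u = x1 * u.
Proof. intros. unfold chX. rewrite Rmax_right, Rmax_left by lra. ring. Qed.

Lemma chX_incr u v : u < v -> chX u < chX v.
Proof.
 intros H. destruct (Rle_or_lt 0 u); [rewrite !chX_pos by lra; nra|].
 destruct (Rle_or_lt v 0); [rewrite !chX_neg by lra; nra|].
 rewrite (chX_neg u), (chX_pos v) by lra. nra.
Qed.

Lemma chX_inj u v : chX u = chX v -> u = v.
Proof.
 intros E. destruct (Rtotal_order u v) as [H|[H|H]]; [|assumption|]; apply chX_incr in H; lra.
Qed.

Lemma chX_0 : chX 0 = 0.
Proof. rewrite chX_pos; lra. Qed.

Lemma chX_range u : -1 <= u <= 1 -> - x1 <= chX u <= x0.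
Proof.
 intros H. destruct (Rle_or_lt 0 u); [rewrite chX_pos by lra|rewrite chX_neg by lra]; nra.
Qed.

Lemma chX_onto x : - x1 <= x <= x0 -> exists u, -1 <= u <= 1 /\ chX u = x.
Proof.
 intros H. destruct (Rle_or_lt 0 x) as [P|P].
 - exists (x / x0). assert (0 <= x / x0 <= 1).
  { split; [apply Rmult_le_pos; [lra|left; now apply Rinv_0_lt_compat]|].
   apply Rmult_le_reg_r with x0; [assumption|]. unfold Rdiv. rewrite Rmult_assoc, Rinv_l; lra. }
  split; [lra|]. rewrite chX_pos by lra. field. lra.
 - exists (x / x1). assert (-1 <= x / x1 <= 0).
  { split; apply Rmult_le_reg_r with x1; try assumption; unfold Rdiv; rewrite Rmult_assoc, Rinv_l;
   lra. }
  split; [lra|]. rewrite chX_neg by lra. field. lra.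
Qed.

Lemma chX_cont u : continuous chX u.
Proof.
 apply (continuous_minus (V := R_NormedModule)).
 - apply (continuous_scal_r (V := R_NormedModule) x0).
  apply (Rmax_cont (fun u => u) (fun _ => 0)); [apply continuous_id|apply continuous_const].
 - apply (continuous_scal_r (V := R_NormedModule) x1).
  apply (Rmax_cont (fun u => - u) (fun _ => 0)); [|apply continuous_const].
  apply (continuous_opp (V := R_NormedModule)), continuous_id.
Qed.

Lemma chart_cont z : continuous chart z.
Proof.
 assert (C10 : continuous (fun w : R * R => 10 * snd w) z).
 { apply (cont2_comp (fun s => 10 * s) snd); [apply continuous_snd|].
  apply (is_derive_continuous _ _ 10). auto_derive; [trivial|ring]. }
 assert (CU : continuous (fun w : R * R => angU (10 * snd w)) z)
  by (apply (cont2_comp angU (fun w => 10 * snd w)); [assumption|apply angU_cont]).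
 assert (CX : continuous (fun w : R * R => chX (fst w * angU (10 * snd w))) z).
 { apply (cont2_comp chX (fun w => fst w * angU (10 * snd w))); [|apply chX_cont].
  apply cont2_mult; [apply continuous_fst|assumption]. }
 assert (CC : forall h : R -> R, (forall x, continuous h x) ->
  continuous (fun w : R * R => h (chX (fst w * angU (10 * snd w)))) z).
 { intros h Ch. apply (cont2_comp h (fun w => chX (fst w * angU (10 * snd w))));
  [assumption|apply Ch]. }
 assert (CT : forall h : R -> R, (forall x, continuous h x) ->
  continuous (fun w : R * R => h (10 * snd w)) z).
 { intros h Ch. apply (cont2_comp h (fun w => 10 * snd w)); [assumption|apply Ch]. }
 apply (continuous_pair (fun z => chX (fst z * angU (10 * snd z))) (fun z => chY (fst z) (10 * snd
  z))); [assumption|].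
 unfold chY. apply cont2_plus; [apply cont2_minus; [now apply CC|]|].
 - apply cont2_mult; [apply (CT angS), angS_cont|]. apply cont2_minus; now apply CC.
 - apply cont2_mult; [apply continuous_fst|]. apply cont2_minus.
  + apply cont2_mult; [apply continuous_const|]. apply (CT angV). intros. apply tent_cont.
  + apply cont2_mult; [apply (CT angW); intros; apply tent_cont|]. apply cont2_plus; now apply CC.
Qed.

Lemma gap_nonneg x : - x1 <= x <= x0 -> 0 <= A x - S x.
Proof.
 intros H. destruct (Req_dec x 0) as [->|N]; [rewrite A0, S0; lra|]. specialize (SA x H N). lra.
Qed.

Lemma ang_ranges t : 0 <= t <= 10 -> -1 <= angU t <= 1 /\ 0 <= angV t <= 1 /\ 0 <= angS t <= 1 /\ 0
 <= angW t <= 1.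
Proof.
 intros Ht. destruct (angle_cases t Ht) as [H|[H|[H|[H|[H|[H|[H|H]]]]]]];
  destruct H as [H1 [-> [-> [-> ->]]]]; lra.
Qed.

Lemma ch_range r t : 0 <= r <= 1 -> 0 <= t <= 10 -> - x1 <= chX (r * angU t) <= x0.
Proof.
 intros Hr Ht. apply chX_range. destruct (ang_ranges t Ht) as [H _]. nra.
Qed.

Lemma chY_bounds r t : 0 <= r <= 1 -> 0 <= t <= 10 ->
 S (chX (r * angU t)) - r * (S (chX (r * angU t)) + l (chX (r * angU t))) <= chY r t /\
 chY r t <= A (chX (r * angU t)) + r * k.
Proof.
 intros Hr Ht. assert (R := ch_range r t Hr Ht). assert (G := gap_nonneg _ R).
  assert (G' := lS _ R).
 destruct (ang_ranges t Ht) as [_ [HV [HS HW]]]. unfold chY.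
 set (x := chX (r * angU t)) in *. set (gp := A x - S x) in *. set (e := S x + l x).
 assert (He : 0 < e) by (unfold e; lra).
 assert (0 <= angS t * gp <= gp) by nra.
 assert (0 <= r * (angW t * e) <= r * e).
 { assert (0 <= angW t * e <= e) by nra. nra. }
 assert (0 <= r * (k * angV t) <= r * k).
 { assert (0 <= k * angV t <= k) by nra. nra. }
 replace (A x) with (S x + gp) by (unfold gp; ring). lra.
Qed.

(** Equal abscissas and [r < r'] force [|angU t'| < 1], so the second point lies on the top or
    bottom edge of its square, at a height that the radius [r] cannot reach. *)
Lemma chart_injective_rho r t r' t' : 0 < r <= 1 -> 0 <= t <= 10 -> 0 < r' <= 1 -> 0 <= t' <= 10 ->
 r * angU t = r' * angU t' -> chY r t = chY r' t' -> r < r' -> False.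
Proof.
 intros Hr Ht Hr' Ht' EU EY Hlt.
 destruct (ang_ranges t Ht) as [HU _].
 assert (B := chY_bounds r t ltac:(lra) Ht). assert (R := ch_range r t ltac:(lra) Ht).
 assert (e := lS _ R). rewrite EY in B.
 assert (U' : -1 < angU t' < 1) by (split; nra).
 unfold chY in B. rewrite <- EU in B. set (x := chX (r * angU t)) in *.
 destruct (angle_cases t' Ht') as [H|[H|[H|[H|[H|[H|[H|H]]]]]]];
  destruct H as [H1 [E1 [E2 [E3 E4]]]]; rewrite E1 in U'; try lra; rewrite E2, E3, E4 in B; nra.
Qed.

(** At a fixed radius [angU] determines the position on the top and on the bottom edge, and along a
    vertical edge the height is strictly monotone with one of the rates [gp], [e'], [k']; [m] is a
    common positive lower bound of these for [nra]. *)
Lemma chart_injective_tau r t t' : 0 < r <= 1 -> 0 <= t < 10 -> 0 <= t' < 10 ->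
 angU t = angU t' -> chY r t = chY r t' -> t = t'.
Proof.
 intros Hr Ht Ht' EU EY.
 assert (R := ch_range r t ltac:(lra) ltac:(lra)). assert (e := lS _ R).
 assert (G := gap_nonneg _ R).
 assert (G' : chX (r * angU t) <> 0 -> S (chX (r * angU t)) < A (chX (r * angU t))) by (intros;
  now apply SA).
 assert (X1 : angU t = 1 \/ angU t = -1 -> chX (r * angU t) <> 0).
 { intros HU E. rewrite <- chX_0 in E. apply chX_inj in E. destruct HU as [HU|HU]; rewrite HU in E;
  lra. }
 unfold chY in EY. rewrite <- EU in EY. set (x := chX (r * angU t)) in *.
 assert (He : 0 < r * (S x + l x)) by (apply Rmult_lt_0_compat; lra).
 assert (Hrk : 0 < r * k) by (apply Rmult_lt_0_compat; lra).
 set (e' := r * (S x + l x)) in *. set (k' := r * k) in *.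
 assert (EY' : A x - angS t * (A x - S x) + (k' * angV t - angW t * e') =
  A x - angS t' * (A x - S x) + (k' * angV t' - angW t' * e')).
 { unfold e', k'. lra. }
 clear EY.
 destruct (angle_cases t ltac:(lra)) as [H|[H|[H|[H|[H|[H|[H|H]]]]]]];
  destruct H as [H1 [E1 [E2 [E3 E4]]]];
 destruct (angle_cases t' ltac:(lra)) as [H'|[H'|[H'|[H'|[H'|[H'|[H'|H']]]]]]];
  destruct H' as [H1' [E1' [E2' [E3' E4']]]];
 rewrite E1, E1' in EU; try lra;
 rewrite E2, E3, E4, E2', E3', E4' in EY'; try lra;
 try (assert (Gx : S x < A x) by (apply G', X1; rewrite E1; lra));
 try (assert (Gx : S x < A x) by (apply G', X1; rewrite E1; first [left; lra|right; lra]));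
 assert (Hgp : 0 < A x - S x) by lra; set (gp := A x - S x) in *; clearbody gp e' k' x;
 clear - Hgp He Hrk EU EY' H1 H1' Ht Ht';
 assert (M : exists m, 0 < m /\ m <= gp /\ m <= e' /\ m <= k') by
 (exists (Rmin gp (Rmin e' k')); pose proof (Rmin_l gp (Rmin e' k'));
  pose proof (Rmin_r gp (Rmin e' k'));
  pose proof (Rmin_l e' k'); pose proof (Rmin_r e' k'); split; [repeat apply Rmin_glb_lt;
   assumption|lra]);
 destruct M as [m [M1 [M2 [M3 M4]]]];
 (destruct (Rtotal_order t t') as [h|[h|h]]; [exfalso|exact h|exfalso]; nra).
Qed.

Lemma chart_nonzero_aux r t : 0 < r <= 1 -> 0 <= t <= 10 ->
 (chX (r * angU t), chY r t) <> origin :> plane.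
Proof.
 intros Hr Ht E. assert (E1 := f_equal fst E). assert (E2 := f_equal snd E). simpl in E1, E2.
 assert (EU : r * angU t = 0) by (apply chX_inj; now rewrite chX_0).
 assert (U0 : angU t = 0) by nra. unfold chY in E2. rewrite E1, A0, S0 in E2.
 assert (L0 := lS 0 ltac:(lra)). rewrite S0 in L0.
 destruct (angle_cases t Ht) as [H|[H|[H|[H|[H|[H|[H|H]]]]]]];
  destruct H as [H1 [F1 [F2 [F3 F4]]]]; rewrite F1 in U0; try lra; rewrite F2, F3, F4 in E2; nra.
Qed.

Lemma in_upper x y : - x1 <= x <= x0 -> A x <= y <= A x + k -> (x <> 0 \/ y <> 0) ->
 exists r t, 0 < r <= 1 /\ 6 <= t <= 10 /\ x = chX (r * angU t) /\ y = chY r t.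
Proof.
 intros Hx Hy Hne. destruct (chX_onto x Hx) as [u [Hu Eu]].
 assert (Hv := div_range (y - A x) k ltac:(lra) Hk).
 destruct (half_square u ((y - A x) / k) Hu Hv) as [r [t [Hr [Ht [E1 E2]]]]].
 - destruct (Req_dec u 0) as [->|]; [right|now left]. rewrite chX_0 in Eu. rewrite <- Eu, A0 in *.
  apply Rmult_integral_contrapositive_currified; [lra|apply Rinv_neq_0_compat; lra].
 - exists r, t. conj3; [assumption|assumption| ]. unfold chY. rewrite E1, Eu. split; [reflexivity|].
  destruct (ang_upper t Ht) as [-> [-> _]].
   replace (k * angV t - 0 * (S x + l x)) with (k * angV t) by ring.
  replace (r * (k * angV t)) with (k * (r * angV t)) by ring. rewrite E2. field. lra.
Qed.

Lemma in_lower x y : - x1 <= x <= x0 -> - l x <= y <= S x -> (x <> 0 \/ y <> 0) ->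
 exists r t, 0 < r <= 1 /\ 1 <= t <= 5 /\ x = chX (r * angU t) /\ y = chY r t.
Proof.
 intros Hx Hy Hne. destruct (chX_onto x Hx) as [u [Hu Eu]]. assert (e := lS _ Hx).
 assert (Hv := div_range (S x - y) (S x + l x) ltac:(lra) ltac:(lra)).
 destruct (half_square u ((S x - y) / (S x + l x)) Hu Hv) as [r [t [Hr [Ht [E1 E2]]]]].
 - destruct (Req_dec u 0) as [->|]; [right|now left]. rewrite chX_0 in Eu. rewrite <- Eu, S0 in *.
  apply Rmult_integral_contrapositive_currified; [lra|apply Rinv_neq_0_compat; lra].
 - exists r, (11 - t). conj3; [assumption|lra| ]. destruct (ang_flip t) as [F1 F2]. unfold chY.
  destruct (ang_lower (11 - t) ltac:(lra)) as [-> [-> _]]. rewrite F1, F2, E1, Eu. split;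
   [reflexivity|].
  replace (r * (k * 0 - angV t * (S x + l x))) with (- (r * angV t) * (S x + l x)) by ring.
   rewrite E2. field. lra.
Qed.

Lemma chart_eq r t : chart (r, t / 10) = (chX (r * angU t), chY r t).
Proof. unfold chart. simpl. replace (10 * (t / 10)) with t by field. reflexivity. Qed.

Lemma closed_upper p : closed_sector chart (6 / 10) 1 p ->
 - x1 <= fst p <= x0 /\ A (fst p) <= snd p <= A (fst p) + k.
Proof.
 intros [r [th [Hr [Hth ->]]]]. unfold chart. simpl.
 split; [apply ch_range; lra|]. assert (B := chY_bounds r (10 * th) ltac:(lra) ltac:(lra)).
 split; [|destruct B as [_ B]; nra]. destruct (ang_ranges (10 * th) ltac:(lra)) as [_ [HV _]].
  unfold chY.
 destruct (ang_upper (10 * th) ltac:(lra)) as [-> [-> _]].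
 assert (0 <= r * (k * angV (10 * th))) by (repeat apply Rmult_le_pos; lra). lra.
Qed.

Lemma open_upper p : open_sector chart (6 / 10) 1 p -> A (fst p) < snd p.
Proof.
 intros [r [th [Hr [Hth ->]]]]. unfold chart, chY. simpl.
 destruct (ang_upper (10 * th) ltac:(lra)) as [-> [-> HV]]. specialize (HV ltac:(lra)).
 assert (0 < r * (k * angV (10 * th))) by (repeat apply Rmult_lt_0_compat; lra). lra.
Qed.

Lemma nonzero_of_closed a b p : 0 <= a -> b <= 1 -> closed_sector chart a b p -> p <> origin.
Proof.
 intros Ha Hb [r [th [Hr [Hth ->]]]]. unfold chart. simpl. apply chart_nonzero_aux; lra.
Qed.

Lemma plane_nonzero (p : plane) : p <> origin <-> fst p <> 0 \/ snd p <> 0.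
Proof.
 destruct p as [x y]. simpl. split.
 - intros H. destruct (Req_dec x 0) as [->|]; [|now left]. destruct (Req_dec y 0) as [->|];
  [|now right].
  now elim H.
 - intros H E. injection E as -> ->. lra.
Qed.

Lemma closed_lower p : closed_sector chart (1 / 10) (5 / 10) p <->
 - x1 <= fst p <= x0 /\ - l (fst p) <= snd p <= S (fst p) /\ p <> origin.
Proof.
 split.
 - intros H. conj3; [ | |apply (nonzero_of_closed (1 / 10) (5 / 10)); lra || assumption];
  destruct H as [r [th [Hr [Hth ->]]]]; unfold chart; simpl;
   assert (R := ch_range r (10 * th) ltac:(lra) ltac:(lra)).
  + assumption.
  + assert (B := chY_bounds r (10 * th) ltac:(lra) ltac:(lra)). assert (e := lS _ R).
   destruct (ang_ranges (10 * th) ltac:(lra)) as [_ [_ [_ HW]]].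
   unfold chY in *. destruct (ang_lower (10 * th) ltac:(lra)) as [F1 [F2 _]]. rewrite F1, F2 in *.
   set (x := chX (r * angU (10 * th))) in *.
   assert (0 <= (1 - r) * (S x + l x)) by (apply Rmult_le_pos; lra).
   assert (0 <= r * (angW (10 * th) * (S x + l x))) by (repeat apply Rmult_le_pos; lra). lra.
 - intros [H1 [H2 H3]]. apply plane_nonzero in H3.
  destruct (in_lower (fst p) (snd p) H1 H2 H3) as [r [t [Hr [Ht [Ex Ey]]]]].
  exists r, (t / 10). conj3; [assumption|lra| ]. rewrite chart_eq, <- Ex, <- Ey. now destruct p.
Qed.

Lemma open_lower p : open_sector chart (1 / 10) (5 / 10) p -> snd p < S (fst p).
Proof.
 intros [r [th [Hr [Hth ->]]]]. unfold chart; simpl.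
  assert (e := lS _ (ch_range r (10 * th) ltac:(lra) ltac:(lra))).
 unfold chY. set (x := chX (r * angU (10 * th))) in *.
 destruct (ang_lower (10 * th) ltac:(lra)) as [-> [-> HW]]. specialize (HW ltac:(lra)).
 assert (0 < r * (angW (10 * th) * (S x + l x))) by (repeat apply Rmult_lt_0_compat; lra). lra.
Qed.

Lemma closed_right a b p : 0 <= a <= b -> b <= 1 -> (closed_sector chart (a / 10) (b / 10) p <->
 0 < fst p <= x0 /\ a * (A (fst p) - S (fst p)) <= A (fst p) - snd p <= b * (A (fst p) - S (fst
  p))).
Proof.
 intros Ha Hb. split.
 - intros [r [th [Hr [Hth ->]]]]. unfold chart, chY; simpl.
  assert (G := gap_nonneg _ (ch_range r (10 * th) ltac:(lra) ltac:(lra))).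
  destruct (ang1 (10 * th) ltac:(lra)) as [E1 [-> [-> ->]]]. rewrite E1, Rmult_1_r,
   chX_pos in * by lra.
  split; [split; [apply Rmult_lt_0_compat; lra|nra]|]. set (gp := A (x0 * r) - S (x0 * r)) in *.
  assert (a * gp <= 10 * th * gp <= b * gp) by (split; apply Rmult_le_compat_r; lra). lra.
 - intros [H1 H2]. assert (gp := SA (fst p) ltac:(lra) ltac:(lra)).
  exists (fst p / x0), ((A (fst p) - snd p) / (A (fst p) - S (fst p)) / 10).
  assert (D := div_range (fst p) x0 ltac:(lra) Hx0).
   assert (0 < fst p / x0) by (apply Rdiv_lt_0_compat; lra).
  set (t := (A (fst p) - snd p) / (A (fst p) - S (fst p))).
  assert (Et : t * (A (fst p) - S (fst p)) = A (fst p) - snd p) by (unfold t; field; lra).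
  assert (Ht : a <= t <= b) by (split; apply Rmult_le_reg_r with (A (fst p) - S (fst p)); lra).
  conj3; [lra|lra| ]. rewrite chart_eq. unfold chY.
   destruct (ang1 t ltac:(lra)) as [-> [-> [-> ->]]].
  rewrite Rmult_1_r, chX_pos by lra. replace (x0 * (fst p / x0)) with (fst p) by (field; lra).
  rewrite Et. destruct p as [x y]. simpl. f_equal. ring.
Qed.

Lemma closed_left a b p : 5 <= a <= b -> b <= 6 -> (closed_sector chart (a / 10) (b / 10) p <->
 - x1 <= fst p < 0 /\ (6 - b) * (A (fst p) - S (fst p)) <= A (fst p) - snd p <= (6 - a) * (A (fst
  p) - S (fst p))).
Proof.
 intros Ha Hb. split.
 - intros [r [th [Hr [Hth ->]]]]. unfold chart, chY; simpl.
  assert (G := gap_nonneg _ (ch_range r (10 * th) ltac:(lra) ltac:(lra))).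
  destruct (ang5 (10 * th) ltac:(lra)) as [E1 [-> [-> ->]]].
  rewrite E1 in *. replace (r * -1) with (- r) in * by ring. rewrite chX_neg in * by lra.
  split; [assert (0 < x1 * r <= x1) by nra; lra|]. set (gp := A (x1 * - r) - S (x1 * - r)) in *.
  assert ((6 - b) * gp <= (6 - 10 * th) * gp <= (6 - a) * gp) by (split; apply Rmult_le_compat_r;
   lra). lra.
 - intros [H1 H2]. assert (gp := SA (fst p) ltac:(lra) ltac:(lra)).
  set (t := (A (fst p) - snd p) / (A (fst p) - S (fst p))).
  exists (- fst p / x1), ((6 - t) / 10).
  assert (D := div_range (- fst p) x1 ltac:(lra) Hx1).
   assert (0 < - fst p / x1) by (apply Rdiv_lt_0_compat; lra).
  assert (Et : t * (A (fst p) - S (fst p)) = A (fst p) - snd p) by (unfold t; field; lra).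
  assert (Ht : 6 - b <= t <= 6 - a) by (split; apply Rmult_le_reg_r with (A (fst p) - S (fst p));
   lra).
  conj3; [lra|lra| ]. rewrite chart_eq. unfold chY.
   destruct (ang5 (6 - t) ltac:(lra)) as [-> [-> [-> ->]]].
  replace (- fst p / x1 * -1) with (- (- fst p / x1)) by ring. rewrite chX_neg by lra.
  replace (x1 * - (- fst p / x1)) with (fst p) by (field; lra).
   replace (6 - (6 - t)) with t by ring.
  rewrite Et. destruct p as [x y]. simpl. f_equal. ring.
Qed.

Lemma ray_closes p : ray chart 1 p <-> ray chart (0 / 10) p.
Proof.
 assert (C : forall r, chart (r, 1) = chart (r, 0 / 10)).
 { intros r. replace 1 with (10 / 10) by lra. rewrite !chart_eq. unfold chY.
  destruct (ang1 0 ltac:(lra)) as [-> [-> [-> ->]]].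
   now destruct (ang8 10 ltac:(lra)) as [-> [-> [-> ->]]]; rewrite Rminus_diag. }
 split; intros [r [th [Hr [Hth ->]]]].
 - exists r, (0 / 10). conj3; [assumption|lra| ]. rewrite <- C. repeat f_equal. lra.
 - exists r, 1. conj3; [assumption|lra| ]. rewrite C. repeat f_equal. lra.
Qed.

(** For the case without parabolic sectors: the angles from 0 to 6/10 are joined, and [S] disappears
    from the description. *)
Lemma closed_lower_full p : closed_sector chart 0 (6 / 10) p <->
 - x1 <= fst p <= x0 /\ - l (fst p) <= snd p <= A (fst p) /\ p <> origin.
Proof.
 assert (E0 : 0 = 0 / 10) by lra. split.
 - intros H. assert (Q : closed_sector chart (0 / 10) (1 / 10) p \/ closed_sector chart (1 / 10) (5
  / 10) p \/
   closed_sector chart (5 / 10) (6 / 10) p).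
  { destruct H as [r [th [Hr [Hth E]]]]. destruct (Rle_or_lt th (1 / 10)); [left|right;
   destruct (Rle_or_lt th (5 / 10)); [left|right]];
    exists r, th; (conj3; [assumption|lra|assumption]). }
  assert (Ne := nonzero_of_closed 0 (6 / 10) p ltac:(lra) ltac:(lra) H).
  destruct Q as [Q|[Q|Q]].
  + apply closed_right in Q; try lra. assert (e := lS (fst p) ltac:(lra)). conj3;
   [lra|lra|assumption].
  + apply closed_lower in Q. assert (e := gap_nonneg (fst p) ltac:(lra)). conj3;
   [lra|lra|assumption].
  + apply closed_left in Q; try lra. assert (e := lS (fst p) ltac:(lra)). conj3;
   [lra|lra|assumption].
 - intros [H1 [H2 H3]].
  assert (Inc : forall a b, 0 <= a -> b <= 6 / 10 -> closed_sector chart a b p -> closed_sector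
   chart 0 (6 / 10) p).
  { intros a b Ha Hb [r [th [Hr [Hth E]]]]. exists r, th. conj3; [assumption|lra|assumption]. }
  destruct (Rle_or_lt (snd p) (S (fst p))) as [Q|Q].
  + apply (Inc (1 / 10) (5 / 10)); [lra|lra|]. apply closed_lower. conj3;
   [assumption|lra|assumption].
  + destruct (Rtotal_order (fst p) 0) as [Z|[Z|Z]].
   * apply (Inc (5 / 10) (6 / 10)); [lra|lra|]. apply closed_left; lra.
   * exfalso. rewrite Z, ?A0, ?S0 in *. lra.
   * apply (Inc (0 / 10) (1 / 10)); [lra|lra|]. apply closed_right; lra.
Qed.

Lemma open_lower_full p : open_sector chart 0 (6 / 10) p -> snd p < A (fst p).
Proof.
 intros [r [th [Hr [Hth E]]]].
 assert (Cs : forall a b, a <= th <= b -> closed_sector chart a b p) by (intros a b Hab;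
  now exists r, th).
 destruct (Rle_or_lt th (1 / 10)) as [Q|Q]; [|destruct (Rlt_or_le th (5 / 10)) as [Q'|Q']].
 - assert (C := Cs (10 * th / 10) (10 * th / 10) ltac:(lra)). apply closed_right in C; [|lra|lra].
  assert (G := SA (fst p) ltac:(lra) ltac:(lra)).
  assert (0 < 10 * th * (A (fst p) - S (fst p))) by (apply Rmult_lt_0_compat; lra). lra.
 - assert (O := open_lower p ltac:(exists r, th; conj3; [assumption|lra|assumption])).
  assert (C := Cs (1 / 10) (5 / 10) ltac:(lra)). apply closed_lower in C.
  assert (G := gap_nonneg (fst p) ltac:(lra)). lra.
 - assert (C := Cs (10 * th / 10) (10 * th / 10) ltac:(lra)). apply closed_left in C; [|lra|lra].
  assert (G := SA (fst p) ltac:(lra) ltac:(lra)).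
  assert (0 < (6 - 10 * th) * (A (fst p) - S (fst p))) by (apply Rmult_lt_0_compat; lra). lra.
Qed.
Lemma chart_is_polar delta :
 (forall x, - x1 <= x <= x0 -> Rabs x < delta / 2 /\ Rabs (A x) + k < delta / 2 /\ Rabs (l x) <
  delta / 2) ->
 0 < delta -> polar_chart delta chart.
Proof.
 intros Hs Hd. split.
 - apply continuous_on_all. exact chart_cont.
 - intros th Hth. unfold chart, chY. simpl. rewrite !Rmult_0_l, chX_0, A0, S0. unfold origin.
  f_equal. ring.
 - intros r Hr. unfold chart, chY. simpl.
  assert (E1 : angU (10 * 0) = angU (10 * 1) /\ angV (10 * 0) = angV (10 * 1) /\
   angS (10 * 0) = angS (10 * 1) /\ angW (10 * 0) = angW (10 * 1)).
  { destruct (ang1 (10 * 0) ltac:(lra)) as [-> [-> [-> ->]]].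
   destruct (ang8 (10 * 1) ltac:(lra)) as [-> [-> [-> ->]]]. repeat split; ring. }
  destruct E1 as [-> [-> [-> ->]]]. reflexivity.
 - intros r th Hr Hth. unfold chart. simpl. apply chart_nonzero_aux; lra.
 - intros r th r' th' Hr Hth Hr' Hth' E.
  assert (E1 := f_equal fst E). assert (E2 := f_equal snd E). simpl in E1, E2.
  apply chX_inj in E1.
  destruct (Rtotal_order r r') as [H|[H|H]].
  + exfalso. apply (chart_injective_rho r (10 * th) r' (10 * th')); try assumption; lra.
  + subst r'. split; [reflexivity|]. apply Rmult_eq_reg_l in E1; [|lra].
   assert (10 * th = 10 * th'); [|lra]. apply (chart_injective_tau r); try assumption; lra.
  + exfalso. apply (chart_injective_rho r' (10 * th') r (10 * th)); try assumption; try lra;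
   now symmetry.
 (* The image is a neighborhood of the origin: near 0 the graph of [A] stays above [- k / 2] and [l]
    above [l 0 / 2], so all small points lie in the strip and are reached from above or from below
    [A]. *)
 - assert (L0 := lS 0 ltac:(lra)). rewrite S0 in L0.
  destruct (proj1 (continuous_eps l 0) (Cl 0) (l 0 / 2) ltac:(lra)) as [d2 [D2 D2']].
  destruct (proj1 (continuous_eps A 0) (CA 0) (k / 2) ltac:(lra)) as [d3 [D3 D3']].
  destruct (min3 x0 x1 d2 Hx0 Hx1 D2) as [e1 [E1 M1]].
   destruct (min3 d3 (l 0 / 2) (k / 2)) as [e2 [E2 M2]]; [lra|lra|lra|].
  destruct (min3 e1 e2 1 E1 E2 Rlt_0_1) as [e [E M3]].
  exists (mkposreal e E). intros [x y] [H1 H2].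
  
  assert (Hx : Rabs x < e) by (rewrite <- (Rplus_0_r x), <- Ropp_0; exact H1).
  assert (Hy : Rabs y < e) by (rewrite <- (Rplus_0_r y), <- Ropp_0; exact H2).
  specialize (D2' x ltac:(rewrite Rminus_0_r; lra)). specialize (D3' x ltac:(rewrite Rminus_0_r;
   lra)).
  rewrite A0, Rminus_0_r in D3'.
  apply Rabs_lt_iff in Hx. apply Rabs_lt_iff in Hy. apply Rabs_lt_iff in D2'.
   apply Rabs_lt_iff in D3'.
  assert (Rx : - x1 <= x <= x0) by lra.
  destruct (classic (x = 0 /\ y = 0)) as [[-> ->]|NZ].
  { exists 0, 0. conj3; [lra|lra| ]. unfold chart, chY. simpl. rewrite !Rmult_0_l, chX_0, A0, S0.
   f_equal. ring. }
  assert (NZ' : x <> 0 \/ y <> 0) by lra. destruct (Rle_or_lt (A x) y) as [Q|Q].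
  + destruct (in_upper x y Rx ltac:(lra) NZ') as [r [t [Hr [Ht [-> ->]]]]].
   exists r, (t / 10). conj3; [lra|lra| ]. now rewrite chart_eq.
  + destruct (proj2 (closed_lower_full (x, y))) as [r [th [Hr [Hth Exy]]]].
   { simpl. conj3; [assumption|lra|now apply plane_nonzero]. }
   exists r, th. conj3; [lra|lra|assumption].
 - intros r th Hr Hth. assert (B := chY_bounds r (10 * th) Hr ltac:(lra)).
  assert (R := ch_range r (10 * th) Hr ltac:(lra)). destruct (Hs _ R) as [Q1 [Q2 Q3]].
  assert (e := lS _ R).
  assert (Y : Rabs (chY r (10 * th)) < delta / 2).
  { set (x := chX (r * angU (10 * th))) in *. pose proof (Rle_abs (A x)).
   apply Rabs_lt_iff in Q3. assert (r * k <= k) by nra.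
   assert (- l x <= S x - r * (S x + l x)) by nra.
   apply Rabs_lt_iff. lra. }
  unfold norm; simpl. unfold prod_norm, norm; simpl. unfold abs; simpl.
  rewrite <- (sqrt_pow2 delta) by lra. apply sqrt_lt_1.
  + 
   nra.
  + nra.
  + pose proof (Rabs_pos (chX (r * angU (10 * th)))). pose proof (Rabs_pos (chY r (10 * th))). nra.
Qed.
End Chart.

(** * From the truncated flow to captured and leaving orbits *)

(** This carries the reversed system of [gT] and [fT] to the given one, so that results about the
    past on the right become results about the future on the left. *)
Definition tp (p : plane) : plane := (- fst p, snd p).

Lemma tp_tp p : tp (tp p) = p.
Proof. destruct p as [a b]. unfold tp. simpl. now rewrite Ropp_involutive. Qed.

Lemma tp_derive g f (c : R -> plane) t :
 is_derive c t (reversed (lienard (gT g) (fT f)) (c t)) ->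
 is_derive (fun s => tp (c s)) t (lienard g f (tp (c t))).
Proof.
 intros H. apply is_derive_pair.
 - assert (Q := is_derive_neg _ _ _ (is_derive_fst _ _ _ H)). 
  replace (snd (tp (c t))) with (- - snd (c t)) by (unfold tp; simpl; ring). exact Q.
 - assert (Q := is_derive_snd _ _ _ H). simpl.
  replace (- g (- fst (c t)) - f (- fst (c t)) (snd (c t)) * snd (c t))
   with (opp (- gT g (fst (c t)) - fT f (fst (c t)) (snd (c t)) * snd (c t))); [exact Q|].
  unfold gT, fT, opp. simpl. ring.
Qed.

Lemma tp_limit (c : R -> plane) : filterlim c (Rbar_locally p_infty) (locally origin) ->
 filterlim (fun s => tp (c s)) (Rbar_locally p_infty) (locally origin).
Proof.
 intros H. apply filterlim_origin in H. apply filterlim_origin. destruct H as [H1 H2].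
 split; [|exact H2]. rewrite <- Ropp_0. now apply tends_opp.
Qed.

Lemma captured_T g f S p : captured (reversed (lienard (gT g) (fT f))) (fun q => S (tp q)) (tp p) ->
 captured (lienard g f) S p.
Proof.
 intros [c [H0 [H1 H2]]]. exists (fun t => tp (c t)). split; [now rewrite H0, tp_tp|]. split.
 - intros t Ht. split; [|now apply H1]. now apply tp_derive, H1.
 - now apply tp_limit.
Qed.

Lemma leaves_T g f S p : leaves (reversed (lienard (gT g) (fT f))) (fun q => S (tp q)) (tp p) ->
 leaves (lienard g f) S p.
Proof.
 intros [c [T [HT [H0 [H1 H2]]]]]. exists (fun t => tp (c t)), T.
 conj4; [assumption|now rewrite H0, tp_tp| |exact H2].
 intros t Ht. now apply tp_derive, H1.
Qed.

Lemma is_derive_curve_reverse (X : plane -> plane) (c : R -> plane) t : is_derive c (- t) (X (c (-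
 t))) ->
 is_derive (fun s => c (- s)) t (reversed X (c (- t))).
Proof.
 intros H. apply (is_derive_ext (fun s => (fst (c (- s)), snd (c (- s))) : plane)).
 { intros s. now destruct (c (- s)). }
 unfold reversed. rewrite (surjective_pairing (X (c (- t)))). 
 apply is_derive_pair.
 - apply (is_derive_reverse (fun s => fst (c s))). now apply is_derive_fst.
 - apply (is_derive_reverse (fun s => snd (c s))). now apply is_derive_snd.
Qed.

Lemma reversed_reversed X : reversed (reversed X) = X.
Proof. apply functional_extensionality. intros p. unfold reversed. now rewrite opp_opp. Qed.

Lemma homoclinic_reversed X p : homoclinic X p -> homoclinic (reversed X) p.
Proof.
 intros [Np [w [W0 [W1 [W2 W3]]]]]. split; [assumption|]. exists (fun t => w (- t)).
 conj4; [now rewrite Ropp_0| | | ].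
 - intros t. now apply is_derive_curve_reverse.
 - apply filterlim_origin. now apply filterlim_origin_back in W3.
 - apply filterlim_origin_back. apply filterlim_origin in W2.
  split; [apply (tends_ext (fun t => fst (w t)))|apply (tends_ext (fun t => snd (w t)))];
   try (intros; now rewrite Ropp_involutive); apply W2.
Qed.

Lemma captured_backward N g f (S : plane -> Prop) x y : flow N (vf N g f) x y ->
 inbox N x y (fun t => t <= 0) -> (forall t, t <= 0 -> S (x t, y t)) ->
 tends (fun t => x (- t)) 0 -> tends (fun t => y (- t)) 0 ->
 captured (reversed (lienard g f)) S (x 0, y 0).
Proof.
 intros Hf Hb HS Hx Hy. exists (fun t => (x (- t), y (- t)) : plane).
 conj3; [now rewrite Ropp_0| | ].
 - intros t Ht. split; [|apply HS; lra].
  apply (is_derive_curve_reverse (lienard g f) (fun t => (x t, y t))).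
  apply (curve_of_xsol g f (fun t => t <= 0)); [|lra].
  apply (xsol_of_sol N); [|assumption]. now apply flow_sol.
 - apply filterlim_origin. now split.
Qed.

(** Leaving concerns the original system, which the truncated flow follows only inside the box of
    size [N]. If the backward orbit reaches the boundary of that box first, it has already left [S],
    which lies in the smaller box of size [e]. *)
Lemma leaves_backward N e g f (S : plane -> Prop) x y T : e < N -> flow N (vf N g f) x y ->
 (forall a b, S (a, b) -> Rabs a <= e /\ Rabs b <= e) -> S (x 0, y 0) -> T <= 0 -> ~ S (x T, y T) ->
 leaves (reversed (lienard g f)) S (x 0, y 0).
Proof.
 intros He Hf HS S0 HT HTS.
 assert (Fin : forall T, T <= 0 -> ~ S (x T, y T) -> inbox N x y (fun t => T <= t <= 0) ->
  leaves (reversed (lienard g f)) S (x 0, y 0)).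
 { clear T HT HTS. intros T HT HTS Hb. destruct (Req_dec T 0) as [->|NT]; [now elim HTS|].
  exists (fun t => (x (- t), y (- t)) : plane), (- T).
  conj4; [lra|now rewrite Ropp_0| |now rewrite Ropp_involutive].
  intros t Ht. apply (is_derive_curve_reverse (lienard g f) (fun t => (x t, y t))).
  apply (curve_of_xsol g f (fun t => T <= t <= 0)); [|lra].
  apply (xsol_of_sol N); [|assumption]. now apply flow_sol. }
 set (h := fun s => N - Rmax (Rabs (x (- s))) (Rabs (y (- s)))).
 assert (Ch : forall s, continuous h s).
 { intros s. apply (continuous_minus (V := R_NormedModule)); [apply continuous_const|].
  assert (Co : forall z : R -> R, (forall t,
   continuous z t) -> continuous (fun s => Rabs (z (- s))) s).
  { intros z Cz. apply (continuous_comp (fun s => z (- s)) Rabs); [|apply continuous_Rabs].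
   apply (continuous_comp Ropp z); [|apply Cz]. apply (continuous_opp (V := R_NormedModule)),
    continuous_id. }
  apply (Rmax_cont (fun s => Rabs (x (- s))) (fun s => Rabs (y (- s)))); apply Co; intros t.
  - eapply flow_cont_x; eassumption.
  - eapply flow_cont_y; eassumption. }
 assert (Hpos : forall s, 0 <= h s -> Rabs (x (- s)) <= N /\ Rabs (y (- s)) <= N).
 { intros s Hs. unfold h in Hs. pose proof (Rmax_l (Rabs (x (- s))) (Rabs (y (- s)))).
  pose proof (Rmax_r (Rabs (x (- s))) (Rabs (y (- s)))). lra. }
 destruct (classic (exists s, 0 <= s <= - T /\ h s <= 0)) as [[s [Hs1 Hs2]]|Hn].
 - destruct (first_zero h 0 s) as [r [Hr1 [Hr2 Hr3]]]; [lra|intros; apply Ch| |assumption|].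
  { unfold h. rewrite Ropp_0. destruct (HS _ _ S0). unfold Rmax. destruct Rle_dec; lra. }
  apply (Fin (- r)); [lra| |].
  + intros Hc. destruct (HS _ _ Hc) as [Q1 Q2]. unfold h in Hr2. unfold Rmax in Hr2.
   destruct Rle_dec; lra.
  + intros t Ht. replace t with (- - t) by ring. apply Hpos.
   destruct (Req_dec (- t) r) as [->|NE]; [lra|]. left. apply Hr3. lra.
 - apply (Fin T); [assumption|assumption|]. intros t Ht. replace t with (- - t) by ring. apply Hpos.
  destruct (Rle_or_lt (h (- t)) 0) as [Q|Q]; [|lra]. elim Hn. exists (- t). split; [lra|assumption].
Qed.

Lemma periodic_T g f p : periodic (lienard (gT g) (fT f)) (tp p) -> periodic (lienard g f) p.
Proof.
 intros [c [T [HT [H0 [H1 [H2 [t Ht]]]]]]]. exists (fun s => tp (c (- s))), T.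
 conj5; [assumption|now rewrite Ropp_0, H0, tp_tp| | | ].
 - intros s. apply (tp_derive g f (fun s => c (- s))). now apply is_derive_curve_reverse.
 - intros s. f_equal. rewrite <- (H2 (- (s + T))). f_equal. ring.
 - exists (- t). intros E. apply Ht. rewrite Ropp_involutive in E. now rewrite <- E, tp_tp.
Qed.

(* The abscissa is monotone along the backward orbit, hence has a limit, which is a rest point. *)
Lemma emanates_of_nonneg N g f x y M : half g f -> 0 < N -> flow N (vf N g f) x y ->
 (forall t, t <= 0 -> 0 <= y t) -> (forall t, t <= 0 -> - M <= x t) -> (x 0 <> 0 \/ y 0 <> 0) ->
 emanates x y.
Proof.
 intros Hh HN Hf Hy Hx Hne. assert (FF := vf_field g f Hh N HN).
 assert (Mono : forall s t, s <= t <= 0 -> x s <= x t).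
 { intros s t Hst. apply (derive_nondecr x (fun r => cl N (y r))); [lra|intros; now apply Hf|].
  intros r Hr. apply cl_nonneg; [lra|]. apply Hy. lra. }
 assert (FL := flip_flow N _ x y HN Hf).
 destruct (tends_nondecr (fun t => - x (- t)) M) as [v [Hv _]].
 { intros s t Hst. assert (Q := Mono (- t) (- s) ltac:(lra)). lra. }
 { intros t Ht. specialize (Hx (- t) ltac:(lra)). lra. }
 assert (Hv' : tends (fun t => x (- t)) (- v)).
 { apply (tends_ext (fun t => - - x (- t))); [intros; ring|now apply tends_opp]. }
 destruct (flow_limit N _ _ _ _ HN (flip_field _ FF) FL Hv') as [L1 L2].
 unfold flipF, vf in L2. rewrite Ropp_0, cl_0, Rmult_0_r in L2 by lra.
 assert (V0 : v = 0).
 { 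
  destruct (Rtotal_order (- v) 0) as [Q|[Q|Q]]; [|lra|]; exfalso.
  - apply (cl_neg N) in Q; [|assumption]. apply (half_neg g f Hh) in Q. lra.
  - apply (cl_pos N) in Q; [|assumption]. apply (half_pos g f Hh) in Q. lra. }
 subst v. rewrite Ropp_0 in Hv'.
 assert (X0 : forall t, t <= 0 -> 0 <= x t).
 { intros t Ht. apply (tends_le _ _ (x t) (- t) Hv'). intros s Hs. apply Mono. lra. }
 assert (Xp : forall t, t <= 0 -> 0 < x t).
 { intros t Ht. destruct (X0 t Ht) as [Q|Q]; [assumption|]. exfalso.
  assert (Z : forall s, s <= t -> x s = 0).
  { intros s Hs. assert (m1 := X0 s ltac:(lra)). assert (m2 := Mono s t ltac:(lra)). lra. }
  assert (Zy : y (t - 1) = 0).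
  { destruct (Hy (t - 1) ltac:(lra)) as [Qy|Qy]; [|now symmetry]. exfalso.
   assert (D := proj1 (Hf (t - 1) I)).
   assert (D0 : is_derive x (t - 1) 0).
   { apply (is_derive_ext_loc (fun _ => 0)); [|auto_derive; [trivial|reflexivity]].
    exists (mkposreal 1 ltac:(lra)). intros s Hs. unfold ball in Hs; simpl in Hs.
    unfold AbsRing_ball, abs, minus, plus, opp in Hs; simpl in Hs. apply Rabs_lt_iff in Hs.
    symmetry. apply Z. lra. }
   apply is_derive_unique in D. apply is_derive_unique in D0. rewrite D in D0.
   apply (cl_pos N) in Qy; lra. }
  destruct (flow_rest N _ x y (t - 1) HN FF Hf (Z (t - 1) ltac:(lra)) Zy 0) as [Q1 Q2]. lra. }
 apply (emanates_of_pos N (vf N g f)); [assumption|assumption|assumption|apply Xp; lra|apply Hy;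
  lra|].
 intros t Ht. apply Xp. lra.
Qed.

(** * Centers *)

Lemma periodic_nat (h : R -> R) P : (forall t, h (t + P) = h t) -> forall n t,
 h (t + INR n * P) = h t.
Proof.
 intros Hp n. induction n as [|n IH]; intros t.
 - simpl. f_equal. ring.
 - rewrite S_INR, <- (IH t), <- (Hp (t + INR n * P)). f_equal. ring.
Qed.

Lemma periodic_reduce a P t : 0 < P -> exists s, a <= s <= a + P /\
 forall h : R -> R, (forall t, h (t + P) = h t) -> h t = h s.
Proof.
 intros HP.
 assert (N : forall u, 0 <= u -> exists n, INR n * P <= u < INR n * P + P).
 { intros u Hu. destruct (nfloor_ex (u / P)) as [n Hn]; [apply Rdiv_le_0_compat; lra|]. exists n.
  assert (E : u = u / P * P) by (field; lra). rewrite E. split; [apply Rmult_le_compat_r; lra|].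
  replace (INR n * P + P) with ((INR n + 1) * P) by ring. apply Rmult_lt_compat_r; lra. }
 destruct (Rle_or_lt a t) as [Q|Q].
 - destruct (N (t - a) ltac:(lra)) as [n Hn]. exists (t - INR n * P). split; [lra|].
  intros h Hh. rewrite <- (periodic_nat h P Hh n (t - INR n * P)). f_equal. ring.
 - destruct (N (a - t) ltac:(lra)) as [n Hn]. exists (t + INR (S n) * P). rewrite S_INR. split;
  [lra|].
  intros h Hh. rewrite <- S_INR. symmetry. now apply periodic_nat.
Qed.

Section Center.
Variables (g : R -> R) (f : R -> R -> R) (d L N : R).
Hypothesis HS : sys g f d L.
Hypothesis HN : 0 < N.
Hypothesis Hno : ~ has_em N (vf N g f).

Let Hh : half g f := sys_half _ _ _ _ HS.
Let HhT : half (gT g) (fT f) := half_T _ _ (sys_half _ _ _ _ HS).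
Let FF : field (vf N g f) := vf_field g f Hh N HN.

(** Without emanating orbits, the backward orbit from the negative axis turns over in the pocket and
    then must come from the positive vertical axis. The two factors [E4] in the bound on [c0] pay
    for the energy weights of the two quadrants. *)
Lemma axis_arc e : 0 < e -> e < N -> e < d -> exists c0, 0 < c0 /\ forall c, 0 < c <= c0 ->
 forall x y, flow N (vf N g f) x y -> x 0 = 0 -> y 0 = - sqrt (2 * c) ->
 exists T2 T1, T2 < T1 < 0 /\ x T2 = 0 /\ y T1 = 0 /\ 0 < x T1 /\ (forall t,
  T2 <= t < T1 -> 0 < y t) /\
  (forall t, T1 < t <= 0 -> y t < 0) /\ (forall t, T2 < t < 0 -> 0 < x t) /\
  inbox e x y (fun t => T2 <= t <= 0).
Proof.
 intros He HeN Hed. assert (HO := sys_right _ _ _ _ HS). assert (HL : 0 <= L) by apply HO.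
 destruct (pocket_exists g f Hh L e HL He) as [c1 [C1 HC]].
 set (E4 := exp (2 * L * e)). assert (P4 : 0 < E4) by apply exp_pos.
 destruct (min3 c1 (e * e / (2 * (E4 * E4))) 1 C1) as [c0 [C0 [M1 [M2 _]]]]; [|lra|].
 { apply Rdiv_lt_0_compat; [|apply Rmult_lt_0_compat; [lra|]]; now apply Rmult_lt_0_compat. }
 exists c0. split; [assumption|]. intros c Hc x y H Ex Ey.
 destruct (HC c ltac:(lra)) as [X0 HP]. assert (HP' := HP). destruct HP' as [_ [HX0 _]].
 assert (Sq : 0 < sqrt (2 * c)) by (apply sqrt_lt_R0; lra).
 destruct (pocket_backward g f Hh N d L e c X0 x y HN HO He HeN Hed HP H) as [T1 [T1n [Ty [Tx [Tn
  Tp]]]]].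
 { lra. }
 { rewrite Ex, Ey. split; [lra|]. unfold En. rewrite Gp_0, Rmult_0_r, exp_0.
  replace (- sqrt (2 * c) * - sqrt (2 * c)) with (sqrt (2 * c) * sqrt (2 * c)) by ring.
  rewrite sqrt_sqrt by lra. lra. }
 destruct (Tp T1 ltac:(lra)) as [TX TE].
 assert (HSh := flow_shift N _ x y T1 H).
 destruct (emanates_or_hits N _ _ _ HN FF HSh) as [Em|[T' [T'n [T'x [T'y T'p]]]]].
 { now rewrite Rplus_0_l. }
 { rewrite Rplus_0_l. lra. }
 { elim Hno. eexists _, _. split; [exact HSh|exact Em]. }
 assert (U := upper_backward_small g f Hh N d L e _ _ T' HN HO He HeN Hed HSh ltac:(lra) T'p).
 cbv beta in U. rewrite !Rplus_0_l in U.
 assert (U' : forall t, T' <= t <= 0 -> Rabs (x (t + T1)) <= e /\ Rabs (y (t + T1)) <= e).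
 { apply U; [lra|lra|]. apply Rle_trans with (2 * (E4 * (c * E4))).
  - rewrite Rmult_assoc. apply Rmult_le_compat_l; [lra|]. apply Rmult_le_compat.
   + left. apply exp_pos.
   + rewrite Ty. unfold En. pose proof (Gp_nonneg g f Hh (x T1) ltac:(lra)). lra.
   + unfold E4. apply exp_nondecr. apply Rmult_le_compat_l; lra.
   + apply Rle_trans with (1 := TE). apply Rmult_le_compat_l; [lra|]. unfold E4. apply exp_nondecr.
    apply Rmult_le_compat_l; lra.
  - apply Rle_trans with (2 * (E4 * (c0 * E4))).
   + apply Rmult_le_compat_l; [lra|]. apply Rmult_le_compat_l; [lra|]. apply Rmult_le_compat_r; lra.
   + replace (e * e) with (2 * (E4 * (e * e / (2 * (E4 * E4)) * E4))) by (field; lra).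
    apply Rmult_le_compat_l; [lra|]. apply Rmult_le_compat_l; [lra|]. apply Rmult_le_compat_r; lra.
     }
 exists (T' + T1), T1. split; [lra|]. split; [assumption|]. split; [assumption|]. split;
  [assumption|].
 conj4; [ |assumption| | ].
 - intros t Ht. destruct (Req_dec t (T' + T1)) as [->|Nt]; [assumption|].
  specialize (T'p (t - T1) ltac:(lra)). replace (t - T1 + T1) with t in T'p by ring. apply T'p.
 - intros t Ht. destruct (Rle_or_lt T1 t) as [Q|Q].
  + rewrite <- Ex. apply (flow_x_decr N _ x y t 0 HN H); [lra|]. intros r Hr. apply Tn. lra.
  + specialize (T'p (t - T1) ltac:(lra)). replace (t - T1 + T1) with t in T'p by ring. apply T'p.
 - intros t Ht. destruct (Rle_or_lt T1 t) as [Q|Q].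
  + apply (in_pocket_small g f Hh L e c X0 _ _ HL He HP). apply Tp. lra.
  + specialize (U' (t - T1) ltac:(lra)). now replace (t - T1 + T1) with t in U' by ring.
Qed.

(** The arc on the right has a mirror image on the left through the same two points of the vertical
    axis; together they close up with period [- T3 - T2]. *)
Lemma axis_periodic : exists c0, 0 < c0 /\ forall c, 0 < c <= c0 ->
 forall x y, flow N (vf N g f) x y -> x 0 = 0 -> y 0 = - sqrt (2 * c) ->
 (exists P, 0 < P /\ (forall t, x (t + P) = x t) /\ (forall t, y (t + P) = y t)) /\
 inbox N x y (fun _ => True) /\ (exists t, 0 < y t) /\
 exists T2 T1, T2 < T1 < 0 /\ x T2 = 0 /\ y T1 = 0 /\ 0 < x T1 /\ (forall t,
  T2 <= t < T1 -> 0 < y t) /\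
  (forall t, T1 < t <= 0 -> y t < 0).
Proof.
 destruct (Gp_small g f (gT g) (fT f) Hh HhT N HN) as [e0 [E1 E2]].
 assert (Hd : 0 < d) by apply (sys_right _ _ _ _ HS).
 destruct (min3 (e0 / 2) (N / 2) (d / 2)) as [e [He [M1 [M2 M3]]]]; [lra|lra|lra|].
 destruct (axis_arc e He ltac:(lra) ltac:(lra)) as [c0 [C0 HC]].
 exists c0. split; [assumption|]. intros c Hc x y H Ex Ey.
 destruct (HC c Hc x y H Ex Ey) as [T2 [T1 [HT [Q1 [Q2 [Q3 [Q4 [Q5 [Q6 Q7]]]]]]]]].
 assert (Y2 : 0 < y T2) by (apply Q4; lra).
 assert (Sq : 0 < sqrt (2 * c)) by (apply sqrt_lt_R0; lra).
 destruct (mirror_arc g f (gT g) (fT f) N N Hh HhT (sys_conj _ _ _ _ HS) HN ltac:(lra) x y T2 H)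
  as [x2 [y2 [T3 [K1 [K2 [K3 [K4 [K5 [K6 [K7 K8]]]]]]]]]]; auto; try lra.
 { intros t Ht. destruct (Q7 t Ht). lra. }
 { intros t Ht. left. apply E2. destruct (Q7 t ltac:(lra)). lra. }
 apply flow_T in K1; [|assumption]. rewrite gT_gT, fT_fT in K1.
 assert (Eq := flow_unique N _ _ _ _ _ 0 FF H K1). cbv beta in Eq. rewrite Ropp_0 in Eq.
 specialize (Eq ltac:(lra) ltac:(lra)).
 set (P := - T3 - T2). assert (HP : 0 < P) by (unfold P; lra).
 assert (Per : forall t, x (t + P) = x t /\ y (t + P) = y t).
 { intros t. destruct (flow_unique N _ _ _ _ _ T2 FF (flow_shift N _ x y P H) H) with (t := t) as
  [W1 W2];
   [| |now split]; replace (T2 + P) with (- T3) by (unfold P; ring);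
   destruct (Eq (- T3)) as [V1 V2]; rewrite Ropp_involutive in V1, V2; lra. }
 split; [exists P; split; [assumption|split; intros; apply Per]|].
 conj3; [ |exists T2; assumption|exists T2, T1; now auto 10].
 intros t _. destruct (periodic_reduce T2 P t HP) as [s [Hs Hp]].
 rewrite (Hp x), (Hp y) by (intros; apply Per).
 destruct (Rle_or_lt s 0) as [Z|Z]; [destruct (Q7 s); lra|].
 destruct (Eq s) as [-> ->]. rewrite Rabs_Ropp. apply K8. unfold P in Hs. lra.
Qed.

Lemma upper_arc_graph (x y : R -> R) T2 T1 : flow N (vf N g f) x y -> T2 < T1 -> x T2 = 0 -> y T1 =
 0 ->
 (forall t, T2 <= t < T1 -> 0 < y t) ->
 exists U : R -> R, (forall v, continuous U v) /\ (forall t, T2 <= t <= T1 -> U (x t) = y t) /\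
  (forall v, x T1 <= v -> U v = 0) /\ (forall v, 0 <= v <= x T1 -> exists t,
   T2 <= t <= T1 /\ x t = v).
Proof.
 intros H HT Ex Ey Hy.
 assert (H' := flip_flow N _ _ _ HN (flow_shift N _ x y T2 H)).
 assert (A1 : T2 - T1 < 0) by lra.
 assert (A2 : x (- 0 + T2) = 0) by now rewrite Ropp_0, Rplus_0_l.
 assert (A3 : forall t, T2 - T1 < t <= 0 -> - y (- t + T2) < 0).
 { intros t Ht. specialize (Hy (- t + T2) ltac:(lra)). lra. }
 assert (A4 : - (T2 - T1) + T2 = T1) by ring.
 destruct (lower_arc_graph N _ _ _ _ HN H' A1 A2) as [Lw [CL [EL RL]]]; [|exact A3|].
 { rewrite A4, Ey. ring. }
 rewrite A4 in RL. exists (fun v => - Lw v). conj4.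
 - intros v. apply (continuous_opp (V := R_NormedModule)), CL.
 - intros t Ht. specialize (EL (- t + T2) ltac:(lra)).
  replace (- (- t + T2) + T2) with t in EL by ring. lra.
 - intros v Hv. rewrite (RL v Hv). apply Ropp_0.
 - intros v Hv. destruct (lower_arc_onto N _ _ _ (T2 - T1) v H' A1 A2) as [t [Ht Et]];
  [now rewrite A4|].
  exists (- t + T2). split; [lra|assumption].
Qed.

(** The radius [delta] places the point between the upper graph [U] and the lower graph [Lw] of one
    periodic orbit. Enclosed there, its orbit meets the negative axis no lower than [yq 0], where
    [axis_periodic] applies. *)
Lemma center_right : exists delta, 0 < delta /\ forall a b, 0 <= a < delta -> Rabs b < delta ->
 (a <> 0 \/ b <> 0) -> periodic (lienard g f) (a, b).
Proof.
 destruct axis_periodic as [c0 [C0 HC]].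
 assert (NR : no_rest N (vf N g f)) by (apply (vf_no_rest g f Hh N d L HN); apply HS).
 assert (Sq : 0 < sqrt (2 * c0)) by (apply sqrt_lt_R0; lra).
 destruct (flow_exists N _ 0 (- sqrt (2 * c0)) HN FF) as [xq [yq [Xq [Yq Hq]]]].
 destruct (HC c0 ltac:(lra) xq yq Hq Xq Yq) as [_ [_ [_ [T2 [T1 [HT [Q1 [Q2 [Q3 [Q4 Q5]]]]]]]]]].
 destruct (upper_arc_graph xq yq T2 T1 Hq ltac:(lra) Q1 Q2 Q4) as [U [CU [EU [UR UO]]]].
 destruct (lower_arc_graph N _ xq yq T1 HN Hq ltac:(lra) Xq Q2 Q5) as [Lw [CL [EL RL]]].
 assert (U0 := EU T2 ltac:(lra)); rewrite Q1 in U0.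
 assert (L0 := EL 0 ltac:(lra)); rewrite Xq in L0.
 assert (Y2 : 0 < yq T2) by (apply Q4; lra).
 destruct (continuous_pos (fun v => U v - yq T2 / 2) 0) as [d1 [D1 E1]].
 { apply (continuous_minus (V := R_NormedModule)); [apply CU|apply continuous_const]. }
 { lra. }
 destruct (continuous_neg (fun v => Lw v - yq 0 / 2) 0) as [d2 [D2 E2]].
 { apply (continuous_minus (V := R_NormedModule)); [apply CL|apply continuous_const]. }
 { lra. }
 destruct (min3 d1 d2 (xq T1) D1 D2 Q3) as [m1 [P1 [M1 [M2 M3]]]].
 destruct (min3 m1 (yq T2 / 2) (- yq 0 / 2) P1) as [delta [P2 [M4 [M5 M6]]]]; [lra|lra|].
 exists delta. split; [assumption|]. intros a b Ha Hb Hne.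
 assert (Ra : Rabs (a - 0) < delta) by (rewrite Rminus_0_r, Rabs_pos_eq; lra).
 specialize (E1 a ltac:(lra)). specialize (E2 a ltac:(lra)). cbv beta in E1, E2.
 apply Rabs_lt_iff in Hb.
 destruct (flow_exists N _ a b HN FF) as [x [y [Ex [Ey H]]]].
 assert (A : exists T, x T = 0 /\ yq 0 <= y T < 0).
 { destruct (Rlt_or_le b 0) as [B|B].
  - destruct (Req_dec a 0) as [Z|Z]; [exists 0; rewrite Ex, Ey; lra|].
   destruct (lower_forward N _ x y HN FF NR H) as [T [T3 [T4 [T5 T6]]]]; [lra|lra|].
   exists T. conj3; [assumption| |assumption].
   assert (W := lower_arc_side N _ xq yq T1 Lw x y T 1 HN FF Hq H ltac:(lra) Xq Q2 Q5 CL EL RL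
    (or_introl eq_refl)).
   specialize (W ltac:(intros s Hs; rewrite Rmult_1_l; now apply T6)).
   rewrite Ex, Ey in W. specialize (W ltac:(lra) ltac:(lra) ltac:(lra) T ltac:(lra)).
   rewrite Rmult_1_l, T4, L0 in W. exact W.
  - destruct (inside_arc N _ xq yq T1 U (fun t => T2 < t < T1) x y HN FF NR Hq H) as [T [_ [T4
   T5]]]; try assumption.
   + lra.
   + lra.
   + intros t. apply between_open.
   + intros t Ht. apply EU. lra.
   + intros v Hv. destruct (UO v ltac:(lra)) as [t [Ht Et]]. exists t. split; [|assumption].
    split; apply Rnot_le_lt; intros Z.
    * assert (t = T2) by lra. subst t. lra.
    * assert (t = T1) by lra. subst t. lra.
   + rewrite Ex. lra.
   + rewrite Ex, Ey. lra.
   + intros Z. rewrite Ex in Z. rewrite Ey. lra.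
   + now exists T. }
 destruct A as [T [T3 T4]]. set (c := y T * y T / 2).
 assert (Hc : y T = - sqrt (2 * c)).
 { unfold c. replace (2 * (y T * y T / 2)) with ((- y T)²) by (unfold Rsqr; field).
  rewrite sqrt_Rsqr; lra. }
 assert (Hc' : 0 < c <= c0).
 { split; [unfold c; pose proof (Rmult_lt_0_compat (- y T) (- y T) ltac:(lra) ltac:(lra)); lra|].
  assert (Q := sqrt_sqrt (2 * c0) ltac:(lra)). rewrite Yq in T4. unfold c.
  assert (- y T * - y T <= sqrt (2 * c0) * sqrt (2 * c0)) by (apply Rmult_le_compat; lra). lra. }
 destruct (HC c Hc' _ _ (flow_shift N _ x y T H)) as [[P [HP [Px Py]]] [Bx [[t1 Ht1] _]]].
 { now rewrite Rplus_0_l, T3. }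
 { now rewrite Rplus_0_l, Hc. }
 exists (fun t => (x t, y t) : plane), P. split; [assumption|]. split; [now rewrite Ex, Ey|].
 conj3.
 - intros t. apply (curve_of_xsol g f (fun _ => True)); [|exact I].
  apply (xsol_of_sol N); [exact H|]. intros s _. specialize (Bx (s - T) I).
  cbv beta in Bx. replace (s - T + T) with s in Bx by ring. exact Bx.
 - intros t. specialize (Px (t - T)). specialize (Py (t - T)). cbv beta in Px, Py.
  replace (t - T + P + T) with (t + P) in Px, Py by ring. replace (t - T + T) with t in Px,
   Py by ring.
  now rewrite Px, Py.
 - destruct (Rle_or_lt 0 b) as [B|B].
  + exists T. intros E. injection E as E3 E4. lra.
  + exists (t1 + T). intros E. injection E as E3 E4. lra.
Qed.
End Center.

Lemma norm_plane_lt (p : plane) r : norm p < r -> Rabs (fst p) < r /\ Rabs (snd p) < r.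
Proof.
 intros H. destruct p as [a b]. unfold norm in H; simpl in H. unfold prod_norm, norm in H;
  simpl in H.
 unfold abs in H; simpl in H.
 assert (Q : forall u v, Rabs u * (Rabs u * 1) + Rabs v * (Rabs v * 1) = Rabs v * (Rabs v * 1) +
  Rabs u * (Rabs u * 1))
  by (intros; ring).
 assert (S1 : forall u v, Rabs u <= sqrt (Rabs u * (Rabs u * 1) + Rabs v * (Rabs v * 1))).
 { intros u v. rewrite <- (sqrt_Rsqr (Rabs u)) at 1 by apply Rabs_pos. apply sqrt_le_1_alt.
  unfold Rsqr.
  pose proof (Rle_0_sqr (Rabs v)). unfold Rsqr in *. lra. }
 assert (S2 := S1 a b). assert (S3 := S1 b a). rewrite Q in S3. simpl. lra.
Qed.

Lemma center_of_no_em g f d L N : sys g f d L -> 0 < N -> ~ has_em N (vf N g f) -> center (lienard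
 g f).
Proof.
 intros HS HN Hno. assert (HST := sys_T _ _ _ _ HS).
 destruct (center_right g f d L N HS HN Hno) as [d1 [D1 H1]].
 destruct (center_right _ _ d L N HST HN) as [d2 [D2 H2]].
 { intros Q. apply Hno. apply (has_em_T _ _ d L HST) in Q; [|assumption]. now rewrite gT_gT,
  fT_fT in Q. }
 exists (Rmin d1 d2). split; [now apply Rmin_glb_lt|]. intros p Hp Hn. apply plane_nonzero in Hp.
 apply norm_plane_lt in Hn. assert (m1 := Rmin_l d1 d2). assert (m2 := Rmin_r d1 d2).
 destruct Hn as [Ha Hb]. destruct (Rle_or_lt 0 (fst p)) as [Q|Q].
 - rewrite (surjective_pairing p). rewrite Rabs_pos_eq in Ha by assumption. apply H1; lra ||
  assumption.
 - apply periodic_T. rewrite Rabs_left in Ha by assumption. unfold tp. apply H2; lra.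
Qed.

(** * Sectors *)

(* [A] is the topmost emanating graph over [0, X]; the homoclinic orbits fill what lies below the
  emanating graph [U <= A], in the pocket. *)
Record side (g : R -> R) (f : R -> R -> R) (L d e c X : R) (A U : R -> R) : Prop := {
 side_pocket : exists e', 0 < e' < 1 /\ e' < d /\ e' <= e /\ pocket g L e' c X;
 side_top : topmost 1 (vf 1 g f) X A;
 side_em : exists xs ys, flow 1 (vf 1 g f) xs ys /\ emanates xs ys /\ xs 0 = X /\ graph_of xs ys U;
 side_pos : forall v, 0 < v <= X -> 0 < U v;
 side_le : forall v, 0 < v <= X -> U v <= A v;
 side_small : forall v, 0 <= v <= X -> A v <= e;
 side_hom : forall a b, 0 < a <= X -> 0 <= b < U a -> hom g f a b }.

Definition band (g : R -> R) (f : R -> R -> R) (X : R) (A U : R -> R) : Prop :=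
 forall a, 0 < a <= X -> U a < A a /\ forall b, U a <= b <= A a -> ~ hom g f a b.

(** The lower boundary of the pocket, obtained by solving [En x y = c * exp (2 * L * x)] for
    [- y]. *)
Definition lowl (g : R -> R) (L c x : R) : R := sqrt (2 * (c * exp (2 * L * x) - Gp g x)).

(** * The right halves of the elliptic, hyperbolic and parabolic sectors *)

Section Right.
Variables (g : R -> R) (f : R -> R -> R) (d L e c X : R) (A U : R -> R).
Hypothesis HS : sys g f d L.
Hypothesis SD : side g f L d e c X A U.

Let Hh : half g f := sys_half _ _ _ _ HS.
Let F1 : field (vf 1 g f) := vf_field g f Hh 1 Rlt_0_1.

Lemma side_X : 0 < X <= e.
Proof. destruct (side_pocket _ _ _ _ _ _ _ _ _ SD) as [e' [H1 [H2 [H3 [_ [H4 _]]]]]]. lra. Qed.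

Lemma side_c : 0 < c.
Proof. destruct (side_pocket _ _ _ _ _ _ _ _ _ SD) as [e' [H1 [H2 [H3 [H4 _]]]]]. exact H4. Qed.

Lemma side_graph : exists xs ys,
 flow 1 (vf 1 g f) xs ys /\ emanates xs ys /\ xs 0 = X /\ graph_of xs ys A.
Proof. exact (proj1 (side_top _ _ _ _ _ _ _ _ _ SD)). Qed.

Lemma side_U_cont v : continuous U v.
Proof. destruct (side_em _ _ _ _ _ _ _ _ _ SD) as [xs [ys [_ [_ [_ H]]]]]. apply H. Qed.

Lemma side_A_cont v : continuous A v.
Proof. destruct side_graph as [xs [ys [_ [_ [_ H]]]]]. apply H. Qed.

Lemma side_U_left v : v <= 0 -> U v = 0.
Proof. destruct (side_em _ _ _ _ _ _ _ _ _ SD) as [xs [ys [_ [_ [_ H]]]]]. apply H. Qed.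

Lemma side_A_left v : v <= 0 -> A v = 0.
Proof. destruct side_graph as [xs [ys [_ [_ [_ H]]]]]. apply H. Qed.

Lemma lowl_cont x : continuous (lowl g L c) x.
Proof.
 apply (continuous_comp (fun x => 2 * (c * exp (2 * L * x) - Gp g x)) sqrt);
  [|apply continuous_sqrt].
 apply (continuous_mult (K := R_AbsRing)); [apply continuous_const|].
 apply (continuous_minus (V := R_NormedModule)); [|apply (Gp_cont g f Hh)].
 apply (is_derive_continuous _ _ (c * (2 * L * exp (2 * L * x)))). auto_derive; [trivial|ring].
Qed.

Lemma lowl_0 : lowl g L c 0 = sqrt (2 * c).
Proof. unfold lowl. f_equal. rewrite Gp_0, Rmult_0_r, exp_0. ring. Qed.

Lemma lowl_pocket x y : 0 <= x <= X -> y <= 0 -> (- lowl g L c x <= y <-> in_pocket g L c X x y).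
Proof.
 intros Hx Hy. destruct (side_pocket _ _ _ _ _ _ _ _ _ SD) as [e' [_ [_ [_ [P1 [P2 [P3 [P4
  _]]]]]]]].
 assert (Q : 0 <= 2 * (c * exp (2 * L * x) - Gp g x)).
 { destruct (Req_dec x X) as [->|N]; [rewrite P3; lra|]. specialize (P4 x ltac:(lra)). lra. }
 unfold lowl, in_pocket, En. split.
 - intros H. split; [assumption|]. assert (S := sqrt_sqrt _ Q). set (s := sqrt _) in *.
  assert (- y * - y <= s * s) by (apply Rmult_le_compat; lra). lra.
 - intros [_ H]. assert (S : sqrt ((- y)²) <= sqrt (2 * (c * exp (2 * L * x) - Gp g x))).
  { apply sqrt_le_1_alt. unfold Rsqr. lra. }
  rewrite sqrt_Rsqr in S by lra. lra.
Qed.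

Lemma lowl_small x : 0 <= x <= X -> Rabs (lowl g L c x) <= e.
Proof.
 intros Hx. assert (0 <= lowl g L c x) by apply sqrt_pos.
 destruct (side_pocket _ _ _ _ _ _ _ _ _ SD) as [e' [Q1 [_ [Q3 Q4]]]].
 assert (P := proj1 (lowl_pocket x (- lowl g L c x) Hx ltac:(lra)) ltac:(lra)).
 destruct (in_pocket_small g f Hh L e' c X _ _ (proj1 (proj2 (sys_right _ _ _ _ HS))) (proj1 Q1) Q4
  P) as [_ Q].
 rewrite Rabs_Ropp in Q. lra.
Qed.

(** The right half of the closed elliptic sector; the last clause removes the origin. *)
Definition region (x y : R) : Prop :=
 0 <= x <= X /\ - lowl g L c x <= y <= U x /\ (0 < x \/ y < 0).

Lemma region_upper x y : flow 1 (vf 1 g f) x y -> 0 < x 0 <= X -> 0 <= y 0 <= U (x 0) ->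
 emanates x y /\ forall t, t <= 0 -> 0 < x t <= X /\ 0 <= y t <= U (x t).
Proof.
 intros H Hx Hy. destruct (side_em _ _ _ _ _ _ _ _ _ SD) as [xs [ys [K1 [K2 [K3 K4]]]]].
 destruct (emanates_below 1 _ xs ys U x y Rlt_0_1 F1 K1 H K4) as [Em Le]; [lra|assumption|].
 split; [assumption|]. intros t Ht. assert (Em' := Em). destruct Em' as [_ [_ [E1 _]]].
 destruct (Req_dec t 0) as [->|Nt]; [lra|]. destruct (E1 t ltac:(lra)).
 assert (W := emanates_x_incr 1 _ x y Rlt_0_1 H Em t 0 ltac:(lra)). specialize (Le t Ht). lra.
Qed.

(** [T] is a time at which the backward orbit is in the upper part of the region: 0 if it starts
    there, otherwise its turning point out of the pocket. From then on it lies below [U] and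
    emanates. *)
Lemma region_backward x y : flow 1 (vf 1 g f) x y -> region (x 0) (y 0) ->
 (forall t, t <= 0 -> region (x t) (y t)) /\ tends (fun t => x (- t)) 0 /\ tends (fun t => y (- t))
  0 /\
 exists T, T <= 0 /\ 0 < x T <= X /\ 0 <= y T /\ y T <= U (x T) /\
  (T < 0 -> y T = 0 /\ inbox 1 x y (fun t => T <= t <= 0)).
Proof.
 intros H [R1 [R2 R3]].
 assert (Sq : forall x, 0 <= lowl g L c x) by (intros; apply sqrt_pos).
 assert (HX := side_X).
 destruct (side_pocket _ _ _ _ _ _ _ _ _ SD) as [e' [Q1 [Q2 [Q3 Q4]]]].
 assert (HX' : X <= e') by apply Q4.
 assert (Up : forall x y : R, 0 < x <= X /\ 0 <= y <= U x -> region x y).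
 { intros a b [H1 H2]. specialize (Sq a). conj3; [lra|lra|now left]. }
 destruct (Rle_or_lt 0 (y 0)) as [B|B].
 - destruct (region_upper x y H ltac:(lra) ltac:(lra)) as [Em Le].
  split; [intros; now apply Up, Le|]. conj3; [apply Em|apply Em| ].
  exists 0. split; [lra|]. split; [lra|]. split; [lra|]. split; [lra|]. intros. lra.
 - assert (HO := sys_right _ _ _ _ HS). assert (HL : 0 <= L) by apply HO.
  destruct (pocket_backward g f Hh 1 d L e' c X x y Rlt_0_1 HO ltac:(lra) ltac:(lra) ltac:(lra) Q4
   H B)
   as [T [T1 [T2 [T3 [T4 T5]]]]]; [apply lowl_pocket; lra|].
  assert (TX : x T <= X) by (apply T5; lra).
  destruct (region_upper _ _ (flow_shift 1 _ x y T H)) as [Em Le].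
  { rewrite Rplus_0_l. lra. }
  { rewrite Rplus_0_l, T2. assert (W := side_pos _ _ _ _ _ _ _ _ _ SD (x T) ltac:(lra)). lra. }
  conj4.
  + intros t Ht. destruct (Rle_or_lt T t) as [Q|Q].
   * destruct (Req_dec t T) as [->|N].
    { specialize (Le 0 ltac:(lra)). cbv beta in Le. rewrite Rplus_0_l in Le. now apply Up. }
    assert (P := T5 t ltac:(lra)). assert (Yn := T4 t ltac:(lra)). assert (P0 := proj1 P).
    split; [assumption|]. apply lowl_pocket in P; [|assumption|lra].
    assert (0 <= U (x t)).
    { destruct (Req_dec (x t) 0) as [->|]; [rewrite side_U_left; lra|].
     left. apply (side_pos _ _ _ _ _ _ _ _ _ SD). lra. }
    split; [lra|now right].
   * specialize (Le (t - T) ltac:(lra)). cbv beta in Le. replace (t - T + T) with t in Le by ring.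
    now apply Up.
  + apply (tends_back_shift x 0 T). apply Em.
  + apply (tends_back_shift y 0 T). apply Em.
  + exists T. split; [lra|]. split; [lra|]. split; [lra|]. split.
   * rewrite T2. left. apply (side_pos _ _ _ _ _ _ _ _ _ SD). lra.
   * intros _. split; [assumption|]. intros t Ht.
    destruct (in_pocket_small g f Hh L e' c X _ _ HL ltac:(lra) Q4 (T5 t Ht)). split; lra.
Qed.

Lemma region_hom x y : flow 1 (vf 1 g f) x y -> region (x 0) (y 0) -> y 0 < U (x 0) -> hom g f (x
 0) (y 0).
Proof.
 intros H R Hy. destruct (region_backward x y H R) as [_ [_ [_ [T [T1 [T2 [T3 [T4 T5]]]]]]]].
 destruct (Req_dec T 0) as [->|N].
 - apply (side_hom _ _ _ _ _ _ _ _ _ SD); [lra|lra].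
 - destruct (T5 ltac:(lra)) as [E B]. apply (hom_segment g f d L HS 1 x y T 0 Rlt_0_1 H T1 B).
  rewrite E. apply (side_hom _ _ _ _ _ _ _ _ _ SD); [assumption|].
  split; [lra|]. now apply (side_pos _ _ _ _ _ _ _ _ _ SD).
Qed.

(** An orbit whose past stays in [y >= 0] and [x >= -1] emanates, and no emanating orbit lies above
    the topmost graph. *)
Lemma upper_leaves x y : flow 1 (vf 1 g f) x y -> x 0 <= X -> 0 < y 0 -> (0 <= x 0 -> A (x 0) < y
 0) ->
 exists t, t <= 0 /\ (x t < - 1 \/ y t < 0).
Proof.
 intros H Hx Hy HA. destruct (classic (exists t, t <= 0 /\ (x t < - 1 \/ y t < 0))) as [Q|Q];
  [assumption|exfalso].
 assert (Q' : forall t, t <= 0 -> -1 <= x t /\ 0 <= y t).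
 { intros t Ht. split; apply Rnot_lt_le; intros Z; apply Q; exists t; (split; [assumption|lra]). }
 assert (Em : emanates x y).
 { apply (emanates_of_nonneg 1 g f x y 1 Hh Rlt_0_1 H); [intros; now apply Q'|intros;
  now apply Q'|right; lra]. }
 assert (W := proj2 (side_top _ _ _ _ _ _ _ _ _ SD) x y H Em Hx). assert (P := proj1 Em).
 specialize (HA ltac:(lra)). lra.
Qed.

Hypothesis e1 : e <= 1.

Lemma side_box v : 0 <= v <= X -> Rabs v <= e /\ 0 <= U v /\ U v <= A v <= e /\ 0 <= lowl g L c v
 <= e.
Proof.
 intros Hv. assert (HX := side_X). assert (S := lowl_small v Hv).
  assert (SA := side_small _ _ _ _ _ _ _ _ _ SD v Hv).
 split; [rewrite Rabs_pos_eq; lra|]. rewrite Rabs_pos_eq in S by apply sqrt_pos.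
 assert (P := sqrt_pos (2 * (c * exp (2 * L * v) - Gp g v))). fold (lowl g L c v) in P.
 destruct (Req_dec v 0) as [->|N].
 - rewrite side_U_left, side_A_left by lra. rewrite side_A_left in SA by lra. lra.
 - assert (Q1 := side_pos _ _ _ _ _ _ _ _ _ SD v ltac:(lra)).
  assert (Q2 := side_le _ _ _ _ _ _ _ _ _ SD v ltac:(lra)). lra.
Qed.

Lemma region_box x y : region x y -> Rabs x <= 1 /\ Rabs y <= 1.
Proof.
 intros [R1 [R2 _]]. destruct (side_box x R1) as [B1 [B2 [B3 B4]]]. split; [lra|].
  apply Rabs_le_iff. lra.
Qed.

Lemma region_captured (S : plane -> Prop) a b : (forall p,
 region (fst p) (snd p) -> S p) -> region a b ->
 captured (reversed (lienard g f)) S (a, b).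
Proof.
 intros HK R. destruct (flow_exists 1 _ a b Rlt_0_1 F1) as [x [y [Ex [Ey H]]]]. subst a b.
 destruct (region_backward x y H R) as [Q1 [Q2 [Q3 _]]].
 apply (captured_backward 1 g f); try assumption; intros t Ht; [apply region_box|apply HK];
  now apply Q1.
Qed.

Lemma graph_captured (S : plane -> Prop) W a : (exists xs ys,
 flow 1 (vf 1 g f) xs ys /\ emanates xs ys /\
  xs 0 = X /\ graph_of xs ys W) -> (forall v, 0 < v <= X -> W v <= A v) ->
 (forall p, 0 < fst p <= X -> snd p = W (fst p) -> S p) -> 0 < a <= X ->
 captured (reversed (lienard g f)) S (a, W a).
Proof.
 intros [xs [ys [K1 [K2 [K3 K4]]]]] WA HK Ha.
 destruct (graph_onto _ _ _ K4 a) as [t0 [Ht0 <-]]; [lra|]. rewrite (graph_eq _ _ _ K4 t0 Ht0).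
 assert (Pos : forall t, t <= 0 -> 0 < xs t <= X /\ 0 <= ys t).
 { intros t Ht. destruct (Req_dec t 0) as [->|N]; [destruct K2; lra|].
  assert (W1 := emanates_x_incr 1 _ xs ys Rlt_0_1 K1 K2 t 0 ltac:(lra)).
  destruct K2 as [_ [_ [K2 _]]]. destruct (K2 t ltac:(lra)). lra. }
 assert (Q := captured_backward 1 g f S (fun t => xs (t + t0)) (fun t => ys (t + t0)) (flow_shift 1
  _ xs ys t0 K1)).
 cbv beta in Q. rewrite !Rplus_0_l in Q. apply Q.
 - intros t Ht. destruct (Pos (t + t0) ltac:(lra)) as [P1 P2].
  destruct (side_box (xs (t + t0)) ltac:(lra)) as [B1 [_ [B2 _]]]. specialize (WA _ P1).
  rewrite (graph_eq _ _ _ K4) in WA by lra. rewrite (Rabs_pos_eq (ys _)) by assumption. lra.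
 - intros t Ht. apply HK; [now apply Pos; lra|]. simpl. symmetry. apply (graph_eq _ _ _ K4). lra.
 - apply (tends_back_shift xs 0 t0), K2.
 - apply (tends_back_shift ys 0 t0), K2.
Qed.

Lemma band_captured (S : plane -> Prop) a b :
 (forall p, 0 < fst p <= X -> U (fst p) <= snd p <= A (fst p) -> S p) -> 0 < a <= X -> U a <= b <=
  A a ->
 captured (reversed (lienard g f)) S (a, b).
Proof.
 intros HK Ha Hb. destruct (flow_exists 1 _ a b Rlt_0_1 F1) as [x [y [Ex [Ey H]]]]. subst a b.
 destruct side_graph as [xa [ya [A1 [A2 [A3 A4]]]]].
  destruct (side_em _ _ _ _ _ _ _ _ _ SD) as [xu [yu [U1 [U2 [U3 U4]]]]].
 assert (U0 := side_pos _ _ _ _ _ _ _ _ _ SD (x 0) Ha).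
 destruct (emanates_below 1 _ xa ya A x y Rlt_0_1 F1 A1 H A4) as [Em Le]; [lra|lra|].
 assert (Ge := emanates_above 1 _ xu yu U x y Rlt_0_1 F1 U1 H U4 Em ltac:(lra) ltac:(lra)).
 assert (Pos : forall t, t <= 0 -> 0 < x t <= X).
 { intros t Ht. destruct (Req_dec t 0) as [->|N]; [lra|].
  assert (W1 := emanates_x_incr 1 _ x y Rlt_0_1 H Em t 0 ltac:(lra)).
  destruct Em as [_ [_ [Em _]]]. destruct (Em t ltac:(lra)). lra. }
 apply (captured_backward 1 g f); [assumption| | |apply Em|apply Em].
 - intros t Ht. specialize (Pos t Ht). specialize (Le t Ht). specialize (Ge t Ht).
  destruct (side_box (x t) ltac:(lra)) as [B1 [B2 [B3 _]]]. split; [lra|]. rewrite Rabs_pos_eq; lra.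
 - intros t Ht. apply HK; simpl; auto.
Qed.
End Right.

Lemma captured_forward N g f (S : plane -> Prop) x y : flow N (vf N g f) x y ->
 inbox N x y (fun t => 0 <= t) -> (forall t, 0 <= t -> S (x t, y t)) -> tends x 0 -> tends y 0 ->
 captured (lienard g f) S (x 0, y 0).
Proof.
 intros Hf Hb HS0 Hx Hy. exists (fun t => (x t, y t) : plane). conj3; [reflexivity| | ].
 - intros t Ht. split; [|now apply HS0]. apply (curve_of_xsol g f (fun t => 0 <= t)); [|assumption].
  apply (xsol_of_sol N); [|assumption]. now apply flow_sol.
 - apply filterlim_origin. now split.
Qed.

(** [captured] provides merely some solution; inside the unit box uniqueness identifies it with the
    truncated flow. *)
Lemma captured_forward_flow g f (S : plane -> Prop) p x y : half g f -> (forall q,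
 S q -> Rabs (fst q) <= 1 /\ Rabs (snd q) <= 1) ->
 captured (lienard g f) S p -> flow 1 (vf 1 g f) x y -> x 0 = fst p -> y 0 = snd p ->
 (forall t, 0 <= t -> S (x t, y t)) /\ tends x 0 /\ tends y 0.
Proof.
 intros Hh HB [w [W0 [W1 W2]]] H Ex Ey.
 assert (K : sol 1 (vf 1 g f) (fun t => 0 <= t) (fun t => fst (w t)) (fun t => snd (w t))).
 { apply sol_of_xsol; [apply xsol_of_curve; intros t Ht; now apply W1|]. intros t Ht. now apply HB,
  W1. }
 assert (Eq : forall t, 0 <= t -> x t = fst (w t) /\ y t = snd (w t)).
 { intros t Ht. apply (sol_unique 1 _ x y (fun t => fst (w t)) (fun t => snd (w t)) 0 t 0 (vf_field
  g f Hh 1 Rlt_0_1)); try lra.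
  - now apply flow_sol.
  - intros r Hr. apply K. lra.
  - now rewrite W0.
  - now rewrite W0. }
 apply filterlim_origin in W2. conj3.
 - intros t Ht. destruct (Eq t Ht) as [-> ->]. rewrite <- surjective_pairing. now apply W1.
 - intros eps He. destruct (proj1 W2 eps He) as [T HT]. exists (Rmax T 0). intros t Ht.
  assert (m1 := Rmax_l T 0). assert (m2 := Rmax_r T 0). rewrite (proj1 (Eq t ltac:(lra))).
   apply HT. lra.
 - intros eps He. destruct (proj2 W2 eps He) as [T HT]. exists (Rmax T 0). intros t Ht.
  assert (m1 := Rmax_l T 0). assert (m2 := Rmax_r T 0). rewrite (proj2 (Eq t ltac:(lra))).
   apply HT. lra.
Qed.
Lemma captured_T_inv g f S p : captured (reversed (lienard g f)) S p ->
 captured (lienard (gT g) (fT f)) (fun q => S (tp q)) (tp p).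
Proof.
 intros H. apply captured_T. rewrite gT_gT, fT_fT, tp_tp.
 destruct H as [w [W0 [W1 W2]]]. exists w. conj3; [assumption| |assumption].
 intros t Ht. rewrite tp_tp. now apply W1.
Qed.

Lemma captured_backward_flow g f (S : plane -> Prop) p x y : half g f ->
 (forall q, S q -> Rabs (fst q) <= 1 /\ Rabs (snd q) <= 1) ->
 captured (reversed (lienard g f)) S p -> flow 1 (vf 1 g f) x y -> x 0 = fst p -> y 0 = snd p ->
 (forall t, t <= 0 -> S (x t, y t)) /\ tends (fun t => x (- t)) 0 /\ tends (fun t => y (- t)) 0.
Proof.
 intros Hh HB Hc H Ex Ey. apply captured_T_inv in Hc. apply flow_T in H; [|apply Rlt_0_1].
 destruct (captured_forward_flow _ _ (fun q => S (tp q)) (tp p) (fun t => - x (- t)) (fun t => y (-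
  t)) (half_T _ _ Hh)) as [Q1 [Q2 Q3]].
 - intros q Hq. destruct (HB _ Hq) as [B1 B2]. unfold tp in B1, B2. simpl in B1, B2.
  now rewrite Rabs_Ropp in B1.
 - exact Hc.
 - exact H.
 - unfold tp. simpl. now rewrite Ropp_0, Ex.
 - unfold tp. simpl. now rewrite Ropp_0, Ey.
 - conj3; [ | |assumption].
  + intros t Ht. specialize (Q1 (- t) ltac:(lra)). unfold tp in Q1. simpl in Q1.
   now rewrite !Ropp_involutive in Q1.
  + apply (tends_ext (fun t => - - x (- t))); [intros; ring|]. rewrite <- Ropp_0.
   now apply tends_opp.
Qed.

(** Functions that vanish on the negative half line are pieced together by a sum, which makes
    continuity immediate. *)
Definition glue (h h' : R -> R) (x : R) : R := h x + h' (- x).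

(** Both lower boundaries equal [sqrt (2 * c)] at 0, which the sum counts twice. They match there
    because the same [c] is used on both sides. *)
Definition lowg (g : R -> R) (L c x : R) : R :=
 lowl g L c (Rmax x 0) + lowl (gT g) L c (Rmax (- x) 0) - sqrt (2 * c).

(** * The sectors around the origin, both halves together *)

Section Global.
Variables (g : R -> R) (f : R -> R -> R) (d L e c X X' : R) (A U A' U' : R -> R).
Hypothesis HS : sys g f d L.
Hypothesis SR : side g f L d e c X A U.
Hypothesis SL : side (gT g) (fT f) L d e c X' A' U'.
Hypothesis e1 : e <= 1.

Let HST : sys (gT g) (fT f) d L := sys_T _ _ _ _ HS.
Let Hh : half g f := sys_half _ _ _ _ HS.
Let F1 : field (vf 1 g f) := vf_field g f Hh 1 Rlt_0_1.

Definition ereg (p : plane) : Prop :=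
 - X' <= fst p <= X /\ - lowg g L c (fst p) <= snd p <= glue U U' (fst p) /\ p <> origin.

Lemma glue_right h h' x : (forall v, v <= 0 -> h' v = 0) -> 0 <= x -> glue h h' x = h x.
Proof. intros H Hx. unfold glue. rewrite H by lra. ring. Qed.

Lemma glue_left h h' x : (forall v, v <= 0 -> h v = 0) -> x <= 0 -> glue h h' x = h' (- x).
Proof. intros H Hx. unfold glue. rewrite H by lra. ring. Qed.

Lemma lowg_right x : 0 <= x -> lowg g L c x = lowl g L c x.
Proof. intros H. unfold lowg. rewrite Rmax_left, Rmax_right, (lowl_0 (gT g)) by lra. ring. Qed.

Lemma lowg_left x : x <= 0 -> lowg g L c x = lowl (gT g) L c (- x).
Proof. intros H. unfold lowg. rewrite Rmax_right, Rmax_left, lowl_0 by lra. ring. Qed.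

Let UL := side_U_left _ _ _ _ _ _ _ _ _ SR.
Let UL' := side_U_left _ _ _ _ _ _ _ _ _ SL.

Lemma ereg_right p : 0 <= fst p -> (ereg p <-> region g L c X U (fst p) (snd p)).
Proof.
 intros Hp. unfold ereg, region. rewrite plane_nonzero, lowg_right, glue_right by assumption.
 assert (X1 := side_X _ _ _ _ _ _ _ _ _ SL).
 split; intros [H1 [H2 H3]]; (conj3; [lra|assumption| ]).
 - destruct (Req_dec (fst p) 0) as [Z|Z]; [|left; lra]. rewrite Z, UL in H2 by lra. right. lra.
 - lra.
Qed.

Lemma ereg_left p : fst p <= 0 -> (ereg p <-> region (gT g) L c X' U' (- fst p) (snd p)).
Proof.
 intros Hp. unfold ereg, region. rewrite plane_nonzero, lowg_left, glue_left by assumption.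
 assert (X1 := side_X _ _ _ _ _ _ _ _ _ SR).
 split; intros [H1 [H2 H3]]; (conj3; [lra|assumption| ]).
 - destruct (Req_dec (fst p) 0) as [Z|Z]; [|left; lra]. rewrite Z, Ropp_0, UL' in H2 by lra. right.
  lra.
 - lra.
Qed.

Lemma region_ereg p : region g L c X U (fst p) (snd p) -> ereg p.
Proof. intros R. apply ereg_right; [apply R|assumption]. Qed.

Lemma region_ereg_T p : region (gT g) L c X' U' (fst p) (snd p) -> ereg (tp p).
Proof.
 intros R. apply ereg_left; unfold tp; simpl; [destruct R; lra|]. now rewrite Ropp_involutive.
Qed.

Lemma ereg_captured_back p : ereg p -> 0 <= fst p -> captured (reversed (lienard g f)) ereg p.
Proof.
 intros R Hp. apply ereg_right in R; [|assumption]. rewrite (surjective_pairing p).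
 apply (region_captured g f d L e c X A U HS SR e1); [apply region_ereg|assumption].
Qed.

Lemma ereg_captured p : ereg p -> fst p <= 0 -> captured (lienard g f) ereg p.
Proof.
 intros R Hp. apply ereg_left in R; [|assumption]. apply captured_T. unfold tp.
 apply (region_captured (gT g) (fT f) d L e c X' A' U' HST SL e1); [apply region_ereg_T|assumption].
Qed.

Lemma ereg_hom p : ereg p -> snd p < glue U U' (fst p) -> homoclinic (lienard g f) p.
Proof.
 intros R Hp. apply (homoclinic_hom g f d L p HS). destruct (Rle_or_lt 0 (fst p)) as [Q|Q].
 - apply ereg_right in R; [|assumption]. rewrite glue_right in Hp by assumption.
  destruct (flow_exists 1 _ (fst p) (snd p) Rlt_0_1 F1) as [x [y [Ex [Ey H]]]].
  rewrite <- Ex, <- Ey. rewrite <- Ex, <- Ey in R, Hp.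
  now apply (region_hom g f d L e c X A U HS SR).
 - apply ereg_left in R; [|lra]. rewrite glue_left in Hp by (assumption || lra). apply hom_T.
  destruct (flow_exists 1 _ (- fst p) (snd p) Rlt_0_1 (vf_field _ _ (sys_half _ _ _ _ HST) 1
   Rlt_0_1)) as [x [y [Ex [Ey H]]]].
  rewrite <- Ex, <- Ey. rewrite <- Ex, <- Ey in R, Hp.
  now apply (region_hom (gT g) (fT f) d L e c X' A' U' HST SL).
Qed.

Lemma ereg_box p : ereg p -> Rabs (fst p) <= 1 /\ Rabs (snd p) <= 1.
Proof.
 intros R. destruct (Rle_or_lt 0 (fst p)) as [Q|Q].
 - apply ereg_right in R; [|assumption]. now apply (region_box g f d L e c X A U HS SR e1).
 - apply ereg_left in R; [|lra]. rewrite <- Rabs_Ropp.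
  now apply (region_box (gT g) (fT f) d L e c X' A' U' HST SL e1).
Qed.
Let Kc (p : plane) : Prop := captured (lienard g f) ereg p /\ captured (reversed (lienard g f))
 ereg p.

(** An orbit that stays in the region and tends to [O] both ways is homoclinic, so by
    [homoclinic_structure] it passes through the negative vertical axis. *)
Lemma captured_orbit p : Kc p -> exists x y tau,
 flow 1 (vf 1 g f) x y /\ x 0 = fst p /\ y 0 = snd p /\
 x tau = 0 /\ y tau < 0 /\ forall t, Kc (x t, y t).
Proof.
 intros [C1 C2]. destruct (flow_exists 1 _ (fst p) (snd p) Rlt_0_1 F1) as [x [y [Ex [Ey H]]]].
 destruct (captured_forward_flow g f ereg p x y Hh ereg_box C1 H Ex Ey) as [P1 [P2 P3]].
 destruct (captured_backward_flow g f ereg p x y Hh ereg_box C2 H Ex Ey) as [Q1 [Q2 Q3]].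
 assert (R : forall t, ereg (x t, y t)).
 { intros t. destruct (Rle_or_lt 0 t); [apply P1|apply Q1]; lra. }
 assert (B : inbox 1 x y (fun _ => True)) by (intros t _; exact (ereg_box _ (R t))).
 destruct (homoclinic_structure g f d L HS 1 x y Rlt_0_1 H B) as [N [t0 HL]]; try assumption.
 { apply (plane_nonzero (x 0, y 0)). apply R. }
 destruct HL as [_ [_ [[L1 [L2 _]] _]]]. cbv beta in L1, L2. rewrite Rplus_0_l in L1, L2.
 exists x, y, t0. repeat (split; [assumption|]). intros t.
 assert (K1 := captured_forward 1 g f ereg _ _ (flow_shift 1 _ x y t H)).
 assert (K2 := captured_backward 1 g f ereg _ _ (flow_shift 1 _ x y t H)).
 cbv beta in K1, K2. rewrite !Rplus_0_l in K1, K2. split.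
 - apply K1; [intros s _; now apply B|intros; apply R| |]; now apply tends_shift.
 - apply K2; [intros s _; now apply B|intros; apply R| |]; now apply tends_back_shift.
Qed.

(** From the negative axis the orbit goes backward within the right half of the region and forward
    within the left half. So every point of the axis in the region qualifies, and these form a
    segment. *)
Lemma captured_axis b b1 b2 : Kc (0, b1) -> Kc (0,
 b2) -> b1 <= b <= b2 \/ b2 <= b <= b1 -> b < 0 -> Kc (0, b).
Proof.
 intros K1 K2 Hb Hn.
 assert (E : forall b, Kc (0, b) -> ereg (0, b)).
 { intros b' [[w [W0 [W1 _]]] _]. rewrite <- W0. apply W1. lra. }
 apply E in K1. apply E in K2.
 assert (R : ereg (0, b)).
 { destruct K1 as [K1 [K1' _]]. destruct K2 as [_ [K2' _]]. simpl in *. conj3; [assumption|simpl| ].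
  - unfold glue in *. rewrite Ropp_0, UL, UL' in * by lra. lra.
  - apply plane_nonzero. right. simpl. lra. }
 split; [apply ereg_captured|apply ereg_captured_back]; simpl; assumption || lra.
Qed.

(* The loops are joined through their intersections with the negative vertical axis. *)
Lemma captured_path_connected : path_connected Kc.
Proof.
 intros p q Kp Kq.
 destruct (captured_orbit p Kp) as [xp [yp [tp [Hp [Xp [Yp [Xpt [Ypt Op]]]]]]]].
 destruct (captured_orbit q Kq) as [xq [yq [tq [Hq [Xq [Yq [Xqt [Yqt Oq]]]]]]]].
 (* [k a] runs from 0 to 1 in the third of [0, 1] that starts at [a / 3]: first along the orbit of
    [p] to the axis, then along the axis, then along the orbit of [q]. *)
 set (k := fun a s => c01 (3 * s - a)).
 assert (Ck : forall a s, continuous (k a) s).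
 { intros a s. apply (continuous_comp (fun s => 3 * s - a) c01); [|apply c01_cont].
  apply (is_derive_continuous _ _ 3). auto_derive; [trivial|ring]. }
 assert (C1 : forall h : R -> R, (forall t, continuous h t) -> forall t s,
  continuous (fun s => h (t * k 0 s)) s).
 { intros h Ch t s. apply (continuous_comp (fun s => t * k 0 s) h); [|apply Ch].
  apply (continuous_mult (K := R_AbsRing)); [apply continuous_const|apply Ck]. }
 assert (C3 : forall h : R -> R, (forall t, continuous h t) -> forall t s,
  continuous (fun s => h (t * (1 - k 2 s))) s).
 { intros h Ch t s. apply (continuous_comp (fun s => t * (1 - k 2 s)) h); [|apply Ch].
  apply (continuous_mult (K := R_AbsRing)); [apply continuous_const|].
  apply (continuous_minus (V := R_NormedModule)); [apply continuous_const|apply Ck]. }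
 exists (fun s => (xp (tp * k 0 s) + xq (tq * (1 - k 2 s)),
  yp (tp * k 0 s) + (k 1 s * (yq tq - yp tp) + (yq (tq * (1 - k 2 s)) - yq tq))) : plane).
 assert (Fx : forall x y, flow 1 (vf 1 g f) x y -> forall t, continuous x t) by (intros;
  eapply flow_cont_x; eassumption).
 assert (Fy : forall x y, flow 1 (vf 1 g f) x y -> forall t, continuous y t) by (intros;
  eapply flow_cont_y; eassumption).
 conj4.
 - apply continuous_on_all. intros s. apply continuous_pair.
  + apply (continuous_plus (V := R_NormedModule)); [now apply C1, (Fx xp yp)|now apply C3,
   (Fx xq yq)].
  + apply (continuous_plus (V := R_NormedModule)); [now apply C1, (Fy xp yp)|].
   apply (continuous_plus (V := R_NormedModule)).
   * apply (continuous_mult (K := R_AbsRing)); [apply Ck|apply continuous_const].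
   * apply (continuous_minus (V := R_NormedModule)); [now apply C3,
    (Fy xq yq)|apply continuous_const].
 - unfold k. rewrite (c01_low (3 * 0 - 0)), (c01_low (3 * 0 - 1)), (c01_low (3 * 0 - 2)) by lra.
  rewrite !Rminus_0_r, Rmult_1_r, Rmult_0_r, Xp, Yp, Xqt.
  destruct p as [a b]. simpl. f_equal; ring.
 - unfold k. rewrite (c01_high (3 * 1 - 0)), (c01_high (3 * 1 - 1)), (c01_high (3 * 1 - 2)) by lra.
  rewrite Rminus_diag, Rmult_0_r, Rmult_1_r, Xq, Yq, Xpt.
  destruct q as [a b]. simpl. f_equal; ring.
 - intros s Hs. destruct (Rle_or_lt s (1 / 3)) as [S1|S1];
  [|destruct (Rle_or_lt s (2 / 3)) as [S2|S2]].
  + unfold k. rewrite (c01_low (3 * s - 2)), (c01_low (3 * s - 1)) by lra. rewrite !Rminus_0_r,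
   Rmult_1_r, Xqt.
   replace (xp _ + 0) with (xp (tp * c01 (3 * s))) by ring.
   replace (yp _ + _) with (yp (tp * c01 (3 * s))) by ring. apply Op.
  + unfold k. rewrite (c01_low (3 * s - 2)), (c01_high (3 * s - 0)), (c01_mid (3 * s - 1)) by lra.
   rewrite Rminus_0_r, !Rmult_1_r, Xqt, Xpt.
   replace (0 + 0) with 0 by ring. set (r := 3 * s - 1).
   assert (Hr : 0 <= r <= 1) by (unfold r; lra).
   assert (Kp' := Op tp). assert (Kq' := Oq tq). rewrite Xpt in Kp'. rewrite Xqt in Kq'.
   apply (captured_axis _ _ _ Kp' Kq').
   * destruct (Rle_or_lt (yp tp) (yq tq)); [left|right]; nra.
   * nra.
  + unfold k. rewrite (c01_high (3 * s - 1)), (c01_high (3 * s - 0)) by lra. rewrite !Rmult_1_r,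
   Xpt.
   replace (0 + xq _) with (xq (tq * (1 - c01 (3 * s - 2)))) by ring.
   replace (yp tp + _) with (yq (tq * (1 - c01 (3 * s - 2)))) by ring. apply Oq.
Qed.

Lemma captured_ext (Y : plane -> plane) (S S' : plane -> Prop) p : (forall q, S q -> S' q) ->
 captured Y S p -> captured Y S' p.
Proof. intros H [w [W0 [W1 W2]]]. exists w. conj3; [assumption| |assumption]. intros t Ht. split;
 [|apply H]; now apply W1. Qed.

Lemma graph_unstable Phi alpha W : (exists xs ys, flow 1 (vf 1 g f) xs ys /\ emanates xs ys /\
  xs 0 = X /\ graph_of xs ys W) -> (forall v, 0 < v <= X -> W v <= A v) ->
 (forall p, ray Phi alpha p <-> 0 < fst p <= X /\ snd p = W (fst p)) ->
 unstable_ray (lienard g f) Phi alpha.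
Proof.
 intros HW WA HR p Hp. apply HR in Hp. destruct p as [a b]. simpl in Hp. destruct Hp as [Hp ->].
 apply (graph_captured g f d L e c X A U HS SR e1 _ W); try assumption. intros q H1 H2.
  now apply HR.
Qed.

Lemma graph_stable Phi alpha W : (exists xs ys,
 flow 1 (vf 1 (gT g) (fT f)) xs ys /\ emanates xs ys /\
  xs 0 = X' /\ graph_of xs ys W) -> (forall v, 0 < v <= X' -> W v <= A' v) ->
 (forall p, ray Phi alpha p <-> - X' <= fst p < 0 /\ snd p = W (- fst p)) ->
 stable_ray (lienard g f) Phi alpha.
Proof.
 intros HW WA HR p Hp. apply HR in Hp. destruct p as [a b]. simpl in Hp. destruct Hp as [Hp ->].
 apply captured_T. unfold tp. simpl.
 apply (graph_captured (gT g) (fT f) d L e c X' A' U' HST SL e1 _ W); try assumption; [|lra].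
 intros q H1 H2. apply HR. unfold tp. simpl. rewrite Ropp_involutive. split; [lra|assumption].
Qed.

Lemma elliptic_of Phi alpha beta : (forall p, closed_sector Phi alpha beta p <-> ereg p) ->
 (forall p, open_sector Phi alpha beta p -> snd p < glue U U' (fst p)) ->
 (forall p, ray Phi alpha p <-> 0 < fst p <= X /\ snd p = U (fst p)) ->
 (forall p, ray Phi beta p <-> - X' <= fst p < 0 /\ snd p = U' (- fst p)) ->
 elliptic_sector (lienard g f) Phi alpha beta.
Proof.
 intros HC HO R1 R2.
 assert (Sub : forall q, ereg q -> closed_sector Phi alpha beta q) by (intros; now apply HC).
 assert (Sub' : forall q, closed_sector Phi alpha beta q -> ereg q) by (intros; now apply HC).
 conj3.
 - right. split.
  + apply (graph_unstable Phi alpha U); [apply SR|apply SR|assumption].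
  + apply (graph_stable Phi beta U'); [apply SL|apply SL|assumption].
 - intros p Hp. assert (R : ereg p).
  { apply HC. destruct Hp as [r [th [Hr [Hth E]]]]. exists r, th. conj3;
   [assumption|lra|assumption]. }
  split; [apply ereg_hom; auto|].
  destruct (Rle_or_lt 0 (fst p)) as [Q|Q]; [right|left]; apply (captured_ext _ _ _ _ Sub).
  + now apply ereg_captured_back.
  + apply ereg_captured; [assumption|lra].
 - assert (E : (fun p => captured (lienard g f) (closed_sector Phi alpha beta) p /\
   captured (reversed (lienard g f)) (closed_sector Phi alpha beta) p) = Kc).
  { assert (E0 : closed_sector Phi alpha beta = ereg).
   { apply functional_extensionality. intros q. apply propositional_extensionality. apply HC. }
   now rewrite E0. }
  rewrite E. exact captured_path_connected.
Qed.

Lemma glue_nonneg x : - X' <= x <= X -> 0 <= glue A A' x.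
Proof.
 intros Hx. destruct (Rle_or_lt 0 x) as [Q|Q].
 - rewrite (glue_right A A') by (assumption || apply (side_A_left _ _ _ _ _ _ _ _ _ SL)).
  destruct (side_box g f d L e c X A U HS SR x ltac:(lra)). lra.
 - rewrite (glue_left A A') by (lra || apply (side_A_left _ _ _ _ _ _ _ _ _ SR)).
  destruct (side_box _ _ d L e c X' A' U' HST SL (- x) ltac:(lra)). lra.
Qed.

(** Points above the topmost graph leave in the past because they do not emanate; leaving in the
    future is the same fact for the reflected system. *)
Lemma hyperbolic_of Phi alpha beta k : 0 <= k -> e + k < 1 ->
 (forall p, closed_sector Phi alpha beta p -> - X' <= fst p <= X /\ glue A A' (fst p) <= snd p <=
  glue A A' (fst p) + k) ->
 (forall p, open_sector Phi alpha beta p -> glue A A' (fst p) < snd p) ->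
 (forall p, ray Phi alpha p <-> - X' <= fst p < 0 /\ snd p = A' (- fst p)) ->
 (forall p, ray Phi beta p <-> 0 < fst p <= X /\ snd p = A (fst p)) ->
 hyperbolic_sector (lienard g f) Phi alpha beta.
Proof.
 intros Hk0 Hk HC HO R1 R2. assert (HX := side_X _ _ _ _ _ _ _ _ _ SR).
  assert (HX' := side_X _ _ _ _ _ _ _ _ _ SL).
 assert (AL := side_A_left _ _ _ _ _ _ _ _ _ SR). assert (AL' := side_A_left _ _ _ _ _ _ _ _ _ SL).
 assert (Box : forall p, closed_sector Phi alpha beta p -> Rabs (fst p) <= e + k /\ Rabs (snd p) <=
  e + k /\ 0 <= snd p).
 { intros p Hp. destruct (HC p Hp) as [P1 P2]. assert (P3 := glue_nonneg _ P1).
  assert (glue A A' (fst p) <= e).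
  { destruct (Rle_or_lt 0 (fst p)) as [Q|Q].
   - rewrite glue_right by assumption. apply (side_small _ _ _ _ _ _ _ _ _ SR). lra.
   - rewrite glue_left by (assumption || lra). apply (side_small _ _ _ _ _ _ _ _ _ SL). lra. }
  conj3; [apply Rabs_le_iff; lra|apply Rabs_le_iff; lra|lra]. }
 split.
 - left. split.
  + apply (graph_stable Phi alpha A'); [apply (side_graph _ _ _ _ _ _ _ _ _ SL)|intros;
   lra|assumption].
  + apply (graph_unstable Phi beta A); [apply (side_graph _ _ _ _ _ _ _ _ _ SR)|intros;
   lra|assumption].
 - intros p Hp.
  assert (Hc : closed_sector Phi alpha beta p).
  { destruct Hp as [r [th [Hr [Hth E]]]]. exists r, th. conj3; [assumption|lra|assumption]. }
  destruct (HC p Hc) as [P1 _]. assert (P2 := HO p Hp). assert (P3 := glue_nonneg _ P1). split.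
  + apply leaves_T. destruct (flow_exists 1 _ (- fst p) (snd p) Rlt_0_1 (vf_field _ _ (sys_half _ _
   _ _ HST) 1 Rlt_0_1))
    as [x [y [Ex [Ey H]]]].
   assert (Et : tp p = (x 0, y 0)) by (unfold tp; now rewrite Ex, Ey). rewrite Et.
   destruct (upper_leaves (gT g) (fT f) d L e c X' A' U' HST SL x y H) as [t [Ht1 Ht2]]; [lra|lra|
    |].
   { rewrite Ex, Ey. intros Q. rewrite glue_left in P2 by (assumption || lra). assumption. }
   apply (leaves_backward 1 (e + k) _ _ _ x y t Hk H).
   * intros a b Hq. destruct (Box _ Hq) as [B1 [B2 _]]. unfold tp in B1, B2. simpl in B1, B2.
    now rewrite Rabs_Ropp in B1.
   * rewrite <- Et, tp_tp. assumption.
   * assumption.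
   * intros Hq. destruct (Box _ Hq) as [B1 [_ B2]]. unfold tp in B1, B2. simpl in B1, B2.
    apply Rabs_le_iff in B1. lra.
  + destruct (flow_exists 1 _ (fst p) (snd p) Rlt_0_1 F1) as [x [y [Ex [Ey H]]]].
   assert (Et : p = (x 0, y 0)) by (rewrite Ex, Ey; apply surjective_pairing). rewrite Et.
   destruct (upper_leaves g f d L e c X A U HS SR x y H) as [t [Ht1 Ht2]]; [lra|lra| |].
   { rewrite Ex, Ey. intros Q. rewrite glue_right in P2 by assumption. assumption. }
   apply (leaves_backward 1 (e + k) _ _ _ x y t Hk H).
   * intros a b Hq. destruct (Box _ Hq) as [B1 [B2 _]]. now split.
   * now rewrite <- Et.
   * assumption.
   * intros Hq. destruct (Box _ Hq) as [B1 [_ B2]]. simpl in B1, B2. apply Rabs_le_iff in B1. lra.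
Qed.
End Global.

(** The pocket dictates the section: [X] is where its boundary meets the axis. Below the threshold
    [c0] the level [c] remains free, since both sides must share it. [D] stands for either
    alternative of the dichotomy. *)
Lemma side_exists g f d L (D : R -> (R -> R) -> (R -> R) -> Prop) X0 : sys g f d L -> 0 < X0 ->
 (forall X, 0 < X <= X0 -> exists A U, D X A U) ->
 (forall X A U, 0 < X <= X0 -> D X A U -> topmost 1 (vf 1 g f) X A /\
  (exists xs ys, flow 1 (vf 1 g f) xs ys /\ emanates xs ys /\ xs 0 = X /\ graph_of xs ys U) /\
  (forall v, 0 < v <= X -> U v <= A v) /\
  (forall a b, 0 < a <= X -> 0 <= b < U a -> hom g f a b)) ->
 (forall X A U, 0 < X < X0 -> D X A U -> forall v, 0 < v <= X -> 0 < U v) ->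
 forall e, 0 < e -> exists c0, 0 < c0 /\ forall c, 0 < c <= c0 ->
  exists X A U, side g f L d e c X A U /\ D X A U.
Proof.
 intros HS HX0 HD HD1 HD2 e He. assert (Hh := sys_half _ _ _ _ HS).
 assert (HO := sys_right _ _ _ _ HS). assert (HL : 0 <= L) by apply HO.
  assert (Hd : 0 < d) by apply HO.
 destruct (HD X0 ltac:(lra)) as [A0 [U0 D0]]. destruct (HD1 X0 A0 U0 ltac:(lra) D0) as [T0 _].
 destruct T0 as [T0 T0']. assert (T1 := T0). destruct T1 as [xt [yt [_ [_ [_ GA]]]]].
 (* Topmost graphs over smaller sections are restrictions of [A0], so its continuity at 0 makes all
    of them at most [e]. *)
 destruct (continuous_neg (fun v => A0 v - e) 0) as [eta [E1 E2]].
 { apply (continuous_minus (V := R_NormedModule)); [apply GA|apply continuous_const]. }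
 { rewrite (graph_left _ _ _ GA); lra. }
 destruct (min3 (X0 / 2) (eta / 2) (d / 2)) as [m [M [M1 [M2 M3]]]]; [lra|lra|lra|].
 destruct (min3 m e (1 / 2) M He) as [e' [E [E3 [E4 E5]]]]; [lra|].
 destruct (pocket_exists g f Hh L e' HL E) as [c0 [C0 HC]].
 exists c0. split; [assumption|]. intros c Hc. destruct (HC c Hc) as [X HP].
 assert (HX : 0 < X <= e') by apply HP.
 destruct (HD X ltac:(lra)) as [A [U DX]]. destruct (HD1 X A U ltac:(lra) DX) as [T [EU [LE HH]]].
 exists X, A, U. split; [|assumption]. split; try assumption.
 - exists e'. conj4; [lra|lra|lra|assumption].
 - intros v Hv. now apply (HD2 X A U ltac:(lra) DX).
 - intros v Hv. destruct (Req_dec v 0) as [->|N].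
  + destruct T as [[xs [ys [_ [_ [_ G']]]]] _]. rewrite (graph_left _ _ _ G'); lra.
  + rewrite (topmost_unique 1 (vf 1 g f) X X0 A A0 v T (conj T0 T0')) by lra.
   assert (Q := E2 v). rewrite Rminus_0_r, Rabs_pos_eq in Q by lra. specialize (Q ltac:(lra)). lra.
Qed.

Lemma side_exists_EH g f d L X0 : sys g f d L -> 0 < X0 -> (forall X, 0 < X <= X0 -> EHr g f 1 X) ->
 forall e, 0 < e -> exists c0, 0 < c0 /\ forall c, 0 < c <= c0 -> exists X A,
  side g f L d e c X A A.
Proof.
 intros HS HX0 HE e He.
 destruct (side_exists g f d L (fun X A U => U = A /\ topmost 1 (vf 1 g f) X A /\
  forall a b, 0 < a <= X -> 0 <= b < A a -> hom g f a b) X0 HS HX0) with (e := e) as [c0 [C0 HC]];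
   try assumption.
 - intros X HX. destruct (HE X HX) as [A [A1 A2]]. now exists A, A.
 - intros X A U HX [-> [T H]]. conj4; [assumption|apply T|intros; lra|assumption].
 - intros X A U HX [-> [T H]] v Hv. destruct (HE X0 ltac:(lra)) as [A0 [T0 _]].
  rewrite (topmost_unique 1 (vf 1 g f) X X0 A A0 v T T0) by lra.
  destruct T0 as [[xs [ys [_ [E0 [E1 G0]]]]] _]. apply (graph_pos _ _ _ E0 G0). lra.
 - exists c0. split; [assumption|]. intros c Hc. destruct (HC c Hc) as [X [A [U [S [-> _]]]]].
  now exists X, A.
Qed.

Lemma side_exists_PP g f d L X0 : sys g f d L -> 0 < X0 -> (forall X, 0 < X <= X0 -> PPr g f 1 X) ->
 forall e, 0 < e -> exists c0, 0 < c0 /\ forall c, 0 < c <= c0 ->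
  exists X A U, side g f L d e c X A U /\ band g f X A U.
Proof.
 intros HS HX0 HP e He.
 destruct (side_exists g f d L (fun X A U => topmost 1 (vf 1 g f) X A /\
  (exists xs ys, flow 1 (vf 1 g f) xs ys /\ emanates xs ys /\ xs 0 = X /\ graph_of xs ys U) /\
  (forall a b, 0 < a <= X -> 0 <= b < U a -> hom g f a b) /\ band g f X A U) X0 HS HX0)
  with (e := e) as [c0 [C0 HC]]; try assumption.
 - intros X HX. destruct (HP X HX) as [A [B [P1 [P2 [P3 [P4 P5]]]]]]. exists A, B.
  conj4; [assumption|assumption|assumption| ]. intros a Ha. split; [now apply P3|].
  intros b. now apply P5.
 - intros X A U HX [P1 [P2 [P3 P4]]]. conj4; [assumption|assumption| |assumption].
  intros v Hv. left. now apply P4.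
 - intros X A U HX [P1 [P2 [P3 P4]]] v Hv.
  destruct (HP X0 ltac:(lra)) as [A0 [B0 [_ [Q2 [_ [Q4 _]]]]]].
  destruct Q2 as [xs [ys [_ [E0 [E1 G0]]]]]. assert (W := graph_pos _ _ _ E0 G0 v ltac:(lra)).
  (* If [U v <= 0], the axis point of abscissa [v] would belong to the nonhomoclinic band, although
     it lies below the positive graph [B0]. *)
  apply Rnot_le_lt. intros Z. destruct (P4 v Hv) as [P5 P6]. apply (P6 0).
  + split; [assumption|]. destruct P1 as [[xa [ya [_ [EA [_ GA]]]]] _].
   now apply (graph_nonneg _ _ _ EA GA).
  + apply Q4; lra.
 - exists c0. split; [assumption|]. intros c Hc.
  destruct (HC c Hc) as [X [A [U [S [_ [_ [_ B]]]]]]]. now exists X, A, U.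
Qed.

(** * Assembly of the sectors in one polar chart *)

Section Assembly.
Variables (g : R -> R) (f : R -> R -> R) (d L delta e c X X' : R) (A U A' U' : R -> R).
Hypothesis HS : sys g f d L.
Hypothesis SR : side g f L d e c X A U.
Hypothesis SL : side (gT g) (fT f) L d e c X' A' U'.
Hypothesis He : e <= delta / 8.
Hypothesis Hdelta : 0 < delta <= 1.

Let HST : sys (gT g) (fT f) d L := sys_T _ _ _ _ HS.
Let Hh : half g f := sys_half _ _ _ _ HS.
Let AL := side_A_left _ _ _ _ _ _ _ _ _ SR.
Let AL' := side_A_left _ _ _ _ _ _ _ _ _ SL.
Let UL := side_U_left _ _ _ _ _ _ _ _ _ SR.
Let UL' := side_U_left _ _ _ _ _ _ _ _ _ SL.

Lemma glue_cont h h' x : (forall v, continuous h v) -> (forall v,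
 continuous h' v) -> continuous (glue h h') x.
Proof.
 intros Ch Ch'. apply (continuous_plus (V := R_NormedModule)); [apply Ch|].
 apply (continuous_comp Ropp h'); [|apply Ch']. apply (continuous_opp (V := R_NormedModule)),
  continuous_id.
Qed.

Lemma lowg_cont x : continuous (lowg g L c) x.
Proof.
 apply (continuous_minus (V := R_NormedModule)); [|apply continuous_const].
 apply (continuous_plus (V := R_NormedModule)).
 - apply (continuous_comp (fun x => Rmax x 0) (lowl g L c)); [|apply (lowl_cont g f d L c HS)].
  apply (Rmax_cont (fun x => x) (fun _ => 0)); [apply continuous_id|apply continuous_const].
 - apply (continuous_comp (fun x => Rmax (- x) 0) (lowl (gT g) L c));
  [|apply (lowl_cont _ _ d L c HST)].
  apply (Rmax_cont (fun x => - x) (fun _ => 0)); [|apply continuous_const].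
  apply (continuous_opp (V := R_NormedModule)), continuous_id.
Qed.

Lemma glue_values x : - X' <= x <= X -> Rabs x <= e /\ 0 <= glue A A' x <= e /\ 0 <= lowg g L c x
 <= e /\
 (x <> 0 -> 0 < glue U U' x <= glue A A' x) /\ (x = 0 -> glue A A' x = 0 /\ glue U U' x = 0 /\ 0 <
  lowg g L c x).
Proof.
 intros Hx. destruct (Rle_or_lt 0 x) as [Q|Q].
 - rewrite !glue_right, lowg_right by assumption.
  destruct (side_box g f d L e c X A U HS SR x ltac:(lra)) as [B1 [B2 [B3 B4]]].
  conj5; [assumption|lra|assumption| | ].
  + intros N. split; [apply SR; lra|lra].
  + intros ->. rewrite AL, UL, lowl_0 by lra. conj3; [reflexivity|reflexivity| ].
   apply sqrt_lt_R0. assert (W := side_c _ _ _ _ _ _ _ _ _ SR). lra.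
 - rewrite !glue_left, lowg_left by (assumption || lra).
  destruct (side_box _ _ d L e c X' A' U' HST SL (- x) ltac:(lra)) as [B1 [B2 [B3 B4]]].
  rewrite Rabs_Ropp in B1. conj5; [assumption|lra|assumption| | ].
  + intros N. split; [apply SL; lra|lra].
  + intros ->. lra.
Qed.

Section WithS.
Variable S : R -> R.
Hypothesis CS : forall x, continuous S x.
Hypothesis S0 : S 0 = 0.
Hypothesis SA : forall x, - X' <= x <= X -> x <> 0 -> 0 < S x < glue A A' x.

Let Phi := chart X X' (delta / 8) (glue A A') S (lowg g L c).

Lemma SA' x : - X' <= x <= X -> x <> 0 -> S x < glue A A' x.
Proof. intros. now apply SA. Qed.

Lemma lS x : - X' <= x <= X -> - lowg g L c x < S x.
Proof.
 intros Hx. destruct (glue_values x Hx) as [_ [_ [V1 [_ V2]]]]. destruct (Req_dec x 0) as [->|N].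
 - rewrite S0. destruct (V2 eq_refl). lra.
 - specialize (SA x Hx N). lra.
Qed.

Let HX : 0 < X := proj1 (side_X _ _ _ _ _ _ _ _ _ SR).
Let HX' : 0 < X' := proj1 (side_X _ _ _ _ _ _ _ _ _ SL).

Lemma A_glue_0 : glue A A' 0 = 0.
Proof. destruct (glue_values 0) as [_ [_ [_ [_ V]]]]; [lra|now apply V]. Qed.

Lemma k_pos : 0 < delta / 8.
Proof. lra. Qed.

Lemma chart_polar : polar_chart delta Phi.
Proof.
 apply chart_is_polar; [exact HX|exact HX'|exact k_pos|
  |exact CS|exact lowg_cont|exact A_glue_0|exact S0|exact SA'|exact lS| |lra].
 - intros. apply glue_cont; intros;
  [apply (side_A_cont _ _ _ _ _ _ _ _ _ SR)|apply (side_A_cont _ _ _ _ _ _ _ _ _ SL)].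
 - intros x Hx. destruct (glue_values x Hx) as [V1 [V2 [V3 _]]].
  rewrite (Rabs_pos_eq (glue _ _ _)), (Rabs_pos_eq (lowg _ _ _ _)) by lra.
  split; [lra|split; lra].
Qed.

Lemma closed_right_iff a b p : 0 <= a <= b -> b <= 1 -> closed_sector Phi (a / 10) (b / 10) p <->
 0 < fst p <= X /\ a * (A (fst p) - S (fst p)) <= A (fst p) - snd p <= b * (A (fst p) - S (fst p)).
Proof.
 intros Ha Hb. unfold Phi. rewrite closed_right; try assumption; [|exact A_glue_0|exact SA'].
 split; intros [H1 H2]; rewrite (glue_right A A') in * by (assumption || lra); now split.
Qed.

Lemma closed_left_iff a b p : 5 <= a <= b -> b <= 6 -> closed_sector Phi (a / 10) (b / 10) p <->
 - X' <= fst p < 0 /\ (6 - b) * (A' (- fst p) - S (fst p)) <= A' (- fst p) - snd p <= (6 - a) * (A'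
  (- fst p) - S (fst p)).
Proof.
 intros Ha Hb. unfold Phi. rewrite closed_left; try assumption; [|exact A_glue_0|exact SA'].
 split; intros [H1 H2]; rewrite (glue_left A A') in * by (assumption || lra); now split.
Qed.

Lemma ray_A_right_iff alpha p : alpha = 0 \/ alpha = 1 -> ray Phi alpha p <-> 0 < fst p <= X /\ snd
 p = A (fst p).
Proof.
 intros Ha. assert (E : ray Phi (0 / 10) p <-> 0 < fst p <= X /\ snd p = A (fst p)).
 { unfold ray. rewrite closed_right_iff by lra. split; intros [H1 H2]; (split; [assumption|lra]). }
 destruct Ha as [->| ->]; [now replace 0 with (0 / 10) at 1 by lra|]. rewrite <- E.
  apply ray_closes.
Qed.

Lemma ray_A_left_iff p : ray Phi (6 / 10) p <-> - X' <= fst p < 0 /\ snd p = A' (- fst p).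
Proof.
 unfold ray. rewrite closed_left_iff by lra. split; intros [H1 H2]; (split; [assumption|lra]).
Qed.

Lemma chart_hyperbolic : hyperbolic_sector (lienard g f) Phi (6 / 10) 1.
Proof.
 apply (hyperbolic_of g f d L e c X X' A U A' U' HS SR SL) with (k := delta / 8); try lra.
 - intros p H. eapply closed_upper in H; try eassumption;
  [exact k_pos|exact A_glue_0|exact SA'|exact lS].
 - intros p H. eapply open_upper in H; try eassumption; exact k_pos.
 - exact ray_A_left_iff.
 - intros p. apply ray_A_right_iff. now right.
Qed.
End WithS.
End Assembly.

(** The chart asks for a curve strictly below [A]; half of [A] serves. The two sectors are cut at
    the angles 0, 6/10 and 1, where this auxiliary curve does not show. *)
Lemma assembly_EH g f d L delta e c X X' A A' : sys g f d L -> side g f L d e c X A A ->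
 side (gT g) (fT f) L d e c X' A' A' -> e <= delta / 8 -> 0 < delta <= 1 ->
 exists Phi theta, polar_chart delta Phi /\ decomposition (lienard g f) Phi theta [Elliptic;
  Hyperbolic].
Proof.
 intros HS SR SL He Hd. assert (HX := side_X _ _ _ _ _ _ _ _ _ SR).
  assert (HX' := side_X _ _ _ _ _ _ _ _ _ SL).
 assert (AL := side_A_left _ _ _ _ _ _ _ _ _ SR). assert (AL' := side_A_left _ _ _ _ _ _ _ _ _ SL).
 assert (V := glue_values g f d L e c X X' A A A' A' HS SR SL).
 set (S := fun x => glue A A' x / 2).
 assert (CS : forall x, continuous S x).
 { intros x. apply (continuous_mult (K := R_AbsRing)); [|apply continuous_const].
  apply glue_cont; intros; [apply (side_A_cont _ _ _ _ _ _ _ _ _ SR)|apply (side_A_cont _ _ _ _ _ _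
   _ _ _ SL)]. }
 assert (A0 : glue A A' 0 = 0) by (destruct (V 0) as [_ [_ [_ [_ W]]]]; [lra|now apply W]).
 assert (S0 : S 0 = 0) by (unfold S; rewrite A0; lra).
 assert (SA : forall x, - X' <= x <= X -> x <> 0 -> 0 < S x < glue A A' x).
 { intros x Hx N. destruct (V x Hx) as [_ [_ [_ [W _]]]]. specialize (W N). unfold S. lra. }
 assert (SA2 : forall x, - X' <= x <= X -> x <> 0 -> S x < glue A A' x) by (intros; now apply SA).
 assert (LS := lS g f d L e c X X' A A A' A' HS SR SL S S0 SA).
 set (Phi := chart X X' (delta / 8) (glue A A') S (lowg g L c)).
 assert (R1 : forall alpha p, alpha = 0 \/ alpha = 1 -> ray Phi alpha p <-> 0 < fst p <= X /\ snd p
  = A (fst p))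
  by (intros; eapply ray_A_right_iff; eassumption).
 assert (R2 : forall p, ray Phi (6 / 10) p <-> - X' <= fst p < 0 /\ snd p = A' (- fst p))
  by (intros; eapply ray_A_left_iff; eassumption).
 exists Phi, (fun i => match i with O => 0 | 1%nat => 6 / 10 | _ => 1 end).
 split; [apply (chart_polar g f d L delta e c X X' A A A' A'); assumption|].
 conj5; [discriminate|reflexivity|reflexivity| | ].
 - intros [|[|i]] Hi; simpl in Hi; [| |lia]; split; try lra; simpl.
  + apply (elliptic_of g f d L e c X X' A A A' A' HS SR SL); [lra| | | |exact R2].
   * intros p. apply closed_lower_full; assumption || lra.
   * intros p Hp. eapply open_lower_full in Hp; eassumption || lra.
   * intros p. apply R1. now left.
  + apply (chart_hyperbolic g f d L delta e c X X' A A A' A'); assumption.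
 - intros [|[|i]] j Hi; simpl in Hi; [| |lia]; intros -> N [E1 E2]; simpl in *; discriminate.
Qed.

(** Here the second curve of the chart is the lower boundary of the bands, so the parabolic sectors
    occupy the angles [0, 1/10] and [5/10, 6/10]. *)
Lemma assembly_EHPP g f d L delta e c X X' A U A' U' : sys g f d L -> side g f L d e c X A U ->
 side (gT g) (fT f) L d e c X' A' U' -> band g f X A U -> band (gT g) (fT f) X' A' U' ->
 e <= delta / 8 -> 0 < delta <= 1 ->
 exists Phi theta, polar_chart delta Phi /\
  decomposition (lienard g f) Phi theta [Parabolic; Elliptic; Parabolic; Hyperbolic].
Proof.
 intros HS SR SL BR BL He Hd. assert (HX := side_X _ _ _ _ _ _ _ _ _ SR).
  assert (HX' := side_X _ _ _ _ _ _ _ _ _ SL).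
 assert (HST := sys_T _ _ _ _ HS).
 assert (AL := side_A_left _ _ _ _ _ _ _ _ _ SR). assert (AL' := side_A_left _ _ _ _ _ _ _ _ _ SL).
 assert (UL := side_U_left _ _ _ _ _ _ _ _ _ SR). assert (UL' := side_U_left _ _ _ _ _ _ _ _ _ SL).
 assert (V := glue_values g f d L e c X X' A U A' U' HS SR SL).
 set (S := glue U U').
 assert (CS : forall x, continuous S x).
 { intros x. apply glue_cont; intros;
  [apply (side_U_cont _ _ _ _ _ _ _ _ _ SR)|apply (side_U_cont _ _ _ _ _ _ _ _ _ SL)]. }
 assert (A0 : glue A A' 0 = 0) by (destruct (V 0) as [_ [_ [_ [_ W]]]]; [lra|now apply W]).
 assert (S0 : S 0 = 0) by (destruct (V 0) as [_ [_ [_ [_ W]]]]; [lra|now apply W]).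
 assert (SA : forall x, - X' <= x <= X -> x <> 0 -> 0 < S x < glue A A' x).
 { intros x Hx N. destruct (V x Hx) as [_ [_ [_ [W _]]]]. specialize (W N). split; [apply W|].
  unfold S.
  destruct (Rle_or_lt 0 x) as [Q|Q].
  - rewrite !glue_right by assumption. apply BR. lra.
  - rewrite !glue_left by (assumption || lra). apply BL. lra. }
 assert (SA2 : forall x, - X' <= x <= X -> x <> 0 -> S x < glue A A' x) by (intros; now apply SA).
 assert (LS := lS g f d L e c X X' A U A' U' HS SR SL S S0 SA).
 set (Phi := chart X X' (delta / 8) (glue A A') S (lowg g L c)).
 assert (R1 : forall alpha p, alpha = 0 \/ alpha = 1 -> ray Phi alpha p <-> 0 < fst p <= X /\ snd p
  = A (fst p))
  by (intros; eapply ray_A_right_iff; eassumption).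
 assert (R2 : forall p, ray Phi (6 / 10) p <-> - X' <= fst p < 0 /\ snd p = A' (- fst p))
  by (intros; eapply ray_A_left_iff; eassumption).
 assert (CR : forall a b p, 0 <= a <= b -> b <= 1 -> closed_sector Phi (a / 10) (b / 10) p <->
  0 < fst p <= X /\ a * (A (fst p) - U (fst p)) <= A (fst p) - snd p <= b * (A (fst p) - U (fst
   p))).
 { intros a b p Ha Hb. unfold Phi.
  rewrite (closed_right_iff g f d L delta e c X X' A U A' U' HS SR SL S S0 SA) by assumption.
  unfold S. split; intros [H1 H2]; rewrite (glue_right U U') in * by (assumption || lra);
   now split. }
 assert (CL : forall a b p, 5 <= a <= b -> b <= 6 -> closed_sector Phi (a / 10) (b / 10) p <-> - X'
  <= fst p < 0 /\
  (6 - b) * (A' (- fst p) - U' (- fst p)) <= A' (- fst p) - snd p <= (6 - a) * (A' (- fst p) - U'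
   (- fst p))).
 { intros a b p Ha Hb. unfold Phi.
  rewrite (closed_left_iff g f d L delta e c X X' A U A' U' HS SR SL S S0 SA) by assumption.
  unfold S. split; intros [H1 H2]; rewrite (glue_left U U') in * by (assumption || lra); now split.
   }
 assert (R3 : forall p, ray Phi (1 / 10) p <-> 0 < fst p <= X /\ snd p = U (fst p)).
 { intros p. unfold ray. rewrite CR by lra. split; intros [H1 H2]; (split; [assumption|lra]). }
 assert (R4 : forall p, ray Phi (5 / 10) p <-> - X' <= fst p < 0 /\ snd p = U' (- fst p)).
 { intros p. unfold ray. rewrite CL by lra. split; intros [H1 H2]; (split; [assumption|lra]). }
 exists Phi, (fun i => match i with O => 0 | 1%nat => 1 / 10 | 2%nat => 5 / 10 | 3%nat => 6 / 10 |
  _ => 1 end).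
 split; [apply (chart_polar g f d L delta e c X X' A U A' U'); assumption|].
 conj5; [discriminate|reflexivity|reflexivity| | ].
 - intros [|[|[|[|i]]]] Hi; simpl in Hi; [| | | |lia]; split; try lra; simpl.
  + right. assert (C : forall p,
   closed_sector Phi 0 (1 / 10) p <-> 0 < fst p <= X /\ U (fst p) <= snd p <= A (fst p)).
   { intros p. replace 0 with (0 / 10) at 1 by lra. rewrite CR by lra. split; intros [H1 H2];
    (split; [assumption|lra]). }
   conj3.
   * apply (graph_unstable g f d L e c X A U HS SR) with (W := A); try lra.
    -- apply (side_graph _ _ _ _ _ _ _ _ _ SR).
    -- intros; lra.
    -- intros p. apply R1. now left.
   * apply (graph_unstable g f d L e c X A U HS SR) with (W := U); try lra;
    [apply SR|apply SR|assumption].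
   * intros p Hp. apply C in Hp. destruct Hp as [P1 P2]. split.
    -- rewrite (surjective_pairing p). apply (band_captured g f d L e c X A U HS SR);
     try assumption; [lra|].
      intros q Q1 Q2. now apply C.
    -- intros Hp. apply homoclinic_reversed in Hp. rewrite reversed_reversed in Hp.
      apply (homoclinic_hom g f d L p HS) in Hp. revert Hp. now apply BR.
  + apply (elliptic_of g f d L e c X X' A U A' U' HS SR SL); [lra| | |exact R3|exact R4].
   * intros p. apply closed_lower; assumption || lra.
   * intros p Hp. eapply open_lower in Hp; try eassumption; lra.
  + left. assert (C : forall p, closed_sector Phi (5 / 10) (6 / 10) p <->
    - X' <= fst p < 0 /\ U' (- fst p) <= snd p <= A' (- fst p)).
   { intros p. rewrite CL by lra. split; intros [H1 H2]; (split; [assumption|lra]). }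
   conj3.
   * apply (graph_stable g f d L e c X' A' U' HS SL) with (W := U'); try lra;
    [apply SL|apply SL|assumption].
   * apply (graph_stable g f d L e c X' A' U' HS SL) with (W := A'); try lra.
    -- apply (side_graph _ _ _ _ _ _ _ _ _ SL).
    -- intros; lra.
    -- exact R2.
   * intros p Hp. apply C in Hp. destruct Hp as [P1 P2]. split.
    -- apply captured_T. apply (band_captured _ _ d L e c X' A' U' HST SL); try assumption; try lra.
      intros q Q1 Q2. apply C. unfold tp. simpl. rewrite Ropp_involutive. split; [lra|assumption].
    -- intros Hp. apply (homoclinic_hom g f d L p HS) in Hp. apply hom_T in Hp.
      revert Hp. apply BL; [lra|assumption].
  + apply (chart_hyperbolic g f d L delta e c X X' A U A' U'); assumption.
 - intros [|[|[|[|i]]]] j Hi; simpl in Hi; [| | | |lia]; intros -> N [E1 E2]; simpl in *;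
  discriminate.
Qed.

(** The alternatives on the two sides agree by [dichotomy_consistent], used in both directions.
    [EHr] is kept in the first case because it is what the unbounded example refutes. *)
Lemma local_dichotomy g f d L : sys g f d L -> has_em 1 (vf 1 g f) ->
 (consists_of (lienard g f) [Elliptic; Hyperbolic] /\
  exists X0, 0 < X0 /\ forall X, 0 < X <= X0 -> EHr g f 1 X) \/
 consists_of (lienard g f) [Elliptic; Hyperbolic; Parabolic; Parabolic].
Proof.
 intros HS Em. assert (HST := sys_T _ _ _ _ HS).
 assert (EmT := has_em_T g f d L HS 1 Rlt_0_1 Em).
 destruct (dichotomy g f d L HS 1 Rlt_0_1 Em) as [X0 [P0 D]].
 destruct (dichotomy _ _ d L HST 1 Rlt_0_1 EmT) as [X1 [P1 D']].
 assert (Min : forall delta, 0 < delta -> exists delta', 0 < delta' <= 1 /\ delta' <= delta).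
 { intros delta Hd. exists (Rmin delta 1). split; [split; [apply Rmin_glb_lt;
  lra|apply Rmin_r]|apply Rmin_l]. }
 assert (Weak : forall delta delta' Phi,
  delta' <= delta -> polar_chart delta' Phi -> polar_chart delta Phi).
 { intros delta delta' Phi Hd [Q1 Q2 Q3 Q4 Q5 Q6 Q7]. split; try assumption.
  intros rho th Hr Ht. specialize (Q7 rho th Hr Ht). lra. }
 destruct D as [D|D]; destruct D' as [D'|D'].
 - left. split; [|now exists X0]. intros delta Hdelta.
  destruct (Min delta Hdelta) as [delta' [Hd' Hd]].
  destruct (side_exists_EH g f d L X0 HS P0 D (delta' / 8) ltac:(lra)) as [c0 [C0 S0]].
  destruct (side_exists_EH _ _ d L X1 HST P1 D' (delta' / 8) ltac:(lra)) as [c1 [C1 S1]].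
  destruct (min3 c0 c1 1 C0 C1 Rlt_0_1) as [c [Hc [M1 [M2 _]]]].
  destruct (S0 c ltac:(lra)) as [X [A SR]]. destruct (S1 c ltac:(lra)) as [X' [A' SL]].
  destruct (assembly_EH g f d L delta' (delta' / 8) c X X' A A' HS SR SL) as [Phi [theta [H1 H2]]];
   [lra|lra|].
  exists Phi, theta, [Elliptic; Hyperbolic]. split; [now apply (Weak delta delta')|]. split;
   [|assumption].
  apply Permutation_refl.
 - exfalso. assert (HST' := HST). apply (dichotomy_consistent _ _ d L 1 X1 X0 HST Rlt_0_1 P1 P0 D').
  now rewrite gT_gT, fT_fT.
 - exfalso. exact (dichotomy_consistent g f d L 1 X0 X1 HS Rlt_0_1 P0 P1 D D').
 - right. intros delta Hdelta. destruct (Min delta Hdelta) as [delta' [Hd' Hd]].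
  destruct (side_exists_PP g f d L X0 HS P0 D (delta' / 8) ltac:(lra)) as [c0 [C0 S0]].
  destruct (side_exists_PP _ _ d L X1 HST P1 D' (delta' / 8) ltac:(lra)) as [c1 [C1 S1]].
  destruct (min3 c0 c1 1 C0 C1 Rlt_0_1) as [c [Hc [M1 [M2 _]]]].
  destruct (S0 c ltac:(lra)) as [X [A [U [SR BR]]]].
   destruct (S1 c ltac:(lra)) as [X' [A' [U' [SL BL]]]].
  destruct (assembly_EHPP g f d L delta' (delta' / 8) c X X' A U A' U' HS SR SL BR BL) as [Phi
   [theta [H1 H2]]]; [lra|lra|].
  exists Phi, theta, [Parabolic; Elliptic; Parabolic; Hyperbolic]. split;
   [now apply (Weak delta delta')|]. split; [|assumption].
  apply (Permutation_trans (perm_swap _ _ _)). apply perm_skip.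
  apply (Permutation_trans (perm_skip _ (perm_swap _ _ _))).
   apply (Permutation_trans (perm_swap _ _ _)).
  apply perm_skip. apply Permutation_refl.
Qed.

Lemma local_trichotomy g f d L : sys g f d L ->
 center (lienard g f) \/ consists_of (lienard g f) [Elliptic; Hyperbolic] \/
 consists_of (lienard g f) [Elliptic; Hyperbolic; Parabolic; Parabolic].
Proof.
 intros HS. destruct (classic (has_em 1 (vf 1 g f))) as [Em|Em].
 - right. destruct (local_dichotomy g f d L HS Em) as [[Q _]|Q]; [now left|now right].
 - left. now apply (center_of_no_em g f d L 1 HS Rlt_0_1).
Qed.

(** An orbit coming from [O] emanates up to some time, so [bounded_hom] applies to that part and the
    conclusion is carried along the orbit. *)
Lemma backward_hom g f d L x y : sys g f d L -> flow 1 (vf 1 g f) x y -> (x 0 <> 0 \/ y 0 <> 0) ->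
 inbox 1 x y (fun t => t <= 0) -> tends (fun t => x (- t)) 0 -> tends (fun t => y (- t)) 0 ->
 (exists M, forall a b, hom g f a b -> Rabs a <= M /\ Rabs b <= M) -> hom g f (x 0) (y 0).
Proof.
 intros HS H Hne B Hx Hy HM.
 destruct (emanates_eventually g f d L HS 1 x y 0 Rlt_0_1 H Hne Hx Hy) as [t0 [Ht0 Em]].
 apply (hom_segment g f d L HS 1 x y t0 0 Rlt_0_1 H Ht0).
 - intros t Ht. apply B. lra.
 - assert (Q := bounded_hom g f d L HS 1 _ _ Rlt_0_1 (flow_shift 1 _ x y t0 H) Em).
  cbv beta in Q. rewrite Rplus_0_l in Q. apply Q; [|assumption]. intros t Ht. apply B. lra.
Qed.

(** A point on the first ray of a parabolic sector tends to [O] in one direction of time. After a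
    reflection in the attracting case it comes from [O], so boundedness makes it homoclinic, which
    the definition of the sector forbids. *)
Lemma no_parabolic g f d L kinds : sys g f d L -> consists_of (lienard g f) kinds ->
 elliptic_region_bounded (lienard g f) -> ~ In Parabolic kinds.
Proof.
 intros HS HC [M HM] Hin. assert (HST := sys_T _ _ _ _ HS).
 destruct (HC 1 Rlt_0_1) as [Phi [theta [l [HP [Hperm [_ [T0 [Tl [HD _]]]]]]]]].
 apply (Permutation_in _ (Permutation_sym Hperm)) in Hin.
 destruct (In_nth _ _ Elliptic Hin) as [i [Hi Ei]].
 assert (Mono : forall j k, (j <= k)%nat -> (k <= length l)%nat -> theta j <= theta k).
 { intros j k Hjk. induction Hjk as [|k Hjk IH]; [intros; lra|]. intros Hk.
  destruct (HD k ltac:(lia)) as [Q _]. specialize (IH ltac:(lia)). lra. }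
 assert (R0 : 0 <= theta i <= 1).
 { rewrite <- T0, <- Tl at 1. split; apply Mono; lia. }
 assert (R1 : 0 <= theta (S i) <= 1).
 { rewrite <- T0, <- Tl at 1. split; apply Mono; lia. }
 destruct (HD i Hi) as [Hlt Sec]. rewrite Ei in Sec. simpl in Sec.
 set (C := closed_sector Phi (theta i) (theta (S i))) in *.
 set (p := Phi (1, theta i)).
 assert (Cp : C p) by (exists 1, (theta i); conj3; [lra|lra|reflexivity]).
 assert (Np : p <> origin) by (apply (chart_nonzero _ _ HP); lra).
 assert (Box : forall q, C q -> Rabs (fst q) <= 1 /\ Rabs (snd q) <= 1).
 { intros q [r [th [Hr [Hth ->]]]]. assert (W := chart_small _ _ HP r th ltac:(lra) ltac:(lra)).
  apply norm_plane_lt in W. lra. }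
 assert (BM : exists M, forall a b, hom g f a b -> Rabs a <= M /\ Rabs b <= M).
 { exists (M + 1). intros a b Hab.
  assert (Q : norm ((a, b) : plane) < M + 1).
  { apply Rle_lt_trans with M; [|lra]. apply HM. now apply (homoclinic_hom g f d L (a, b) HS). }
  apply norm_plane_lt in Q. simpl in Q. lra. }
 apply plane_nonzero in Np. assert (Hh := sys_half _ _ _ _ HS).
 destruct (flow_exists 1 _ (fst p) (snd p) Rlt_0_1 (vf_field g f Hh 1 Rlt_0_1)) as [x [y [Ex [Ey
  H]]]].
 assert (Hom : hom g f (fst p) (snd p)).
 { destruct Sec as [[_ [_ Sec]]|[_ [_ Sec]]]; destruct (Sec p Cp) as [Cap _].
  - destruct (captured_forward_flow g f C p x y Hh Box Cap H Ex Ey) as [Q1 [Q2 Q3]].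
   apply hom_T. assert (HT := flow_T 1 g f x y Rlt_0_1 H).
   assert (W := backward_hom _ _ d L _ _ HST HT). cbv beta in W. rewrite Ropp_0, Ex, Ey in W.
    apply W.
   + lra.
   + intros t Ht. destruct (Box _ (Q1 (- t) ltac:(lra))) as [B1 B2]. simpl in B1, B2.
    now rewrite Rabs_Ropp.
   + apply (tends_ext (fun t => - x t)); [intros; now rewrite Ropp_involutive|].
    rewrite <- Ropp_0. now apply tends_opp.
   + apply (tends_ext y); [intros; now rewrite Ropp_involutive|assumption].
   + destruct BM as [M' HM']. exists M'. intros a b Hab. rewrite <- (Ropp_involutive a) in Hab.
    apply hom_T, HM' in Hab. now rewrite Rabs_Ropp in Hab.
  - destruct (captured_backward_flow g f C p x y Hh Box Cap H Ex Ey) as [Q1 [Q2 Q3]].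
   assert (W := backward_hom g f d L x y HS H). rewrite Ex, Ey in W. apply W; try assumption.
   intros t Ht. exact (Box _ (Q1 t Ht)). }
 assert (Hp : homoclinic (lienard g f) p) by now apply (homoclinic_hom g f d L p HS).
 destruct Sec as [[_ [_ Sec]]|[_ [_ Sec]]]; destruct (Sec p Cp) as [_ NH]; apply NH.
 - assumption.
 - now apply homoclinic_reversed.
Qed.

(** * The point reflection *)

Definition reflected (X : plane -> plane) (p : plane) : plane := opp (X (opp p)).

Lemma oppp (p : plane) : opp (opp p) = p.
Proof. exact (opp_opp p). Qed.

Lemma reflected_reflected X : reflected (reflected X) = X.
Proof. apply functional_extensionality. intros p. unfold reflected. now rewrite !oppp. Qed.

Lemma norm_oppp (p : plane) : norm (opp p : plane) = norm p.
Proof. exact (norm_opp (V := prod_NormedModule R_AbsRing R_NormedModule R_NormedModule) p). Qed.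

Lemma opp_origin : opp origin = origin.
Proof. exact (opp_zero (G := prod_NormedModule R_AbsRing R_NormedModule R_NormedModule)). Qed.

Lemma opp_nonzero (p : plane) : p <> origin -> opp p <> origin.
Proof. intros N E. apply N. now rewrite <- (oppp p), E, opp_origin. Qed.

Lemma opp_derive X (w : R -> plane) t : is_derive w t (X (w t)) ->
 is_derive (fun s => opp (w s) : plane) t (reflected X (opp (w t))).
Proof.
 intros H. unfold reflected. rewrite oppp. now apply (is_derive_opp w).
Qed.

Lemma opp_continuous (p : plane) : continuous (fun q : plane => opp q : plane) p.
Proof. apply (continuous_opp (V := prod_NormedModule R_AbsRing R_NormedModule R_NormedModule)),
 continuous_id. Qed.

Lemma opp_limit (w : R -> plane) (F : (R -> Prop) -> Prop) : filterlim w F (locally origin) ->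
 filterlim (fun s => opp (w s) : plane) F (locally origin).
Proof.
 intros H. apply (filterlim_comp _ _ _ w (fun q => opp q) F (locally origin)); [assumption|].
 rewrite <- opp_origin at 2. apply opp_continuous.
Qed.

Lemma captured_reflected X S p : captured X S (opp p) -> captured (reflected X) (fun q => S (opp
 q)) p.
Proof.
 intros [w [W0 [W1 W2]]]. exists (fun t => opp (w t)). conj3; [now rewrite W0, oppp|
  |now apply opp_limit].
 intros t Ht. rewrite oppp. split; [now apply opp_derive, W1|now apply W1].
Qed.

Lemma captured_conj_reversed X S p : captured (reversed X) S (opp p) ->
 captured (reversed (reflected X)) (fun q => S (opp q)) p.
Proof. exact (captured_reflected (reversed X) S p). Qed.

Lemma leaves_reflected X S p : leaves X S (opp p) -> leaves (reflected X) (fun q => S (opp q)) p.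
Proof.
 intros [w [T [HT [W0 [W1 W2]]]]]. exists (fun t => opp (w t)), T.
 conj4; [assumption|now rewrite W0, oppp| |now rewrite oppp].
 intros t Ht. now apply opp_derive, W1.
Qed.

Lemma homoclinic_reflected X p : homoclinic X (opp p) -> homoclinic (reflected X) p.
Proof.
 intros [Np [w [W0 [W1 [W2 W3]]]]]. split; [intros ->; now rewrite opp_origin in Np|].
 exists (fun t => opp (w t)). split; [now rewrite W0, oppp|].
 split; [intros t; now apply opp_derive|split; now apply opp_limit].
Qed.

Lemma homoclinic_reflected_inv X p : homoclinic (reflected X) p -> homoclinic X (opp p).
Proof. intros H. rewrite <- (reflected_reflected X). apply homoclinic_reflected. now rewrite oppp.
 Qed.

Lemma center_reflected X : center X -> center (reflected X).
Proof.
 intros [delta [Hd H]]. exists delta. split; [assumption|]. intros p Np Hp.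
 destruct (H (opp p)) as [w [T [HT [W0 [W1 [W2 [t Ht]]]]]]];
  [now apply opp_nonzero|now rewrite norm_oppp|].
 exists (fun t => opp (w t)), T. conj5; [assumption|now rewrite W0, oppp| | | ].
 - intros s. now apply opp_derive.
 - intros s. now rewrite W2.
 - exists t. intros E. apply Ht. now rewrite <- E, oppp.
Qed.

Lemma elliptic_region_bounded_reflected X : elliptic_region_bounded X -> elliptic_region_bounded
 (reflected X).
Proof.
 intros [M H]. exists M. intros p Hp. rewrite <- norm_oppp. now apply H, homoclinic_reflected_inv.
Qed.

Section ReflectedChart.
Variables (X : plane -> plane) (Phi : R * R -> plane).
Let Psi (z : R * R) : plane := opp (Phi z).

Lemma closed_sector_conj a b : closed_sector Psi a b = (fun q => closed_sector Phi a b (opp q)).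
Proof.
 apply functional_extensionality. intros q. apply propositional_extensionality.
 split; intros [r [th [Hr [Hth E]]]]; exists r, th; (conj3; [assumption|assumption| ]).
 - now rewrite E; unfold Psi; rewrite oppp.
 - unfold Psi. now rewrite <- E, oppp.
Qed.

Lemma open_sector_conj a b q : open_sector Psi a b q -> open_sector Phi a b (opp q).
Proof.
 intros [r [th [Hr [Hth E]]]]; exists r, th; (conj3; [assumption|assumption| ]).
 now rewrite E; unfold Psi; rewrite oppp.
Qed.

Lemma stable_ray_reflected Y a : stable_ray Y Phi a -> stable_ray (reflected Y) Psi a.
Proof.
 unfold stable_ray, ray. rewrite closed_sector_conj. intros H p Hp. apply captured_reflected.
  now apply H.
Qed.

Lemma opposite_sides_reflected a b : opposite_sides X Phi a b -> opposite_sides (reflected X) Psi a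
 b.
Proof.
 assert (Q : forall a, unstable_ray X Phi a -> unstable_ray (reflected X) Psi a)
  by (intros c; exact (stable_ray_reflected (reversed X) c)).
 intros [[H1 H2]|[H1 H2]]; [left|right]; split; auto; now apply stable_ray_reflected.
Qed.

Lemma attracting_reflected Y a b : attracting_sector Y Phi a b -> attracting_sector (reflected Y)
 Psi a b.
Proof.
 intros [H1 [H2 H3]]. conj3; [now apply stable_ray_reflected|now apply stable_ray_reflected| ].
 rewrite closed_sector_conj. intros p Hp. destruct (H3 _ Hp) as [H4 H5].
 split; [now apply captured_reflected|]. intros Q. now apply H5, homoclinic_reflected_inv.
Qed.

Lemma path_connected_opp K : path_connected K -> path_connected (fun p => K (opp p)).
Proof.
 intros H p q Hp Hq. destruct (H _ _ Hp Hq) as [w [W1 [W2 [W3 W4]]]]. exists (fun s => opp (w s)).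
 conj4; [ |now rewrite W2, oppp|now rewrite W3, oppp| ].
 - intros s Hs. apply (filterlim_comp _ _ _ w (fun q => opp q) _ (locally (w s)));
  [now apply W1|apply opp_continuous].
 - intros s Hs. rewrite oppp. now apply W4.
Qed.

Lemma sector_reflected k a b : sector X Phi k a b -> sector (reflected X) Psi k a b.
Proof.
 destruct k; simpl.
 - intros [H1 [H2 H3]]. split; [now apply opposite_sides_reflected|]. rewrite closed_sector_conj.
  split.
  + intros p Hp. destruct (H2 _ (open_sector_conj _ _ _ Hp)) as [H4 H5]. split;
   [now apply homoclinic_reflected|].
   destruct H5 as [H5|H5]; [left; now apply captured_reflected|right;
    now apply captured_conj_reversed].
  + apply path_connected_opp in H3. intros p q [P1 P2] [Q1 Q2].
   assert (Inv : forall Y p, captured (reflected Y) (fun q => closed_sector Phi a b (opp q)) p ->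
    captured Y (closed_sector Phi a b) (opp p)).
   { intros Y r Hr. rewrite <- (oppp r) in Hr. apply captured_reflected in Hr.
    rewrite reflected_reflected in Hr.
    destruct Hr as [w [W0 [W1 W2]]]. exists w. conj3; [assumption| |assumption].
    intros t Ht. destruct (W1 t Ht) as [V1 V2]. rewrite oppp in V2. now split. }
   destruct (H3 p q) as [w [W1 [W2 [W3 W4]]]].
   * split; [now apply Inv|apply (Inv (reversed X)); exact P2].
   * split; [now apply Inv|apply (Inv (reversed X)); exact Q2].
   * exists w. conj4; [assumption|assumption|assumption| ]. intros s Hs.
    destruct (W4 s Hs). split; [now apply captured_reflected|now apply captured_conj_reversed].
 - intros [H1 H2]. split; [now apply opposite_sides_reflected|]. rewrite closed_sector_conj.
  intros p Hp.
  destruct (H2 _ (open_sector_conj _ _ _ Hp)) as [H4 H5].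
  split; [now apply leaves_reflected|exact (leaves_reflected (reversed X) _ _ H5)].
 - intros [H|H]; [left; now apply attracting_reflected|right;
  exact (attracting_reflected (reversed X) _ _ H)].
Qed.

Lemma polar_chart_conj delta : polar_chart delta Phi -> polar_chart delta Psi.
Proof.
 intros [C1 C2 C3 C4 C5 C6 C7]. unfold Psi. split.
 - intros z Hz. apply (filterlim_comp _ _ _ Phi (fun q => opp q) _ (locally (Phi z)));
  [now apply C1|apply opp_continuous].
 - intros th Hth. rewrite C2 by assumption. apply opp_origin.
 - intros r Hr. now rewrite C3.
 - intros. apply opp_nonzero. now apply C4.
 - intros r th r' th' H1 H2 H3 H4 E. apply C5; try assumption.
  now rewrite <- (oppp (Phi (r, th))), E, oppp.
 - assert (Q := opp_continuous origin). rewrite <- opp_origin in C6. specialize (Q _ C6).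
  unfold filtermap in Q. revert Q. apply filter_imp. intros p [r [th [H1 [H2 H3]]]].
  exists r, th. conj3; [assumption|assumption| ]. now rewrite <- H3, oppp.
 - intros. rewrite norm_oppp. now apply C7.
Qed.
End ReflectedChart.

Lemma consists_of_reflected X kinds : consists_of X kinds -> consists_of (reflected X) kinds.
Proof.
 intros H delta Hd. destruct (H delta Hd) as [Phi [theta [l [H1 [H2 [H3 [H4 [H5 [H6 H7]]]]]]]]].
 exists (fun z => opp (Phi z)), theta, l. conj3; [now apply polar_chart_conj|assumption| ].
 conj5; [assumption|assumption|assumption| |assumption].
 intros i Hi. destruct (H6 i Hi). split; [assumption|now apply sector_reflected].
Qed.

(** The point reflection exchanges the half planes without reversing time. By the symmetry
    hypothesis [f] has opposite signs on the two half axes near [O], so the sign on the positive one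
    is reversed. *)
Definition fO (f : R -> R -> R) (x y : R) : R := f (- x) (- y).

Lemma lienard_reflected g f : reflected (lienard g f) = lienard (gT g) (fO f).
Proof.
 apply functional_extensionality. intros [x y]. unfold reflected, lienard, gT, fO, opp; simpl.
 unfold prod_opp, opp; simpl. f_equal; ring.
Qed.

(** * From the hypotheses to a normalized system *)

(** Induction on the order of the zero: dividing by [x] shifts the coefficients and keeps the sign
    for [x > 0]. *)
Lemma pseries_leading_sign m : forall a : nat -> R, Rbar_lt 0 (CV_radius a) ->
 (forall k, (k < m)%nat -> a k = 0) -> a m <> 0 ->
 exists d, 0 < d /\ forall x, 0 < x < d -> 0 < a m * PSeries a x.
Proof.
 induction m as [|m IH]; intros a Ha Hk Hm.
 - assert (C : continuous (fun x => a 0%nat * PSeries a x) 0).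
  { apply (continuous_mult (K := R_AbsRing)); [apply continuous_const|].
   apply continuity_pt_filterlim. apply PSeries_continuity. now rewrite Rabs_R0. }
  destruct (continuous_pos _ _ C) as [d [D1 D2]].
  { rewrite PSeries_0. assert (Q := Rsqr_pos_lt _ Hm). exact Q. }
  exists d. split; [assumption|]. intros x Hx. apply D2. rewrite Rminus_0_r, Rabs_pos_eq; lra.
 - destruct (IH (PS_decr_1 a)) as [d [D1 D2]].
  + now rewrite CV_radius_decr_1.
  + intros k Hk'. apply Hk. lia.
  + exact Hm.
  + exists d. split; [assumption|]. intros x Hx. rewrite PSeries_decr_1_aux by (apply Hk; lia).
   specialize (D2 x Hx). unfold PS_decr_1 at 1 in D2.
   replace (a (S m) * (x * PSeries (PS_decr_1 a) x)) with (x * (a (S m) * PSeries (PS_decr_1 a) x))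
    by ring.
   apply Rmult_lt_0_compat; lra.
Qed.

Lemma pseries_sign (h : R -> R) (a : nat -> R) r : 0 < r -> (forall x,
 Rabs x < r -> is_pseries a x (h x)) ->
 exists d, 0 < d /\ ((forall x, 0 < x <= d -> h x <= 0) \/ (forall x, 0 < x <= d -> 0 <= h x)).
Proof.
 intros Hr H.
 assert (E : forall x, 0 < x < r -> h x = PSeries a x).
 { intros x Hx. symmetry. apply is_pseries_unique, H. rewrite Rabs_pos_eq; lra. }
 destruct (classic (exists m, a m <> 0)) as [Hm|Hn].
 - destruct (Wf_nat.dec_inh_nat_subset_has_unique_least_element (fun m => a m <> 0)) as [m [[M1 M2]
  _]].
  { intros n. destruct (Req_dec (a n) 0); [right|left]; lra. }
  { exact Hm. }
  destruct (pseries_leading_sign m a) as [d [D1 D2]].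
  + apply Rbar_lt_le_trans with (Rabs (r / 2)); [simpl; apply Rabs_pos_lt; lra|].
   apply Rbar_not_lt_le. intros Q. apply CV_disk_outside in Q. apply Q, ex_series_lim_0.
   exists (h (r / 2)). apply (proj1 (is_pseries_R a (r / 2) (h (r / 2)))). apply H.
    rewrite Rabs_pos_eq; lra.
  + intros k Hk. destruct (Req_dec (a k) 0) as [|N]; [assumption|]. specialize (M2 k N). lia.
  + assumption.
  + destruct (min3 (d / 2) (r / 2) 1) as [e [He [E1 [E2 _]]]]; [lra|lra|lra|].
   exists e. split; [assumption|]. destruct (Rlt_or_le (a m) 0) as [S|S]; [left|right];
    intros x Hx; rewrite E by lra; specialize (D2 x ltac:(lra)).
   * apply Rnot_lt_le. intros Z. assert (Q := Rmult_lt_0_compat (- a m) _ ltac:(lra) Z). lra.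
   * apply Rnot_lt_le. intros Z. assert (Q := Rmult_le_pos (a m) (- PSeries a x) S ltac:(lra)). lra.
 - exists (r / 2). split; [lra|]. left. intros x Hx. rewrite E by lra.
  rewrite <- (Rmult_0_l (PSeries a x)).
  rewrite <- (PSeries_scal 0). right. apply PSeries_ext. intros n. unfold PS_scal, scal; simpl;
   unfold mult; simpl.
  apply NNPP. intros N. apply Hn. exists n. intros Z. apply N. rewrite Z. ring.
Qed.

(** On the axis only the last term of each homogeneous part survives, with [0 ^ 0 = 1]; this leaves
    a power series in one variable. *)
Lemma analytic2_axis_sign f : analytic_at2 f 0 0 ->
 exists d, 0 < d /\ ((forall x, 0 < x <= d -> f x 0 <= 0) \/ (forall x, 0 < x <= d -> 0 <= f x 0)).
Proof.
 intros [a [r [Hr H]]]. apply (pseries_sign (fun x => f x 0) (fun n => a n 0%nat) r Hr).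
 intros x Hx. destruct (H x 0 Hx) as [_ S]; [rewrite Rabs_R0; lra|].
 rewrite !Rplus_0_l in S. apply is_pseries_R. revert S. apply is_series_ext. intros [|n].
 - rewrite sum_O. simpl. ring.
 - rewrite sum_Sn, Nat.sub_diag. simpl (0 ^ 0).
  assert (Z : sum_n (fun i => a i (S n - i)%nat * x ^ i * 0 ^ (S n - i)) n = 0).
  { rewrite (sum_n_ext_loc _ (fun _ => 0)).
   - rewrite sum_n_const. apply Rmult_0_r.
   - intros i Hi. rewrite (pow_i (S n - i)) by lia. apply Rmult_0_r. }
  rewrite Z. unfold plus; simpl. match goal with |- ?u = ?v => change (u = v :> R) end. ring.
Qed.

Lemma norm_plane_le (a b : R) : norm ((a, b) : plane) <= Rabs a + Rabs b.
Proof.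
 unfold norm; simpl. unfold prod_norm, norm; simpl. unfold abs; simpl.
 pose proof (Rabs_pos a). pose proof (Rabs_pos b).
 rewrite <- (sqrt_Rsqr (Rabs a + Rabs b)) by lra. apply sqrt_le_1_alt. unfold Rsqr.
 assert (0 <= Rabs a * Rabs b) by (apply Rmult_le_pos; assumption). lra.
Qed.

(** [lipschitz_on] allows any real constant, which is replaced by its absolute value; a box of size
    [N] is enclosed in the ball of radius [N + N]. *)
Lemma half_of_hypotheses g f : hypotheses g f -> half g f.
Proof.
 intros H. split.
 - apply H.
 - intros N. destruct (hyp_g_lipschitz _ _ H N) as [L HL]. exists (Rabs L). split;
  [apply Rabs_pos|].
  intros x x' Hx Hx'. apply Rle_trans with (L * Rabs (x - x')); [exact (HL x x' Hx Hx')|].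
  apply Rmult_le_compat_r; [apply Rabs_pos|apply Rle_abs].
 - intros N. destruct (hyp_f_lipschitz _ _ H (N + N)) as [L HL]. exists (Rabs L). split;
  [apply Rabs_pos|].
  intros x y x' y' Hx Hy Hx' Hy'.
  assert (Q := HL (x, y) (x', y') ltac:(apply Rle_trans with (1 := norm_plane_le _ _); lra)
   ltac:(apply Rle_trans with (1 := norm_plane_le _ _); lra)).
  apply Rle_trans with (1 := Q). apply Rle_trans with (Rabs L * norm ((x - x', y - y') : plane)).
  + apply Rmult_le_compat_r; [apply norm_ge_0|apply Rle_abs].
  + apply Rmult_le_compat_l; [apply Rabs_pos|apply norm_plane_le].
Qed.

Lemma Gp_gT g f x : half g f -> 0 <= x -> Gp (gT g) x = Gp g (- x).
Proof.
 intros Hh Hx. assert (D : forall t, is_derive (fun s => Gp (gT g) s - Gp g (- s)) t 0).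
 { intros t. replace 0 with (gT g t - - g (- t)) by (unfold gT; ring).
  apply (is_derive_minus (V := R_NormedModule)); [apply (Gp_derive _ _ (half_T _ _ Hh))|].
  apply is_derive_reverse. apply (Gp_derive _ _ Hh). }
 assert (Q1 := derive_nondecr _ (fun _ => 0) 0 x Hx (fun t _ => D t) (fun _ _ => Rle_refl 0)).
 assert (Q2 := derive_nonincr _ (fun _ => 0) 0 x Hx (fun t _ => D t) (fun _ _ => Rle_refl 0)).
 cbv beta in Q1, Q2. rewrite Ropp_0, !Gp_0 in Q1, Q2. lra.
Qed.

(** In the odd case equal potentials mean equal abscissas after reflection; in the other case the
    identity is the hypothesis at [x] and [- x2] with denominators cleared. *)
Lemma conj_half_of_hypotheses g f : hypotheses g f -> conj_half g f (gT g) (fT f).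
Proof.
 intros H x x2 y Hx Hx2 E. assert (Hh := half_of_hypotheses g f H).
 destruct (hyp_symmetric _ _ H) as [[S1 S2]|[_ S2]].
 - assert (Eg : gT g = g) by (apply functional_extensionality; intros v; unfold gT;
  now rewrite <- S1).
  rewrite Eg in *. assert (x = x2).
  { destruct (Rtotal_order x x2) as [Q|[Q|Q]]; [|assumption|].
   - assert (W := Gp_incr g f Hh x x2 ltac:(lra)). lra.
   - assert (W := Gp_incr g f Hh x2 x ltac:(lra)). lra. }
  subst x2. unfold fT. now rewrite (S2 x y Hx).
 - rewrite (Gp_gT g f x2 Hh) in E by lra. assert (Q := S2 x (- x2) y ltac:(lra) Hx E).
  assert (G1 := half_pos g f Hh x Hx). assert (G2 := half_neg g f Hh (- x2) ltac:(lra)).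
  unfold gT, fT. assert (Q' : f x y * g (- x2) = f (- x2) y * g x).
  { replace (f x y) with (f x y / g x * g x) by (field; lra). rewrite Q. field. lra. }
  lra.
Qed.

(** The factors [g] in the conjugation identity are positive, so [f] and [fT f] have the same sign
    at points of equal potential; [sg] covers both signs. *)
Lemma axis_sign_left g f d sg : half g f -> conj_half g f (gT g) (fT f) -> 0 < d ->
 (forall x, 0 < x <= d -> sg * f x 0 <= 0) -> exists d', 0 < d' /\ forall x,
  0 < x <= d' -> sg * fT f x 0 <= 0.
Proof.
 intros Hh HC Hd Hs. assert (HhT := half_T _ _ Hh).
 destruct (Gp_small (gT g) (fT f) g f HhT Hh d Hd) as [d' [D1 D2]].
 exists (d' / 2). split; [lra|]. intros x2 Hx2. specialize (D2 x2 ltac:(rewrite Rabs_pos_eq; lra)).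
 assert (P2 := Gp_pos _ _ HhT x2 ltac:(lra)).
 destruct (ivt (Gp g) 0 d (Gp (gT g) x2)) as [x [Hx Ex]]; [lra|intros;
  apply (Gp_cont g f Hh)|rewrite Gp_0; lra|].
 assert (Px : 0 < x). { destruct (Req_dec x 0) as [->|]; [rewrite Gp_0 in Ex|]; lra. }
 assert (Q := HC x x2 0 Px ltac:(lra) Ex). assert (G1 := half_pos g f Hh x Px).
 assert (G2 := half_pos _ _ HhT x2 ltac:(lra)). specialize (Hs x ltac:(lra)).
 apply Rnot_lt_le. intros Z. assert (W := Rmult_lt_0_compat _ _ Z G1).
 assert (W' := Rmult_le_pos (- (sg * f x 0)) _ ltac:(lra) (Rlt_le _ _ G2)).
 replace (sg * fT f x2 0 * g x) with (sg * (fT f x2 0 * g x)) in W by ring. rewrite <- Q in W. lra.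
Qed.

(** The bound is [f x y <= f x 0 + L * |y|] in the unit box. [L] is chosen before [d], so that both
    halves can later share a smaller [d]. *)
Lemma one_sided_of_sign g f d0 : half g f -> 0 < d0 -> (forall x, 0 < x <= d0 -> f x 0 <= 0) ->
 exists L, forall d, 0 < d <= d0 -> d <= 1 -> one_sided f d L.
Proof.
 intros Hh Hd Hs. destruct (half_flip _ _ Hh 1) as [L [HL HLf]]. exists L.
 intros d Hd1 Hd2. conj3; [lra|assumption| ]. intros x y Hx Hy.
 assert (R1 : Rabs x <= 1) by (rewrite Rabs_pos_eq; lra).
 assert (Q := HLf x y x 0 R1 ltac:(lra) R1 ltac:(rewrite Rabs_R0; lra)).
 replace (x - x) with 0 in Q by ring. rewrite Rabs_R0, Rplus_0_l, Rminus_0_r in Q.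
  apply Rabs_le_iff in Q.
 specialize (Hs x ltac:(lra)). lra.
Qed.

Lemma one_sided_weaken f d L L' : one_sided f d L -> L <= L' -> one_sided f d L'.
Proof.
 intros [H1 [H2 H3]] HL. conj3; [assumption|lra| ]. intros x y Hx Hy.
 apply Rle_trans with (1 := H3 x y Hx Hy). apply Rmult_le_compat_r; [apply Rabs_pos|assumption].
Qed.

Lemma sys_of_sign g f d0 : half g f -> conj_half g f (gT g) (fT f) -> 0 < d0 ->
 (forall x, 0 < x <= d0 -> f x 0 <= 0) -> exists d L, sys g f d L.
Proof.
 intros Hh HC Hd Hs. destruct (axis_sign_left g f d0 1 Hh HC Hd) as [d1 [D1 Hs1]].
 { intros x Hx. specialize (Hs x Hx). lra. }
 destruct (one_sided_of_sign g f d0 Hh Hd Hs) as [L0 O0].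
 destruct (one_sided_of_sign _ _ d1 (half_T _ _ Hh) D1) as [L1 O1].
 { intros x Hx. specialize (Hs1 x Hx). lra. }
 destruct (min3 d0 d1 1 Hd D1 Rlt_0_1) as [d [Q [Q1 [Q2 Q3]]]]. exists d, (Rmax L0 L1).
 split; try assumption.
 - apply (one_sided_weaken f d L0); [apply O0; lra|apply Rmax_l].
 - apply (one_sided_weaken (fT f) d L1); [apply O1; lra|apply Rmax_r].
Qed.

Lemma half_O g f : half g f -> half (gT g) (fO f).
Proof.
 intros Hh. destruct (half_T _ _ Hh) as [H1 H2 _]. split; [assumption|assumption|].
 intros N. destruct (half_flip _ _ Hh N) as [L [HL H]]. exists L. split; [assumption|].
 intros x y x' y' Hx Hy Hx' Hy'. unfold fO.
 assert (Q := H (- x) (- y) (- x') (- y')). rewrite !Rabs_Ropp in Q. specialize (Q Hx Hy Hx' Hy').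
 replace (- x - - x') with (- (x - x')) in Q by ring.
  replace (- y - - y') with (- (y - y')) in Q by ring.
 now rewrite !Rabs_Ropp in Q.
Qed.

Lemma conj_half_O g f : conj_half g f (gT g) (fT f) -> conj_half (gT g) (fO f) (gT (gT g)) (fT (fO
 f)).
Proof.
 intros HC x x2 y Hx Hx2 E. rewrite gT_gT in *. assert (Q := HC x2 x (- y) Hx2 Hx (eq_sym E)).
 unfold fT, fO in *. rewrite Ropp_involutive. lra.
Qed.

(** If [f] is nonnegative on the positive axis near [O], conjugation makes it nonpositive on the
    negative one, which the point reflection brings to the right. *)
Lemma normalization g f : hypotheses g f ->
 (exists d L, sys g f d L) \/ (exists d L, sys (gT g) (fO f) d L).
Proof.
 intros H. assert (Hh := half_of_hypotheses g f H). assert (HC := conj_half_of_hypotheses g f H).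
 destruct (hyp_f_analytic _ _ H) as [delta [D1 D2]].
 destruct (analytic2_axis_sign f) as [d [Hd [S|S]]].
 - apply D2. apply Rle_lt_trans with (1 := norm_plane_le 0 0). rewrite Rabs_R0. lra.
 - left. now apply (sys_of_sign g f d).
 - right. destruct (axis_sign_left g f d (-1) Hh HC Hd) as [d1 [Hd1 S1]].
  { intros x Hx. specialize (S x Hx). lra. }
  apply (sys_of_sign _ _ d1 (half_O g f Hh) (conj_half_O g f HC) Hd1).
  intros x Hx. specialize (S1 x Hx). unfold fO, fT in *. rewrite Ropp_0. lra.
Qed.

Lemma trichotomy g f : hypotheses g f ->
 (center (lienard g f) \/ consists_of (lienard g f) [Elliptic; Hyperbolic] \/
  consists_of (lienard g f) [Elliptic; Hyperbolic; Parabolic; Parabolic]) /\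
 (forall kinds : list sector_kind, consists_of (lienard g f) kinds ->
  elliptic_region_bounded (lienard g f) -> ~ In Parabolic kinds).
Proof.
 intros H. destruct (normalization g f H) as [[d [L HS]]|[d [L HS]]].
 - split; [now apply (local_trichotomy g f d L)|]. intros kinds. now apply (no_parabolic g f d L).
 - rewrite <- (reflected_reflected (lienard g f)), lienard_reflected. split.
  + destruct (local_trichotomy _ _ d L HS) as [Q|[Q|Q]]; [left|right; left|right; right];
    [now apply center_reflected|now apply consists_of_reflected|now apply consists_of_reflected].
  + intros kinds Hk Hb. apply consists_of_reflected in Hk.
   apply elliptic_region_bounded_reflected in Hb.
   rewrite reflected_reflected in Hk, Hb. now apply (no_parabolic _ _ d L kinds HS).
Qed.

(** * Examples *)

(* The primitive [phi] of [cl 1] equals [x^2 / 2] for [|x| <= 1] and [|x| - 1 / 2] beyond;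
  [exg] is [2 phi phi'], so that with [f = -3 phi'] the curve [y = phi x] is invariant. *)
Definition phi (x : R) : R := cl 1 x * cl 1 x / 2 + (x - cl 1 x) * cl 1 x.

Definition exg (x : R) : R := cl 1 x * cl 1 x * cl 1 x + 2 * (x - cl 1 x).

(** The damping is [- 3 * x] near [O]; the factors [h] and [k] prolong it or cut it off farther
    out. *)
Definition exf (h k : R -> R) (x y : R) : R := - 3 * (h x * k y).

Lemma cl1_cases x : (-1 <= x <= 1 /\ cl 1 x = x) \/ (1 <= x /\ cl 1 x = 1) \/ (x <= -1 /\ cl 1 x =
 -1).
Proof. unfold cl, Rmax, Rmin. repeat destruct Rle_dec; lra. Qed.

Lemma exg_phi x : exg x = 2 * phi x * cl 1 x.
Proof. unfold exg, phi. destruct (cl1_cases x) as [[_ ->]|[[_ ->]|[_ ->]]]; field. Qed.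

Lemma exg_odd x : exg x = - exg (- x).
Proof. unfold exg. rewrite cl_opp by lra. ring. Qed.

(** A global quadratic remainder also covers the points where the formula of a piecewise function
    changes. *)
Lemma is_derive_quadratic (h : R -> R) a l C : (forall x,
 Rabs (h x - h a - l * (x - a)) <= C * (x - a)²) ->
 is_derive h a l.
Proof.
 intros H. apply is_derive_Reals. intros eps He.
 assert (HC : 0 <= C).
 { specialize (H (a + 1)). replace (a + 1 - a) with 1 in H by ring. unfold Rsqr in H.
  pose proof (Rabs_pos (h (a + 1) - h a - l * 1)). lra. }
 exists (mkposreal (eps / (C + 1)) ltac:(apply Rdiv_lt_0_compat; lra)). simpl. intros u Hu Hd.
 specialize (H (a + u)). replace (a + u - a) with u in H by ring.
 assert (Pu : 0 < Rabs u) by now apply Rabs_pos_lt.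
 replace ((h (a + u) - h a) / u - l) with ((h (a + u) - h a - l * u) / u) by (field; assumption).
 unfold Rdiv. rewrite Rabs_mult, Rabs_inv. apply Rmult_lt_reg_r with (Rabs u); [assumption|].
 rewrite Rmult_assoc, Rinv_l, Rmult_1_r by lra. rewrite Rsqr_abs in H. unfold Rsqr in H.
 apply Rle_lt_trans with (1 := H). rewrite <- Rmult_assoc. apply Rmult_lt_compat_r; [assumption|].
 apply Rle_lt_trans with (C * (eps / (C + 1))); [apply Rmult_le_compat_l; lra|].
 apply Rmult_lt_reg_r with (C + 1); [lra|]. unfold Rdiv. rewrite !Rmult_assoc, Rinv_l by lra. lra.
Qed.

Lemma phi_derive a : is_derive phi a (cl 1 a).
Proof.
 apply (is_derive_quadratic phi a (cl 1 a) 1). intros x. rewrite Rmult_1_l. unfold phi, Rsqr.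
  apply Rabs_le_iff.
 destruct (cl1_cases x) as [[H1 ->]|[[H1 ->]|[H1 ->]]];
  destruct (cl1_cases a) as [[H2 ->]|[[H2 ->]|[H2 ->]]];
  pose proof (Rle_0_sqr (x - a)) as Q0; pose proof (Rle_0_sqr (x - 1)) as Q1;
   pose proof (Rle_0_sqr (x + 1)) as Q2;
  pose proof (Rle_0_sqr (a - 1)) as Q3; pose proof (Rle_0_sqr (a + 1)) as Q4; unfold Rsqr in *;
   split; nra.
Qed.

Lemma phi_nonneg x : 0 <= phi x.
Proof. unfold phi. destruct (cl1_cases x) as [[H1 ->]|[[H1 ->]|[H1 ->]]]; nra. Qed.

Lemma is_series_finite (a : nat -> R) m : (forall n,
 (m < n)%nat -> a n = 0) -> is_series a (sum_n a m).
Proof.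
 intros H. unfold is_series. apply (filterlim_ext_loc (fun _ => sum_n a m));
  [|apply filterlim_const].
 exists m. intros n Hn. induction Hn as [|n Hn IH]; [reflexivity|].
 rewrite sum_Sn, <- IH, H by lia. symmetry. apply Rplus_0_r.
Qed.

Record profile (h k : R -> R) : Prop := {
 prof_h_id : forall x, Rabs x <= 1 -> h x = x;
 prof_h_odd : forall x, h (- x) = - h x;
 prof_h_bd : forall x, Rabs (h x) <= 1;
 prof_h_lip : forall x x', Rabs (h x - h x') <= 3 * Rabs (x - x');
 prof_k_id : forall y, Rabs y <= 1 -> k y = 1;
 prof_k_bd : forall y, Rabs (k y) <= 1;
 prof_k_lip : forall y y', Rabs (k y - k y') <= Rabs (y - y') }.

Lemma Rabs_prod_diff a b a' b' A B : Rabs (a - a') <= A -> Rabs (b - b') <= B -> Rabs b <= 1 ->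
 Rabs a' <= 1 ->
 Rabs (a * b - a' * b') <= A + B.
Proof.
 intros H1 H2 H3 H4. replace (a * b - a' * b') with ((a - a') * b + a' * (b - b')) by ring.
 apply Rle_trans with (1 := Rabs_triang _ _). rewrite !Rabs_mult.
 pose proof (Rabs_pos (a - a')). pose proof (Rabs_pos (b - b')). pose proof (Rabs_pos b).
  pose proof (Rabs_pos a').
 apply Rplus_le_compat.
 - apply Rle_trans with (A * 1); [apply Rmult_le_compat; lra|lra].
 - apply Rle_trans with (1 * B); [apply Rmult_le_compat; lra|lra].
Qed.

Lemma exg_lip x x' : Rabs (exg x - exg x') <= 7 * Rabs (x - x').
Proof.
 assert (C := cl_lipschitz 1 x x'). unfold exg.
 assert (B : forall v, Rabs (cl 1 v) <= 1) by (intros; apply cl_abs; lra).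
 assert (B2 : forall v, Rabs (cl 1 v * cl 1 v) <= 1).
 { intros v. rewrite Rabs_mult. pose proof (B v). pose proof (Rabs_pos (cl 1 v)).
  apply Rle_trans with (1 * 1); [apply Rmult_le_compat; lra|lra]. }
 assert (Q1 := Rabs_prod_diff _ _ _ _ _ _ C C (B x) (B x')).
 assert (Q2 := Rabs_prod_diff _ _ _ _ _ _ Q1 C (B x) (B2 x')).
 set (u := cl 1 x * cl 1 x * cl 1 x) in *. set (u' := cl 1 x' * cl 1 x' * cl 1 x') in *.
 set (D := Rabs (x - x')) in *. assert (E := Rle_refl D). unfold D at 1 in E.
 apply Rabs_le_iff in Q2. apply Rabs_le_iff in C. apply Rabs_le_iff in E. apply Rabs_le_iff. lra.
Qed.

Section Profile.
Variables h k : R -> R.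
Hypothesis HP : profile h k.

Lemma exf_lip x y x' y' : Rabs (exf h k x y - exf h k x' y') <= 9 * (Rabs (x - x') + Rabs (y - y')).
Proof.
 assert (Q := Rabs_prod_diff _ _ _ _ _ _ (prof_h_lip _ _ HP x x') (prof_k_lip _ _ HP y y')
  (prof_k_bd _ _ HP y) (prof_h_bd _ _ HP x')).
 unfold exf. replace (-3 * (h x * k y) - -3 * (h x' * k y')) with (-3 * (h x * k y - h x' * k y'))
  by ring.
 rewrite Rabs_mult, (Rabs_left (-3)) by lra. pose proof (Rabs_pos (y - y')). lra.
Qed.

Lemma exf_lipschitz : lipschitz (fun p : plane => exf h k (fst p) (snd p)).
Proof.
 exists 18. intros [x y] [x' y'] _ _. set (q := minus (x, y) (x', y') : plane).
 assert (Q : Rabs (fst q) + Rabs (snd q) <= 2 * norm q).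
 { apply Rnot_lt_le. intros Z.
  assert (Z' : norm q < (Rabs (fst q) + Rabs (snd q)) / 2) by lra. apply norm_plane_lt in Z'. lra. }
 apply Rle_trans with (9 * (Rabs (fst q) + Rabs (snd q))); [exact (exf_lip x y x' y')|].
 apply Rle_trans with (9 * (2 * norm q)); [apply Rmult_le_compat_l; lra|].
 right. rewrite <- Rmult_assoc. f_equal. ring.
Qed.

Lemma exg_lipschitz : lipschitz exg.
Proof. exists 7. intros x x' _ _. apply exg_lip. Qed.

Lemma exg_sign x : x <> 0 -> 0 < x * exg x.
Proof.
 intros N. unfold exg. destruct (cl1_cases x) as [[H1 ->]|[[H1 ->]|[H1 ->]]]; [|nra|nra].
 replace (x * (x * x * x + 2 * (x - x))) with ((x * x) * (x * x)) by ring.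
 assert (0 < x * x) by (apply Rsqr_pos_lt; assumption). now apply Rmult_lt_0_compat.
Qed.

Lemma exg_analytic x0 : Rabs x0 < 1 / 2 -> analytic_at exg x0.
Proof.
 intros H0. set (a := fun n => match n with O => x0 * x0 * x0 | 1%nat => 3 * x0 * x0 |
  2%nat => 3 * x0 | 3%nat => 1 | _ => 0 end).
 exists a, (1 / 2). split; [lra|]. intros x Hx. apply is_pseries_R.
 assert (Q := is_series_finite (fun n => a n * (x - x0) ^ n) 3).
 replace (exg x) with (sum_n (fun n => a n * (x - x0) ^ n) 3).
 - apply Q. intros [|[|[|[|n]]]] Hn; try lia. simpl. ring.
 - rewrite !sum_Sn, sum_O. unfold plus; simpl.
  apply Rabs_lt_iff in H0. apply Rabs_lt_iff in Hx. unfold exg. rewrite cl_id by lra. ring.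
Qed.

Lemma exf_analytic x0 y0 : Rabs x0 < 1 / 2 -> Rabs y0 < 1 / 2 -> analytic_at2 (exf h k) x0 y0.
Proof.
 intros Hx0 Hy0. set (a := fun n m : nat => match n, m with O, O => - 3 * x0 | 1%nat, O => - 3 | _,
  _ => 0 end).
 exists a, (1 / 2). split; [lra|]. intros u v Hu Hv.
 assert (Z : forall n, (1 < n)%nat -> forall i, a i (n - i)%nat = 0).
 { intros n Hn [|[|i]]; simpl.
  - destruct n; [lia|reflexivity].
  - destruct n as [|[|n]]; [lia|lia|reflexivity].
  - reflexivity. }
 assert (S0 : forall (t : nat -> R) n, (forall i, t i = 0) -> sum_n t n = 0).
 { intros t n Ht. rewrite (sum_n_ext _ (fun _ => 0)) by exact Ht. rewrite sum_n_const.
  apply Rmult_0_r. }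
 split.
 - eexists. apply (is_series_finite _ 1). intros n Hn. apply S0. intros i. rewrite (Z n Hn),
  !Rmult_0_l. apply Rabs_R0.
 - replace (exf h k (x0 + u) (y0 + v)) with
   (sum_n (fun n => sum_n (fun i => a i (n - i)%nat * u ^ i * v ^ (n - i)) n) 1).
  + apply is_series_finite. intros n Hn. apply S0. intros i. rewrite (Z n Hn).
   now rewrite !Rmult_0_l.
  + rewrite sum_Sn, sum_O, sum_Sn, !sum_O. unfold plus; simpl. unfold exf.
   apply Rabs_lt_iff in Hx0. apply Rabs_lt_iff in Hy0. apply Rabs_lt_iff in Hu.
    apply Rabs_lt_iff in Hv.
   rewrite (prof_h_id _ _ HP), (prof_k_id _ _ HP) by (apply Rabs_le_iff; lra). ring.
Qed.

Lemma example_hypotheses : hypotheses exg (exf h k).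
Proof.
 split.
 - exists (1 / 2). split; [lra|apply exg_analytic].
 - exists (1 / 2). split; [lra|]. intros x y Hn. apply norm_plane_lt in Hn. now apply exf_analytic.
 - apply exg_sign.
 - intros M. destruct exg_lipschitz as [L HL]. exists L. intros p q _ _. now apply HL.
 - intros M. destruct exf_lipschitz as [L HL]. exists L. intros p q _ _. now apply HL.
 - left. split; [apply exg_odd|]. intros x y _. unfold exf. rewrite (prof_h_odd _ _ HP). ring.
Qed.

Lemma example_sys : exists d L, sys exg (exf h k) d L.
Proof.
 apply (sys_of_sign _ _ 1); [|apply conj_half_of_hypotheses, example_hypotheses|lra|].
 - apply half_of_hypotheses, example_hypotheses.
 - intros x Hx. unfold exf. rewrite (prof_h_id _ _ HP), (prof_k_id _ _ HP) by (rewrite ?Rabs_R0,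
  ?Rabs_pos_eq; lra). lra.
Qed.

(* [y = m x^2] is invariant near the origin iff [2 m^2 - 3 m + 1 = 0]. *)
Lemma example_emanates m v : (m = 1 / 2 \/ m = 1) -> 0 < v <= 1 ->
 exists x y, flow 1 (vf 1 exg (exf h k)) x y /\ emanates x y /\ x 0 = v /\ y 0 = m * v * v.
Proof.
 intros Hm Hv. destruct example_sys as [d [L HS]]. assert (Hh := sys_half _ _ _ _ HS).
 assert (FF := vf_field _ _ Hh 1 Rlt_0_1).
 destruct (flow_exists 1 _ v (m * v * v) Rlt_0_1 FF) as [x [y [Ex [Ey H]]]].
 (* On the invariant curve the first equation reads x' = m x^2; this is its solution through [v],
    and it tends to 0 in the past. *)
 set (X := fun t => / (/ v - m * t)).
 assert (Pv : 0 < / v) by (apply Rinv_0_lt_compat; lra).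
 assert (D : forall t, t <= 0 -> / v <= / v - m * t) by (intros t Ht; nra).
 assert (BX : forall t, t <= 0 -> 0 < X t <= v).
 { intros t Ht. specialize (D t Ht). unfold X. split; [apply Rinv_0_lt_compat; lra|].
  rewrite <- (Rinv_inv v) at 2. apply Rinv_le_contravar; lra. }
 assert (K : sol 1 (vf 1 exg (exf h k)) (fun t => t <= 0) X (fun t => m * X t * X t)).
 { intros t Ht. specialize (BX t Ht). specialize (D t Ht).
  assert (XX : 0 <= X t * X t <= 1) by (split; nra).
  assert (BY : 0 <= m * X t * X t <= 1) by (rewrite Rmult_assoc; destruct Hm as [->| ->]; lra).
  assert (DX : is_derive X t (m * X t * X t)).
  { unfold X. assert (Pd : 0 < / v - m * t) by lra. revert Pd. generalize (/ v). intros w Pd.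
   auto_derive; [lra|]. field. lra. }
  split; [now rewrite cl_id by lra|].
  replace (vf 1 exg (exf h k) (X t) (m * X t * X t)) with (m * (2 * X t * (m * X t * X t))).
  - apply (is_derive_ext (fun s => m * (X s * X s))); [intros; symmetry; apply Rmult_assoc|].
   replace (m * (2 * X t * (m * X t * X t))) with (m * (m * X t * X t * X t + X t * (m * X t * X
    t))) by ring.
   apply (is_derive_scal (fun s => X s * X s)). now apply (is_derive_mult X X); [| |intros;
    apply Rmult_comm].
  - unfold vf, exf, exg. rewrite !(cl_id 1 (X t)), (cl_id 1 (m * X t * X t)) by lra.
   rewrite (prof_h_id _ _ HP), (prof_k_id _ _ HP) by (apply Rabs_le_iff; lra).
   destruct Hm as [->| ->]; field. }
 assert (Eq : forall t, t <= 0 -> x t = X t /\ y t = m * X t * X t).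
 { intros t Ht. apply (sol_unique 1 _ x y X (fun t => m * X t * X t) t 0 0 FF); try lra.
  - now apply flow_sol.
  - intros s Hs. apply K. lra.
  - rewrite Ex. unfold X. rewrite Rmult_0_r, Rminus_0_r. now rewrite Rinv_inv.
  - rewrite Ey. unfold X. rewrite Rmult_0_r, Rminus_0_r. now rewrite Rinv_inv. }
 exists x, y. conj3; [assumption| |now split].
 assert (TX : tends (fun t => x (- t)) 0).
 { intros eps He. exists (2 / eps). intros t Ht. assert (0 < 2 / eps) by (apply Rdiv_lt_0_compat;
  lra).
  rewrite (proj1 (Eq (- t) ltac:(lra))), Rminus_0_r. specialize (BX (- t) ltac:(lra)).
  rewrite Rabs_pos_eq by lra. unfold X. rewrite <- (Rinv_inv eps).
  assert (0 < / eps) by now apply Rinv_0_lt_compat. unfold Rdiv in Ht.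
  apply Rinv_lt_contravar; [apply Rmult_lt_0_compat; [assumption|nra]|nra]. }
 conj5; [lra|rewrite Ey; nra| |assumption| ].
 - intros t Ht. destruct (Eq t ltac:(lra)) as [-> ->]. specialize (BX t ltac:(lra)). split;
  [lra|nra].
 - intros eps He. destruct (TX eps He) as [T HT]. exists (Rmax T 0). intros t Ht.
  assert (m1 := Rmax_l T 0). assert (m2 := Rmax_r T 0). specialize (HT t ltac:(lra)).
  destruct (Eq (- t) ltac:(lra)) as [E1 ->]. rewrite E1, Rminus_0_r in HT. rewrite Rminus_0_r.
  specialize (BX (- t) ltac:(lra)). rewrite Rabs_pos_eq in HT by lra. rewrite Rabs_pos_eq by nra.
   nra.
Qed.

Lemma example_has_em : has_em 1 (vf 1 exg (exf h k)).
Proof. destruct (example_emanates 1 1) as [x [y [H1 [H2 _]]]]; [now right|lra|now exists x, y]. Qed.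
End Profile.

Definition h2 : R -> R := cl 1.
Definition k2 (_ : R) : R := 1.
(** Equal to [x] on [-1, 1] and back to 0 at distance 2; with [k1] the damping vanishes where
    [|x| >= 2] or [|y| >= 2]. *)
Definition h1 (x : R) : R := 2 * cl 1 x - cl 2 x.
Definition k1 (y : R) : R := c01 (2 - Rabs y).

Lemma profile_unbounded : profile h2 k2.
Proof.
 unfold h2, k2. split.
 - intros x Hx. apply cl_id. now apply Rabs_le_iff in Hx.
 - intros x. apply cl_opp. lra.
 - intros x. apply cl_abs. lra.
 - intros x x'. pose proof (cl_lipschitz 1 x x'). pose proof (Rabs_pos (x - x')). lra.
 - reflexivity.
 - intros _. rewrite Rabs_R1. lra.
 - intros y y'. replace (1 - 1) with 0 by ring. rewrite Rabs_R0. apply Rabs_pos.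
Qed.

Lemma h1_values x : (Rabs x <= 1 -> h1 x = x) /\ Rabs (h1 x) <= 1 /\ (2 <= Rabs x -> h1 x = 0).
Proof.
 unfold h1. destruct (Rcase_abs x) as [Q|Q].
 - rewrite (Rabs_left x) by assumption.
  conj3; [|apply Rabs_le_iff|]; unfold cl, Rmax, Rmin; repeat destruct Rle_dec; lra.
 - rewrite (Rabs_right x) by assumption.
  conj3; [|apply Rabs_le_iff|]; unfold cl, Rmax, Rmin; repeat destruct Rle_dec; lra.
Qed.

Lemma profile_bounded : profile h1 k1.
Proof.
 split.
 - intros x. apply h1_values.
 - intros x. unfold h1. rewrite !cl_opp by lra. ring.
 - intros x. apply h1_values.
 - intros x x'. pose proof (cl_lipschitz 1 x x') as C1. pose proof (cl_lipschitz 2 x x') as C2.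
  unfold h1.
  apply Rabs_le_iff in C1. apply Rabs_le_iff in C2. apply Rabs_le_iff. lra.
 - intros y Hy. unfold k1. apply c01_high. lra.
 - intros y. unfold k1, c01. apply Rabs_le_iff. unfold Rmax, Rmin. repeat destruct Rle_dec; lra.
 - intros y y'. unfold k1, c01. pose proof (Rabs_triang_inv2 y y') as T. apply Rabs_le_iff in T.
  apply Rabs_le_iff.
  unfold Rmax, Rmin. repeat destruct Rle_dec; lra.
Qed.

(** The difference [w = y - phi x] solves the linear equation w' = 2 (cl 1 x) w, so an orbit with a
    point on the curve [y = phi x] stays on it. There [y >= 0], whereas a homoclinic orbit crosses
    the negative vertical axis. *)
Lemma unbounded_example_not_hom v : ~ hom exg (exf h2 k2) v (phi v).
Proof.
 intros [N [x [y [t [[HN [H [[L1 [L2 _]] [_ B]]]] [Ex Ey]]]]]].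
 assert (K : xsol exg (exf h2 k2) (fun _ => True) x y) by (apply (xsol_of_sol N); assumption).
 set (w := fun s => y s - phi (x s)).
 set (D := fun s => w s * w s). set (D' := fun s => 4 * cl 1 (x s) * D s).
 assert (Hw : forall s, is_derive w s (2 * cl 1 (x s) * w s)).
 { intros s. destruct (K s Logic.I) as [K1 K2].
  assert (K3 := is_derive_comp_R phi x s _ _ (phi_derive (x s)) K1).
  assert (K4 := is_derive_minus (V := R_NormedModule) _ _ _ _ _ K2 K3).
  unfold w. rewrite exg_phi in K4. unfold exf, h2, k2, minus, plus, opp in K4. simpl in K4.
  replace (2 * cl 1 (x s) * (y s - phi (x s))) with
   (- (2 * phi (x s) * cl 1 (x s)) - -3 * (cl 1 (x s) * 1) * y s + - (y s * cl 1 (x s))) by ring.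
    exact K4. }
 assert (HD : forall s, is_derive D s (D' s)).
 { intros s. unfold D', D. replace (4 * cl 1 (x s) * (w s * w s)) with
   (2 * cl 1 (x s) * w s * w s + w s * (2 * cl 1 (x s) * w s)) by ring.
  apply (is_derive_mult w w); [apply Hw|apply Hw|intros; apply Rmult_comm]. }
 assert (B4 : forall s, - 4 * D s <= D' s <= 4 * D s).
 { intros s. assert (P : 0 <= D s) by apply Rle_0_sqr. unfold D'.
  assert (C := cl_bounds 1 (x s) ltac:(lra)). split; nra. }
 assert (Dt : D t = 0) by (unfold D, w; rewrite Ex, Ey; ring).
 assert (D0 : D 0 <= 0).
 { destruct (Rle_or_lt t 0) as [Q|Q].
  - assert (W := gronwall D D' 4 t 0 Q (fun s _ => HD s) (fun s _ => proj2 (B4 s))). rewrite Dt,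
   Rmult_0_l in W. exact W.
  - assert (W := gronwall_back D D' 4 0 t ltac:(lra) (fun s _ => HD s) (fun s _ => proj1 (B4 s))).
   rewrite Dt, Rmult_0_l in W. exact W. }
 unfold D, w in D0. rewrite L1 in D0. assert (P0 := phi_nonneg 0).
 assert (0 < - (y 0 - phi 0) * - (y 0 - phi 0)) by (apply Rmult_lt_0_compat; lra). lra.
Qed.

(** Since [y = x^2] emanates, the topmost graph is at least that high and [y = x^2 / 2] lies
    strictly below it; without parabolic sectors its points would be homoclinic. *)
Lemma unbounded_example : consists_of (lienard exg (exf h2 k2)) [Elliptic; Hyperbolic; Parabolic;
 Parabolic].
Proof.
 destruct (example_sys _ _ profile_unbounded) as [d [L HS]].
 destruct (local_dichotomy _ _ d L HS (example_has_em _ _ profile_unbounded)) as [[_ [X0 [P0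
  HE]]]|Q]; [exfalso|exact Q].
 destruct (min3 X0 1 1 P0 Rlt_0_1 Rlt_0_1) as [X [PX [M1 [M2 _]]]].
 destruct (HE X ltac:(lra)) as [A [[_ Top] Hom]].
 destruct (example_emanates _ _ profile_unbounded 1 X) as [x [y [H [Em [Ex Ey]]]]];
  [now right|lra|].
 specialize (Top x y H Em ltac:(lra)). rewrite Ex, Ey in Top.
 assert (0 < X * X) by now apply Rmult_lt_0_compat.
 apply (unbounded_example_not_hom X). apply Hom; [lra|].
 replace (phi X) with (X * X / 2) by (unfold phi; rewrite cl_id by lra; field). lra.
Qed.

(* Outside the support of the damping the energy is conserved, hence an orbit that tends to the
  origin never exceeds the maximum of the energy over the support. *)
Lemma bounded_example : elliptic_region_bounded (lienard exg (exf h1 k1)).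
Proof.
 assert (Hh := half_of_hypotheses _ _ (example_hypotheses _ _ profile_bounded)).
 assert (EvenG : forall v, Gp exg v = Gp exg (Rabs v)).
 { assert (Eg : gT exg = exg) by (apply functional_extensionality; intros v; unfold gT;
  now rewrite <- exg_odd).
  assert (Q : forall v, 0 <= v -> Gp exg v = Gp exg (- v)).
  { intros v Hv. rewrite <- Eg at 1. now apply (Gp_gT exg (exf h1 k1)). }
  intros v. destruct (Rcase_abs v) as [S|S]; [|now rewrite Rabs_right].
  rewrite Rabs_left by assumption. rewrite (Q (- v)) by lra. now rewrite Ropp_involutive. }
 (* On the support of the damping [|x| <= 2] and [|y| <= 2], so the energy there is at most
    [2^2 / 2 + Gp exg 2]. *)
 set (C := 2 + Gp exg 2). assert (P2 := Gp_pos _ _ Hh 2 ltac:(lra)).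
 exists (2 * (C + 1)). intros p [_ [w [W0 [W1 [W2 _]]]]].
 assert (K := xsol_of_curve exg (exf h1 k1) (fun _ => True) w (fun t _ => W1 t)).
 set (x := fun t => fst (w t)) in K. set (y := fun t => snd (w t)) in K.
 apply filterlim_origin in W2. destruct W2 as [Lx Ly].
 set (H := fun t => En exg (x t) (y t)).
 assert (DH : forall t, is_derive H t (- (exf h1 k1 (x t) (y t) * y t * y t))).
 { intros t. destruct (K t Logic.I) as [K1 K2]. unfold H, En.
  assert (D1 := is_derive_comp_R (Gp exg) x t _ _ (Gp_derive _ _ Hh (x t)) K1).
  assert (D2 := is_derive_mult y y t _ _ K2 K2 Rmult_comm).
  assert (D3 := is_derive_scal _ t (/ 2) _ D2).
  assert (D4 := is_derive_plus (V := R_NormedModule) _ _ _ _ _ D3 D1).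
  apply (is_derive_ext (fun s => / 2 * (y s * y s) + Gp exg (x s))).
  { intros s. f_equal. apply Rmult_comm. }
  replace (- (exf h1 k1 (x t) (y t) * y t * y t)) with
   (/ 2 * ((- exg (x t) - exf h1 k1 (x t) (y t) * y t) * y t + y t * (- exg (x t) - exf h1 k1 (x t)
    (y t) * y t)) + y t * exg (x t)) by field.
  exact D4. }
 assert (Out : forall t, C < H t -> exf h1 k1 (x t) (y t) = 0).
 { intros t Ht. destruct (Rle_or_lt 2 (Rabs (x t))) as [Q|Q].
  - unfold exf. rewrite (proj2 (proj2 (h1_values (x t))) Q). ring.
  - destruct (Rle_or_lt 2 (Rabs (y t))) as [Q'|Q'].
   + unfold exf, k1. rewrite (c01_low (2 - Rabs (y t))) by lra. ring.
   + exfalso. unfold H, En, C in Ht. rewrite (EvenG (x t)) in Ht.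
    assert (G2 := Gp_incr _ _ Hh (Rabs (x t)) 2 ltac:(split; [apply Rabs_pos|assumption])).
    assert (y t * y t <= 2 * 2).
    { apply (square_lt (y t) 2) in Q'. lra. }
    lra. }
 assert (HC : H 0 <= C).
 { apply Rnot_lt_le. intros Z.
  assert (Tz : exists T, 0 < T /\ H T < C).
  { destruct (Gp_small exg (exf h1 k1) exg (exf h1 k1) Hh Hh 2 ltac:(lra)) as [e [E1 E2]].
   destruct (Lx e E1) as [T1 HT1]. destruct (Ly 1 ltac:(lra)) as [T2 HT2].
   exists (Rmax 1 (Rmax T1 T2)).
   assert (m1 := Rmax_l 1 (Rmax T1 T2)). assert (m2 := Rmax_r 1 (Rmax T1 T2)).
   assert (m3 := Rmax_l T1 T2). assert (m4 := Rmax_r T1 T2). split; [lra|].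
   set (T := Rmax 1 (Rmax T1 T2)) in *. specialize (HT1 T ltac:(lra)).
    specialize (HT2 T ltac:(lra)).
   rewrite Rminus_0_r in HT1, HT2. apply E2 in HT1. apply square_lt in HT2.
   unfold H, En, C. unfold x, y. lra. }
  destruct Tz as [T [T0 TC]].
  destruct (first_zero (fun t => H t - C) 0 T) as [c [Hc1 [Hc2 Hc3]]]; [lra| |lra|lra|].
  { intros t _. apply (continuous_minus (V := R_NormedModule)); [|apply continuous_const].
   exact (is_derive_continuous _ _ _ (DH t)). }
  assert (Q := derive_nondecr H _ 0 c ltac:(lra) (fun t _ => DH t)).
  assert (H 0 <= H c); [|lra]. apply Q. intros t Ht. rewrite Out; [lra|].
   specialize (Hc3 t ltac:(lra)). lra. }
 (* Linear growth of the potential turns the bound on the energy into a bound on [x]. *)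
 assert (Gx : Rabs (x 0) - 1 <= Gp exg (x 0)).
 { rewrite EvenG. set (v := Rabs (x 0)). assert (Pv : 0 <= v) by apply Rabs_pos.
  destruct (Rle_or_lt v 1) as [Q|Q]; [assert (W := Gp_nonneg _ _ Hh v Pv); lra|].
  assert (W := derive_nondecr (fun s => Gp exg s - s) (fun s => exg s - 1) 1 v ltac:(lra)).
  assert (W1' := Gp_nonneg _ _ Hh 1 ltac:(lra)).
  assert (Gp exg 1 - 1 <= Gp exg v - v); [|lra]. apply W.
  - intros s _. apply (is_derive_minus (V := R_NormedModule));
   [apply (Gp_derive _ _ Hh)|apply (is_derive_id (K := R_AbsRing))].
  - intros s Hs. unfold exg. destruct (cl1_cases s) as [[H1 ->]|[[H1 ->]|[H1 ->]]]; lra. }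
 assert (Ex : x 0 = fst p) by (unfold x; now rewrite W0). assert (Ey : y 0 = snd p) by (unfold y;
  now rewrite W0).
 unfold H, En in HC. rewrite Ex, Ey in *.
 assert (Gn : 0 <= Gp exg (fst p)) by (rewrite EvenG; apply (Gp_nonneg _ _ Hh), Rabs_pos).
 assert (Yb : Rabs (snd p) <= C + 1).
 { apply Rabs_le_iff. assert (0 <= C) by (unfold C; lra). split; nra. }
 pose proof (Rle_0_sqr (snd p)) as Sq. unfold Rsqr in Sq.
 rewrite (surjective_pairing p). apply Rle_trans with (1 := norm_plane_le _ _). simpl. lra.
Qed.

Theorem theorem5 :
  (forall (g : R -> R) (f : R -> R -> R), hypotheses g f ->
    (center (lienard g f) \/
     consists_of (lienard g f) [Elliptic; Hyperbolic] \/
     consists_of (lienard g f) [Elliptic; Hyperbolic; Parabolic; Parabolic]) /\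
    (forall kinds : list sector_kind,
      consists_of (lienard g f) kinds -> In Elliptic kinds ->
      elliptic_region_bounded (lienard g f) -> ~ In Parabolic kinds) /\
    (consists_of (lienard g f) [Elliptic; Hyperbolic; Parabolic; Parabolic] ->
      ~ elliptic_region_bounded (lienard g f))) /\
  (exists (g : R -> R) (f : R -> R -> R),
    hypotheses g f /\
    lipschitz g /\ lipschitz (fun p : plane => f (fst p) (snd p)) /\
    consists_of (lienard g f) [Elliptic; Hyperbolic] /\
    elliptic_region_bounded (lienard g f)) /\
  (exists (g : R -> R) (f : R -> R -> R),
    hypotheses g f /\
    lipschitz g /\ lipschitz (fun p : plane => f (fst p) (snd p)) /\
    consists_of (lienard g f) [Elliptic; Hyperbolic; Parabolic; Parabolic] /\
    ~ elliptic_region_bounded (lienard g f)).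
Proof.
 assert (P3 : forall g f, hypotheses g f ->
  consists_of (lienard g f) [Elliptic; Hyperbolic; Parabolic; Parabolic]
   -> ~ elliptic_region_bounded (lienard g f)).
 { intros g f H Hc Hb. apply (proj2 (trichotomy g f H) _ Hc Hb). simpl. tauto. }
 conj3.
 - intros g f H. destruct (trichotomy g f H) as [T1 T2].
  conj3; [assumption| |now apply P3]. intros kinds Hk _. now apply T2.
 - exists exg, (exf h1 k1). assert (H := example_hypotheses _ _ profile_bounded).
  conj5; [assumption|exact exg_lipschitz|exact (exf_lipschitz _ _ profile_bounded)|
   |exact bounded_example].
  destruct (example_sys _ _ profile_bounded) as [d [L HS]].
  destruct (local_dichotomy _ _ d L HS (example_has_em _ _ profile_bounded)) as [[Q _]|Q];
   [exact Q|].
  (* Four sectors would contradict the boundedness of the elliptic region, so the local alternative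
     leaves two. *)
  elim (P3 _ _ H Q bounded_example).
 - exists exg, (exf h2 k2). assert (H := example_hypotheses _ _ profile_unbounded).
  conj4; [assumption|exact exg_lipschitz|exact (exf_lipschitz _ _ profile_unbounded)| ].
  split; [exact unbounded_example|]. apply P3; [assumption|exact unbounded_example].
Qed.
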